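(* There exists a universal constant $\beta>0$ (independent of $n,d,\lambda$) such that for all constants $d>1$ and $\lambda\in\mathbb R$ with $|\lambda|\le\sqrt d$ the following holds. Let $G\sim\mathrm{SBM}(n,d,\lambda)$ and let $A$ be the adjacency matrix of $G$ in which every edge is independently given a uniformly random sign, i.e. $A$ is symmetric, $A_{uv}=0$ if $uv\notin E(G)$, and the $A_{uv}$ for $uv\in E(G)$ are independent uniform in $\{\pm1\}$. Then, with probability $1-o_n(1)$, for every external field $h\in\mathbb R^n$ simultaneously, $$\rho_{\mathrm{MLSI}}\left(\mu_{\beta A/\sqrt d,\,h}\right)\ \ge\ n^{-1-o_n(1)},$$ where the $o_n(1)$ in the exponent is a deterministic sequence tending to $0$ (possibly depending on $d,\lambda$).
   Context: Stochastic block model $\mathrm{SBM}(n,d,\lambda)$: draw $\boldsymbol\sigma\in\{\pm1\}^n$ uniformly at random; given $\boldsymbol\sigma$, include each edge $uv$, $u\ne v\in[n]$, independently with probability $\frac{d+\lambda\sqrt d}{n}$ if $\boldsymbol\sigma(u)=\boldsymbol\sigma(v)$ and with probability $\frac{d-\lambda\sqrt d}{n}$ otherwise. Ising model: for symmetric $J\in\mathbb R^{n\times n}$ and $h\in\mathbb R^n$, $\mu_{J,h}(\sigma)\propto\exp\left(\frac12\sigma^\top J\sigma+\langle h,\sigma\rangle\right)$ on $\{\pm1\}^n$. MLSI constant: for a distribution $\mu$ of full support on $\{\pm1\}^n$, Glauber dynamics $P$ from $\sigma$ chooses $i\in[n]$ uniformly and moves to $\sigma^{\oplus i}$ ($\sigma$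 with coordinate $i$ negated) with probability $\frac{\mu(\sigma^{\oplus i})}{\mu(\sigma)+\mu(\sigma^{\oplus i})}$, staying at $\sigma$ otherwise; $P_x$ denotes the law of one step from $x$. Let $\mathcal E_\mu(f,g)=\mathbb E_{x\sim\mu,\,y\sim P_x}[(f(x)-f(y))(g(x)-g(y))]$ and $\mathrm{Ent}_\mu[f]=\mathbb E_\mu[f\log f]-\mathbb E_\mu[f]\log\mathbb E_\mu[f]$. Then $\rho_{\mathrm{MLSI}}(\mu)$ is the largest $C$ such that $\mathcal E_\mu(f,\log f)\ge C\,\mathrm{Ent}_\mu[f]$ for all $f:\{\pm1\}^n\to\mathbb R_{>0}$. *)

(* Defs.v *)
From HB Require Import structures.
From mathcomp Require Import all_boot all_order all_algebra.
From mathcomp Require Import all_classical all_reals all_analysis.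
Set Implicit Arguments.
Unset Strict Implicit.
Unset Printing Implicit Defensive.
Import Order.TTheory GRing.Theory Num.Theory.
Import numFieldNormedType.Exports.
Local Open Scope classical_set_scope.
Local Open Scope ring_scope.

(* {-1,+1}^n, a boolean b standing for the sign (-1) ^+ b. *)
Definition config (n : nat) := {ffun 'I_n -> bool}.

Definition spin (R : realType) (n : nat) (s : config n) : 'cV[R]_n :=
  \col_i (-1) ^+ (s i).

Definition flip (n : nat) (s : config n) (i : 'I_n) : config n :=
  [ffun j => s j (+) (j == i)].

Definition ising_weight (R : realType) (n : nat) (J : 'M[R]_n) (h : 'cV[R]_n)
    (s : config n) : R :=
  expR (2^-1 * ((spin R s)^T *m J *m spin R s) 0 0 + (h^T *m spin R s) 0 0).

Definition ising (R : realType) (n : nat) (J : 'M[R]_n) (h : 'cV[R]_n)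
    (s : config n) : R :=
  ising_weight J h s / \sum_t ising_weight J h t.

Section mlsi.
Variables (R : realType) (n : nat) (mu : config n -> R).

Definition flip_prob (s : config n) (i : 'I_n) : R :=
  mu (flip s i) / (mu s + mu (flip s i)).

Definition glauber (s t : config n) : R :=
  n%:R^-1 * \sum_(i < n) (flip_prob s i * (t == flip s i)%:R
                          + (1 - flip_prob s i) * (t == s)%:R).

Definition expect (f : config n -> R) : R := \sum_s mu s * f s.

Definition dirichlet (f g : config n -> R) : R :=
  expect (fun s => \sum_t glauber s t * ((f s - f t) * (g s - g t))).

Definition entropy (f : config n -> R) : R :=
  expect (fun s => f s * ln (f s)) - expect f * ln (expect f).

(* For n >= 1 and mu of full support the supremum is finite and attained;
   for n = 0 the entropy vanishes identically and the value is +oo. *)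
Definition rho_MLSI : \bar R :=
  ereal_sup [set C%:E | C in
    [set C : R | forall f : config n -> R, (forall s, 0 < f s) ->
       C * entropy f <= dirichlet f (fun s => ln (f s))]].

End mlsi.

(* Unordered pairs of distinct vertices, encoded by their increasing listing. *)
Definition upair (n : nat) := {p : 'I_n * 'I_n | (p.1 < p.2)%N}.

Section sbm.
Variables (R : realType) (n : nat) (d lambda : R).

Definition edge_prob (s : config n) (p : upair n) : R :=
  if s (val p).1 == s (val p).2 then (d + lambda * Num.sqrt d) / n%:R
  else (d - lambda * Num.sqrt d) / n%:R.

(* Joint mass of the labels s and the edge set E. When n is smaller than
   d + `|lambda| * Num.sqrt d an edge probability can exceed 1, the model is
   then undefined and the values are meaningless; this concerns only finitely
   many n for given d and lambda. *)
Definition sbm (s : config n) (E : {set upair n}) : R :=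
  2 ^- n * \prod_p (if p \in E then edge_prob s p else 1 - edge_prob s p).

(* c draws a sign for every pair; only the signs of the edges are used. *)
Definition signed_adj (E : {set upair n}) (c : {ffun upair n -> bool}) :
    'M[R]_n :=
  \sum_(p in E) (-1) ^+ (c p) *:
    (delta_mx (val p).1 (val p).2 + delta_mx (val p).2 (val p).1).

Definition signed_sbm_prob (Q : 'M[R]_n -> Prop) : R :=
  \sum_(s : config n) \sum_(E : {set upair n})
    \sum_(c : {ffun upair n -> bool} | `[< Q (signed_adj E c) >])
      sbm s E * 2 ^- #|{: upair n}|.

End sbm.

(* Main.v *)
Require Import Defs.
From HB Require Import structures.
From mathcomp Require Import all_boot all_order all_algebra.
From mathcomp Require Import all_classical all_reals all_analysis.
From mathcomp Require Import ring lra zify.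
From mathcomp Require Import finset.
Set Implicit Arguments.
Unset Strict Implicit.
Unset Printing Implicit Defensive.
Import Order.TTheory GRing.Theory Num.Theory.
Import numFieldNormedType.Exports.
Local Open Scope ring_scope.

(* Call a vertex bad if it lies in a connected set S of vertices meeting at least C d |S| edges.
   With high probability the edges touching bad vertices form a forest of depth O(log n / d),
   up to at most one further edge in each component, while on the remaining edges the signed
   adjacency matrix has norm O(sqrt d), by the method of Kahn and Szemeredi: light pairs are
   treated by a union bound over integer vectors, heavy pairs by a discrepancy bound.

   Stochastic localization compares a measure w exp (\sum_k l_k^2 / 2) with the tilts of w: if the
   covariance of (l_k) is at most a along the localization, the MLSI constant deteriorates by a
   factor exp (O(a)) only. This is used twice. Passing from product measures to the Ising model
   on the forest, a is o(log n), since the descendants of a vertex, weighted geometrically in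
   their depth, number o(log n); this costs n^(o(1)). Passing from the forest to the whole model,
   a is bounded: correlations of vertices that are not bad are summable along the forest, and
   a trickle-down recursion propagates the bound. Tilts are arbitrary throughout, which makes the
   result uniform in the external field. *)

(** * Means, variances and entropies under unnormalised weights *)

(** With d fixed, the largest degree of the graph is unbounded, so the signed adjacency matrix has
    norm far above sqrt d and no spectral condition holds for the whole interaction. The dense spots
    are therefore split off and treated through their tree structure. There correlations decay like
    tau ^ k with tau of order beta / sqrt d. Writing tau ^ 2 = om * nu, the factor nu ^ k pays for
    the number of descendants, which grows like (C d) ^ k, and om ^ k for the ancestors: smallness
    of tau ^ 2 * d suffices, which is why the scale 1 / sqrt d is reached. The surplus edge of a
    tree is handled with the remaining edges. Their form is made positive semidefinite by a diagonal
    term; squares of spins are 1, so this does not change the measure. The diagonal is confined to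
    vertices that are not bad and to ends of surplus edges, because variances are bounded only
    there. Gaussian increments of stochastic localization are replaced by random signs, so every
    object is a finite sum and limits occur only in the number of steps. The factor 1 / n of the
    result is the uniform choice of a site in Glauber dynamics. *)

Section weights.
Variables (R : realType) (T : finType).
Implicit Types (w f g : T -> R).

Definition mass w : R := \sum_x w x.
Definition mean w f : R := (\sum_x w x * f x) / mass w.
Definition cov w f g : R :=
  mean w (fun x => f x * g x) - mean w f * mean w g.
Definition var w f : R := cov w f f.
Definition ent w f : R :=
  mean w (fun x => f x * ln (f x)) - mean w f * ln (mean w f).

Variables (t0 : T).

Lemma mass_gt0 w : (forall x, 0 < w x) -> 0 < mass w.
Proof.
move=> w0; rewrite /mass (bigD1 t0) //= ltr_wpDr //.
by apply: sumr_ge0 => x _; exact: ltW.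
Qed.

Lemma mean_mass w f : (forall x, 0 < w x) ->
  mean w f * mass w = \sum_x w x * f x.
Proof. by move=> w0; rewrite /mean divfK // gt_eqF // mass_gt0. Qed.

Lemma mean_eq w f g : f =1 g -> mean w f = mean w g.
Proof. by move=> fg; rewrite /mean (eq_bigr _ (fun x _ => congr1 _ (fg x))). Qed.

Arguments mean_eq {w f g} _.

Lemma meanD w f g : mean w (fun x => f x + g x) = mean w f + mean w g.
Proof.
rewrite /mean -mulrDl -big_split; congr (_ / _).
by apply: eq_bigr => x _; rewrite mulrDr.
Qed.

Lemma meanZ w c f : mean w (fun x => c * f x) = c * mean w f.
Proof.
rewrite /mean mulrA mulr_sumr; congr (_ / _).
by apply: eq_bigr => x _; rewrite mulrCA.
Qed.

Lemma meanN w f : mean w (fun x => - f x) = - mean w f.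
Proof. by rewrite -mulN1r -meanZ; apply: mean_eq => x; rewrite mulN1r. Qed.

Lemma meanB w f g : mean w (fun x => f x - g x) = mean w f - mean w g.
Proof. by rewrite meanD meanN. Qed.

Lemma mean_sum (I : finType) w (F : I -> T -> R) :
  mean w (fun x => \sum_i F i x) = \sum_i mean w (F i).
Proof.
rewrite /mean -mulr_suml exchange_big; congr (_ / _).
by apply: eq_bigr => x _; rewrite mulr_sumr.
Qed.

Lemma mean_cst w c : (forall x, 0 < w x) -> mean w (fun=> c) = c.
Proof.
by move=> w0; rewrite /mean -mulr_suml mulrAC divff ?mul1r ?gt_eqF ?mass_gt0.
Qed.

Lemma ler_mean w f g : (forall x, 0 < w x) -> (forall x, f x <= g x) ->
  mean w f <= mean w g.
Proof.
move=> w0 fg; rewrite /mean ler_pM2r ?invr_gt0 ?mass_gt0 //.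
by apply: ler_sum => x _; rewrite ler_pM2l.
Qed.

Lemma mean_ge0 w f : (forall x, 0 < w x) -> (forall x, 0 <= f x) ->
  0 <= mean w f.
Proof. by move=> w0 f0; rewrite -(mean_cst 0 w0) ler_mean. Qed.

Lemma mean_gt0 w f : (forall x, 0 < w x) -> (forall x, 0 < f x) ->
  0 < mean w f.
Proof.
move=> w0 f0; apply: divr_gt0; last exact: mass_gt0.
by apply: (mass_gt0 (w := fun x => w x * f x)) => x; rewrite mulr_gt0.
Qed.

Lemma mean_scale w c f : c != 0 -> mean (fun x => c * w x) f = mean w f.
Proof.
move=> c0; rewrite /mean /mass -mulr_sumr.
under eq_bigr do rewrite -mulrA.
by rewrite -mulr_sumr -mulf_div divff ?mul1r.
Qed.

Lemma mean_ext w w' f : w =1 w' -> mean w f = mean w' f.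
Proof.
move=> ww; rewrite /mean /mass; congr (_ / _); last exact: eq_bigr.
by apply: eq_bigr => x _; rewrite ww.
Qed.

Lemma var_center w f c : (forall x, 0 < w x) ->
  var w f = mean w (fun x => (f x - c) ^+ 2) - (mean w f - c) ^+ 2.
Proof.
move=> w0; have -> : mean w (fun x => (f x - c) ^+ 2) =
   mean w (fun x => f x * f x) - 2 * c * mean w f + c ^+ 2.
  rewrite -meanZ -[c ^+ 2](mean_cst _ w0) -meanB -meanD.
  by apply: mean_eq => x; ring.
by rewrite /var /cov; ring.
Qed.

Lemma var_le w f c : (forall x, 0 < w x) ->
  var w f <= mean w (fun x => (f x - c) ^+ 2).
Proof. by move=> w0; rewrite (var_center f c w0) gerBl sqr_ge0. Qed.

Lemma varE w f : (forall x, 0 < w x) ->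
  var w f = mean w (fun x => (f x - mean w f) ^+ 2).
Proof. by move=> w0; rewrite (var_center f (mean w f) w0) subrr expr0n subr0. Qed.

Lemma var_ge0 w f : (forall x, 0 < w x) -> 0 <= var w f.
Proof. by move=> w0; rewrite varE // mean_ge0 // => x; exact: sqr_ge0. Qed.

Lemma covE w f g : (forall x, 0 < w x) ->
  cov w f g = mean w (fun x => (f x - mean w f) * g x).
Proof.
move=> w0; rewrite /cov -meanZ -meanB.
by apply: mean_eq => x; rewrite mulrBl.
Qed.

Lemma cov_sumr (I : finType) w f (c : I -> R) (F : I -> T -> R) :
  cov w f (fun x => \sum_i c i * F i x) = \sum_i c i * cov w f (F i).
Proof.
rewrite /cov.
have -> : mean w (fun x => f x * (\sum_i c i * F i x)) =
    \sum_i c i * mean w (fun x => f x * F i x).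
  rewrite (mean_eq (g := fun x => \sum_i c i * (f x * F i x))); last first.
    by move=> x; rewrite mulr_sumr; apply: eq_bigr => i _; rewrite mulrCA.
  by rewrite mean_sum; apply: eq_bigr => i _; rewrite meanZ.
rewrite mean_sum mulr_sumr -sumrB; apply: eq_bigr => i _.
by rewrite meanZ; ring.
Qed.

(** This is ln t <= t - 1 at t = x / m. It bounds the entropy of a family of conditional means by
    their variance divided by the overall mean. *)
Lemma xlnx_le (x m : R) : 0 < x -> 0 < m ->
  x * ln x - x * ln m <= x ^+ 2 / m - x.
Proof.
move=> x0 m0; rewrite -mulrBr -ln_div ?posrE //.
have -> : x ^+ 2 / m - x = x * (x / m - 1) by rewrite expr2; field; rewrite gt_eqF.
rewrite ler_pM2l //.
have xm : 0 < x / m by rewrite divr_gt0.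
have := @le_ln1Dx R (x / m - 1).
by rewrite addrCA subrr addr0; apply; rewrite ltrBrDl subrr.
Qed.

(* The variational formula: Ent is the infimum over m of this mean. *)
Lemma ent_le w f m : (forall x, 0 < w x) -> (forall x, 0 < f x) -> 0 < m ->
  ent w f <= mean w (fun x => f x * ln (f x) - f x * ln m - f x + m).
Proof.
move=> w0 f0 m0; rewrite meanD meanB meanB mean_cst // /ent.
rewrite (mean_eq (f := fun x => f x * ln m) (g := fun x => ln m * f x)); last first.
  by move=> x; rewrite mulrC.
rewrite meanZ.
set M := mean w f; have M0 : 0 < M by exact: mean_gt0.
have := xlnx_le m0 M0.
have := @le_ln1Dx R (m / M - 1).
rewrite addrCA subrr addr0 ltrBrDl subrr divr_gt0 // => /(_ isT).
rewrite ln_div ?posrE // => h _.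
suff : M * (ln m - ln M) <= m - M by lra.
have -> : m - M = M * (m / M - 1) by field; rewrite gt_eqF.
by rewrite ler_pM2l.
Qed.

(** The integrand is pointwise nonnegative, so entropies under two comparable weights can be
    compared term by term, as in the perturbation argument of Holley and Stroock. *)
Lemma ent_eq w f : (forall x, 0 < w x) -> (forall x, 0 < f x) ->
  ent w f = mean w (fun x => f x * ln (f x) - f x * ln (mean w f) - f x + mean w f).
Proof.
move=> w0 f0; rewrite meanD meanB meanB mean_cst // /ent.
rewrite (mean_eq (f := fun x => f x * ln (mean w f)) (g := fun x => ln (mean w f) * f x)).
  by rewrite meanZ; ring.
by move=> x; rewrite mulrC.
Qed.

Lemma entropy_integrand_ge0 (x m : R) : 0 < x -> 0 < m ->
  0 <= x * ln x - x * ln m - x + m.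
Proof.
move=> x0 m0.
have := @le_ln1Dx R (m / x - 1).
rewrite addrCA subrr addr0 ltrBrDl subrr divr_gt0 // => /(_ isT).
rewrite ln_div ?posrE // => h.
suff : x * (ln m - ln x) <= m - x by lra.
have -> : m - x = x * (m / x - 1) by field; rewrite gt_eqF.
by rewrite ler_pM2l.
Qed.

Lemma ent_ge0 w f : (forall x, 0 < w x) -> (forall x, 0 < f x) -> 0 <= ent w f.
Proof.
move=> w0 f0; rewrite ent_eq // mean_ge0 // => x.
by rewrite entropy_integrand_ge0 // mean_gt0.
Qed.

(** Fenchel-Young duality between x ln x and the exponential: the entropy integrand of [x] against M
    * (expR p / N) is nonnegative. *)
Lemma gibbs_pointwise (x p M N : R) : 0 < x -> 0 < M -> 0 < N ->
  x * p <= x * ln x - x * ln M + x * ln N - x + M * (expR p / N).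
Proof.
move=> x0 M0 N0.
have e1 : 0 < expR p / N by rewrite divr_gt0 // expR_gt0.
have e0 : 0 < M * (expR p / N) by rewrite mulr_gt0.
have := entropy_integrand_ge0 x0 e0.
by rewrite lnM ?posrE // ln_div ?posrE ?expR_gt0 // expRK; lra.
Qed.

(** The Donsker-Varadhan inequality, for a density [f] that is not normalised. *)
Lemma gibbs_variational w f (p : T -> R) : (forall x, 0 < w x) ->
  (forall x, 0 < f x) ->
  mean w (fun x => f x * p x) <=
    ent w f + mean w f * ln (mean w (fun x => expR (p x))).
Proof.
move=> w0 f0; set M := mean w f; set N := mean w (fun x => expR (p x)).
have M0 : 0 < M by exact: mean_gt0.
have N0 : 0 < N by apply: mean_gt0 => // x; exact: expR_gt0.
have key x : f x * p x <= f x * ln (f x) - f x * ln M + f x * ln N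
                          - f x + M * (expR (p x) / N).
  exact: gibbs_pointwise.
apply: (le_trans (ler_mean w0 key)).
rewrite meanD meanB meanD meanB.
rewrite (mean_eq (f := fun x => f x * ln M) (g := fun x => ln M * f x)) => [|x]; last by rewrite mulrC.
rewrite (mean_eq (f := fun x => f x * ln N) (g := fun x => ln N * f x)) => [|x]; last by rewrite mulrC.
rewrite (mean_eq (f := fun x => M * (expR (p x) / N)) (g := fun x => (M / N) * expR (p x))) => [|x]; last by ring.
rewrite !meanZ -/M -/N /ent -/M divfK ?gt_eqF //.
by lra.
Qed.

Lemma mass_le_of_ratio w w' c : (forall x, w x <= c * w' x) -> mass w <= c * mass w'.
Proof. by move=> h; rewrite /mass mulr_sumr; apply: ler_sum. Qed.

End weights.
Arguments mean_eq {R T w f g} _.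

Section mixture.
Variables (R : realType) (T Y : finType) (t0 : T) (y0 : Y).
Variables (v : Y -> T -> R) (w : T -> R).
Hypothesis v0 : forall y x, 0 < v y x.
Hypothesis wE : forall x, w x = \sum_y v y x.

Definition mixw y : R := mass (v y) / mass w.

Lemma mix_gt0 x : 0 < w x.
Proof.
have : 0 < mass (fun y => v y x) by apply: mass_gt0.
by rewrite wE.
Qed.

Lemma mixw_gt0 y : 0 < mixw y.
Proof. by rewrite divr_gt0 // mass_gt0 //; exact: mix_gt0. Qed.

Lemma mean_mix f : mean w f = \sum_y mixw y * mean (v y) f.
Proof.
rewrite {1}/mean; under eq_bigr do rewrite wE mulr_suml.
rewrite exchange_big mulr_suml; apply: eq_bigr => y _ /=.
have a0 := gt_eqF (mass_gt0 t0 (v0 y)); have b0 := gt_eqF (mass_gt0 t0 mix_gt0).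
by rewrite /mixw /mean; field; rewrite a0 b0.
Qed.

Lemma mixw1 : \sum_y mixw y = 1.
Proof.
rewrite -(mean_cst t0 1 mix_gt0) mean_mix; apply: eq_bigr => y _.
by rewrite mean_cst // mulr1.
Qed.

Lemma mix_var_le (m : Y -> R) c :
  \sum_y mixw y * m y ^+ 2 - (\sum_y mixw y * m y) ^+ 2 <=
  \sum_y mixw y * (m y - c) ^+ 2.
Proof.
have -> : \sum_y mixw y * (m y - c) ^+ 2 =
  \sum_y mixw y * m y ^+ 2 - 2 * c * (\sum_y mixw y * m y) + c ^+ 2 * \sum_y mixw y.
  rewrite !mulr_sumr -sumrB -big_split; apply: eq_bigr => y _ /=; ring.
rewrite mixw1.
have := sqr_ge0 (\sum_y mixw y * m y - c); nra.
Qed.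

Lemma var_mix g c :
  var w g <= \sum_y mixw y * var (v y) g + \sum_y mixw y * (mean (v y) g - c) ^+ 2.
Proof.
have := mix_var_le (fun y => mean (v y) g) c; rewrite -mean_mix => h.
rewrite [var w g]/var /cov mean_mix -expr2.
have -> : \sum_y mixw y * mean (v y) (fun x => g x * g x) =
   \sum_y mixw y * var (v y) g + \sum_y mixw y * mean (v y) g ^+ 2.
  by rewrite -big_split; apply: eq_bigr => y _ /=; rewrite -mulrDr /var /cov expr2 subrK.
by lra.
Qed.

(** Chain rule for entropy; the entropy of the conditional means is bounded by their chi-square. The
    free centre [c] allows the mean before a random tilt in place of the mean of the mixture. *)
Lemma ent_mix f c : (forall x, 0 < f x) ->
  ent w f <= \sum_y mixw y * ent (v y) f
    + (\sum_y mixw y * (mean (v y) f - c) ^+ 2) / mean w f.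
Proof.
move=> f0; set m := fun y => mean (v y) f.
have m0 y : 0 < m y by exact: mean_gt0.
have M0 : 0 < mean w f by apply: mean_gt0 => //; exact: mix_gt0.
rewrite [ent w f]/ent mean_mix.
have -> : \sum_y mixw y * mean (v y) (fun x => f x * ln (f x)) =
  \sum_y mixw y * ent (v y) f + \sum_y mixw y * (m y * ln (m y)).
  by rewrite -big_split; apply: eq_bigr => y _ /=; rewrite -mulrDr /ent subrK.
rewrite -addrA lerD2l.
have h : \sum_y mixw y * (m y * ln (m y) - m y * ln (mean w f)) <=
         \sum_y mixw y * (m y ^+ 2 / mean w f - m y).
  apply: ler_sum => y _; apply: ler_wpM2l; first exact: ltW (mixw_gt0 y).
  exact: (xlnx_le (m0 y) M0).
have e1 : \sum_y mixw y * (m y * ln (m y) - m y * ln (mean w f)) =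
  \sum_y mixw y * (m y * ln (m y)) - mean w f * ln (mean w f).
  rewrite [in X in _ - X * _]mean_mix mulr_suml -sumrB.
  by apply: eq_bigr => y _; rewrite -/(m y); ring.
have e2 : \sum_y mixw y * (m y ^+ 2 / mean w f - m y) =
  (\sum_y mixw y * m y ^+ 2 - (mean w f) ^+ 2) / mean w f.
  have -> : \sum_y mixw y * (m y ^+ 2 / mean w f - m y) =
    (\sum_y mixw y * m y ^+ 2) / mean w f - mean w f.
    rewrite [X in _ = _ - X](mean_mix f) mulr_suml -sumrB.
    by apply: eq_bigr => y _; rewrite -/(m y); ring.
  by field; rewrite gt_eqF.
rewrite -e1; apply: (le_trans h); rewrite e2 ler_pM2r ?invr_gt0 //.
by rewrite [in X in _ - X ^+ 2]mean_mix; exact: mix_var_le.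
Qed.

End mixture.

(** * Exponential moments, cosh and random signs *)

Section elementary.
Variable R : realType.

Lemma ge0_of_derive_ge0 (f f' : R -> R) : (forall x : R, is_derive x 1 f (f' x)) ->
  (forall x, 0 <= x -> 0 <= f' x) -> 0 <= f 0 -> forall x, 0 <= x -> 0 <= f x.
Proof.
move=> df f'0 f0 x x0; apply: (le_trans f0).
have der y : derivable f y 1 by have := df y => -[].
apply: (@ger0_derive1_ndecr R f 0 x) => //.
- move=> y; rewrite in_itv /= => /andP[y0 _]; rewrite derive1E.
  by have [_ ->] := df y; apply: f'0; exact: ltW.
- apply: derivable_within_continuous => y _; exact: der.
Qed.

Lemma expR_le_quad (u : R) : `|u| <= 2^-1 -> `|expR u - 1 - u| <= 2 * u ^+ 2.
Proof.
rewrite ler_norml => /andP[h1 h2].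
have a := expR_ge1Dx u; have b := expR_ge1Dx (- u).
have e0 := expR_gt0 u; rewrite expRN in b.
have h : expR u * (1 - u) <= 1.
  have := ler_pM2l e0 (1 - u) (expR u)^-1; rewrite b divff ?gt_eqF // => ->.
rewrite ger0_norm; last by lra.
nra.
Qed.

End elementary.

Section mgf.
Variables (R : realType) (T : finType) (t0 : T).

Lemma is_derive_expsum (p c : T -> R) (t : R) :
  is_derive t 1 (fun s : R => \sum_x p x * expR (s * c x))
    (\sum_x p x * c x * expR (t * c x)).
Proof.
have E (s : seq T) : is_derive t 1 (fun s0 : R => \sum_(x <- s) p x * expR (s0 * c x))
    (\sum_(x <- s) p x * c x * expR (t * c x)).
  elim: s => [|x s IH].
    rewrite big_nil; under eq_fun do rewrite big_nil.
    exact: is_derive_cst.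
  rewrite big_cons; under eq_fun do rewrite big_cons.
  apply: is_deriveD => /=.
  apply: is_derive_eq; rewrite /GRing.scale /=; ring.
exact: E.
Qed.

(** The second derivative of the logarithm of the moment generating function is the variance under
    the exponentially tilted weight, so the bound follows by integrating twice from 0. *)
Lemma ln_mgf_le (w g : T -> R) (A t : R) : (forall x, 0 < w x) ->
  (forall s, var (fun x => w x * expR (s * g x)) g <= A) -> mean w g = 0 ->
  0 <= t -> ln (mean w (fun x => expR (t * g x))) <= A / 2 * t ^+ 2.
Proof.
move=> w0 hv g0 tge0.
(* [ph k] is the k-th derivative of the unnormalised moment generating function. *)
pose ph (k : nat) (s : R) : R := \sum_x (w x * g x ^+ k) * expR (s * g x).
have dph k (s : R) : is_derive s 1 (ph k) (ph k.+1 s).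
  have := is_derive_expsum (fun x => w x * g x ^+ k) g s.
  have -> : \sum_x w x * g x ^+ k * g x * expR (s * g x) = ph k.+1 s.
    by apply: eq_bigr => x _; rewrite exprSr mulrA.
  by [].
have ph0 s : 0 < ph 0%N s.
  apply: (mass_gt0 t0 (w := fun x => w x * g x ^+ 0 * expR (s * g x))) => x.
  by rewrite expr0 mulr1 mulr_gt0 // expR_gt0.
have m0 : 0 < mass w by exact: mass_gt0.
have phE : ph 0%N 0 = mass w.
  by apply: eq_bigr => x _; rewrite expr0 mulr1 mul0r expR0 mulr1.
have varE s : var (fun x => w x * expR (s * g x)) g =
   (ph 2%N s * ph 0%N s - ph 1%N s ^+ 2) / ph 0%N s ^+ 2.
  have e0 : mass (fun x => w x * expR (s * g x)) = ph 0%N s.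
    by apply: eq_bigr => x _; rewrite expr0 mulr1.
  rewrite /var /cov /mean e0.
  have -> : \sum_x w x * expR (s * g x) * (g x * g x) = ph 2%N s.
    by apply: eq_bigr => x _; ring.
  have -> : \sum_x w x * expR (s * g x) * g x = ph 1%N s.
    by apply: eq_bigr => x _; ring.
  by field; rewrite gt_eqF.
pose G (s : R) := A * s - ph 1%N s / ph 0%N s.
have dG (s : R) : is_derive s 1 G (A - (ph 2%N s * ph 0%N s - ph 1%N s ^+ 2) / ph 0%N s ^+ 2).
  have n0 : ph 0%N s != 0 by rewrite gt_eqF.

  have dV := is_deriveV n0 (dph 0%N s).
  have dM := is_deriveM (dph 1%N s) dV.
  have dA : is_derive s 1 (fun s : R => A * s) A.
    by apply: is_derive_eq; rewrite /GRing.scale /=; ring.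
  have := is_deriveB dA dM.
  set D := (X in is_derive _ _ _ X -> _) => h.
  have -> : A - (ph 2%N s * ph 0%N s - ph 1%N s ^+ 2) / ph 0%N s ^+ 2 = D.
    by rewrite /D /GRing.scale /=; field.
  exact: h.
have G0 s : 0 <= s -> 0 <= G s.
  apply: (ge0_of_derive_ge0 dG) => [x _|]; first by rewrite subr_ge0 -varE.
  rewrite /G mulr0 sub0r oppr_ge0.
  have -> : ph 1%N 0 = mean w g * mass w.
    by rewrite mean_mass //; apply: eq_bigr => x _; rewrite mul0r expR0 mulr1 expr1.
  by rewrite g0 !mul0r.
pose F (s : R) := A / 2 * s ^+ 2 - (ln (ph 0%N s) - ln (mass w)).
have dF (s : R) : is_derive s 1 F (G s).
  have dl := is_derive1_comp (is_derive1_ln (ph0 s)) (dph 0%N s).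
  have dA : is_derive s 1 (fun s : R => A / 2 * s ^+ 2) (A * s).
    by apply: is_derive_eq; rewrite /GRing.scale /=; field.
  have dl2 : is_derive s 1 (fun s => ln (ph 0%N s) - ln (mass w)) (ph 1%N s / ph 0%N s).
    have := is_deriveB dl (is_derive_cst (ln (mass w)) s 1).
    by rewrite subr0 mulrC.
  exact: is_deriveB dA dl2.
have F0 := ge0_of_derive_ge0 dF G0.
have -> : mean w (fun x => expR (t * g x)) = ph 0%N t / mass w.
  by rewrite /mean; congr (_ / _); apply: eq_bigr => x _; rewrite expr0 mulr1.
rewrite ln_div ?posrE // -subr_ge0; apply: F0 => //.
by rewrite /F expr0n mulr0 phE subrr subr0.
Qed.

End mgf.

Section cosh.
Variable R : realType.

Definition ch (u : R) : R := (expR u + expR (- u)) / 2.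

Lemma ch_ge (u : R) : 1 + u ^+ 2 / 2 <= ch u.
Proof.
wlog u0 : u / 0 <= u.
  move=> h; have [/h //|/ltW u0] := leP 0 u.
  have -> : ch u = ch (- u) by rewrite /ch opprK addrC.
  by rewrite -sqrrN; apply: h; rewrite oppr_ge0.
have dE (x : R) : is_derive x 1 (fun x : R => expR (- x)) (- expR (- x)).
  by apply: is_derive_eq; rewrite /GRing.scale /=; ring.
have d1 (x : R) : is_derive x 1 (fun x : R => expR x - expR (- x) - 2 * x)
     (expR x + expR (- x) - 2).
  have h : is_derive x 1 (fun x : R => 2 * x) 2.
    by apply: is_derive_eq; rewrite /GRing.scale /=; ring.
  have := is_deriveB (is_deriveB (is_derive_expR x) (dE x)) h.
  by rewrite opprK.
have p2 (x : R) : 0 <= expR x + expR (- x) - 2.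
  have e0 := expR_gt0 x; rewrite expRN.
  have -> : expR x + (expR x)^-1 - 2 = (expR x - 1) ^+ 2 / expR x by field; rewrite gt_eqF.
  by rewrite divr_ge0 ?sqr_ge0 // ltW.
have p1 (x : R) : 0 <= x -> 0 <= expR x - expR (- x) - 2 * x.
  apply: (ge0_of_derive_ge0 d1) => [y _|]; first exact: p2.
  by rewrite oppr0 expR0 mulr0 subrr subr0.
have d0 (x : R) : is_derive x 1 (fun x : R => expR x + expR (- x) - 2 - x ^+ 2)
     (expR x - expR (- x) - 2 * x).
  have h : is_derive x 1 (fun x : R => x ^+ 2) (2 * x).
    by apply: is_derive_eq; rewrite /GRing.scale /=; ring.
  have := is_deriveB (is_deriveB (is_deriveD (is_derive_expR x) (dE x)) (is_derive_cst (2 : R) x 1)) h.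
  by rewrite subr0.
have := ge0_of_derive_ge0 d0 p1 _ u0.
by rewrite oppr0 expR0 expr0n /= /ch => /(_ _); lra.
Qed.

Lemma ch_ge1 (u : R) : 1 <= ch u.
Proof. by apply: le_trans (ch_ge u); rewrite lerDl divr_ge0 // sqr_ge0. Qed.

Lemma ch_gt0 (u : R) : 0 < ch u.
Proof. by apply: lt_le_trans (ch_ge1 u). Qed.

(** The sub-Gaussian bound for a fair sign: [ln_mgf_le] on the two-point space, where every tilted
    variance is at most 1. *)
Lemma ch_le (u : R) : ch u <= expR (u ^+ 2 / 2).
Proof.
pose g (b : bool) : R := (-1) ^+ b.
have one b : 0 < (fun=> 1 : R) (b : bool) by [].
wlog u0 : u / 0 <= u.
  move=> h; have [/h //|/ltW u0] := leP 0 u.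
  have -> : ch u = ch (- u) by rewrite /ch opprK addrC.
  by rewrite -[u ^+ 2]sqrrN; apply: h; rewrite oppr_ge0.
have E (F : bool -> R) : mean (fun=> 1) F = (F true + F false) / 2.
  rewrite /mean /mass !big_bool /= !mul1r; congr (_ / _).
have chE : mean (fun=> 1) (fun x => expR (u * g x)) = ch u.
  by rewrite E /g /= expr0 expr1 mulr1 mulrN1 addrC.
have hv s : var (fun x => 1 * expR (s * g x)) g <= 1.
  have w0 x : 0 < 1 * expR (s * g x) by rewrite mul1r expR_gt0.
  apply: (le_trans (var_le true g 0 w0)).
  rewrite -[leRHS](mean_cst true 1 w0) (ler_mean true) //= => x.
  by rewrite subr0 /g sqrr_sign.
have := ln_mgf_le true one hv _ u0.
rewrite E /g /= expr0 expr1 addNr mul0r => /(_ erefl).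
rewrite -/g chE => h; rewrite -[leLHS]lnK ?posrE ?ch_gt0 // ler_expR.
by apply: (le_trans h); rewrite mul1r mulrC.
Qed.

(** Converse of [ch_le] up to fourth order, through exp (v - v ^ 2) <= 1 + v. It controls the
    discretisation: with [u] of order N ^ (-1/2), a product of N such factors loses only exp (O(1 /
    N)). *)
Lemma expR_le_ch (u : R) : expR (u ^+ 2 / 2) <= ch u * expR (u ^+ 4 / 4).
Proof.
have v0 : 0 <= u ^+ 2 / 2 by rewrite divr_ge0 // sqr_ge0.
apply: (@le_trans _ _ ((1 + u ^+ 2 / 2) * expR (u ^+ 4 / 4))); last first.
  by rewrite ler_pM2r ?expR_gt0 // ch_ge.
have -> : u ^+ 4 / 4 = (u ^+ 2 / 2) ^+ 2 by field.
set v := u ^+ 2 / 2 in v0 *.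
have p : 0 < 1 + v by lra.
have : expR (v - v ^+ 2) <= 1 + v.
  rewrite -[leRHS](@lnK R) ?posrE // ler_expR.
  have := @le_ln1Dx R ((1 + v)^-1 - 1).
  rewrite addrCA subrr addr0 ltrBrDl subrr invr_gt0 p => /(_ isT).
  rewrite lnV ?posrE // => h.
  apply: (@le_trans _ _ (1 - (1 + v)^-1)); last by lra.
  rewrite -subr_ge0.
  have -> : 1 - (1 + v)^-1 - (v - v ^+ 2) = v ^+ 3 / (1 + v) by field; rewrite gt_eqF.
  by rewrite divr_ge0 ?exprn_ge0 // ltW.
rewrite expRB ler_pdivrMr ?expR_gt0 //.
Qed.

End cosh.

Section rademacher.
Variables (R : realType) (K : finType).

Definition sg (b : bool) : R := (-1) ^+ b.

Lemma sg_sqr b : sg b * sg b = 1.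
Proof. by rewrite /sg -expr2 sqrr_sign. Qed.

Lemma sg_norm b : `|sg b| = 1.
Proof. by rewrite /sg normr_sign. Qed.

Lemma rademacher_orthogonal (k k' : K) :
  \sum_(y : {ffun K -> bool}) sg (y k) * sg (y k') =
  (k == k')%:R * #|{ffun K -> bool}|%:R.
Proof.
case: eqVneq => [<-|kk].
  by rewrite mul1r; under eq_bigr do rewrite sg_sqr; rewrite sumr_const cardT.
rewrite mul0r.
pose fl (y : {ffun K -> bool}) := [ffun j => y j (+) (j == k)].
have flK : involutive fl.
  by move=> y; apply/ffunP => j; rewrite !ffunE -addbA addbb addbF.
set S := LHS; suff : S = - S by lra.
rewrite {1}/S (reindex_inj (inv_inj flK)) -sumrN; apply: eq_bigr => y _.
rewrite !ffunE eqxx eq_sym (negbTE kk) addbF addbT /sg.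
by case: (y k) => /=; rewrite ?expr0 ?expr1 !mulNr ?opprK.
Qed.

Lemma rademacher_second_moment (c : K -> R) :
  \sum_(y : {ffun K -> bool}) (\sum_k sg (y k) * c k) ^+ 2 =
  #|{ffun K -> bool}|%:R * \sum_k c k ^+ 2.
Proof.
transitivity (\sum_k \sum_k' c k * c k' * \sum_(y : {ffun K -> bool}) sg (y k) * sg (y k')).
  under eq_bigr do rewrite expr2 mulr_suml.
  rewrite exchange_big; apply: eq_bigr => k _ /=.
  under eq_bigr do rewrite mulr_sumr.
  rewrite exchange_big; apply: eq_bigr => k' _ /=.
  by rewrite mulr_sumr; apply: eq_bigr => y _; ring.
rewrite mulr_sumr; apply: eq_bigr => k _.
rewrite (bigD1 k) //= [X in _ + X]big1 => [|k' kk].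
  by rewrite rademacher_orthogonal eqxx mul1r addr0; ring.
by rewrite rademacher_orthogonal eq_sym (negbTE kk) mul0r mulr0.
Qed.

Lemma prod_ch (a : K -> R) :
  \sum_(y : {ffun K -> bool}) expR (\sum_k sg (y k) * a k) =
  #|{ffun K -> bool}|%:R * \prod_k ch (a k).
Proof.
have := bigA_distr_bigA (fun (k : K) (b : bool) => expR (sg b * a k)).
move=> h.
transitivity (\sum_(y : {ffun K -> bool}) \prod_k expR (sg (y k) * a k)).
  by apply: eq_bigr => y _; exact: expR_sum.
rewrite -h.
rewrite card_ffun card_bool natrX -prodr_const -big_split /=.
apply: eq_bigr => k _.
rewrite big_bool /sg /= expr0 expr1 mulN1r mul1r /ch.
by rewrite mulrCA divff ?mulr1 ?pnatr_eq0 // addrC.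
Qed.

End rademacher.

(** * One random exponential tilt *)

Section step.
Variables (R : realType) (T K : finType) (t0 : T).
Variable l : K -> T -> R.
Notation Y := {ffun K -> bool}.

Definition rad (y : Y) (x : T) : R := \sum_k sg R (y k) * l k x.

Lemma cov_tilt (w e g : T -> R) : (forall x, 0 < w x) -> (forall x, 0 < e x) ->
  mean (fun x => e x * w x) g - mean w g =
  mean w (fun x => (g x - mean w g) * e x) / mean w e.
Proof.
move=> w0 e0; have m0 := mass_gt0 t0 w0; have n0 := mean_gt0 t0 w0 e0.
have -> : mean w (fun x => (g x - mean w g) * e x) =
    mean w (fun x => g x * e x) - mean w g * mean w e.
  by rewrite -meanZ -meanB; apply: mean_eq => x; rewrite mulrBl.
have -> : mean (fun x => e x * w x) g = mean w (fun x => g x * e x) / mean w e.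
  rewrite /mean /mass.
  have -> : \sum_x e x * w x * g x = \sum_x w x * (g x * e x).
    by apply: eq_bigr => x _; ring.
  have -> : \sum_x w x * e x = \sum_x e x * w x by apply: eq_bigr => x _; rewrite mulrC.
  have p0 : \sum_x e x * w x != 0.
    by rewrite gt_eqF //; apply: (mass_gt0 t0 (w := fun x => e x * w x)) => x; rewrite mulr_gt0.
  by field; rewrite p0 /= (gt_eqF m0).
by field; rewrite gt_eqF.
Qed.

(** To first order the mean of [g] moves by eps times its covariance with [rad y]; averaging over
    the signs turns the square into the sum of squared covariances, and the remainder is of fourth
    order in eps. The factor 8 is 2 from squaring a sum of two terms and 4 from the weights [mixw],
    which are not uniform in y. *)
Lemma step_var (w : T -> R) (eps B G : R) (g : T -> R) :
  (forall x, 0 < w x) -> 0 <= eps -> 0 <= B -> (forall y x, `|rad y x| <= B) ->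
  eps * B <= 2^-1 -> (forall x, `|g x| <= G) ->
  \sum_(y : Y) mixw (fun y x => expR (eps * rad y x) * w x)
                    (fun x => \sum_(y : Y) expR (eps * rad y x) * w x) y *
     (mean (fun x => expR (eps * rad y x) * w x) g - mean w g) ^+ 2
  <= 8 * eps ^+ 2 * (\sum_k cov w g (l k) ^+ 2) + 128 * G ^+ 2 * (eps * B) ^+ 4.
Proof.
move=> w0 e0 B0 hB eB hG.
set v := fun y x => expR (eps * rad y x) * w x.
set w' := fun x => \sum_(y : Y) expR (eps * rad y x) * w x.
have G0 : 0 <= G by apply: le_trans (hG t0).
have v0 y x : 0 < v y x by rewrite mulr_gt0 // expR_gt0.
have m0 := mass_gt0 t0 w0.
pose den y := mean w (fun x => expR (eps * rad y x)).
have small y x : `|eps * rad y x| <= 2^-1.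
  by rewrite normrM ger0_norm //; apply: le_trans eB; rewrite ler_wpM2l.
have den_ge y : 2^-1 <= den y.
  rewrite -(mean_cst t0 2^-1 w0) ler_mean // => x.
  have := expR_ge1Dx (eps * rad y x); have := small y x.
  by rewrite ler_norml => /andP[]; lra.
have massv y : mass (v y) = mass w * den y.
  by rewrite mulrC mean_mass //; apply: eq_bigr => x _; rewrite mulrC.
have massw' : mass w' = mass w * \sum_y den y.
  by rewrite mulr_sumr /mass exchange_big; apply: eq_bigr => y _; rewrite -massv.
pose num y := mean w (fun x => (g x - mean w g) * expR (eps * rad y x)).
pose c (y : Y) := \sum_k sg R (y k) * cov w g (l k).
have cE y : c y = cov w g (rad y) by rewrite cov_sumr.
have mg : `|mean w g| <= G.
  rewrite ler_norml -{1}(mean_cst t0 (- G) w0) -{2}(mean_cst t0 G w0).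
  by rewrite !ler_mean // => x; have := hG x; rewrite ler_norml => /andP[].
have num2 y : num y ^+ 2 <= 2 * (eps * c y) ^+ 2 + 32 * G ^+ 2 * (eps * B) ^+ 4.
  pose r := mean w (fun x => (g x - mean w g) * (expR (eps * rad y x) - 1 - eps * rad y x)).
  have -> : num y = eps * c y + r.
    rewrite cE covE // -meanZ -meanD /num.
    have z : mean w (fun x => g x - mean w g) = 0 by rewrite meanB mean_cst // subrr.
    rewrite -[RHS]addr0 -z -meanD; apply: mean_eq => x; ring.
  have hr : `|r| <= 4 * G * (eps * B) ^+ 2.
    have pt x : `|(g x - mean w g) * (expR (eps * rad y x) - 1 - eps * rad y x)|
        <= 4 * G * (eps * B) ^+ 2.
      have a1 : `|g x - mean w g| <= 2 * G.
        by apply: (le_trans (ler_normB _ _)); have := hG x; lra.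
      have a2 := expR_le_quad (small y x).
      have a3 : (eps * rad y x) ^+ 2 <= (eps * B) ^+ 2.
        rewrite -real_normK ?num_real // ler_pXn2r ?nnegrE ?mulr_ge0 //.
        by rewrite normrM ger0_norm // ler_wpM2l.
      rewrite normrM; apply: (@le_trans _ _ (2 * G * (2 * (eps * rad y x) ^+ 2))).
        by apply: ler_pM.
      rewrite -subr_ge0.
      have -> : 4 * G * (eps * B) ^+ 2 - 2 * G * (2 * (eps * rad y x) ^+ 2) =
         4 * G * ((eps * B) ^+ 2 - (eps * rad y x) ^+ 2) by ring.
      by rewrite mulr_ge0 ?subr_ge0 // mulr_ge0.
    rewrite ler_norml -{1}(mean_cst t0 (- _) w0) -{2}(mean_cst t0 (4 * _ * _) w0).
    by rewrite !ler_mean // => x; have := pt x; rewrite ler_norml => /andP[].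
  have hr2 : r ^+ 2 <= 16 * G ^+ 2 * (eps * B) ^+ 4.
    have -> : 16 * G ^+ 2 * (eps * B) ^+ 4 = (4 * G * (eps * B) ^+ 2) ^+ 2 by ring.
    by rewrite -real_normK ?num_real // ler_pXn2r ?nnegrE // !mulr_ge0 ?sqr_ge0.
  have := sqr_ge0 (eps * c y - r); nra.
pose NY : R := #|{: Y}|%:R.
have NY0 : 0 < NY by rewrite ltr0n; apply/card_gt0P; exists [ffun => true].
have sden : NY / 2 <= \sum_y den y.
  have -> : NY / 2 = \sum_(y : Y) 2^-1 by rewrite sumr_const cardT mulr_natl /NY -cardT.
  by apply: ler_sum.
have term y : mixw v w' y * (mean (v y) g - mean w g) ^+ 2 <= 4 / NY * num y ^+ 2.
  have -> : mean (v y) g - mean w g = num y / den y.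
    by apply: (cov_tilt (e := fun x => expR (eps * rad y x))) => // x; exact: expR_gt0.
  rewrite /mixw massv massw'.
  have d0 : 0 < den y by apply: lt_le_trans (den_ge y).
  have S0 : 0 < \sum_y den y by apply: lt_le_trans sden; rewrite divr_gt0.
  have -> : mass w * den y / (mass w * \sum_y0 den y0) * (num y / den y) ^+ 2 =
     ((den y)^-1 * (\sum_y0 den y0)^-1) * num y ^+ 2.
    by field; rewrite !gt_eqF.
  apply: ler_wpM2r; first exact: sqr_ge0.
  have -> : 4 / NY = 2 * (2 / NY) by ring.
  apply: ler_pM; rewrite ?invr_ge0 ?(ltW d0) ?(ltW S0) //.
    by rewrite -[leRHS]invrK lef_pV2 ?posrE // ?invr_gt0.
  by rewrite -[leRHS]invf_div lef_pV2 ?posrE // divr_gt0.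
apply: (le_trans (ler_sum _ (fun y _ => term y))).
rewrite -mulr_sumr.
apply: (@le_trans _ _ (4 / NY * \sum_(y : Y) (2 * (eps * c y) ^+ 2 + 32 * G ^+ 2 * (eps * B) ^+ 4))).
  by apply: ler_wpM2l; [rewrite divr_ge0 // ltW | apply: ler_sum].
have -> : \sum_(y : Y) (2 * (eps * c y) ^+ 2 + 32 * G ^+ 2 * (eps * B) ^+ 4) =
   NY * (2 * eps ^+ 2 * (\sum_k cov w g (l k) ^+ 2) + 32 * G ^+ 2 * (eps * B) ^+ 4).
  have e1 (z : R) : \sum_(y : Y) z = NY * z.
    by rewrite sumr_const cardT mulr_natl /NY -cardT.
  rewrite big_split /= e1 mulrDr; congr (_ + _).
  rewrite mulrCA -rademacher_second_moment mulr_sumr.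
  by apply: eq_bigr => y _; rewrite exprMn mulrA.
rewrite le_eqVlt; apply/orP; left; apply/eqP; field.
by rewrite gt_eqF.
Qed.

(** The Gibbs variational inequality is tested on g / a, where [g] combines the centred l_k with
    coefficients proportional to their covariances with [f]. Bounded variance under all tilts makes
    [g] sub-Gaussian, so the entropy of [f] dominates the squared covariance vector. *)
Lemma entropic_stability (w f : T -> R) (a : R) :
  (forall x, 0 < w x) -> (forall x, 0 < f x) -> 0 < a ->
  (forall th c : K -> R, var (fun x => w x * expR (\sum_k th k * l k x))
     (fun x => \sum_k c k * l k x) <= a * \sum_k c k ^+ 2) ->
  \sum_k cov w f (l k) ^+ 2 <= 2 * a * mean w f * ent w f.
Proof.
move=> w0 f0 a0 hv; set M := mean w f; have M0 : 0 < M by exact: mean_gt0.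
pose b k := cov w f (l k) / M.
pose g0 x := \sum_k b k * l k x.
pose g x := g0 x - mean w g0.
have mg : mean w g = 0 by rewrite /g meanB mean_cst // subrr.
pose S := \sum_k b k ^+ 2.
have S0 : 0 <= S by apply: sumr_ge0 => k _; exact: sqr_ge0.
have hg s : var (fun x => w x * expR (s * g x)) g <= a * S.
  have := hv (fun k => s * b k) b; rewrite -/S => h.
  have e1 : (fun x => w x * expR (s * g x)) =
    (fun x => expR (- (s * mean w g0)) * (w x * expR (\sum_k s * b k * l k x))).
    apply: funext => x; rewrite mulrCA -expRD; congr (_ * expR _).
    rewrite /g mulrBr addrC; congr (_ + _).
    by rewrite mulr_sumr; apply: eq_bigr => k _; rewrite mulrA.
  have w1 x : 0 < w x * expR (\sum_k s * b k * l k x) by rewrite mulr_gt0 // expR_gt0.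
  have w2 x : 0 < expR (- (s * mean w g0)) * (w x * expR (\sum_k s * b k * l k x)).
    by rewrite mulr_gt0 // expR_gt0.
  rewrite e1; apply: le_trans h.
  set W := (fun x => w x * expR (\sum_k s * b k * l k x)).
  apply: (le_trans (var_le t0 _ (mean W g0 - mean w g0) w2)).
  rewrite mean_scale ?gt_eqF ?expR_gt0 // [leRHS]varE //.
  by apply: ler_mean => // x; rewrite /g; rewrite opprB addrA subrK.
(* The parameter 1 / a is optimal for the linear gain against the quadratic loss. *)
have t1 : 0 <= a^-1 by rewrite invr_ge0 ltW.
have := ln_mgf_le t0 w0 hg mg t1.
have := gibbs_variational t0 (fun x => a^-1 * g x) w0 f0.
rewrite -/M; set L := ln _ => h1 h2.
have e2 : mean w (fun x => f x * (a^-1 * g x)) = a^-1 * (M * S).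
  rewrite (mean_eq (g := fun x => a^-1 * (f x * g x))) => [|x]; last by ring.
  rewrite meanZ; congr (_ * _).
  have -> : mean w (fun x => f x * g x) = cov w f g0.
    rewrite /cov -/M mulrC -[mean w g0 * M]meanZ -meanB; apply: mean_eq => x.
    by rewrite /g; ring.
  rewrite cov_sumr /S mulr_sumr; apply: eq_bigr => k _.
  by rewrite /b; field; rewrite gt_eqF.
rewrite e2 in h1.
have h3 : a^-1 * (M * S) <= ent w f + M * (a * S / 2 * a^-1 ^+ 2).
  by apply: (le_trans h1); rewrite lerD2l ler_pM2l.
have -> : \sum_k cov w f (l k) ^+ 2 = M ^+ 2 * S.
  by rewrite mulr_sumr; apply: eq_bigr => k _; rewrite /b; field; rewrite gt_eqF.
have h4 : a^-1 * (M * S) / 2 <= ent w f.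
  have : M * (a * S / 2 * a^-1 ^+ 2) = a^-1 * (M * S) / 2 by field; rewrite gt_eqF.
  by move: h3; lra.
have : M * S <= 2 * a * ent w f.
  have -> : M * S = 2 * a * (a^-1 * (M * S) / 2) by field; rewrite gt_eqF.
  by rewrite ler_pM2l // mulr_gt0.
move=> h5; have -> : 2 * a * M * ent w f = M * (2 * a * ent w f) by ring.
by rewrite expr2 -mulrA ler_pM2l.
Qed.

Lemma cov_CS (w f g : T -> R) : (forall x, 0 < w x) ->
  cov w f g ^+ 2 <= var w f * var w g.
Proof.
move=> w0.
have q (s : R) : 0 <= var w f - 2 * s * cov w f g + s ^+ 2 * var w g.
  have := var_ge0 t0 (fun x => f x - s * g x) w0.
  have -> // : var w (fun x => f x - s * g x) = var w f - 2 * s * cov w f g + s ^+ 2 * var w g.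
  rewrite /var /cov meanB meanZ.
  have -> : mean w (fun x => (f x - s * g x) * (f x - s * g x)) =
     mean w (fun x => f x * f x) - 2 * s * mean w (fun x => f x * g x)
       + s ^+ 2 * mean w (fun x => g x * g x).
    by rewrite -!meanZ -meanB -meanD; apply: mean_eq => x; ring.
  by ring.
have vg := var_ge0 t0 g w0; have vf := var_ge0 t0 f w0.
move: vg; rewrite le_eqVlt => /orP[/eqP vg|vg].
  rewrite -vg mulr0; have [->|c0] := eqVneq (cov w f g) 0; first by rewrite expr0n.
  have := q ((var w f + 1) / (2 * cov w f g)).
  rewrite -vg mulr0 addr0.
  have -> : 2 * ((var w f + 1) / (2 * cov w f g)) * cov w f g = var w f + 1 by field.
  by lra.
have := q (cov w f g / var w g).
have -> : var w f - 2 * (cov w f g / var w g) * cov w f g + (cov w f g / var w g) ^+ 2 * var w g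
   = (var w f * var w g - cov w f g ^+ 2) / var w g by field; rewrite gt_eqF.
by rewrite pmulr_lge0 ?invr_gt0 // subr_ge0.
Qed.

End step.

(** * Discretised stochastic localization *)

Section dirichlet_form.
Variables (R : realType) (T I Y : finType) (t0 : T) (y0 : Y) (s : I -> T -> T).

(* The Glauber Dirichlet form E(f, ln f) of the normalisation of w, times the number of sites. *)
Definition Dn (w f : T -> R) : R :=
  (\sum_i \sum_x w x * w (s i x) / (w x + w (s i x)) *
     ((f x - f (s i x)) * (ln (f x) - ln (f (s i x))))) / mass w.

(** The constant stands on the Dirichlet side: a smaller [C] is a stronger inequality. *)
Definition MLSI (w : T -> R) (C : R) : Prop :=
  forall f : T -> R, (forall x, 0 < f x) -> ent w f <= C * Dn w f.

Lemma ln_mono_ge0 (a b : R) : 0 < a -> 0 < b -> 0 <= (a - b) * (ln a - ln b).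
Proof.
move=> a0 b0; have [h|h] := leP b a.
  by rewrite mulr_ge0 // subr_ge0 // ler_ln.
by rewrite mulr_le0 // subr_le0 ?ltW // ltr_ln.
Qed.

(* The parallel-sum is the minimum over t of the quadratic on the right. *)
Lemma parallel_le (a b t : R) : 0 < a -> 0 < b ->
  a * b / (a + b) <= (1 - t) ^+ 2 * a + t ^+ 2 * b.
Proof.
move=> a0 b0; have s0 : 0 < a + b by rewrite addr_gt0.
rewrite ler_pdivrMr // -subr_ge0.
have -> : ((1 - t) ^+ 2 * a + t ^+ 2 * b) * (a + b) - a * b =
  (a - t * (a + b)) ^+ 2 by ring.
exact: sqr_ge0.
Qed.

Lemma parallel_eq (a b : R) : 0 < a -> 0 < b ->
  a * b / (a + b) = (1 - a / (a + b)) ^+ 2 * a + (a / (a + b)) ^+ 2 * b.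
Proof. by move=> a0 b0; field; rewrite gt_eqF // addr_gt0. Qed.

(** As a minimum of linear functions the parallel sum is concave and homogeneous, hence
    superadditive: the [t] that is optimal for the totals serves for every [y]. *)
Lemma parallel_sum (a b : Y -> R) : (forall y, 0 < a y) -> (forall y, 0 < b y) ->
  \sum_y a y * b y / (a y + b y) <=
  (\sum_y a y) * (\sum_y b y) / (\sum_y a y + \sum_y b y).
Proof.
move=> a0 b0.
have A0 : 0 < \sum_y a y by exact: (mass_gt0 y0 (w := a)).
have B0 : 0 < \sum_y b y by exact: (mass_gt0 y0 (w := b)).
rewrite parallel_eq //; set t := _ / _.
rewrite !mulr_sumr -big_split; apply: ler_sum => y _ /=.
exact: parallel_le.
Qed.

Lemma parallel_mono (a b c d : R) : 0 < a -> 0 < b -> a <= c -> b <= d ->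
  a * b / (a + b) <= c * d / (c + d).
Proof.
move=> a0 b0 ac bd.
have c0 : 0 < c by exact: lt_le_trans ac. have d0 : 0 < d by exact: lt_le_trans bd.
rewrite (parallel_eq c0 d0); apply: (le_trans (parallel_le (c / (c + d)) a0 b0)).
by rewrite lerD // ler_wpM2l ?sqr_ge0.
Qed.

Lemma Dn_ge0 w f : (forall x, 0 < w x) -> (forall x, 0 < f x) -> 0 <= Dn w f.
Proof.
move=> w0 f0; rewrite /Dn divr_ge0 //; last by rewrite ltW // (mass_gt0 t0).
apply: sumr_ge0 => i _; apply: sumr_ge0 => x _.
by rewrite mulr_ge0 ?ln_mono_ge0 // divr_ge0 ?mulr_ge0 ?addr_ge0 // ltW.
Qed.

Lemma Dn_le w w' c f : (forall x, 0 < w x) -> (forall x, 0 < f x) ->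
  (forall x, w x <= w' x) -> mass w' <= c * mass w -> Dn w f <= c * Dn w' f.
Proof.
move=> w0 f0 ww hm.
have w'0 x : 0 < w' x by exact: lt_le_trans (ww x).
have m0 := mass_gt0 t0 w0; have m'0 := mass_gt0 t0 w'0.
rewrite /Dn ler_pdivrMr //.
set S' := (X in _ <= c * (X / _) * _).
have S0 : 0 <= S'.
  apply: sumr_ge0 => i _; apply: sumr_ge0 => x _.
  by rewrite mulr_ge0 ?ln_mono_ge0 // divr_ge0 ?mulr_ge0 ?addr_ge0 // ltW.
apply: (@le_trans _ _ S').
  apply: ler_sum => i _; apply: ler_sum => x _.
  by apply: ler_wpM2r; [exact: ln_mono_ge0 | exact: parallel_mono].
have -> : c * (S' / mass w') * mass w = S' * ((c * mass w) / mass w') by ring.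
by rewrite -[leLHS]mulr1 ler_wpM2l // ler_pdivlMr // mul1r.
Qed.

Lemma Dn_scale c w f : 0 < c -> Dn (fun x => c * w x) f = Dn w f.
Proof.
move=> c0; rewrite /Dn /mass -mulr_sumr.
have -> : \sum_i \sum_x c * w x * (c * w (s i x)) / (c * w x + c * w (s i x)) *
     ((f x - f (s i x)) * (ln (f x) - ln (f (s i x)))) =
  c * \sum_i \sum_x w x * w (s i x) / (w x + w (s i x)) *
     ((f x - f (s i x)) * (ln (f x) - ln (f (s i x)))).
  rewrite mulr_sumr; apply: eq_bigr => i _; rewrite mulr_sumr; apply: eq_bigr => x _.
  rewrite -mulrDr invfM; set D := (w x + _)^-1; set X := (f x - _) * _.
  have -> : c * w x * (c * w (s i x)) * (c^-1 * D) * X =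
     (c * c^-1) * (c * (w x * w (s i x) * D * X)) by ring.
  by rewrite divff ?mul1r // gt_eqF.
by rewrite invfM mulrACA divff ?mul1r // gt_eqF.
Qed.

(** By superadditivity of the parallel sum. Localization rests on it: the inequality is known for
    the components and has to be carried back to their mixture. *)
Lemma Dn_mix (v : Y -> T -> R) (w f : T -> R) :
  (forall y x, 0 < v y x) -> (forall x, w x = \sum_y v y x) ->
  (forall x, 0 < f x) -> \sum_y mixw v w y * Dn (v y) f <= Dn w f.
Proof.
move=> v0 wE f0.
have w0 := mix_gt0 y0 v0 wE.
have m0 := mass_gt0 t0 w0.
rewrite /Dn ler_pdivlMr // mulr_suml.
have e y : mixw v w y * ((\sum_i \sum_x v y x * v y (s i x) / (v y x + v y (s i x)) *
     ((f x - f (s i x)) * (ln (f x) - ln (f (s i x))))) / mass (v y)) * mass w =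
   \sum_i \sum_x v y x * v y (s i x) / (v y x + v y (s i x)) *
     ((f x - f (s i x)) * (ln (f x) - ln (f (s i x)))).
  rewrite /mixw; set S := \sum_i _.
  by have := mass_gt0 t0 (v0 y) => my; field; rewrite !gt_eqF.
rewrite (eq_bigr _ (fun y _ => e y)) exchange_big; apply: ler_sum => i _ /=.
rewrite exchange_big; apply: ler_sum => x _ /=.
rewrite -mulr_suml; apply: ler_wpM2r; first exact: ln_mono_ge0.
by rewrite !wE; apply: parallel_sum.
Qed.

End dirichlet_form.

Section localization.
Variables (R : realType) (T I K : finType) (t0 : T) (s : I -> T -> T).
Variables (w0 : T -> R) (l : K -> T -> R).
Hypothesis w0_gt0 : forall x, 0 < w0 x.
Notation Y := {ffun K -> bool}.

(* Averaging [locw eps j (th + eps * y)] over y in {-1,1}^K gives [locw eps j.+1 th]. With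
   eps = N^(-1/2), the weight [locw eps N 0] tends to [w0 * exp (\sum_k l_k ^ 2 / 2)], so the
   tilts [locw eps j th], j = N, N-1, ..., 0, discretise stochastic localization. *)
Definition locw (eps : R) (j : nat) (th : K -> R) (x : T) : R :=
  w0 x * (\prod_k ch (eps * l k x) ^+ j) * expR (\sum_k th k * l k x).

Lemma locw_gt0 eps j th x : 0 < locw eps j th x.
Proof.
rewrite !mulr_gt0 ?expR_gt0 //; apply: prodr_gt0 => k _.
by rewrite exprn_gt0 // ch_gt0.
Qed.

Lemma locw_shift eps j th (y : Y) x :
  expR (eps * rad l y x) * locw eps j th x =
  locw eps j (fun k => th k + eps * sg R (y k)) x.
Proof.
rewrite /locw mulrCA -expRD; congr (_ * expR _).
rewrite /rad mulr_sumr -big_split; apply: eq_bigr => k _ /=; ring.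
Qed.

Lemma locw_tilt eps j th c x :
  locw eps j th x * expR (\sum_k c k * l k x) = locw eps j (fun k => th k + c k) x.
Proof.
rewrite /locw -mulrA -expRD; congr (_ * expR _).
by rewrite -big_split; apply: eq_bigr => k _ /=; rewrite mulrDl.
Qed.

Let NY : R := #|{: Y}|%:R.

Lemma NY_gt0 : 0 < NY.
Proof. by rewrite ltr0n; apply/card_gt0P; exists [ffun => true]. Qed.

Lemma locw_mix eps j th x :
  \sum_(y : Y) expR (eps * rad l y x) * locw eps j th x =
  NY * locw eps j.+1 th x.
Proof.
rewrite -mulr_suml.
have -> : \sum_(y : Y) expR (eps * rad l y x) = NY * \prod_k ch (eps * l k x).
  rewrite -prod_ch; apply: eq_bigr => y _; congr expR.
  by rewrite mulr_sumr; apply: eq_bigr => k _; rewrite mulrCA.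
rewrite /locw.
have -> : \prod_k ch (eps * l k x) ^+ j.+1 =
   \prod_k ch (eps * l k x) * \prod_k ch (eps * l k x) ^+ j.
  by rewrite -big_split; apply: eq_bigr => k _ /=; rewrite exprS.
ring.
Qed.

Variables (B : R).
Hypothesis B_ge0 : 0 <= B.
Hypothesis radB : forall (y : Y) x, `|rad l y x| <= B.

Lemma locw_le eps j th x : locw eps j th x <= locw eps j.+1 th x.
Proof.
rewrite /locw ler_pM2r ?expR_gt0 // ler_pM2l //.
apply: ler_prod => k _; rewrite exprn_ge0 /=; last by rewrite ltW // ch_gt0.
by rewrite exprS ler_peMl ?ch_ge1 // exprn_ge0 // ltW // ch_gt0.
Qed.

(** A crude factor 2 suffices, because it only affects terms that already carry a factor
    [eps ^+ 2]. *)
Lemma locw_mass_le eps j th : 0 <= eps -> eps * B <= 2^-1 ->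
  mass (locw eps j.+1 th) <= 2 * mass (locw eps j th).
Proof.
move=> e0 eB; rewrite /mass mulr_sumr; apply: ler_sum => x _.
have e1 := locw_mix eps j th x; rewrite -mulr_suml in e1.
rewrite -(ler_pM2l NY_gt0) -e1 [NY * (2 * _)]mulrA ler_pM2r ?locw_gt0 //.
have -> : NY * 2 = \sum_(y : Y) 2 by rewrite sumr_const mulr_natl /NY cardT.
apply: ler_sum => y _.
have h : eps * rad l y x <= 2^-1.
  apply: le_trans eB; rewrite ler_wpM2l //.
  exact: le_trans (ler_norm _) (radB y x).
have := expR_ge1Dx (- (eps * rad l y x)); rewrite expRN => h2.
have e2 := expR_gt0 (eps * rad l y x).
have : expR (eps * rad l y x) * (1 - eps * rad l y x) <= 1.
  have := ler_pM2l e2 (1 - eps * rad l y x) (expR (eps * rad l y x))^-1.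
  by rewrite h2 divff ?gt_eqF // => ->.
nra.
Qed.

Lemma mean_locwS eps j th g :
  mean (fun x => \sum_(y : Y) expR (eps * rad l y x) * locw eps j th x) g =
  mean (locw eps j.+1 th) g.
Proof.
rewrite (mean_ext (w' := fun x => NY * locw eps j.+1 th x)); last exact: locw_mix.
by rewrite mean_scale // gt_eqF // NY_gt0.
Qed.

Lemma ent_locwS eps j th f :
  ent (fun x => \sum_(y : Y) expR (eps * rad l y x) * locw eps j th x) f =
  ent (locw eps j.+1 th) f.
Proof. by rewrite /ent !mean_locwS. Qed.

Lemma var_locwS eps j th f :
  var (fun x => \sum_(y : Y) expR (eps * rad l y x) * locw eps j th x) f =
  var (locw eps j.+1 th) f.
Proof. by rewrite /var /cov !mean_locwS. Qed.

Lemma Dn_locwS eps j th f :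
  Dn s (fun x => \sum_(y : Y) expR (eps * rad l y x) * locw eps j th x) f =
  Dn s (locw eps j.+1 th) f.
Proof.
rewrite -[RHS](Dn_scale s (locw eps j.+1 th) f NY_gt0); congr (Dn s _ f).
by apply: funext => x; exact: locw_mix.
Qed.

(** Level j.+1 is a mixture of tilts at level j. The average of their entropies is bounded by the
    hypothesis and [Dn_mix]; the spread of their means is bounded, through [step_var] and
    [entropic_stability], by eps ^ 2 * a times an entropy at level j. The lower bound [m] on [f]
    appears because the fourth-order error is divided by the mean of [f]. *)
Lemma ent_step eps a Kj G m e j (f : T -> R) :
  0 <= eps -> eps * B <= 2^-1 -> 0 < a -> 0 <= Kj -> 0 < m ->
  (forall x, m <= f x <= G) ->
  (forall th c, var (locw eps j th) (fun x => \sum_k c k * l k x) <=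
     a * \sum_k c k ^+ 2) ->
  (forall th, ent (locw eps j th) f <= Kj * Dn s (locw eps j th) f + e) -> 0 <= e ->
  forall th, ent (locw eps j.+1 th) f <=
    (1 + 64 * eps ^+ 2 * a) * (Kj * Dn s (locw eps j.+1 th) f + e)
    + 128 * G ^+ 2 * B ^+ 4 / m * eps ^+ 4.
Proof.
move=> e0 eB a0 K0 m0 hf hv IH he th.
have f0 x : 0 < f x by have /andP[h _] := hf x; exact: lt_le_trans h.
have fG x : `|f x| <= G by rewrite gtr0_norm //; have /andP[] := hf x.
pose w := locw eps j th.
have w_gt0 x : 0 < w x by exact: locw_gt0.
pose v (y : Y) x := expR (eps * rad l y x) * w x.
pose w' x := \sum_(y : Y) v y x.
have v0 y x : 0 < v y x by rewrite mulr_gt0 // expR_gt0.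
have w'E x : w' x = \sum_y v y x by [].
have y0 : Y := [ffun => true].
have w'0 := mix_gt0 y0 v0 w'E.
have q0 y := mixw_gt0 t0 y0 v0 w'E y.
have q1 := mixw1 t0 y0 v0 w'E.
have h1 := ent_mix t0 y0 v0 w'E (mean w f) f0.
have h2 := step_var t0 w_gt0 e0 B_ge0 radB eB fG.
rewrite -/v -/w' in h2.
have h3 : \sum_k cov w f (l k) ^+ 2 <= 2 * a * mean w f * ent w f.
  apply: (entropic_stability t0) => // th' c.
  have := hv (fun k => th k + th' k) c; rewrite (_ : locw _ _ _ = (fun x => w x * expR (\sum_k th' k * l k x))) //.
  by apply: funext => x; rewrite locw_tilt.
have M0 : 0 < mean w f by exact: mean_gt0.
have M'0 : 0 < mean w' f by exact: mean_gt0.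
have Mm : m <= mean w' f.
  rewrite -(mean_cst t0 m w'0) ler_mean // => x; by have /andP[] := hf x.
have ww := locw_le eps j th.
have mm := locw_mass_le j th e0 eB.
have MM : mean w f <= 2 * mean w' f.
  rewrite mean_locwS /mean.
  have n0 := mass_gt0 t0 w_gt0; have n1 := mass_gt0 t0 (locw_gt0 eps j.+1 th).
  rewrite ler_pdivrMr //.
  set S' := \sum_x locw eps j.+1 th x * f x.
  have S0 : 0 <= S' by apply: sumr_ge0 => x _; rewrite ltW // mulr_gt0 // locw_gt0.
  apply: (@le_trans _ _ S').
    by apply: ler_sum => x _; rewrite ler_pM2r.
  have -> : 2 * (S' / mass (locw eps j.+1 th)) * mass w =
     S' * ((2 * mass w) / mass (locw eps j.+1 th)) by ring.
  by rewrite -[leLHS]mulr1 ler_wpM2l // ler_pdivlMr // mul1r.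
have hD : Dn s w f <= 2 * Dn s (locw eps j.+1 th) f by apply: (Dn_le t0).
have Ew := IH th; rewrite -/w in Ew.
set D' := Dn s (locw eps j.+1 th) f in hD *.
have D'0 : 0 <= D' by apply: (Dn_ge0 t0) => // x; exact: locw_gt0.
have h4 : \sum_y mixw v w' y * ent (v y) f <= Kj * D' + e.
  apply: (@le_trans _ _ (\sum_y (Kj * (mixw v w' y * Dn s (v y) f) + mixw v w' y * e))).
    apply: ler_sum => y _.
    have -> : v y = locw eps j (fun k => th k + eps * sg R (y k)).
      by apply: funext => x; rewrite /v locw_shift.
    by rewrite mulrCA -mulrDr ler_pM2l.
  rewrite big_split -mulr_sumr -mulr_suml q1 mul1r lerD2r ler_wpM2l //.
  by rewrite /D' -Dn_locwS; apply: (Dn_mix t0 y0).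
rewrite -ent_locwS -/w -/w'; apply: (le_trans h1).
have E0 : 0 <= ent w f by exact: ent_ge0.
have h5 : (\sum_y mixw v w' y * (mean (v y) f - mean w f) ^+ 2) / mean w' f <=
   32 * eps ^+ 2 * a * ent w f + 128 * G ^+ 2 * B ^+ 4 / m * eps ^+ 4.
  rewrite ler_pdivrMr //; apply: (le_trans h2).
  rewrite [leRHS]mulrDl; apply: lerD.
    apply: (@le_trans _ _ (8 * eps ^+ 2 * (2 * a * mean w f * ent w f))).
      by rewrite ler_wpM2l // mulr_ge0 // sqr_ge0.
    have -> : 8 * eps ^+ 2 * (2 * a * mean w f * ent w f) =
       16 * (eps ^+ 2 * a * ent w f) * mean w f by ring.
    have -> : 32 * eps ^+ 2 * a * ent w f * mean w' f =
       16 * (eps ^+ 2 * a * ent w f) * (2 * mean w' f) by ring.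
    by rewrite ler_wpM2l // mulr_ge0 // !mulr_ge0 // ?sqr_ge0 // ltW.
  have -> : 128 * G ^+ 2 * B ^+ 4 / m * eps ^+ 4 * mean w' f =
    128 * G ^+ 2 * (eps * B) ^+ 4 * (mean w' f / m) by ring.
  rewrite -[leLHS]mulr1 ler_wpM2l //.
    have e4 : 0 <= (eps * B) ^+ 4 by rewrite exprn_ge0 // mulr_ge0.
    by rewrite mulr_ge0 // mulr_ge0 // sqr_ge0.
  by rewrite ler_pdivlMr // mul1r.
have h6 : 32 * eps ^+ 2 * a * ent w f <= 64 * eps ^+ 2 * a * (Kj * D' + e).
  have -> : 64 * eps ^+ 2 * a * (Kj * D' + e) = 32 * eps ^+ 2 * a * (Kj * (2 * D') + 2 * e) by ring.
  apply: ler_wpM2l; first by rewrite mulr_ge0 ?(ltW a0) // mulr_ge0 // sqr_ge0.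
  apply: (le_trans Ew); apply: lerD; first exact: ler_wpM2l.
  by lra.
by move: h4 h5 h6; lra.
Qed.

End localization.

Section limits.
Variable R : realType.

Lemma eventually_nat_ge (x : R) : exists N : nat, x <= N%:R.
Proof.
exists (Num.truncn `|x|).+1; apply: le_trans (ler_norm x) _.
by rewrite ltW // truncnS_gt.
Qed.

(** The passage to infinitely many steps: expR (c / N) compares the discretised weight with its
    limit, and D / N is the accumulated fourth-order error. *)
Lemma le_of_asymptotic (x A D c : R) (N1 : nat) : 0 <= A -> 0 <= D -> 0 <= c ->
  (forall N : nat, (N1 <= N)%N -> (0 < N)%N ->
     x <= expR (c / N%:R) * (expR (c / N%:R) * A + D / N%:R)) -> x <= A.
Proof.
move=> A0 D0 c0 h; apply/ler_addgt0Pr => e e0.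
have [N hN] := eventually_nat_ge (4 * c + (4 * c * A + 2 * D) / e + N1%:R).
have q0 : 0 <= (4 * c * A + 2 * D) / e.
  by rewrite divr_ge0 ?(ltW e0) // addr_ge0 ?mulr_ge0.
pose M := N.+1.
have M0 : 0 < M%:R :> R by rewrite ltr0n.
have NM : N%:R <= M%:R :> R by rewrite ler_nat.
have N1M : (N1 <= M)%N.
  rewrite -(ler_nat R); apply: le_trans NM; apply: le_trans hN.
  by rewrite lerDr addr_ge0 // mulr_ge0.
have cM : 4 * c <= M%:R.
  by apply: le_trans NM; apply: le_trans hN; rewrite -addrA lerDl addr_ge0.
have qM : (4 * c * A + 2 * D) / e <= M%:R.
  apply: le_trans NM; apply: le_trans hN; rewrite addrAC lerDr.
  by rewrite addr_ge0 // mulr_ge0.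
have := h M N1M (ltn0Sn _); set u := c / M%:R.
have u0 : 0 <= u by rewrite divr_ge0 // ltW.
have u4 : u <= 4^-1 by rewrite ler_pdivrMr // mulrC ler_pdivlMr // mulrC.
have h1 : expR (2 * u) <= 1 + 4 * u.
  have : `|2 * u| <= 2^-1 by rewrite ger0_norm ?mulr_ge0 //; lra.
  by move=> /expR_le_quad; rewrite ler_norml => /andP[_]; nra.
have h2 : expR u <= 2.
  have : `|u| <= 2^-1 by rewrite ger0_norm //; lra.
  by move=> /expR_le_quad; rewrite ler_norml => /andP[_]; nra.
have -> : expR u * (expR u * A + D / M%:R) = expR (2 * u) * A + expR u * (D / M%:R).
  have -> : expR (2 * u) = expR u * expR u by rewrite -expRD; congr expR; ring.
  ring.
move=> h3; apply: (le_trans h3).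
have DM0 : 0 <= D / M%:R by rewrite divr_ge0 // ltW.
have h4 : expR (2 * u) * A <= (1 + 4 * u) * A by rewrite ler_wpM2r.
have h5 : expR u * (D / M%:R) <= 2 * (D / M%:R) by rewrite ler_wpM2r.
apply: (le_trans (lerD h4 h5)); rewrite mulrDl mul1r -addrA lerD2l.
have -> : 4 * u * A + 2 * (D / M%:R) = (4 * c * A + 2 * D) / M%:R.
  by rewrite /u; field; rewrite gt_eqF.
by rewrite ler_pdivrMr // -ler_pdivrMl // mulrC.
Qed.

(** By Lagrange's identity. *)
Lemma sum_CS (K : finType) (F H : K -> R) :
  (\sum_k F k * H k) ^+ 2 <= (\sum_k F k ^+ 2) * (\sum_k H k ^+ 2).
Proof.
rewrite -subr_ge0.
have -> : (\sum_k F k ^+ 2) * (\sum_k H k ^+ 2) - (\sum_k F k * H k) ^+ 2 =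
  2^-1 * \sum_k \sum_k' (F k * H k' - F k' * H k) ^+ 2.
  have e1 : \sum_k \sum_k' (F k * H k' - F k' * H k) ^+ 2 =
    \sum_k \sum_k' (F k ^+ 2 * H k' ^+ 2) + \sum_k \sum_k' (H k ^+ 2 * F k' ^+ 2)
    - 2 * \sum_k \sum_k' ((F k * H k) * (F k' * H k')).
    rewrite mulr_sumr -!big_split -sumrB; apply: eq_bigr => k _ /=.
    rewrite mulr_sumr -!big_split -sumrB; apply: eq_bigr => k' _ /=; ring.
  have e2 (A B : K -> R) : \sum_k \sum_k' A k * B k' = (\sum_k A k) * (\sum_k B k).
    by rewrite mulr_suml; apply: eq_bigr => k _; rewrite mulr_sumr.
  by rewrite e1 !e2; field.
rewrite mulr_ge0 ?invr_ge0 //; apply: sumr_ge0 => k _; apply: sumr_ge0 => k' _.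
exact: sqr_ge0.
Qed.

End limits.

Section localization_theorem.
Variables (R : realType) (T I K : finType) (t0 : T) (s : I -> T -> T).
Variables (w0 : T -> R) (l : K -> T -> R).
Hypothesis w0_gt0 : forall x, 0 < w0 x.
Notation Y := {ffun K -> bool}.

Let B : R := \sum_x \sum_k `|l k x|.

Lemma localization_B_ge0 : 0 <= B.
Proof. by apply: sumr_ge0 => x _; apply: sumr_ge0. Qed.

Lemma localization_radB (y : Y) x : `|rad l y x| <= B.
Proof.
apply: (@le_trans _ _ (\sum_k `|l k x|)).
  apply: (le_trans (ler_norm_sum _ _ _)); apply: ler_sum => k _.
  by rewrite normrM sg_norm mul1r.
rewrite /B (bigD1 x) //= lerDl; apply: sumr_ge0 => x' _; exact: sumr_ge0.
Qed.

Let eps (N : nat) : R := Num.sqrt N%:R^-1.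

Lemma eps_ge0 N : 0 <= eps N. Proof. exact: sqrtr_ge0. Qed.

Lemma eps_sqr N : eps N ^+ 2 = N%:R^-1.
Proof. by rewrite /eps sqr_sqrtr // invr_ge0. Qed.

Lemma epsB N : (0 < N)%N -> 4 * B ^+ 2 <= N%:R -> eps N * B <= 2^-1.
Proof.
move=> N0 hN; have n0 : 0 < N%:R :> R by rewrite ltr0n.
have b0 := localization_B_ge0.
rewrite -(@ler_pXn2r _ 2) ?nnegrE ?mulr_ge0 ?eps_ge0 //.
rewrite exprMn eps_sqr mulrC ler_pdivrMr //.
by rewrite -ler_pdivrMl ?invr_gt0 ?exprn_gt0 // exprVn invrK; move: hN; rewrite -natrX.
Qed.

Lemma ent_iter a K0 N m G (f : T -> R) : (0 < N)%N -> 4 * B ^+ 2 <= N%:R ->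
  0 < a -> 0 <= K0 -> 0 < m -> (forall x, m <= f x <= G) ->
  (forall j th c, (j < N)%N ->
     var (locw w0 l (eps N) j th) (fun x => \sum_k c k * l k x) <=
     a * \sum_k c k ^+ 2) ->
  (forall th, MLSI s (fun x => w0 x * expR (\sum_k th k * l k x)) K0) ->
  forall j th, (j <= N)%N ->
    ent (locw w0 l (eps N) j th) f <= (1 + 64 * a / N%:R) ^+ j *
      (K0 * Dn s (locw w0 l (eps N) j th) f
       + j%:R * (128 * G ^+ 2 * B ^+ 4 / m * eps N ^+ 4)).
Proof.
move=> N0 hN a0 K00 m0 hf hv h0.
have f0 x : 0 < f x by have /andP[h _] := hf x; exact: lt_le_trans h.
set C := 128 * G ^+ 2 * B ^+ 4 / m * eps N ^+ 4.
have b0 := localization_B_ge0.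
have C0 : 0 <= C.
  by rewrite /C mulr_ge0 ?exprn_ge0 ?eps_ge0 // divr_ge0 ?(ltW m0) // mulr_ge0 ?exprn_ge0 // mulr_ge0 // sqr_ge0.
have n0 : 0 < N%:R :> R by rewrite ltr0n.
set r := 1 + _.
have r1 : 1 <= r by rewrite lerDl divr_ge0 ?(ltW n0) // mulr_ge0 // ltW.
elim=> [|j IH] th jN.
  rewrite expr0 mul1r mul0r addr0.
  have -> : locw w0 l (eps N) 0 th = (fun x => w0 x * expR (\sum_k th k * l k x)).
    by apply: funext => x; rewrite /locw big1 ?mulr1 // => k _; rewrite expr0.
  exact: h0.
have IH' th' := IH th' (ltnW jN).
have rj0 : 0 <= r ^+ j by rewrite exprn_ge0 // (le_trans _ r1).
have D0 : 0 <= Dn s (locw w0 l (eps N) j.+1 th) f.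
  by apply: (Dn_ge0 t0) => // x; exact: locw_gt0.
have := @ent_step R T I K t0 s w0 l w0_gt0 B b0 localization_radB (eps N) a
   (r ^+ j * K0) G m (r ^+ j * (j%:R * C)) j f (eps_ge0 N) (epsB N0 hN) a0
   (mulr_ge0 rj0 K00) m0 hf (fun th c => hv j th c jN).
have -> : 1 + 64 * eps N ^+ 2 * a = r by rewrite eps_sqr /r; congr (_ + _); ring.
rewrite -/C => h; apply: (le_trans (h _ _ th)).
- by move=> th'; have := IH' th'; rewrite mulrDr mulrA.
- by rewrite mulr_ge0 // mulr_ge0.
rewrite exprS.
have -> : r * (r ^+ j * K0 * Dn s (locw w0 l (eps N) j.+1 th) f + r ^+ j * (j%:R * C)) =
   r * r ^+ j * (K0 * Dn s (locw w0 l (eps N) j.+1 th) f + j%:R * C) by ring.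
have -> : K0 * Dn s (locw w0 l (eps N) j.+1 th) f + j.+1%:R * C =
   (K0 * Dn s (locw w0 l (eps N) j.+1 th) f + j%:R * C) + C by rewrite -natr1; ring.
rewrite [leRHS]mulrDr lerD2l ler_peMl // -exprS.
by rewrite exprn_ege1.
Qed.

Lemma exists_pos_bounds (f : T -> R) : (forall x, 0 < f x) ->
  exists m G : R, 0 < m /\ forall x, m <= f x <= G.
Proof.
move=> f0; exists (\sum_x (f x)^-1)^-1, (\sum_x f x).
have S0 : 0 < \sum_x (f x)^-1.
  by apply: (mass_gt0 t0 (w := fun x => (f x)^-1)) => x; rewrite invr_gt0.
rewrite invr_gt0 S0; split=> // x; apply/andP; split.
  rewrite -[leRHS]invrK lef_pV2 ?posrE ?invr_gt0 //.
  by rewrite (bigD1 x) //= lerDl; apply: sumr_ge0 => y _; rewrite invr_ge0 ltW.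
by rewrite (bigD1 x) //= lerDl; apply: sumr_ge0 => y _; rewrite ltW.
Qed.

(** For each fixed [f] the inequality at level N is transferred to the limiting weight, from which
    it differs by a factor exp (O(1 / N)), and then N tends to infinity. The factor expR (64 * a)
    dominates (1 + 64 a / N) ^ N. *)
Theorem localization_MLSI a K0 (N0 : nat) : 0 < a -> 0 <= K0 ->
  (forall N j th c, (N0 <= N)%N -> (j < N)%N ->
     var (locw w0 l (Num.sqrt N%:R^-1) j th) (fun x => \sum_k c k * l k x) <=
     a * \sum_k c k ^+ 2) ->
  (forall th, MLSI s (fun x => w0 x * expR (\sum_k th k * l k x)) K0) ->
  MLSI s (fun x => w0 x * expR (\sum_k l k x ^+ 2 / 2)) (K0 * expR (64 * a)).
Proof.
move=> a0 K00 hv h0 f f0.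
set mu := fun x => _.
have mu0 x : 0 < mu x by rewrite mulr_gt0 // expR_gt0.
have [m [G [m0 hf]]] := exists_pos_bounds f0.
have b0 := localization_B_ge0.
pose c := \sum_x \sum_k l k x ^+ 4 / 4.
have c0 : 0 <= c by apply: sumr_ge0 => x _; apply: sumr_ge0 => k _; rewrite divr_ge0 // -[4%N]/(2 * 2)%N exprM sqr_ge0.
have cx x : \sum_k l k x ^+ 4 / 4 <= c.
  rewrite /c (bigD1 x) //= lerDl; apply: sumr_ge0 => x' _.
  by apply: sumr_ge0 => k _; rewrite divr_ge0 // -[4%N]/(2 * 2)%N exprM sqr_ge0.
have [N2 hN2] := eventually_nat_ge (4 * B ^+ 2).
have Dmu : 0 <= Dn s mu f by exact: Dn_ge0.
pose C := 128 * G ^+ 2 * B ^+ 4 / m.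
have C0 : 0 <= C.
  by rewrite /C divr_ge0 ?(ltW m0) // mulr_ge0 ?exprn_ge0 // mulr_ge0 // sqr_ge0.
have e640 := ltW (expR_gt0 (64 * a)).
apply: (@le_of_asymptotic R _ _ (expR (64 * a) * C) c (maxn N0 N2)) => //.
- by rewrite mulr_ge0 // mulr_ge0.
- by rewrite mulr_ge0.
move=> N; rewrite geq_max => /andP[N0N N2N] Np.
have n0 : 0 < N%:R :> R by rewrite ltr0n.
have hN : 4 * B ^+ 2 <= N%:R by apply: (le_trans hN2); rewrite ler_nat.
pose th0 (k : K) : R := 0.
pose W := locw w0 l (eps N) N th0.
have W0 x : 0 < W x by exact: locw_gt0.
set E := expR (c / N%:R).
have th00 x : expR (\sum_k th0 k * l k x) = 1.
  by rewrite big1 ?expR0 // => k _; rewrite mul0r.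
have Wmu x : W x <= mu x.
  rewrite /W /locw th00 mulr1 /mu ler_pM2l // expR_sum; apply: ler_prod => k _.
  rewrite exprn_ge0 /=; last by rewrite ltW // ch_gt0.
  have -> : expR (l k x ^+ 2 / 2) = expR ((eps N * l k x) ^+ 2 / 2) ^+ N.
    rewrite -expRM_natl; congr expR; rewrite exprMn eps_sqr.
    by field; rewrite gt_eqF.
  by rewrite ler_pXn2r ?nnegrE ?(ltW (expR_gt0 _)) ?(ltW (ch_gt0 _)) // ch_le.
have muW x : mu x <= E * W x.
  rewrite /W /locw th00 mulr1 /mu mulrCA ler_pM2l //.
  apply: (@le_trans _ _ ((\prod_k ch (eps N * l k x) ^+ N) * expR (\sum_k l k x ^+ 4 / 4 / N%:R))).
    rewrite !expR_sum -big_split /=; apply: ler_prod => k _.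
    rewrite ltW ?expR_gt0 //=.
    have -> : expR (l k x ^+ 2 / 2) = expR ((eps N * l k x) ^+ 2 / 2) ^+ N.
      rewrite -expRM_natl; congr expR; rewrite exprMn eps_sqr.
      by field; rewrite gt_eqF.
    have -> : expR (l k x ^+ 4 / 4 / N%:R) = expR ((eps N * l k x) ^+ 4 / 4) ^+ N.
      rewrite -expRM_natl; congr expR; rewrite exprMn -[4%N]/(2 * 2)%N [eps N ^+ _]exprM eps_sqr.
      by field; rewrite gt_eqF.
    rewrite -exprMn ler_pXn2r ?nnegrE ?(ltW (expR_gt0 _)) //.
      exact: expR_le_ch.
    by rewrite mulr_ge0 ?(ltW (expR_gt0 _)) ?(ltW (ch_gt0 _)).
  rewrite [leRHS]mulrC ler_pM2l; last first.
    by apply: prodr_gt0 => k _; rewrite exprn_gt0 // ch_gt0.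
  by rewrite /E ler_expR -mulr_suml ler_pM2r ?invr_gt0.
have hW : ent W f <= expR (64 * a) * (K0 * Dn s W f + C / N%:R).
  have := ent_iter Np hN a0 K00 m0 hf (fun j th c jN => hv N j th c N0N jN) h0 th0 (leqnn N).
  rewrite -/W => h; apply: (le_trans h).
  have DW : 0 <= Dn s W f by exact: Dn_ge0.
  have -> : N%:R * (128 * G ^+ 2 * B ^+ 4 / m * eps N ^+ 4) = C / N%:R.
    rewrite -/C -[4%N in X in _ * (_ * X)]/(2 * 2)%N [eps N ^+ _]exprM eps_sqr.
    by field; rewrite gt_eqF.
  apply: ler_wpM2r.
    by apply: addr_ge0; [exact: mulr_ge0 | apply: divr_ge0 => //; exact: ltW].
  have -> : expR (64 * a) = expR (64 * a / N%:R) ^+ N.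
    by rewrite -expRM_natl; congr expR; field; rewrite gt_eqF.
  rewrite ler_pXn2r ?nnegrE ?(ltW (expR_gt0 _)) ?expR_ge1Dx //.
  by rewrite addr_ge0 // divr_ge0 ?(ltW n0) // mulr_ge0 // ltW.
have mW := mass_gt0 t0 W0; have mmu := mass_gt0 t0 mu0.
have Mf : 0 < mean W f by exact: mean_gt0.
have h1 : ent mu f <= E * ent W f.
  apply: (le_trans (ent_le t0 mu0 f0 Mf)).
  rewrite [ent W f](ent_eq t0) // {1}/mean ler_pdivrMr //.
  set phi := fun x => f x * ln (f x) - f x * ln (mean W f) - f x + mean W f.
  have phi0 x : 0 <= phi x by exact: entropy_integrand_ge0.
  apply: (@le_trans _ _ (\sum_x E * (W x * phi x))).
    apply: ler_sum => x _; rewrite mulrA; apply: ler_wpM2r; first exact: phi0.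
    exact: muW.
  rewrite -mulr_sumr -mulrA ler_wpM2l ?(ltW (expR_gt0 _)) //.
  rewrite -mean_mass // ler_wpM2l //; first exact: mean_ge0.
  by apply: ler_sum.
have h2 : Dn s W f <= E * Dn s mu f.
  apply: (Dn_le t0) => //; apply: mass_le_of_ratio => x; exact: muW.
apply: (le_trans h1); rewrite ler_wpM2l ?(ltW (expR_gt0 _)) //.
apply: (le_trans hW).
have -> : E * (K0 * expR (64 * a) * Dn s mu f) + expR (64 * a) * C / N%:R =
  expR (64 * a) * (K0 * (E * Dn s mu f) + C / N%:R) by ring.
by rewrite ler_wpM2l // lerD2r ler_wpM2l.
Qed.

(* The trickle-down recursion a_(j+1) <= a_j + 8 a_j ^ 2 / N + O(N ^ -2). *)
Lemma locw_var_bound : (forall th c,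
     var (fun x => w0 x * expR (\sum_k th k * l k x)) (fun x => \sum_k c k * l k x) <=
     64^-1 * \sum_k c k ^+ 2) ->
  exists N0 : nat, forall N j th c, (N0 <= N)%N -> (j < N)%N ->
     var (locw w0 l (Num.sqrt N%:R^-1) j th) (fun x => \sum_k c k * l k x) <=
     32^-1 * \sum_k c k ^+ 2.
Proof.
move=> h0.
have b0 := localization_B_ge0.
pose Q := \sum_x \sum_k l k x ^+ 2.
have Q0 : 0 <= Q by apply: sumr_ge0 => x _; apply: sumr_ge0 => k _; exact: sqr_ge0.
have [N0 hN0] := eventually_nat_ge (4 * B ^+ 2 + 128 * (128 * Q * B ^+ 4)).
exists N0.+1 => N j th c NN jN.
have n0 : 0 < N%:R :> R by rewrite ltr0n (leq_trans _ NN).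
have Np : (0 < N)%N by rewrite (leq_trans _ NN).
have hN' : 4 * B ^+ 2 + 128 * (128 * Q * B ^+ 4) <= N%:R.
  by apply: (le_trans hN0); rewrite ler_nat ltnW.
have QB : 0 <= 128 * Q * B ^+ 4 by rewrite mulr_ge0 ?exprn_ge0 // mulr_ge0.
have hN : 4 * B ^+ 2 <= N%:R by apply: le_trans hN'; rewrite lerDl mulr_ge0.
have QN : 128 * Q * B ^+ 4 / N%:R <= 128^-1.
  have : 128 * (128 * Q * B ^+ 4) <= N%:R.
    by apply: le_trans hN'; rewrite lerDr mulr_ge0 ?sqr_ge0.
  by rewrite ler_pdivrMr //; lra.
have eB := epsB Np hN.
have main j' : (j' <= N)%N -> forall th c,
   var (locw w0 l (eps N) j' th) (fun x => \sum_k c k * l k x) <=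
   (64^-1 + j'%:R / (64 * N%:R)) * \sum_k c k ^+ 2.
  elim: j' => [|j' IH] jN' th' c'.
    rewrite mul0r addr0.
    have -> : locw w0 l (eps N) 0 th' = (fun x => w0 x * expR (\sum_k th' k * l k x)).
      by apply: funext => x; rewrite /locw big1 ?mulr1 // => k _; rewrite expr0.
    exact: h0.
  have {}IH := IH (ltnW jN').
  set A := 64^-1 + _ in IH.
  have A0 : 0 <= A by rewrite addr_ge0 // ?invr_ge0 // divr_ge0 // mulr_ge0 // ltW.
  have A32 : A <= 32^-1.
    have : j'%:R / (64 * N%:R) <= 64^-1 :> R.
      by rewrite invfM mulrCA -[leRHS]mulr1 ler_wpM2l // ler_pdivrMr // mul1r ler_nat ltnW.
    by rewrite /A; lra.
  pose w := locw w0 l (eps N) j' th'.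
  have w_gt0 x : 0 < w x by exact: locw_gt0.
  pose v (y : Y) x := expR (eps N * rad l y x) * w x.
  pose w' x := \sum_(y : Y) v y x.
  have v0 y x : 0 < v y x by rewrite mulr_gt0 // expR_gt0.
  have w'E x : w' x = \sum_y v y x by [].
  have y0 : Y := [ffun => true].
  have q1 := mixw1 t0 y0 v0 w'E.
  pose g x := \sum_k c' k * l k x.
  pose C2 := \sum_k c' k ^+ 2.
  have C20 : 0 <= C2 by apply: sumr_ge0 => k _; exact: sqr_ge0.
  have gG x : `|g x| <= Num.sqrt (C2 * Q).
    rewrite -[leLHS]sqrtr_sqr ler_wsqrtr //.
    have cs : g x ^+ 2 <= C2 * \sum_k l k x ^+ 2 by exact: sum_CS.
    apply: (le_trans cs); rewrite ler_wpM2l // /Q (bigD1 x) //= lerDl.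
    by apply: sumr_ge0 => x' _; apply: sumr_ge0 => k _; exact: sqr_ge0.
  have h2 := step_var t0 w_gt0 (eps_ge0 N) b0 localization_radB eB gG.
  rewrite -/v -/w' in h2.
  have h1 := var_mix t0 y0 v0 w'E g (mean w g).
  (* The covariance vector is tested against itself: a variance bound [A] for all linear forms is a
     bound on the norm of the covariance matrix. *)
  have h3 : \sum_k cov w g (l k) ^+ 2 <= A ^+ 2 * C2.
    pose b k := cov w g (l k).
    pose S := \sum_k b k ^+ 2.
    have S0 : 0 <= S by apply: sumr_ge0 => k _; exact: sqr_ge0.
    rewrite -/S; have [->|Sn] := eqVneq S 0; first by rewrite mulr_ge0 // sqr_ge0.
    have Sp : 0 < S by rewrite lt_def Sn.
    have e : cov w g (fun x => \sum_k b k * l k x) = S.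
      by rewrite cov_sumr; apply: eq_bigr => k _; rewrite -expr2.
    have := cov_CS t0 g (fun x => \sum_k b k * l k x) w_gt0; rewrite e => hcs.
    have : S ^+ 2 <= (A * C2) * (A * S).
      apply: (le_trans hcs); apply: ler_pM; rewrite ?var_ge0 //; exact: IH.
    have -> : A * C2 * (A * S) = S * (A ^+ 2 * C2) by ring.
    by rewrite expr2 ler_pM2l.
  have h4 : \sum_y mixw v w' y * var (v y) g <= A * C2.
    apply: (@le_trans _ _ (\sum_y mixw v w' y * (A * C2))).
      apply: ler_sum => y _; rewrite ler_pM2l ?(mixw_gt0 t0 y0) //.
      have -> : v y = locw w0 l (eps N) j' (fun k => th' k + eps N * sg R (y k)).
        by apply: funext => x; rewrite /v locw_shift.
      exact: IH.
    by rewrite -mulr_suml q1 mul1r.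
  rewrite -var_locwS -/v -/w' -/g -/C2; apply: (le_trans h1).
  (* In units of C2 / N, the main term is at most 8 / 32 ^ 2 = 1 / 128 since A <= 1 / 32, and N is
     large enough for the error to be at most 1 / 128; together they make the increment 1 / 64. *)
  have h5 : \sum_y mixw v w' y * (mean (v y) g - mean w g) ^+ 2 <= C2 / (64 * N%:R).
    apply: (le_trans h2).
    rewrite eps_sqr sqr_sqrtr ?mulr_ge0 //.
    have e4 : (eps N * B) ^+ 4 = B ^+ 4 / N%:R / N%:R.
      have e5 : eps N ^+ 4 = N%:R^-1 ^+ 2 by rewrite -eps_sqr -exprM.
      by rewrite exprMn e5; ring.
    rewrite e4.
    have -> : 128 * (C2 * Q) * (B ^+ 4 / N%:R / N%:R) =
       C2 / N%:R * (128 * Q * B ^+ 4 / N%:R) by ring.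
    have p1 : 8 / N%:R * \sum_k cov w g (l k) ^+ 2 <= C2 / N%:R * 128^-1.
      have -> : C2 / N%:R * 128^-1 = 8 / N%:R * (32^-1 ^+ 2 * C2) by field; rewrite gt_eqF.
      apply: ler_wpM2l; first by rewrite divr_ge0 // ltW.
      by apply: (le_trans h3); rewrite ler_wpM2r // ler_pXn2r ?nnegrE.
    have p2 : C2 / N%:R * (128 * Q * B ^+ 4 / N%:R) <= C2 / N%:R * 128^-1.
      by rewrite ler_wpM2l // divr_ge0 // ltW.
    apply: (le_trans (lerD p1 p2)); rewrite le_eqVlt; apply/orP; left; apply/eqP.
    by field; rewrite gt_eqF.
  apply: (le_trans (lerD h4 h5)); rewrite -natr1 le_eqVlt; apply/orP; left; apply/eqP.
  by rewrite /A; field; rewrite gt_eqF.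
apply: (le_trans (main j (ltnW jN) th c)); apply: ler_wpM2r.
  by apply: sumr_ge0 => k _; exact: sqr_ge0.
have : j%:R / (64 * N%:R) <= 64^-1 :> R.
  by rewrite invfM mulrCA -[leRHS]mulr1 ler_wpM2l // ler_pdivrMr // mul1r ler_nat ltnW.
by lra.
Qed.

End localization_theorem.

(** * Ising models on forests *)

Section flips.
Variables (R : realType) (n : nat).
Implicit Types (x : config n) (i j : 'I_n).

Definition spn i x : R := sg R (x i).

Definition flp i x : config n := flip x i.

Lemma flpK i : involutive (flp i).
Proof. by move=> x; apply/ffunP => j; rewrite !ffunE -addbA addbb addbF. Qed.

Lemma flpC i j x : flp i (flp j x) = flp j (flp i x).
Proof. by apply/ffunP => k; rewrite !ffunE -!addbA [(k == j) (+) _]addbC. Qed.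

Lemma spn_flp_eq i x : spn i (flp i x) = - spn i x.
Proof.
rewrite /spn /sg ffunE eqxx addbT; case: (x i) => /=; rewrite ?expr0 ?expr1 //.
by rewrite opprK.
Qed.

Lemma spn_flp_neq i j x : j != i -> spn j (flp i x) = spn j x.
Proof. by move=> ji; rewrite /spn ffunE (negbTE ji) addbF. Qed.

Lemma spn_sqr i x : spn i x ^+ 2 = 1.
Proof. by rewrite expr2 sg_sqr. Qed.

Lemma sum_flp i (F : config n -> R) : \sum_x F (flp i x) = \sum_x F x.
Proof. by rewrite [RHS](reindex_inj (inv_inj (flpK i))). Qed.

Lemma sum_flp_half i (F : config n -> R) :
  \sum_x F x = 2^-1 * \sum_x (F x + F (flp i x)).
Proof. by rewrite big_split /= sum_flp; field. Qed.

Lemma flp_invariant_const (g : config n -> R) :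
  (forall i x, g (flp i x) = g x) -> forall x y, g x = g y.
Proof.
move=> hg x y.
have [m hm] := ubnP #|[set i | x i != y i]|.
elim: m x hm => // m IH x; rewrite ltnS => hm.
have [e|/set0Pn[i]] := eqVneq [set i | x i != y i] set0.
  congr g; apply/ffunP => i; apply/eqP/negPn/negP => h.
  have : i \in [set i | x i != y i] by rewrite inE.
  by rewrite e inE.
rewrite inE => xy; rewrite -(hg i); apply: IH; apply: leq_trans hm.
apply: proper_card; apply/properP; split.
  apply/fintype.subsetP => j; rewrite !inE !ffunE; case: (eqVneq j i) => [->|_]; last by rewrite addbF.
  by move: xy; case: (x i) (y i) => [] [].
exists i; rewrite !inE ?xy // !ffunE eqxx addbT.
by move: xy; case: (x i) (y i) => [] [].
Qed.

End flips.

(** * Modified log-Sobolev inequality for product measures *)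

Section product_measure.
Variables (R : realType) (n : nat).
Variable w : config n -> R.
Hypothesis w0 : forall x, 0 < w x.
Hypothesis w_prod : forall i j x, i != j ->
  w x * w (flp i (flp j x)) = w (flp i x) * w (flp j x).
Let t0 : config n := [ffun=> true].

Definition avg (i : 'I_n) (f : config n -> R) x : R :=
  (w x * f x + w (flp i x) * f (flp i x)) / (w x + w (flp i x)).

Definition edir (i : 'I_n) (f : config n -> R) : R :=
  \sum_x w x * w (flp i x) / (w x + w (flp i x)) *
    ((f x - f (flp i x)) * (ln (f x) - ln (f (flp i x)))).

Lemma ww_gt0 i x : 0 < w x + w (flp i x).
Proof. by rewrite addr_gt0. Qed.

Lemma avg_gt0 i f : (forall x, 0 < f x) -> forall x, 0 < avg i f x.
Proof. by move=> f0 x; rewrite divr_gt0 ?ww_gt0 // addr_gt0 // mulr_gt0. Qed.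

Lemma avg_flp i f x : avg i f (flp i x) = avg i f x.
Proof. by rewrite /avg flpK [in X in _ / X]addrC; congr (_ / _); rewrite addrC. Qed.

Lemma sum_avg i f : \sum_x w x * avg i f x = \sum_x w x * f x.
Proof.
rewrite (sum_flp_half i) [RHS](sum_flp_half i); congr (_ * _); apply: eq_bigr => x _.
by rewrite avg_flp -mulrDl /avg mulrCA divff ?mulr1 // gt_eqF // ww_gt0.
Qed.

(** This is concavity of the logarithm, p ln a + q ln b <= ln m, multiplied by the mean m. *)
Lemma two_point_entropy (p q a b : R) : 0 <= p -> 0 <= q -> p + q = 1 ->
  0 < a -> 0 < b ->
  p * (a * ln a) + q * (b * ln b) - (p * a + q * b) * ln (p * a + q * b) <=
  p * q * ((a - b) * (ln a - ln b)).
Proof.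
move=> p0 q0 pq a0 b0; set m := p * a + q * b.
have m0 : 0 < m.
  have [h|h] := ltP 0 p; first by rewrite ltr_pwDl ?mulr_gt0 // mulr_ge0 // ltW.
  have p00 : p = 0 by lra.
  have q1 : q = 1 by lra.
  by have -> : m = b by rewrite /m p00 q1; ring.
have hc : p * ln a + q * ln b <= ln m.
  have h z : 0 < z -> ln z - ln m <= z / m - 1.
    move=> z0; rewrite -ln_div ?posrE //.
    have := @le_ln1Dx R (z / m - 1).
    by rewrite addrCA subrr addr0; apply; rewrite ltrBrDl subrr divr_gt0.
  have := h a a0; have := h b b0 => h1 h2.
  have e : p * (a / m - 1) + q * (b / m - 1) = 0.
    have -> : p * (a / m - 1) + q * (b / m - 1) = m / m - (p + q) by rewrite /m; ring.
    by rewrite divff ?gt_eqF // pq subrr.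
  have h3 := ler_wpM2l q0 h1; have h4 := ler_wpM2l p0 h2.
  have : p * (ln a - ln m) + q * (ln b - ln m) <= 0 by rewrite -e lerD.
  have -> : p * (ln a - ln m) + q * (ln b - ln m) = p * ln a + q * ln b - (p + q) * ln m by ring.
  by rewrite pq mul1r; lra.
have := ler_wpM2l (ltW m0) hc.
have -> : m * (p * ln a + q * ln b) = p * (a * ln a) + q * (b * ln b)
   - p * q * ((a - b) * (ln a - ln b)).
  have qE : q = 1 - p by lra.
  by rewrite /m qE; ring.
by lra.
Qed.

Lemma avg_entropy i f : (forall x, 0 < f x) ->
  \sum_x w x * (f x * ln (f x)) - \sum_x w x * (avg i f x * ln (avg i f x)) <=
  2^-1 * edir i f.
Proof.
move=> f0; rewrite -sumrB (sum_flp_half i) ler_pM2l ?invr_gt0 //.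
apply: ler_sum => x _; rewrite avg_flp.
have s0 := ww_gt0 i x.
set S := w x + _ in s0 *; set a := f x; set b := f (flp i x).
pose p := w x / S; pose q := w (flp i x) / S.
have p0 : 0 <= p by rewrite divr_ge0 ?ltW.
have q0 : 0 <= q by rewrite divr_ge0 ?ltW.
have pq : p + q = 1 by rewrite /p /q -mulrDl divff // gt_eqF.
have h0 := ler_wpM2l (ltW s0) (two_point_entropy p0 q0 pq (f0 x) (f0 (flp i x))).
have e0 : p * f x + q * f (flp i x) = avg i f x by rewrite /avg /p /q -/S; ring.
rewrite e0 -/a -/b in h0.
have wp : w x = S * p by rewrite /p; field; rewrite gt_eqF.
have wq : w (flp i x) = S * q by rewrite /q; field; rewrite gt_eqF.
rewrite wq wp.
have -> : S * p * (S * q) / S * ((a - b) * (ln a - ln b)) =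
   S * (p * q * ((a - b) * (ln a - ln b))) by field; rewrite gt_eqF.
apply: le_trans h0; set A := avg i f x; set L := ln A.
rewrite le_eqVlt; apply/orP; left; apply/eqP.
have -> : S * p * (a * ln a) - S * p * (A * L) + (S * q * (b * ln b) - S * q * (A * L)) =
  S * (p * (a * ln a) + q * (b * ln b) - (p + q) * (A * L)) by ring.
by rewrite pq mul1r.
Qed.

Lemma log_sum (a b c d : R) : 0 < a -> 0 < b -> 0 < c -> 0 < d ->
  (a + c) * (ln (a + c) - ln (b + d)) <= a * (ln a - ln b) + c * (ln c - ln d).
Proof.
move=> a0 b0 c0 d0; have ac : 0 < a + c by rewrite addr_gt0.
have bd : 0 < b + d by rewrite addr_gt0.
set M := (a + c) / (b + d); have M0 : 0 < M by rewrite divr_gt0.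
have lM : ln M = ln (a + c) - ln (b + d) by rewrite ln_div.
have bM : 0 < b * M by rewrite mulr_gt0. have dM : 0 < d * M by rewrite mulr_gt0.
have := entropy_integrand_ge0 a0 bM; have := entropy_integrand_ge0 c0 dM.
rewrite !(@lnM R _ M) ?posrE // -lM => h1 h2.
have e : b * M + d * M = a + c by rewrite -mulrDl /M mulrC divfK // gt_eqF.
lra.
Qed.

(** Sum of two log-sum inequalities. Together with homogeneity it is the joint convexity of (a - b)
    (ln a - ln b). *)
Lemma symm_log_convex (a b c d : R) : 0 < a -> 0 < b -> 0 < c -> 0 < d ->
  (a + c - (b + d)) * (ln (a + c) - ln (b + d)) <=
  (a - b) * (ln a - ln b) + (c - d) * (ln c - ln d).
Proof.
move=> a0 b0 c0 d0; have := log_sum a0 b0 c0 d0; have := log_sum b0 a0 d0 c0; lra.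
Qed.

Lemma symm_log_scale (t a b : R) : 0 < t -> 0 < a -> 0 < b ->
  (t * a - t * b) * (ln (t * a) - ln (t * b)) = t * ((a - b) * (ln a - ln b)).
Proof. by move=> t_0 a0 b0; rewrite !lnM ?posrE //; ring. Qed.

(** In a product measure the conditional weights [p], [q] of coordinate i do not depend on
    coordinate j, so joint convexity applies to the average; relabelling one half of the sum by
    [flp i] reassembles the original form. *)
Lemma edir_avg i j f : i != j -> (forall x, 0 < f x) ->
  edir j (avg i f) <= edir j f.
Proof.
move=> ij f0; rewrite /edir.
pose p x := w x / (w x + w (flp i x)).
pose q x := w (flp i x) / (w x + w (flp i x)).
pose G a b : R := (a - b) * (ln a - ln b).
pose cj x := w x * w (flp j x) / (w x + w (flp j x)).
have p0 x : 0 < p x by rewrite divr_gt0 // ww_gt0.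
have q0 x : 0 < q x by rewrite divr_gt0 // ww_gt0.
have cross x : w x * w (flp i (flp j x)) = w (flp j x) * w (flp i x).
  by rewrite w_prod // mulrC.
have pj x : p (flp j x) = p x.
  rewrite /p; have h := cross x.
  have n1 := lt0r_neq0 (ww_gt0 i x); have n2 := lt0r_neq0 (ww_gt0 i (flp j x)).
  apply/eqP; rewrite eqr_div //; apply/eqP.
  by rewrite !mulrDr h; ring.
have qj x : q (flp j x) = q x.
  have pq y : q y = 1 - p y by rewrite /p /q; field; rewrite gt_eqF // ww_gt0.
  by rewrite !pq pj.
have avgE x : avg i f x = p x * f x + q x * f (flp i x) by rewrite /avg /p /q; ring.
have cj0 x : 0 <= cj x by rewrite divr_ge0 ?ltW ?ww_gt0 // mulr_gt0.
apply: (@le_trans _ _ (\sum_x cj x * (p x * G (f x) (f (flp j x)) + q x * G (f (flp i x)) (f (flp j (flp i x)))))).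
  apply: ler_sum => x _; apply: ler_wpM2l; first exact: cj0.
  rewrite !avgE pj qj [flp i (flp j x)]flpC /G.
  rewrite -!symm_log_scale //.
  by apply: symm_log_convex; rewrite mulr_gt0.
have -> : \sum_x cj x * (p x * G (f x) (f (flp j x)) + q x * G (f (flp i x)) (f (flp j (flp i x)))) =
   \sum_x cj x * p x * G (f x) (f (flp j x)) + \sum_x cj (flp i x) * q (flp i x) * G (f x) (f (flp j x)).
  rewrite -[X in _ = _ + X](sum_flp i) -big_split; apply: eq_bigr => x _ /=.
  by rewrite !flpK mulrDr !mulrA.
rewrite -big_split le_eqVlt; apply/orP; left; apply/eqP; apply: eq_bigr => x _ /=.
rewrite -mulrDl -/(cj x) -/(G _ _); congr (_ * _).
have h := cross x.
have c1 : cj (flp i x) = cj x * (w (flp i x) / w x).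
  rewrite /cj flpC.
  have e : w (flp i (flp j x)) = w (flp j x) * w (flp i x) / w x.
    by rewrite -h; field; rewrite gt_eqF.
  rewrite e; field.
  rewrite !gt_eqF ?ww_gt0 //=.
  by rewrite addr_gt0 // mulr_gt0.
have q1 : q (flp i x) = p x by rewrite /q /p flpK addrC.
rewrite c1 q1 /p; field.
by rewrite !gt_eqF ?ww_gt0.
Qed.

(** Tensorisation: coordinates are averaged out one at a time. Averaging coordinate i costs half of
    [edir i] of the current function, which by [edir_avg] is at most that of [f], and the last
    function is constant. *)
Lemma product_MLSI : MLSI (flp (n:=n)) w 2^-1.
Proof.
move=> f f0; have m0 := mass_gt0 t0 w0.
pose F := fix F (s : seq 'I_n) := if s is i :: s' then avg i (F s') else f.
have F0 s x : 0 < F s x.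
  by elim: s x => [|i s IH] x /=; [exact: f0 | exact: avg_gt0].
have Fm s : \sum_x w x * F s x = \sum_x w x * f x.
  by elim: s => //= i s IH; rewrite sum_avg.
have Fd s j : j \notin s -> edir j (F s) <= edir j f.
  elim: s => //= i s IH; rewrite inE negb_or => /andP[ji js].
  apply: le_trans (IH js); apply: edir_avg => //; first by rewrite eq_sym.
have Fent s : uniq s -> \sum_x w x * (f x * ln (f x)) - \sum_x w x * (F s x * ln (F s x)) <=
    2^-1 * \sum_(i <- s) edir i f.
  elim: s => [|i s IH] /=; first by rewrite big_nil subrr mulr0.
  move=> /andP[is_ us]; rewrite big_cons mulrDr.
  have := avg_entropy i (F0 s); have := Fd s i is_; have := IH us; lra.
have Finv s i x : i \in s -> F s (flp i x) = F s x.
  elim: s x => //= j s IH x; rewrite inE.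
  case: (eqVneq i j) => [->|ij] /=; first by rewrite avg_flp.
  move=> is_; rewrite /avg [flp j (flp i x)]flpC !IH //.
  have h := w_prod x ij; rewrite flpC in h.
  have s1 := ww_gt0 j x; have s2 := ww_gt0 j (flp i x).
  rewrite [flp j (flp i x)]flpC in s2.
  have n1 := lt0r_neq0 s1; have n2 := lt0r_neq0 s2.
  apply/eqP; rewrite eqr_div //; apply/eqP.
  have h' : w x * w (flp j (flp i x)) = w (flp i x) * w (flp j x) by [].
  rewrite [flp i (flp j x)]flpC.
  have -> : (w (flp i x) * F s x + w (flp j (flp i x)) * F s (flp j x)) * (w x + w (flp j x)) =
    w (flp i x) * w x * F s x + (w (flp i x) * w (flp j x)) * F s x
    + (w x * w (flp j (flp i x))) * F s (flp j x)
    + w (flp j (flp i x)) * w (flp j x) * F s (flp j x) by ring.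
  rewrite h'.
  have -> : (w x * F s x + w (flp j x) * F s (flp j x)) * (w (flp i x) + w (flp j (flp i x))) =
    w (flp i x) * w x * F s x + (w x * w (flp j (flp i x))) * F s x
    + w (flp i x) * w (flp j x) * F s (flp j x)
    + w (flp j (flp i x)) * w (flp j x) * F s (flp j x) by ring.
  by rewrite h'.
pose s := enum 'I_n.
have cst x y : F s x = F s y.
  by apply: flp_invariant_const => i z; apply: Finv; rewrite mem_enum.
have Fs x : F s x = mean w f.
  rewrite /mean -(Fm s) (eq_bigr (fun y => w y * F s x)); last by move=> y _; rewrite (cst y x).
  by rewrite -mulr_suml mulrAC divff ?mul1r // gt_eqF.
have e1 : \sum_x w x * (F s x * ln (F s x)) = mass w * (mean w f * ln (mean w f)).
  by rewrite /mass mulr_suml; apply: eq_bigr => x _; rewrite Fs.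
have := Fent s (enum_uniq _); rewrite e1 big_enum /= => h.
rewrite /ent /Dn -(ler_pM2r m0) mulrBl mean_mass //.
rewrite mulrA divfK ?gt_eqF // [_ * mass w]mulrC.
by rewrite /mass; apply: le_trans h _.
Qed.

End product_measure.

(** * Variances of linear functions on a forest *)

Section forest_variance.
Variables (R : realType) (n : nat).
Variables (par : 'I_n -> option 'I_n) (depth : 'I_n -> nat) (kap : 'I_n -> R).
Variables (tau : R) (D : 'I_n -> 'I_n -> R).
Hypothesis par_depth : forall c p, par c = Some p -> (depth p < depth c)%N.
Hypothesis kap_tau : forall c, 4 * `|kap c| <= tau.
Hypothesis D_ge0 : forall v j, 0 <= D v j.
Hypothesis D_refl : forall j, 1 <= D j j.
Hypothesis D_par : forall v j p, par j = Some p -> tau * D v p <= D v j.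
Let t0 : config n := [ffun=> true].

Definition pedge (c : 'I_n) (x : config n) : R :=
  if par c is Some p then kap c * spn R c x * spn R p x else 0.

Definition fweight (S : {set 'I_n}) (h : 'I_n -> R) (x : config n) : R :=
  expR (\sum_(c in S) pedge c x + \sum_(i in S) h i * spn R i x).

Definition tnh (t : R) : R := (expR t - expR (- t)) / (expR t + expR (- t)).

Lemma tnhE t : tnh t = 1 - 2 / (expR (2 * t) + 1).
Proof.
have e : expR (2 * t) = expR t ^+ 2 by rewrite -expRM_natl.
have p := expR_gt0 t.
by rewrite /tnh expRN e; field; rewrite !gt_eqF //= -?expr2 addr_gt0 ?exprn_gt0.
Qed.

(** Half of this difference is the coefficient a leaf passes to its parent, hence the factor 4 in
    [kap_tau]. *)
Lemma tnh_diff (a k : R) : `|tnh (a + k) - tnh (a - k)| <= 8 * `|k|.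
Proof.
wlog k0 : k / 0 <= k.
  move=> h; have [/h //|/ltW k0] := leP 0 k.
  have := h (- k); rewrite oppr_ge0 => /(_ k0).
  by rewrite opprK normrN distrC.
rewrite (ger0_norm k0) !tnhE.
set P := expR (2 * (a + k)); set Q := expR (2 * (a - k)).
have P0 : 0 < P by exact: expR_gt0. have Q0 : 0 < Q by exact: expR_gt0.
have PQ : Q = P * expR (- (4 * k)) by rewrite /P /Q -expRD; congr expR; ring.
have h := expR_ge1Dx (- (4 * k)).
have QP : Q <= P by rewrite PQ ger_pMr // -[leRHS]expR0 ler_expR oppr_le0 mulr_ge0.
have -> : 1 - 2 / (P + 1) - (1 - 2 / (Q + 1)) = 2 * (P - Q) / ((P + 1) * (Q + 1)).
  by field; rewrite !gt_eqF // addr_gt0.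
have P1 : 0 < P + 1 by rewrite addr_gt0. have Q1 : 0 < Q + 1 by rewrite addr_gt0.
rewrite ger0_norm; last by rewrite divr_ge0 ?mulr_ge0 ?subr_ge0 // ltW.
rewrite ler_pdivrMr ?mulr_gt0 //.
have hk : P - Q <= 4 * k * P by rewrite PQ; nra.
have : 4 * k * P <= 4 * k * ((P + 1) * (Q + 1)).
  by apply: ler_wpM2l; [rewrite mulr_ge0 | nra].
lra.
Qed.

Lemma tnh_le1 t : tnh t ^+ 2 <= 1.
Proof.
have e := expR_gt0 (2 * t).
have h1 : -1 <= tnh t.
  rewrite tnhE; have : 2 / (expR (2 * t) + 1) <= 2.
    by rewrite ler_pdivrMr ?addr_gt0 //; lra.
  lra.
have h2 : tnh t <= 1 by rewrite tnhE gerBl divr_ge0 // ltW // addr_gt0.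
nra.
Qed.

(* A leaf is summed out, its coefficient passing to its parent with a factor at most tau. *)
Lemma forest_var_le (S : {set 'I_n}) (h y : 'I_n -> R) :
  (forall c p, c \in S -> par c = Some p -> p \in S) ->
  var (fweight S h) (fun x => \sum_(j in S) y j * spn R j x) <=
  \sum_(v in S) (\sum_(j in S) `|y j| * D v j) ^+ 2.
Proof.
have [m hm] := ubnP #|S|.
elim: m S hm h y => // m IH S; rewrite ltnS => hm h y Scl.
have [S0|/set0Pn[j0 j0S]] := eqVneq S set0.
  rewrite S0 !big_set0 -[leRHS](expr0n R 2).
  have w0 x : 0 < fweight set0 h x by exact: expR_gt0.
  apply: (le_trans (var_le t0 _ 0 w0)).
  rewrite (mean_eq (g := fun=> 0)) ?mean_cst ?expr0n // => x.
  by rewrite big_set0 subrr expr0n.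
(* A deepest vertex of [S] has no child in [S]: it is a leaf. *)
pose j := [arg max_(j > j0 in S) depth j].
have [jS jmax] : j \in S /\ forall c, c \in S -> (depth c <= depth j)%N.
  by rewrite /j; case: arg_maxnP.
have nochild c : c \in S -> par c != Some j.
  move=> cS; apply/eqP => /par_depth; rewrite ltnNge jmax //.
pose S' := S :\ j.
have sumS (F : 'I_n -> R) : \sum_(i in S) F i = F j + \sum_(i in S') F i.
  by rewrite (big_setD1 j).
have S'lt : (#|S'| < m)%N by apply: leq_trans hm; rewrite [in leqRHS](cardsD1 j) jS.
have S'cl c p : c \in S' -> par c = Some p -> p \in S'.
  rewrite !inE => /andP[cj cS] cp; rewrite (Scl _ _ cS cp) andbT.
  by apply/eqP => pj; have := nochild c cS; rewrite cp pj eqxx.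
pose t (x : config n) : R := h j + (if par j is Some p then kap j * spn R p x else 0).
pose w := fweight S h; pose w' := fweight S' h.
have w0 x : 0 < w x by exact: expR_gt0.
have w'0 x : 0 < w' x by exact: expR_gt0.
have wE x : w x = w' x * expR (t x * spn R j x).
  rewrite /w /w' /fweight -expRD; congr expR; rewrite !sumS /t mulrDl /pedge.
  by case: (par j) => [p|]; ring.
have t_flp x : t (flp j x) = t x.
  rewrite /t; case E: (par j) => [p|] //; rewrite spn_flp_neq //.
  by apply/eqP => pj; have := par_depth E; rewrite pj ltnn.
have w'_flp x : w' (flp j x) = w' x.
  rewrite /w' /fweight; congr expR; congr (_ + _); apply: eq_bigr => c; rewrite !inE => /andP[cj cS].
    rewrite /pedge; case E: (par c) => [p|] //.
    rewrite !spn_flp_neq //; apply/eqP => pj.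
    by have := nochild c cS; rewrite E pj eqxx.
  by rewrite spn_flp_neq.
pose g' (x : config n) := \sum_(i in S') y i * spn R i x.
have g'_flp x : g' (flp j x) = g' x.
  by apply: eq_bigr => c; rewrite !inE => /andP[cj cS]; rewrite spn_flp_neq.
(* [W] is the average of [w] over the two values of the spin at j. *)
pose W x := w' x * ch (t x).
have W0 x : 0 < W x by rewrite mulr_gt0 // ch_gt0.
have sgn x : spn R j x = 1 \/ spn R j x = -1.
  by rewrite /spn /sg; case: (x j); [right | left]; rewrite ?expr1 ?expr0.
have massE : mass w = mass W.
  rewrite /mass (sum_flp_half j) mulr_sumr; apply: eq_bigr => x _.
  rewrite !wE w'_flp t_flp spn_flp_eq /W /ch.
  by case: (sgn x) => ->; rewrite ?opprK mulr1 mulrN1; field.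
pose u x := tnh (t x).
(* Given the other spins, the spin at j has mean [u] and variance at most 1, whence the summand y j
   ^ 2. *)
have key c : mean w (fun x => (\sum_(i in S) y i * spn R i x - c) ^+ 2) <=
   mean W (fun x => (g' x + y j * u x - c) ^+ 2) + y j ^+ 2.
  rewrite -[y j ^+ 2](mean_cst t0 _ W0) -meanD /mean massE ler_pM2r ?invr_gt0 ?(mass_gt0 t0) //.
  rewrite (sum_flp_half j) mulr_sumr; apply: ler_sum => x _.
  rewrite !sumS -!/(g' _) g'_flp !wE w'_flp t_flp spn_flp_eq /W.
  have e1 := expR_gt0 (t x); have e2 := expR_gt0 (- t x).
  have uE : u x * ch (t x) = (expR (t x) - expR (- t x)) / 2.
    by rewrite /u /tnh /ch; field; rewrite gt_eqF // addr_gt0.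
  have u1 := tnh_le1 (t x); rewrite -/(u x) in u1.
  have c0 := ch_gt0 (t x).
  have -> : 2^-1 * (w' x * expR (t x * spn R j x) * (y j * spn R j x + g' x - c) ^+ 2 +
     w' x * expR (t x * - spn R j x) * (y j * - spn R j x + g' x - c) ^+ 2) =
    w' x * ((expR (t x) * (g' x - c + y j) ^+ 2 + expR (- t x) * (g' x - c - y j) ^+ 2) / 2).
    by case: (sgn x) => ->; rewrite ?opprK mulr1 mulrN1; field.
  have -> : (expR (t x) * (g' x - c + y j) ^+ 2 + expR (- t x) * (g' x - c - y j) ^+ 2) / 2 =
    ch (t x) * ((g' x - c) ^+ 2 + y j ^+ 2) + 2 * y j * (g' x - c) * ((expR (t x) - expR (- t x)) / 2).
    by rewrite /ch; field.
  rewrite -uE -[leRHS]mulrA ler_pM2l //.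
  have -> : ch (t x) * ((g' x - c) ^+ 2 + y j ^+ 2) + 2 * y j * (g' x - c) * (u x * ch (t x)) =
    ch (t x) * ((g' x - c) ^+ 2 + y j ^+ 2 + 2 * y j * (g' x - c) * u x) by ring.
  rewrite ler_pM2l //; have := sqr_ge0 (y j * u x); nra.
(* Averaging over a leaf leaves a forest weight with a changed field at the parent, and the
   conditional mean of the leaf is affine in the parent's spin; both hold because a function of one
   spin is affine. *)
have [h' [al [k' [hk' WE uE]]]] : exists h' al k',
   [/\ `|k'| <= tau, forall g, mean W g = mean (fweight S' h') g &
     forall x, u x = al + (if par j is Some p then k' * spn R p x else 0)].
  case E: (par j) => [p|].
    pose A := ch (h j + kap j); pose B := ch (h j - kap j).
    have A0 : 0 < A by exact: ch_gt0. have B0 : 0 < B by exact: ch_gt0.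
    pose a := (ln A + ln B) / 2; pose b := (ln A - ln B) / 2.
    have pS' : p \in S'.
      rewrite !inE (Scl _ _ jS E) andbT; apply/eqP => pj.
      by have := par_depth E; rewrite pj ltnn.
    have sgp x : spn R p x = 1 \/ spn R p x = -1.
      by rewrite /spn /sg; case: (x p); [right | left]; rewrite ?expr1 ?expr0.
    exists (fun i => h i + (i == p)%:R * b), ((tnh (h j + kap j) + tnh (h j - kap j)) / 2),
      ((tnh (h j + kap j) - tnh (h j - kap j)) / 2); split.
    - rewrite normrM [`|2^-1|]ger0_norm ?invr_ge0 // ler_pdivrMr //.
      have := tnh_diff (h j) (kap j); have := kap_tau j; lra.
    - move=> g; rewrite (mean_ext (w' := fun x => expR a * fweight S' (fun i => h i + (i == p)%:R * b) x)).
        by rewrite mean_scale // gt_eqF // expR_gt0.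
      move=> x; rewrite /W /w' /fweight.
      have -> : \sum_(i in S') (h i + (i == p)%:R * b) * spn R i x =
         \sum_(i in S') h i * spn R i x + b * spn R p x.
        rewrite (eq_bigr (fun i => h i * spn R i x + (i == p)%:R * b * spn R i x)); last by move=> i _; rewrite mulrDl.
        rewrite big_split /=; congr (_ + _); rewrite (big_setD1 p) //= eqxx mul1r big1 ?addr0 // => i.
        by rewrite !inE => /andP[ip _]; rewrite (negbTE ip) !mul0r.
      have -> : forall P H z : R, expR a * expR (P + (H + z)) = expR (P + H) * expR (a + z).
        by move=> P H z; rewrite -!expRD; congr expR; ring.
      congr (_ * _).
      rewrite /t E; case: (sgp x) => ->.
        have -> : a + b * 1 = ln A by rewrite /a /b; field.
        by rewrite lnK ?posrE // mulr1.
      have -> : a + b * -1 = ln B by rewrite /a /b; field.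
      by rewrite lnK ?posrE // mulrN1.
    - by move=> x; rewrite /u /t E; case: (sgp x) => ->; rewrite ?mulr1 ?mulrN1; field.
  exists h, (tnh (h j)), 0; split.
  - by rewrite normr0; apply: le_trans (kap_tau j); rewrite mulr_ge0.
  - move=> g; rewrite (mean_ext (w' := fun x => ch (h j) * w' x)).
      by rewrite mean_scale // gt_eqF // ch_gt0.
    by move=> x; rewrite /W /t E addr0 mulrC.
  - by move=> x; rewrite /u /t E !addr0.
pose y' i := y i + (if par j is Some p then (i == p)%:R * (y j * k') else 0).
have gE x : g' x + y j * u x = y j * al + \sum_(i in S') y' i * spn R i x.
  rewrite uE /y'; case E: (par j) => [p|]; last first.
    by rewrite addr0 addrC; congr (_ + _); apply: eq_bigr => i _; rewrite addr0.
  have pS' : p \in S'.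
    rewrite !inE (Scl _ _ jS E) andbT; apply/eqP => pj.
    by have := par_depth E; rewrite pj ltnn.
  rewrite (eq_bigr (fun i => y i * spn R i x + (i == p)%:R * (y j * k') * spn R i x)); last by move=> i _; rewrite mulrDl.
  rewrite [X in _ = _ + X]big_split /= -/(g' x).
  have -> : \sum_(i in S') (i == p)%:R * (y j * k') * spn R i x = y j * k' * spn R p x.
    rewrite (big_setD1 p) //= eqxx mul1r big1 ?addr0 // => i.
    by rewrite !inE => /andP[ip _]; rewrite (negbTE ip) !mul0r.
  ring.
pose c0 := mean (fweight S' h') (fun x => \sum_(i in S') y' i * spn R i x).
apply: (le_trans (var_le t0 _ (y j * al + c0) w0)); apply: (le_trans (key _)).
rewrite WE (mean_eq (g := fun x => (\sum_(i in S') y' i * spn R i x - c0) ^+ 2)); last first.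
  by move=> x; rewrite gE; congr (_ ^+ 2); ring.
have fw0 x : 0 < fweight S' h' x by exact: expR_gt0.
rewrite /c0 -varE // (big_setD1 j) //= addrC; apply: lerD; last first.
  rewrite -(real_normK (num_real (y j))) ler_pXn2r // ?nnegrE ?normr_ge0 //.
    rewrite sumS; apply: (@le_trans _ _ (`|y j| * D j j)).
      by rewrite ler_peMr.
    by rewrite lerDl; apply: sumr_ge0 => i _; rewrite mulr_ge0.
  by apply: sumr_ge0 => i _; rewrite mulr_ge0.
apply: (le_trans (IH S' S'lt h' y' S'cl)); apply: ler_sum => v vS'.
rewrite ler_pXn2r // ?nnegrE; try by apply: sumr_ge0 => i _; rewrite mulr_ge0.
rewrite sumS /y'; case E: (par j) => [p|]; last first.
  rewrite (eq_bigr (fun i => `|y i| * D v i)) ?lerDr ?mulr_ge0 // => i _.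
  by rewrite addr0.
have pS' : p \in S'.
  rewrite !inE (Scl _ _ jS E) andbT; apply/eqP => pj.
  by have := par_depth E; rewrite pj ltnn.
apply: (@le_trans _ _ (\sum_(i in S') (`|y i| * D v i + (i == p)%:R * (`|y j| * tau * D v i)))).
  apply: ler_sum => i _; case: eqVneq => [->|_]; last by rewrite !mul0r !addr0.
  rewrite !mul1r -mulrDl; apply: ler_wpM2r => //.
  apply: (le_trans (ler_normD _ _)); rewrite lerD2l normrM.
  by apply: ler_wpM2l.
rewrite big_split /= addrC lerD2r (big_setD1 p) //= eqxx mul1r big1 ?addr0 => [|i]; last first.
  by rewrite !inE => /andP[ip _]; rewrite (negbTE ip) !mul0r.
by rewrite -mulrA; apply: ler_wpM2l => //; apply: D_par.
Qed.

End forest_variance.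

(** * Factorisation of positive semidefinite forms *)

Section psd.
Variables (R : realType) (n : nat).
Implicit Types (M : 'I_n -> 'I_n -> R) (y : 'I_n -> R).

Lemma sum_delta (F : 'I_n -> R) p : \sum_j (j == p)%:R * F j = F p.
Proof.
rewrite (bigD1 p) //= eqxx mul1r big1 ?addr0 // => j jp.
by rewrite (negbTE jp) mul0r.
Qed.

Definition qf M y : R := \sum_i \sum_j M i j * y i * y j.

Lemma qf_add_single M y p t : (forall i j, M i j = M j i) ->
  qf M (fun i => y i + (i == p)%:R * t) =
  qf M y + 2 * t * (\sum_i M i p * y i) + M p p * t ^+ 2.
Proof.
move=> sM; rewrite /qf.
have E1 i : \sum_j M i j * (y i + (i == p)%:R * t) * (y j + (j == p)%:R * t) =
  \sum_j M i j * y i * y j + (i == p)%:R * t * \sum_j M i j * y j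
  + M i p * y i * t + (i == p)%:R * (M i p * t ^+ 2).
  rewrite mulr_sumr -big_split /=.
  have -> : \sum_j M i j * (y i + (i == p)%:R * t) * (y j + (j == p)%:R * t) =
    \sum_j ((M i j * y i * y j + (i == p)%:R * t * (M i j * y j))
     + (j == p)%:R * (M i j * (y i + (i == p)%:R * t) * t)).
    by apply: eq_bigr => j _; ring.
  by rewrite big_split /= sum_delta big_split /= -mulr_sumr; ring.
rewrite (eq_bigr _ (fun i _ => E1 i)) !big_split /=.
under [X in _ + X + _ + _]eq_bigr do rewrite -mulrA.
have sE : \sum_j M p j * y j = \sum_i M i p * y i.
  by apply: eq_bigr => j _; rewrite sM.
rewrite !sum_delta sE -mulr_suml; ring.
Qed.

Lemma qf_single M p : (forall i j, M i j = M j i) ->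
  qf M (fun i => 0 + (i == p)%:R * 1) = M p p.
Proof.
move=> sM; rewrite (qf_add_single (fun=> 0)) // /qf.
have -> : \sum_i M i p * 0 = 0 by rewrite big1 // => i _; rewrite mulr0.
rewrite big1 => [|i _]; last by rewrite big1 // => j _; rewrite mulr0.
by ring.
Qed.

(** Pivots are eliminated one at a time, by induction on the number of nonzero diagonal entries; a
    positive semidefinite form with zero diagonal vanishes. The strengthened claim, that [u k]
    vanishes when M k k = 0, keeps the slot [p] free for the new rank-one term. *)
Lemma psd_factor M : (forall i j, M i j = M j i) -> (forall y, 0 <= qf M y) ->
  exists u : 'I_n -> 'I_n -> R, forall i j, M i j = \sum_k u k i * u k j.
Proof.
suff H m : forall M, (#|[set i | M i i != 0%R]| < m)%N ->
   (forall i j, M i j = M j i) -> (forall y, 0 <= qf M y) ->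
  exists u : 'I_n -> 'I_n -> R, (forall i j, M i j = \sum_k u k i * u k j) /\
    forall k, M k k = 0 -> forall i, u k i = 0.
  move=> sM pM; have [u [hu _]] := H _ M (ltnSn _) sM pM.
  by exists u.
elim: m => // m IH {}M hm sM pM.
have y0 i0 : qf M (fun i => 0 + (i == i0)%:R * 1) = M i0 i0 by exact: qf_single.
have diag_ge0 i : 0 <= M i i by rewrite -y0.
have [e|/finset.set0Pn[p]] := eqVneq [set i | M i i != 0%R] finset.set0.
  have d0 i : M i i = 0.
    apply/eqP/negPn/negP => h.
    have : i \in [set i | M i i != 0%R] by rewrite inE.
    by rewrite e inE.
  exists (fun _ _ => 0); split=> // i j.
  rewrite big1 => [|k _]; last by rewrite mul0r.
  have hq (t : R) : 0 <= 2 * t * M i j.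
    have := pM (fun k => (0 + (k == i)%:R * 1) + (k == j)%:R * t).
    rewrite qf_add_single // y0 !d0 mul0r addr0 add0r.
    rewrite (bigD1 i) //= eqxx big1 => [|k ki]; last by rewrite (negbTE ki) mul0r addr0 mulr0.
    by rewrite addr0 add0r mul1r mulr1.
  have := hq 1; have := hq (-1); lra.
rewrite inE => pp; have p0 : 0 < M p p by rewrite lt_def pp diag_ge0.
pose s := Num.sqrt (M p p).
have s0 : 0 < s by rewrite sqrtr_gt0.
have ss : s ^+ 2 = M p p by rewrite sqr_sqrtr // ltW.
pose v i := M i p / s.
pose M' i j := M i j - v i * v j.
have sM' i j : M' i j = M' j i by rewrite /M' sM mulrC.
have qM' y : qf M' y = qf M y - (\sum_i M i p * y i) ^+ 2 / M p p.
  rewrite /qf.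
  have -> : (\sum_i M i p * y i) ^+ 2 / M p p = \sum_i \sum_j v i * v j * y i * y j.
    rewrite expr2 mulr_suml mulr_suml; apply: eq_bigr => i _.
    rewrite mulr_sumr mulr_suml; apply: eq_bigr => j _.
    by rewrite /v -ss; field; rewrite gt_eqF.
  rewrite -sumrB; apply: eq_bigr => i _; rewrite -sumrB; apply: eq_bigr => j _.
  by rewrite /M'; ring.
have pM' y : 0 <= qf M' y.
  pose t := - (\sum_i M i p * y i) / M p p.
  have := pM (fun i => y i + (i == p)%:R * t).
  rewrite qf_add_single // qM' /t; set S := \sum_i M i p * y i.
  have -> : qf M y + 2 * (- S / M p p) * S + M p p * (- S / M p p) ^+ 2 = qf M y - S ^+ 2 / M p p.
    by field; rewrite gt_eqF.
  by [].
have y0' i0 : qf M' (fun i => 0 + (i == i0)%:R * 1) = M' i0 i0.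
  exact: qf_single.
have M'pp : M' p p = 0 by rewrite /M' /v -ss; field; rewrite gt_eqF.
have M'0 i : M i i = 0 -> M' i i = 0.
  move=> h; apply/eqP; rewrite eq_le; apply/andP; split; last by rewrite -y0'.
  by rewrite /M' h sub0r oppr_le0 -expr2 sqr_ge0.
have card' : (#|[set i | M' i i != 0%R]| < m)%N.
  rewrite -ltnS; apply: leq_trans hm; rewrite ltnS.
  apply: proper_card; apply/properP; split.
    apply/fintype.subsetP => i; rewrite !inE; apply: contraNneq => /M'0 ->.
    by [].
  by exists p; rewrite !inE // M'pp eqxx.
have [u [hu hu0]] := IH M' card' sM' pM'.
exists (fun k => if k == p then v else u k); split.
  move=> i j; rewrite (bigD1 p) //= eqxx.
  have -> : M i j = v i * v j + M' i j by rewrite /M' addrC subrK.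
  congr (_ + _); rewrite hu (bigD1 p) //= !hu0 // mul0r add0r.
  by apply: eq_bigr => k /negbTE ->.
move=> k hk i; case: eqP => [kp|_]; first by move: p0; rewrite -kp hk ltxx.
by apply: hu0; apply: M'0.
Qed.

End psd.

(** * Ancestors and a weighted Schur test *)

Section ancestors.
Variables (R : realType) (n : nat).
Variables (par : 'I_n -> option 'I_n) (depth : 'I_n -> nat) (N : nat).
Hypothesis par_depth : forall c p, par c = Some p -> (depth p < depth c)%N.
Hypothesis depth_lt : forall c, (depth c < N)%N.

Definition anc (k : nat) (j : 'I_n) : option 'I_n := iter k (obind par) (Some j).

Lemma anc0 j : anc 0 j = Some j. Proof. by []. Qed.

Lemma ancS k j : anc k.+1 j = obind par (anc k j). Proof. by []. Qed.

Lemma anc_par k j p : par j = Some p -> anc k.+1 j = anc k p.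
Proof. by move=> jp; rewrite /anc iterSr /= jp. Qed.

Lemma anc_None k j : par j = None -> anc k.+1 j = None.
Proof. by move=> jp; rewrite /anc iterSr /= jp; elim: k => //= k ->. Qed.

Lemma anc_depth k j v : anc k j = Some v -> (depth v + k <= depth j)%N.
Proof.
elim: k j => [|k IH] j; first by move=> [<-]; rewrite addn0.
case E: (par j) => [p|]; last by rewrite anc_None.
rewrite (anc_par _ E) => /IH; have := par_depth E; lia.
Qed.

Lemma anc_oversize k j : (N <= k)%N -> anc k j = None.
Proof.
case E: (anc k j) => [v|] // Nk; have := anc_depth E; have := depth_lt j; lia.
Qed.

Variable tau : R.
Hypothesis tau0 : 0 <= tau.

(* Equal to tau ^ k if v is the k-th ancestor of j, and to 0 if v is no ancestor of j. *)
Definition Dw (v j : 'I_n) : R := \sum_(k < N) tau ^+ k * (anc k j == Some v)%:R.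

Lemma Dw_ge0 v j : 0 <= Dw v j.
Proof. by apply: sumr_ge0 => k _; rewrite mulr_ge0 ?exprn_ge0. Qed.

Lemma Dw_refl j : 1 <= Dw j j.
Proof.
have N0 : (0 < N)%N by apply: leq_trans (depth_lt j).
rewrite /Dw (bigD1 (Ordinal N0)) //= eqxx expr0 mulr1 lerDl.
by apply: sumr_ge0 => k _; rewrite mulr_ge0 ?exprn_ge0.
Qed.

Lemma Dw_par v j p : par j = Some p -> tau * Dw v p <= Dw v j.
Proof.
move=> jp; have N0 : (0 < N)%N by apply: leq_trans (depth_lt j).
rewrite /Dw; case: N N0 anc_oversize => // m _ over.
have np : anc m p = None by rewrite -(anc_par m jp) over.
rewrite big_ord_recr /= np mulr0 addr0.
rewrite big_ord_recl mulr_sumr -[leLHS]add0r lerD //; first by rewrite mulr_ge0 ?exprn_ge0.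
apply: ler_sum => k _; rewrite (anc_par _ jp) /= exprS mulrA.
by [].
Qed.

Variables (om nu : R) (m : 'I_n -> R) (A : {set 'I_n}).
Hypothesis om0 : 0 <= om.
Hypothesis nu0 : 0 <= nu.
Hypothesis tau2 : tau ^+ 2 = om * nu.
Hypothesis m0 : forall j, 0 < m j.

Definition Lw (v : 'I_n) : R :=
  \sum_(j in A) \sum_(k < N) m j * nu ^+ k * (anc k j == Some v)%:R.

(** A Schur test. The weight tau ^ k at distance k splits into om ^ k, which is summed over the
    ancestors of [j], and nu ^ k * m j, which is summed over the descendants of [v] and gives
    [Lw v]. The weights [m] make room for vertices of unbounded degree. *)
Lemma Dw_CS (y : 'I_n -> R) (Kc : R) :
  (forall j, j \in A -> \sum_(k < N) om ^+ k * (if anc k j is Some v then Lw v else 0) <= Kc) ->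
  \sum_v (\sum_(j in A) `|y j| * Dw v j) ^+ 2 <= Kc * \sum_(j in A) y j ^+ 2 / m j.
Proof.
move=> hK.
pose I (v j : 'I_n) (k : 'I_N) : R := (anc k j == Some v)%:R.
have CS v : (\sum_(j in A) `|y j| * Dw v j) ^+ 2 <=
   (\sum_(j in A) \sum_(k < N) y j ^+ 2 / m j * om ^+ k * I v j k) * Lw v.
  pose Fq (q : 'I_n * 'I_N) := (q.1 \in A)%:R * (`|y q.1| / Num.sqrt (m q.1) * Num.sqrt (om ^+ q.2)) * I v q.1 q.2.
  pose Hq (q : 'I_n * 'I_N) := (q.1 \in A)%:R * (Num.sqrt (m q.1) * Num.sqrt (nu ^+ q.2)) * I v q.1 q.2.
  have bb (b : bool) : b%:R * b%:R = b%:R :> R by case: b; rewrite ?mulr1 ?mulr0.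
  have := sum_CS Fq Hq.
  have -> : \sum_k Fq k * Hq k = \sum_(j in A) `|y j| * Dw v j.
    rewrite -(pair_bigA _ (fun j k => Fq (j, k) * Hq (j, k))) /= [RHS]big_mkcond /=.
    apply: eq_bigr => j _; rewrite /Fq /Hq /=; case: (j \in A) => /=; last first.
      by rewrite big1 // => k _; rewrite !mul0r.
    rewrite /Dw mulr_sumr; apply: eq_bigr => k _; rewrite !mul1r.
    have tk : Num.sqrt (om ^+ k) * Num.sqrt (nu ^+ k) = tau ^+ k.
      rewrite -sqrtrM ?exprn_ge0 // -exprMn -tau2 -exprM mulnC exprM.
      by rewrite sqrtr_sqr ger0_norm // exprn_ge0.
    have sm : Num.sqrt (m j) != 0 by rewrite gt_eqF // sqrtr_gt0.
    rewrite -tk -[in RHS](bb (anc k j == Some v)) -!/(I v j k); field; exact: sm.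
  have -> : \sum_k Fq k ^+ 2 = \sum_(j in A) \sum_(k < N) y j ^+ 2 / m j * om ^+ k * I v j k.
    rewrite -(pair_bigA _ (fun j k => Fq (j, k) ^+ 2)) /= [RHS]big_mkcond /=.
    apply: eq_bigr => j _; rewrite /Fq /=; case: (j \in A) => /=; last first.
      by rewrite big1 // => k _; rewrite !mul0r expr0n.
    apply: eq_bigr => k _; rewrite mul1r !exprMn exprVn real_normK ?num_real //.
    by rewrite !sqr_sqrtr ?exprn_ge0 ?(ltW (m0 j)) // [I v j k ^+ 2]bb.
  have -> : \sum_k Hq k ^+ 2 = Lw v.
    rewrite -(pair_bigA _ (fun j k => Hq (j, k) ^+ 2)) /= /Lw [RHS]big_mkcond /=.
    apply: eq_bigr => j _; rewrite /Hq /=; case: (j \in A) => /=; last first.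
      by rewrite big1 // => k _; rewrite !mul0r expr0n.
    apply: eq_bigr => k _; rewrite mul1r !exprMn.
    by rewrite !sqr_sqrtr ?exprn_ge0 ?(ltW (m0 j)) // [I v j k ^+ 2]bb.
  by [].
apply: (le_trans (ler_sum _ (fun v _ => CS v))).
under eq_bigr do rewrite mulr_suml.
rewrite exchange_big mulr_sumr; apply: ler_sum => j jA /=.
have -> : \sum_v (\sum_(k < N) y j ^+ 2 / m j * om ^+ k * I v j k) * Lw v =
  (y j ^+ 2 / m j) * \sum_(k < N) om ^+ k * (if anc k j is Some v then Lw v else 0).
  under eq_bigr do rewrite mulr_suml.
  rewrite exchange_big mulr_sumr; apply: eq_bigr => k _ /=.
  rewrite /I; case: (anc k j) => [v|]; last first.
    rewrite big1 ?mulr0 // => v _.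
    by rewrite mulr0 mul0r.
  rewrite (eq_bigr (fun i => (i == v)%:R * (y j ^+ 2 / m j * om ^+ k * Lw i))); last first.
    move=> i _; have -> : (Some v == Some i) = (i == v) by rewrite eq_sym.
    by ring.
  by rewrite sum_delta mulrA.
rewrite mulrC; apply: ler_wpM2r; last exact: hK.
by rewrite divr_ge0 ?sqr_ge0 // ltW.
Qed.

End ancestors.

Section invariance.
Variables (R : realType) (T : finType).

Lemma var_ext (w w' g : T -> R) : w =1 w' -> var w g = var w' g.
Proof. by move=> e; rewrite /var /cov !(mean_ext _ e). Qed.

Lemma var_eq (w f g : T -> R) : f =1 g -> var w f = var w g.
Proof. by move=> /funext ->. Qed.

Arguments var_eq {w f g} _.

Lemma var_scale (w g : T -> R) c : c != 0 -> var (fun x => c * w x) g = var w g.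
Proof. by move=> c0; rewrite /var /cov !mean_scale. Qed.

Lemma ent_scale (w g : T -> R) c : c != 0 -> ent (fun x => c * w x) g = ent w g.
Proof. by move=> c0; rewrite /ent !mean_scale. Qed.

Lemma MLSI_scale (I : finType) (s : I -> T -> T) (w : T -> R) c C : 0 < c ->
  MLSI s w C -> MLSI s (fun x => c * w x) C.
Proof. by move=> c0 h f f0; rewrite ent_scale ?gt_eqF // Dn_scale //; exact: h. Qed.

Lemma MLSI_ext (I : finType) (s : I -> T -> T) (w w' : T -> R) C : w =1 w' ->
  MLSI s w C -> MLSI s w' C.
Proof. by move=> /funext ->. Qed.

End invariance.
Arguments var_eq {R T w f g} _.

Section linear_weights.
Variables (R : realType) (n : nat).
Let t0 : config n := [ffun=> true].

Lemma spn_cross (i j k : 'I_n) (x : config n) : i != j ->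
  spn R k x + spn R k (flp i (flp j x)) = spn R k (flp i x) + spn R k (flp j x).
Proof.
move=> ij; have [->|ki] := eqVneq k i.
  by rewrite !spn_flp_eq [spn R i (flp j x)]spn_flp_neq //; ring.
by rewrite !(spn_flp_neq _ _ ki) addrC.
Qed.

Lemma linear_MLSI (h : 'I_n -> R) :
  MLSI (flp (n:=n)) (fun x => expR (\sum_i h i * spn R i x)) 2^-1.
Proof.
apply: product_MLSI => [x|i j x ij]; first exact: expR_gt0.
rewrite -!expRD; congr expR; rewrite -!big_split; apply: eq_bigr => k _ /=.
by rewrite -!mulrDr spn_cross.
Qed.

Lemma sum_linear (K : finType) (z : K -> R) (u : K -> 'I_n -> R) (x : config n) :
  \sum_k z k * (\sum_i u k i * spn R i x) = \sum_i (\sum_k z k * u k i) * spn R i x.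
Proof.
under eq_bigr do rewrite mulr_sumr.
rewrite exchange_big; apply: eq_bigr => i _ /=.
by rewrite mulr_suml; apply: eq_bigr => k _; rewrite mulrA.
Qed.

End linear_weights.

(** * Localization on the forest *)

Section forest_MLSI.
Variables (R : realType) (n : nat).
Variables (par : 'I_n -> option 'I_n) (depth : 'I_n -> nat) (N : nat).
Hypothesis par_depth : forall c p, par c = Some p -> (depth p < depth c)%N.
Hypothesis depth_lt : forall c, (depth c < N)%N.
Variables (b om nu ell : R) (ep : 'I_n -> bool).
Hypothesis b0 : 0 < b.
Hypothesis om0 : 0 <= om.
Hypothesis om_le : om <= 2^-1.
Hypothesis nu0 : 0 < nu.
Hypothesis tau2 : (4 * b) ^+ 2 = om * nu.
Hypothesis ell0 : 0 < ell.
Hypothesis hell : forall v, \sum_j Dw par N nu v j <= ell.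
Let t0 : config n := [ffun=> true].

Definition kapb (c : 'I_n) : R := b * sg R (ep c).

Let tau0 : 0 <= 4 * b. Proof. by rewrite mulr_ge0 // ltW. Qed.

Let chld (j : 'I_n) : R := \sum_c (par c == Some j)%:R.
Let m (j : 'I_n) : R := 1 + chld j.

Let chld_ge0 j : 0 <= chld j. Proof. exact: sumr_ge0. Qed.
Let m_gt0 j : 0 < m j. Proof. by rewrite ltr_pwDl. Qed.

(** The children of j lie one level below j, so weighting each vertex by one plus the number of its
    children costs one factor 1 / nu. *)
Lemma Lw_degree v : Lw par N nu m [set: 'I_n] v <= (1 + nu^-1) * ell.
Proof.
have -> : Lw par N nu m [set: 'I_n] v = \sum_j m j * Dw par N nu v j.
  rewrite /Lw (eq_bigl predT) => [|j]; last by rewrite inE.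
  by apply: eq_bigr => j _; rewrite /Dw mulr_sumr; apply: eq_bigr => k _; rewrite mulrA.
rewrite (eq_bigr (fun j => Dw par N nu v j + chld j * Dw par N nu v j)); last first.
  by move=> j _; rewrite mulrDl mul1r.
rewrite big_split mulrDl mul1r; apply: lerD; first exact: hell.
apply: (@le_trans _ _ (nu^-1 * \sum_c Dw par N nu v c)); last first.
  by rewrite ler_wpM2l ?invr_ge0 ?(ltW nu0).
rewrite /chld; under eq_bigr do rewrite mulr_suml.
rewrite exchange_big mulr_sumr; apply: ler_sum => c _ /=.
case E: (par c) => [p|]; last first.
  rewrite big1 => [|j _]; last by rewrite mul0r.
  by rewrite mulr_ge0 ?invr_ge0 ?(ltW nu0) // Dw_ge0 // ltW.
rewrite (eq_bigr (fun j => (j == p)%:R * Dw par N nu v j)); last first.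
  move=> j _; have -> // : (Some p == Some j) = (j == p) by rewrite eq_sym.
rewrite sum_delta ler_pdivlMl //.
exact: (Dw_par par_depth depth_lt (ltW nu0)).
Qed.

Lemma geom_le (q : R) k : 0 <= q -> q <= 2^-1 -> \sum_(i < k) q ^+ i <= 2.
Proof.
move=> q0 q1.
have h : \sum_(i < k) q ^+ i <= 2 - 2 * q ^+ k.
  elim: k => [|k IH]; first by rewrite big_ord0 expr0; lra.
  rewrite big_ord_recr exprS /=.
  have qk : 0 <= q ^+ k by rewrite exprn_ge0.
  nra.
by apply: (le_trans h); rewrite gerBl mulr_ge0 // exprn_ge0.
Qed.

(** The linear form of an edge from c to its parent p is sqrt b times the spin at c plus or minus
    the spin at p; half its square is b plus the signed coupling of strength b. *)
Let ucf (c i : 'I_n) : R :=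
  if par c is Some p then Num.sqrt b * ((i == c)%:R + sg R (ep c) * (i == p)%:R) else 0.

Let l (c : 'I_n) (x : config n) : R := \sum_i ucf c i * spn R i x.

Let lE c x : l c x = if par c is Some p
  then Num.sqrt b * (spn R c x + sg R (ep c) * spn R p x) else 0.
Proof.
rewrite /l /ucf; case: (par c) => [p|]; last by rewrite big1 // => i _; rewrite mul0r.
rewrite (eq_bigr (fun i => (i == c)%:R * (Num.sqrt b * spn R i x) +
   (i == p)%:R * (Num.sqrt b * sg R (ep c) * spn R i x))) => [|i _]; last by ring.
by rewrite big_split /= !sum_delta; ring.
Qed.

(** Each form [l c] involves at most two vertices, and vertex j occurs in at most m j of them;
    Cauchy-Schwarz at j costs the factor m j, which the division cancels. Unweighted, the largest
    degree would enter here. *)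
Lemma ucf_energy (z : 'I_n -> R) :
  \sum_j (\sum_c z c * ucf c j) ^+ 2 / m j <= 2 * b * \sum_c z c ^+ 2.
Proof.
pose inc (c j : 'I_n) : R := (c == j)%:R + (par c == Some j)%:R.
have inc_ge0 c j : 0 <= inc c j by rewrite addr_ge0.
have minc j : \sum_c inc c j = m j.
  rewrite big_split /=; congr (_ + _).
  by rewrite (eq_bigr (fun c => (c == j)%:R * 1)) ?sum_delta // => c _; rewrite mulr1.
have ub c j : `|ucf c j| <= Num.sqrt b * inc c j.
  rewrite /ucf /inc; case E: (par c) => [p|]; last first.
    by rewrite normr0 mulr_ge0 ?sqrtr_ge0 // addr_ge0.
  rewrite normrM ger0_norm ?sqrtr_ge0 // ler_wpM2l ?sqrtr_ge0 //.
  apply: (le_trans (ler_normD _ _)); rewrite normrM sg_norm mul1r !normr_nat.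
  rewrite [c == j]eq_sym; have -> : (Some p == Some j) = (j == p) by rewrite eq_sym.
  by [].
have inc2 c j : inc c j ^+ 2 <= inc c j.
  rewrite /inc; case E: (par c) => [p|]; last by case: eqP => _; rewrite /= ?addr0 ?expr1n ?expr0n.
  have -> : (Some p == Some j) = (p == j) by [].
  case: (eqVneq c j) => [cj|_] /=; case: (eqVneq p j) => [pj|_] /=;
    rewrite ?addr0 ?add0r ?expr1n ?expr0n //.
  by have := par_depth E; rewrite pj -cj ltnn.
have bb : Num.sqrt b ^+ 2 = b by rewrite sqr_sqrtr // ltW.
have CS j : (\sum_c z c * ucf c j) ^+ 2 <= b * (\sum_c z c ^+ 2 * inc c j) * m j.
  have h1 : `|\sum_c z c * ucf c j| <= Num.sqrt b * \sum_c (`|z c| * Num.sqrt (inc c j)) * Num.sqrt (inc c j).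
    rewrite mulr_sumr; apply: (le_trans (ler_norm_sum _ _ _)); apply: ler_sum => c _.
    rewrite normrM -[X in _ <= _ * X]mulrA -expr2 sqr_sqrtr // mulrCA.
    by apply: ler_wpM2l.
  have h2 := sum_CS (fun c => `|z c| * Num.sqrt (inc c j)) (fun c => Num.sqrt (inc c j)).
  have e1 : \sum_c (`|z c| * Num.sqrt (inc c j)) ^+ 2 = \sum_c z c ^+ 2 * inc c j.
    by apply: eq_bigr => c _; rewrite exprMn real_normK ?num_real // sqr_sqrtr.
  have e2 : \sum_c Num.sqrt (inc c j) ^+ 2 = m j.
    by rewrite -minc; apply: eq_bigr => c _; rewrite sqr_sqrtr.
  rewrite e1 e2 in h2.
  have S0 : 0 <= \sum_c (`|z c| * Num.sqrt (inc c j)) * Num.sqrt (inc c j).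
    by apply: sumr_ge0 => c _; rewrite !mulr_ge0 ?sqrtr_ge0.
  rewrite -(real_normK (num_real (\sum_c z c * ucf c j))).
  apply: (@le_trans _ _ ((Num.sqrt b * \sum_c (`|z c| * Num.sqrt (inc c j)) * Num.sqrt (inc c j)) ^+ 2)).
    by rewrite ler_pXn2r // ?nnegrE ?mulr_ge0 ?sqrtr_ge0.
  by rewrite exprMn bb -mulrA ler_wpM2l // ltW.
apply: (@le_trans _ _ (\sum_j b * (\sum_c z c ^+ 2 * inc c j))).
  by apply: ler_sum => j _; rewrite ler_pdivrMr.
rewrite -mulr_sumr exchange_big /= -mulrA mulrCA ler_pM2l // mulr_sumr.
apply: ler_sum => c _; rewrite -mulr_sumr mulrC ler_wpM2r ?sqr_ge0 //.
rewrite /inc big_split /= -[2]/(1 + 1); apply: lerD.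
  rewrite (eq_bigr (fun j => (j == c)%:R * 1)) ?sum_delta // => j _.
  by rewrite mulr1 eq_sym.
case E: (par c) => [p|]; last by rewrite big1.
rewrite (eq_bigr (fun j => (j == p)%:R * 1)) ?sum_delta // => j _.
by rewrite mulr1; have -> : (Some p == Some j) = (j == p) by rewrite eq_sym.
Qed.

Definition forest_cov_const : R := 4 * b * (1 + nu^-1) * ell.

Lemma tree_var_bound (kap h : 'I_n -> R) (z : 'I_n -> R) : (forall c, `|kap c| <= b) ->
  var (fweight par kap [set: 'I_n] h) (fun x => \sum_c z c * l c x) <=
  forest_cov_const * \sum_c z c ^+ 2.
Proof.
move=> hk; set y := fun j => \sum_c z c * ucf c j.
rewrite (var_eq (g := fun x => \sum_(j in [set: 'I_n]) y j * spn R j x)); last first.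
  move=> x; rewrite /l sum_linear; apply: eq_bigl => j; by rewrite inE.
have h1 : var (fweight par kap [set: 'I_n] h) (fun x => \sum_(j in [set: 'I_n]) y j * spn R j x)
  <= \sum_(v in [set: 'I_n]) (\sum_(j in [set: 'I_n]) `|y j| * Dw par N (4 * b) v j) ^+ 2.
  apply: (@forest_var_le R n par depth kap (4 * b) (Dw par N (4 * b)) par_depth).
  - by move=> c; rewrite ler_wpM2l.
  - by move=> v j; apply: Dw_ge0.
  - by move=> j; apply: Dw_refl tau0 j; exact: depth_lt.
  - by move=> v j p; apply: (Dw_par par_depth depth_lt).
  - by move=> c p _ _; rewrite inE.
apply: (le_trans h1).
rewrite (eq_bigl predT) => [|v]; last by rewrite inE.
have hK j : j \in [set: 'I_n] -> \sum_(k < N) om ^+ k *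
   (if anc par k j is Some v then Lw par N nu m [set: 'I_n] v else 0) <= 2 * ((1 + nu^-1) * ell).
  move=> _; have E0 : 0 <= (1 + nu^-1) * ell.
    by rewrite mulr_ge0 ?(ltW ell0) // addr_ge0 // invr_ge0 ltW.
  apply: (@le_trans _ _ (\sum_(k < N) om ^+ k * ((1 + nu^-1) * ell))).
    apply: ler_sum => k _; rewrite ler_wpM2l ?exprn_ge0 //.
    by case: (anc par k j) => // v; exact: Lw_degree.
  by rewrite -mulr_suml ler_wpM2r // geom_le.
apply: (le_trans (Dw_CS tau0 om0 (ltW nu0) tau2 m_gt0 y hK)).
apply: (@le_trans _ _ (2 * ((1 + nu^-1) * ell) * (2 * b * \sum_c z c ^+ 2))).
  apply: ler_wpM2l.
    by rewrite mulr_ge0 // mulr_ge0 ?(ltW ell0) // addr_ge0 // invr_ge0 ltW.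
  rewrite (eq_bigl predT) => [|j]; last by rewrite inE.
  exact: ucf_energy.
by rewrite le_eqVlt /forest_cov_const; apply/orP; left; apply/eqP; ring.
Qed.

Let p1 (c : 'I_n) : R := if par c is Some _ then 1 else 0.

Lemma tree_sqr x : \sum_c l c x ^+ 2 / 2 =
  \sum_c b * p1 c + \sum_(c in [set: 'I_n]) pedge par kapb c x.
Proof.
rewrite [X in _ = _ + X](eq_bigl predT) => [|c]; last by rewrite inE.
rewrite -big_split; apply: eq_bigr => c _ /=; rewrite lE /pedge /p1 /kapb.
case: (par c) => [p|]; last by rewrite expr0n mul0r mulr0 addr0.
rewrite exprMn sqr_sqrtr ?(ltW b0) //.
have := spn_sqr R c x; have := spn_sqr R p x; have := sg_sqr R (ep c).
set s := sg R (ep c); set u := spn R c x; set v := spn R p x => hs hv hu.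
have -> : (u + s * v) ^+ 2 = u ^+ 2 + 2 * s * u * v + (s * s) * v ^+ 2 by ring.
by rewrite hu hv hs; field.
Qed.

(** The localization stays within forest Ising models: the values of [l c] are 0 and plus or minus 2
    sqrt b, according to whether the edge is satisfied, so each cosh factor is itself a coupling
    along that edge. After j < N steps with eps = N ^ (-1/2) its strength is at most b. *)
Lemma locw_forest eps j th h : exists (C : R) (kap h' : 'I_n -> R),
  [/\ C != 0, (forall c, kap c = (ln (ch (eps * (2 * Num.sqrt b)) ^+ j) / 2) * sg R (ep c)) &
   forall x, locw (fun x => expR (\sum_i h i * spn R i x)) l eps j th x =
             C * fweight par kap [set: 'I_n] h' x].
Proof.
pose A := ln (ch (eps * (2 * Num.sqrt b)) ^+ j) / 2.
pose kap c := A * sg R (ep c).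
pose h' i := h i + \sum_k th k * ucf k i.
exists (expR (\sum_c A * p1 c)), kap, h'; split=> [||x] //; first by rewrite gt_eqF ?expR_gt0.
rewrite /locw /fweight -expRD.
have -> : \prod_k ch (eps * l k x) ^+ j = expR (\sum_k (A * p1 k + pedge par kap k x)).
  rewrite expR_sum; apply: eq_bigr => c _; rewrite lE /pedge /p1 /kap.
  case: (par c) => [p|]; last first.
    by rewrite mulr0 /ch oppr0 expR0 mulr0 addr0 expR0 divff ?expr1n.
  have cj0 : 0 < ch (eps * (2 * Num.sqrt b)) ^+ j by rewrite exprn_gt0 // ch_gt0.
  have sgn (u : R) : u ^+ 2 = 1 -> u = 1 \/ u = -1.
    move=> hu; have : (u - 1) * (u + 1) = 0 by rewrite -subr_sqr hu expr1n subrr.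
    by move=> /eqP; rewrite mulf_eq0 subr_eq0 addr_eq0 => /orP[] /eqP ->; [left | right].
  have hs : sg R (ep c) = 1 \/ sg R (ep c) = -1 by apply: sgn; rewrite expr2 sg_sqr.
  have hu := sgn _ (spn_sqr R c x); have hv := sgn _ (spn_sqr R p x).
  have E1 : expR (A + A) = ch (eps * (2 * Num.sqrt b)) ^+ j.
    by have -> : A + A = ln (ch (eps * (2 * Num.sqrt b)) ^+ j); [rewrite /A; field | rewrite lnK ?posrE].
  have E0 : ch 0 = 1 :> R by rewrite /ch oppr0 expR0 divff.
  have chN (z : R) : ch (- z) = ch z by rewrite /ch opprK addrC.
  move: hs hu hv; set s := sg R (ep c); set u := spn R c x; set v := spn R p x => hs hu hv.
  pose t := s * u * v.
  have u2 : u ^+ 2 = 1 by case: hu => ->; rewrite ?sqrrN expr1n.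
  have svE : u + s * v = (1 + t) * u.
    have tu : t * u = s * v by rewrite -[RHS]mulr1 -[in RHS]u2 /t; ring.
    by rewrite mulrDl mul1r tu.
  have ht : t = 1 \/ t = -1.
    rewrite /t; case: hs => ->; case: hu => ->; case: hv => ->;
      rewrite ?mulr1 ?mulrN1 ?opprK; by [left | right].
  have -> : A * s * u * v = A * t by rewrite /t; ring.
  rewrite mulr1 svE; case: ht => ->; last first.
    by rewrite subrr mul0r !mulr0 E0 expr1n mulrN1 subrr expR0.
  rewrite mulr1 E1; case: hu => ->.
    by rewrite mulr1 [Num.sqrt b * _]mulrC.
  have -> : eps * (Num.sqrt b * ((1 + 1) * -1)) = - (eps * (2 * Num.sqrt b)) by ring.
  by rewrite chN.
rewrite -!expRD; congr expR.
have -> : \sum_(i in [set: 'I_n]) h' i * spn R i x =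
   \sum_i h i * spn R i x + \sum_k th k * l k x.
  rewrite (eq_bigl predT) => [|c]; last by rewrite inE.
  by rewrite /l sum_linear -big_split; apply: eq_bigr => i _; rewrite /h' mulrDl.
rewrite [\sum_(c in [set: 'I_n]) pedge _ _ _ _](eq_bigl predT) => [|c]; last by rewrite inE.
by rewrite big_split /=; ring.
Qed.

Lemma forest_MLSI (h : 'I_n -> R) :
  MLSI (flp (n:=n)) (fweight par kapb [set: 'I_n] h) (2^-1 * expR (64 * forest_cov_const)).
Proof.
pose w0 (x : config n) := expR (\sum_i h i * spn R i x).
have w00 x : 0 < w0 x by exact: expR_gt0.
have F0 : 0 < forest_cov_const.
  by rewrite mulr_gt0 // !mulr_gt0 // addr_gt0 // invr_gt0.
have H1 N' j th z : (1 <= N')%N -> (j < N')%N ->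
  var (locw w0 l (Num.sqrt N'%:R^-1) j th) (fun x => \sum_k z k * l k x) <=
     forest_cov_const * \sum_k z k ^+ 2.
  move=> N0 jN; have [C [kap [h' [C0 hk hW]]]] := locw_forest (Num.sqrt N'%:R^-1) j th h.
  rewrite (var_ext _ hW) var_scale //; apply: tree_var_bound => c.
  rewrite hk normrM sg_norm mulr1.
  set u := ch _; have u1 : 1 <= u by exact: ch_ge1.
  have up : 0 < u by exact: lt_le_trans u1.
  have l0 : 0 <= ln u by exact: ln_ge0.
  rewrite lnXn // -[ln u *+ j]mulr_natl ger0_norm; last by rewrite divr_ge0 // mulr_ge0.
  have lu : ln u <= 2 * b / N'%:R.
    rewrite -[leRHS]expRK ler_ln ?posrE ?expR_gt0 //.
    apply: (le_trans (ch_le _)); rewrite ler_expR exprMn sqr_sqrtr ?invr_ge0 //.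
    rewrite exprMn sqr_sqrtr ?(ltW b0) // le_eqVlt; apply/orP; left; apply/eqP.
    by field; rewrite pnatr_eq0 -lt0n.
  have n0 : 0 < N'%:R :> R by rewrite ltr0n.
  rewrite ler_pdivrMr //; apply: (@le_trans _ _ (N'%:R * ln u)).
    by rewrite ler_wpM2r // ler_nat ltnW.
  by rewrite mulrC -ler_pdivlMr // [b * 2]mulrC.
have H0 th : MLSI (flp (n:=n)) (fun x => w0 x * expR (\sum_k th k * l k x)) 2^-1.
  apply: (MLSI_ext (w := fun x => expR (\sum_i (h i + \sum_k th k * ucf k i) * spn R i x))).
    move=> x; rewrite /w0 -expRD; congr expR; rewrite /l sum_linear -big_split.
    by apply: eq_bigr => i _; rewrite mulrDl.
  exact: linear_MLSI.
have hh : (0 : R) <= 2^-1 by rewrite invr_ge0.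
have := localization_MLSI t0 w00 F0 hh H1 H0.
have c0 : 0 < expR (- \sum_c b * p1 c) by exact: expR_gt0.
move=> /(MLSI_scale c0); apply: MLSI_ext => x.
rewrite /w0 /fweight tree_sqr -!expRD; congr expR.
rewrite [\sum_(i in [set: 'I_n]) h i * _](eq_bigl predT) => [|c]; last by rewrite inE.
ring.
Qed.

End forest_MLSI.

(** * From the forest to the whole model *)

Section bulk.
Variables (R : realType) (n : nat).
Variables (w0 : config n -> R) (M : 'I_n -> 'I_n -> R) (W : {set 'I_n}).
Variables (ka Kw K0 : R).
Hypothesis w00 : forall x, 0 < w0 x.
Hypothesis sM : forall i j, M i j = M j i.
Hypothesis pM : forall y, 0 <= qf M y.
Hypothesis uM : forall y, qf M y <= ka * \sum_i y i ^+ 2.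
Hypothesis dM : forall i, i \notin W -> M i i = 0.
Hypothesis ka0 : 0 <= ka.
Hypothesis Kw0 : 0 <= Kw.
Hypothesis K00 : 0 <= K0.
Hypothesis kaK : ka * Kw <= 64^-1.
Hypothesis hvar : forall (h y : 'I_n -> R),
  var (fun x => w0 x * expR (\sum_i h i * spn R i x)) (fun x => \sum_(j in W) y j * spn R j x)
  <= Kw * \sum_(j in W) y j ^+ 2.
Hypothesis hM : forall h : 'I_n -> R,
  MLSI (flp (n:=n)) (fun x => w0 x * expR (\sum_i h i * spn R i x)) K0.
Let t0 : config n := [ffun=> true].

(** A factorisation of [M] provides linear forms whose squares sum to the quadratic form. Their
    initial variance is at most ka * Kw <= 1 / 64, [locw_var_bound] keeps it below 1 / 32, and the
    loss is exp (64 / 32). *)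
Lemma bulk_MLSI :
  MLSI (flp (n:=n)) (fun x => w0 x * expR (qf M (fun i => spn R i x) / 2)) (K0 * expR 2).
Proof.
have [u hu] := psd_factor sM pM.
pose l (k : 'I_n) (x : config n) := \sum_i u k i * spn R i x.
have qfE y : qf M y = \sum_k (\sum_i u k i * y i) ^+ 2.
  rewrite /qf; under eq_bigr do under eq_bigr do rewrite hu !mulr_suml.
  rewrite (eq_bigr (fun i => \sum_k \sum_j u k i * u k j * y i * y j)); last first.
    by move=> i _; rewrite exchange_big.
  rewrite exchange_big; apply: eq_bigr => k _ /=.
  rewrite expr2 mulr_suml; apply: eq_bigr => i _; rewrite mulr_sumr.
  by apply: eq_bigr => j _; ring.
(* A zero diagonal entry kills a column of the factor, so the forms involve vertices of [W] alone,
   where the variance is controlled. *)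
have u0 i k : i \notin W -> u k i = 0.
  move=> /dM; rewrite hu => /eqP; rewrite psumr_eq0 => [/allP h|k' _]; last by rewrite -expr2 sqr_ge0.
  have /implyP := h k (mem_index_enum k); rewrite mulf_eq0 orbb => /(_ isT) /eqP.
  by [].
(* [uM] bounds the norm of the factor; this is the same bound for its transpose. *)
have yb (c : 'I_n -> R) : \sum_i (\sum_k c k * u k i) ^+ 2 <= ka * \sum_k c k ^+ 2.
  set y := fun i => \sum_k c k * u k i.
  set S := \sum_i y i ^+ 2; set C := \sum_k c k ^+ 2.
  have S0 : 0 <= S by apply: sumr_ge0 => i _; exact: sqr_ge0.
  have C0 : 0 <= C by apply: sumr_ge0 => i _; exact: sqr_ge0.
  have SE : S = \sum_k c k * (\sum_i u k i * y i).
    rewrite /S; under [RHS]eq_bigr do rewrite mulr_sumr.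
    rewrite exchange_big; apply: eq_bigr => i _ /=.
    by rewrite expr2 {1}/y mulr_suml; apply: eq_bigr => k _; rewrite mulrA.
  have h1 := sum_CS c (fun k => \sum_i u k i * y i).
  rewrite -SE -qfE -/C in h1.
  have h2 : S ^+ 2 <= C * (ka * S) by apply: (le_trans h1); rewrite ler_wpM2l.
  have [->|Sn] := eqVneq S 0; first by rewrite mulr_ge0.
  have Sp : 0 < S by rewrite lt_def Sn.
  by rewrite -(ler_pM2l Sp) -expr2; apply: (le_trans h2); rewrite le_eqVlt; apply/orP; left; apply/eqP; ring.
have linE (c : 'I_n -> R) x : \sum_k c k * l k x = \sum_i (\sum_k c k * u k i) * spn R i x.
  exact: sum_linear.
have hv th c : var (fun x => w0 x * expR (\sum_k th k * l k x)) (fun x => \sum_k c k * l k x)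
   <= 64^-1 * \sum_k c k ^+ 2.
  rewrite (var_ext (w' := fun x => w0 x * expR (\sum_i (\sum_k th k * u k i) * spn R i x))); last first.
    by move=> x; rewrite linE.
  pose y i := \sum_k c k * u k i.
  have y_out i : i \notin W -> y i = 0.
    by move=> iW; rewrite /y big1 // => k _; rewrite u0 // mulr0.
  rewrite (var_eq (g := fun x => \sum_(j in W) y j * spn R j x)); last first.
    move=> x; rewrite linE [RHS]big_mkcond /=; apply: eq_bigr => i _.
    by case: ifPn => // iW; rewrite -/(y i) y_out // mul0r.
  apply: (le_trans (hvar _ _)).
  apply: (@le_trans _ _ (Kw * (ka * \sum_k c k ^+ 2))).
    rewrite ler_wpM2l //; apply: le_trans (yb c).
    rewrite big_mkcond /=; apply: ler_sum => i _; case: ifP => // _; exact: sqr_ge0.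
  rewrite mulrA [Kw * ka]mulrC ler_wpM2r //; apply: sumr_ge0 => k _; exact: sqr_ge0.
have [N0 hN0] := locw_var_bound t0 w00 hv.
have a0 : (0 : R) < 32^-1 by rewrite invr_gt0.
have H0 th : MLSI (flp (n:=n)) (fun x => w0 x * expR (\sum_k th k * l k x)) K0.
  by apply: MLSI_ext (hM (fun i => \sum_k th k * u k i)) => x; rewrite linE.
have := localization_MLSI t0 w00 a0 K00 hN0 H0.
have -> : 64 * 32^-1 = 2 :> R by field.
apply: MLSI_ext => x; congr (_ * expR _).
by rewrite qfE mulr_suml.
Qed.

End bulk.

(** * Variances at good vertices and at ends of extra edges *)

Section boundary_variance.
Variables (R : realType) (n : nat).
Variables (par : 'I_n -> option 'I_n) (depth : 'I_n -> nat) (N : nat).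
Hypothesis par_depth : forall c p, par c = Some p -> (depth p < depth c)%N.
Hypothesis depth_lt : forall c, (depth c < N)%N.
Variables (tau om nu : R) (G Y : {set 'I_n}) (kap : 'I_n -> R).
Hypothesis kap_tau : forall c, 4 * `|kap c| <= tau.
Hypothesis tau0 : 0 <= tau.
Hypothesis tau_le : tau <= 2^-1.
Hypothesis om0 : 0 <= om.
Hypothesis nu0 : 0 <= nu.
Hypothesis tau2 : tau ^+ 2 = om * nu.
Hypothesis hG : forall j, j \in G ->
  \sum_(k < N) om ^+ k * (if anc par k j is Some v then \sum_(i in G) Dw par N nu v i else 0) <= 8.
Hypothesis hY : forall v, (#|[set j in Y | [exists k : 'I_N, anc par k j == Some v]]| <= 2)%N.

Lemma sqr_sum_card (A : {set 'I_n}) (z : 'I_n -> R) :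
  (\sum_(j in A) z j) ^+ 2 <= #|A|%:R * \sum_(j in A) z j ^+ 2.
Proof.
have := sum_CS (fun j => (j \in A)%:R) (fun j => (j \in A)%:R * z j).
have e1 : \sum_j (j \in A)%:R * ((j \in A)%:R * z j) = \sum_(j in A) z j.
  rewrite [RHS]big_mkcond; apply: eq_bigr => j _.
  by case: (j \in A); rewrite ?mul1r ?mul0r.
have e2 : \sum_j (j \in A)%:R ^+ 2 = #|A|%:R :> R.
  rewrite -sum1_card natr_sum [RHS]big_mkcond; apply: eq_bigr => j _.
  by case: (j \in A); rewrite ?expr1n ?expr0n.
have e3 : \sum_j ((j \in A)%:R * z j) ^+ 2 = \sum_(j in A) z j ^+ 2.
  rewrite [RHS]big_mkcond; apply: eq_bigr => j _.
  by case: (j \in A); rewrite ?mul1r ?mul0r ?expr0n.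
by rewrite e1 e2 e3.
Qed.

Lemma sum_Dw_sqr (j : 'I_n) : \sum_v Dw par N tau v j ^+ 2 <= 4.
Proof.
have g2 : \sum_(k < N) tau ^+ k <= 2 by exact: geom_le.
have D2 v : Dw par N tau v j ^+ 2 <= 2 * Dw par N tau v j.
  rewrite expr2; apply: ler_wpM2r; first exact: Dw_ge0.
  apply: le_trans g2; apply: ler_sum => k _.
  by rewrite ler_piMr ?exprn_ge0 // lern1 leq_b1.
apply: (le_trans (ler_sum _ (fun v _ => D2 v))); rewrite -mulr_sumr.
have -> : (4 : R) = 2 * 2 by ring.
rewrite ler_wpM2l // /Dw exchange_big; apply: le_trans g2; apply: ler_sum => k _ /=.
rewrite -mulr_sumr ler_piMr ?exprn_ge0 //.
case: (anc par k j) => [v|]; last by rewrite big1.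
rewrite (eq_bigr (fun i => (i == v)%:R * 1)) ?sum_delta // => i _.
by rewrite mulr1; have -> : (Some v == Some i) = (i == v) by rewrite eq_sym.
Qed.

(** [G] is treated by the Schur test with unit weights, and [Y] by plain Cauchy-Schwarz, since at
    most two of its vertices lie below any [v]. Each part contributes 8, doubled when the square of
    the sum is split, and 32 = 16 + 16. *)
Lemma boundary_var (h y : 'I_n -> R) :
  var (fweight par kap [set: 'I_n] h) (fun x => \sum_(j in G :|: Y) y j * spn R j x) <=
  32 * \sum_(j in G :|: Y) y j ^+ 2.
Proof.
pose z j := if j \in G :|: Y then y j else 0.
pose zG j := if j \in G then y j else 0.
pose zY j := if (j \in Y) && (j \notin G) then y j else 0.
have zE j : `|z j| = `|zG j| + `|zY j|.
  rewrite /z /zG /zY inE; case: (j \in G) => /=; first by rewrite andbF normr0 addr0.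
  by rewrite andbT normr0 add0r; case: (j \in Y).
rewrite (var_eq (g := fun x => \sum_(j in [set: 'I_n]) z j * spn R j x)); last first.
  move=> x; rewrite big_mkcond [RHS](eq_bigl predT) => [|j]; last by rewrite inE.
  by apply: eq_bigr => j _; rewrite /z; case: ifP => //; rewrite mul0r.
have h1 : var (fweight par kap [set: 'I_n] h) (fun x => \sum_(j in [set: 'I_n]) z j * spn R j x)
  <= \sum_(v in [set: 'I_n]) (\sum_(j in [set: 'I_n]) `|z j| * Dw par N tau v j) ^+ 2.
  apply: (@forest_var_le R n par depth kap tau (Dw par N tau) par_depth) => //.
  - by move=> v j; apply: Dw_ge0.
  - by move=> j; apply: Dw_refl tau0 j; exact: depth_lt.
  - by move=> v j p; apply: (Dw_par par_depth depth_lt).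
  - by move=> c p _ _; rewrite inE.
apply: (le_trans h1).
pose a v := \sum_(j in G) `|y j| * Dw par N tau v j.
pose c v := \sum_j `|zY j| * Dw par N tau v j.
have split v : \sum_(j in [set: 'I_n]) `|z j| * Dw par N tau v j = a v + c v.
  rewrite (eq_bigl predT) => [|j]; last by rewrite inE.
  rewrite /a [X in _ = X + _]big_mkcond -big_split; apply: eq_bigr => j _ /=.
  rewrite zE mulrDl; congr (_ + _); rewrite /zG; case: ifP => //.
  by rewrite normr0 mul0r.
have ac v : (a v + c v) ^+ 2 <= 2 * a v ^+ 2 + 2 * c v ^+ 2.
  by have := sqr_ge0 (a v - c v); nra.
rewrite (eq_bigl predT) => [|j]; last by rewrite inE.
apply: (@le_trans _ _ (\sum_v (2 * a v ^+ 2 + 2 * c v ^+ 2))).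
  by apply: ler_sum => v _; rewrite split.
rewrite big_split -!mulr_sumr /=.
have hA : \sum_v a v ^+ 2 <= 8 * \sum_(j in G) y j ^+ 2.
  have m0 (j : 'I_n) : (0 : R) < (fun=> 1) j by [].
  have hK j : j \in G -> \sum_(k < N) om ^+ k *
      (if anc par k j is Some v then Lw par N nu (fun=> 1) G v else 0) <= 8.
    move=> jG; apply: le_trans (hG jG); apply: ler_sum => k _.
    case: (anc par k j) => // v; rewrite ler_wpM2l ?exprn_ge0 //.
    apply: ler_sum => i _; rewrite /Dw; apply: ler_sum => k' _.
    by rewrite mul1r.
  have := Dw_CS tau0 om0 nu0 tau2 m0 y hK.
  by under [X in _ <= _ * X]eq_bigr do rewrite divr1.
have hC : \sum_v c v ^+ 2 <= 8 * \sum_j zY j ^+ 2.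
  pose Yv v := [set j in Y | [exists k : 'I_N, anc par k j == Some v]].
  have cE v : c v = \sum_(j in Yv v) `|zY j| * Dw par N tau v j.
    rewrite [RHS]big_mkcond; apply: eq_bigr => j _; case: ifPn => //.
    rewrite inE negb_and => /orP[jY|].
      by rewrite /zY (negbTE jY) normr0 mul0r.
    rewrite negb_exists => /forallP hk; rewrite /Dw big1 ?mulr0 // => k _.
    by rewrite (negbTE (hk k)) mulr0.
  have cb v : c v ^+ 2 <= 2 * \sum_j zY j ^+ 2 * Dw par N tau v j ^+ 2.
    rewrite cE; apply: (le_trans (sqr_sum_card _ _)).
    apply: ler_pM => //; first by apply: sumr_ge0 => j _; exact: sqr_ge0.
      by rewrite ler_nat; exact: hY.
    rewrite big_mkcond; apply: ler_sum => j _; case: ifP => _.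
      by rewrite exprMn real_normK // num_real.
    by rewrite mulr_ge0 // sqr_ge0.
  apply: (le_trans (ler_sum _ (fun v _ => cb v))).
  rewrite -mulr_sumr exchange_big /=.
  have -> : (8 : R) = 2 * 4 by ring.
  rewrite -mulrA ler_wpM2l // mulr_sumr; apply: ler_sum => j _.
  rewrite -mulr_sumr mulrC ler_wpM2r ?sqr_ge0 //.
  exact: sum_Dw_sqr.
have sG : \sum_(j in G) y j ^+ 2 <= \sum_(j in G :|: Y) y j ^+ 2.
  rewrite big_mkcond [leRHS]big_mkcond; apply: ler_sum => j _ /=; rewrite inE.
  by case: (j \in G) => //=; case: ifP => // _; exact: sqr_ge0.
have sY : \sum_j zY j ^+ 2 <= \sum_(j in G :|: Y) y j ^+ 2.
  rewrite [leRHS]big_mkcond; apply: ler_sum => j _ /=; rewrite inE /zY.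
  case: (j \in G) => /=; first by rewrite andbF expr0n sqr_ge0.
  by rewrite andbT; case: ifP => //; rewrite expr0n.
by move: hA hC sG sY; lra.
Qed.

End boundary_variance.

Section ising_link.
Variables (R : realType) (n : nat).
Let t0 : config n := [ffun=> true].

Lemma ising_weightE (J : 'M[R]_n) (h : 'cV[R]_n) x :
  ising_weight J h x = expR (qf (fun i j => J i j) (fun i => spn R i x) / 2 +
                             \sum_i h i 0 * spn R i x).
Proof.
rewrite /ising_weight; congr expR; congr (_ + _).
  rewrite mulrC; congr (_ / _); rewrite !mxE /qf exchange_big /=; apply: eq_bigr => j _.
  rewrite !mxE mulr_suml; apply: eq_bigr => i _; rewrite !mxE.
  by rewrite -/(spn R i x) -/(spn R j x) /spn /sg; ring.
by rewrite !mxE; apply: eq_bigr => i _; rewrite !mxE.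
Qed.

(** Glauber dynamics picks its site uniformly, so [Dn] is n times the Dirichlet form, and this is
    the source of the factor 1 / n. *)
Lemma rho_MLSI_ge (w : config n -> R) K : (0 < n)%N -> 0 < K ->
  (forall x, 0 < w x) -> MLSI (flp (n:=n)) w K ->
  (((n%:R * K)^-1)%:E <= rho_MLSI (fun x => (w x / \sum_y w y)%R))%E.
Proof.
move=> n0 K0 w0 hM; have Z0 := mass_gt0 t0 w0; rewrite /mass in Z0.
set Z := \sum_y w y in Z0 *.
pose mu x := w x / Z.
have nn : 0 < n%:R :> R by rewrite ltr0n.
apply: ereal_sup_ubound; exists (n%:R * K)^-1 => // f f0.
have eE g : expect mu g = mean w g.
  rewrite /expect /mean mulr_suml; apply: eq_bigr => x _; rewrite /mu; ring.
have entE : entropy mu f = ent w f by rewrite /entropy !eE.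
rewrite entE.
have -> : dirichlet mu f (fun s => ln (f s)) = n%:R^-1 * Dn (flp (n:=n)) w f.
  rewrite /dirichlet /expect /Dn exchange_big /= mulr_suml mulr_sumr.
  apply: eq_bigr => x _.
  have ww i : 0 < w x + w (flp i x) by rewrite addr_gt0.
  have -> : \sum_t glauber mu x t * ((f x - f t) * (ln (f x) - ln (f t))) =
    n%:R^-1 * \sum_i w (flp i x) / (w x + w (flp i x)) * ((f x - f (flp i x)) * (ln (f x) - ln (f (flp i x)))).
    rewrite /glauber; under eq_bigr do rewrite -mulrA mulr_suml.
    rewrite -mulr_sumr; congr (_ * _); rewrite exchange_big; apply: eq_bigr => i _ /=.
    rewrite (bigD1 (flp i x)) //= big1 => [|t tx].
      rewrite addr0 eqxx mulr1.
      have -> : (flp i x == x) = false.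
        by apply/eqP => /ffunP /(_ i); rewrite !ffunE eqxx; case: (x i).
      rewrite mulr0 addr0 /flip_prob -/(flp i x) /mu; congr (_ * _).
      by field; rewrite !gt_eqF //= -mulrDl mulr_gt0 // invr_gt0.
    rewrite -/(flp i x) (negbTE tx) mulr0 add0r; case: eqP => [->|_].
      by rewrite subrr mul0r mulr0.
    by rewrite mulr0 mul0r.
  rewrite mulrCA; congr (_ * _); rewrite mulr_sumr mulr_suml; apply: eq_bigr => i _.
  have -> : mass w = Z by [].
  rewrite /mu; set D := (f x - _) * _; set q := (w x + _)^-1; ring.
rewrite invfM -mulrA ler_wpM2l ?invr_ge0 ?(ltW nn) // ler_pdivrMl //.
exact: hM.
Qed.

End ising_link.

(** * A deterministic criterion *)

Section deterministic.
Variables (R : realType) (n : nat).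
Variables (par : 'I_n -> option 'I_n) (depth : 'I_n -> nat) (N : nat).
Variables (b om nu ell ka : R) (ep : 'I_n -> bool) (G Y : {set 'I_n}).
Variables (M : 'I_n -> 'I_n -> R) (J : 'M[R]_n) (C0 : R).

(** The variance 32 of [boundary_var] times the norm 1 / 2048 is the 1 / 64 required by [bulk_MLSI],
    and b <= 1 / 8 gives 4 b <= 1 / 2 for the geometric sums. The constant [C0] cancels in the
    normalisation. *)
Theorem ising_rho_ge :
  (0 < n)%N ->
  (forall c p, par c = Some p -> (depth p < depth c)%N) ->
  (forall c, (depth c < N)%N) ->
  0 < b -> b <= 8^-1 -> 0 <= om -> om <= 2^-1 -> 0 < nu -> (4 * b) ^+ 2 = om * nu ->
  0 < ell -> (forall v, \sum_j Dw par N nu v j <= ell) ->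
  (forall j, j \in G ->
    \sum_(k < N) om ^+ k * (if anc par k j is Some v then \sum_(i in G) Dw par N nu v i else 0) <= 8) ->
  (forall v, (#|[set j in Y | [exists k : 'I_N, anc par k j == Some v]]| <= 2)%N) ->
  (forall i j, M i j = M j i) -> (forall y, 0 <= qf M y) ->
  0 <= ka -> ka <= 2048^-1 -> (forall y, qf M y <= ka * \sum_i y i ^+ 2) ->
  (forall i, i \notin G :|: Y -> M i i = 0) ->
  (forall x : config n, qf (fun i j => J i j) (fun i => spn R i x) / 2 =
     C0 + \sum_c pedge par (kapb b ep) c x + qf M (fun i => spn R i x) / 2) ->
  forall h : 'cV[R]_n,
  (((n%:R * (2^-1 * expR (64 * forest_cov_const b nu ell) * expR 2))^-1)%:E
     <= rho_MLSI (ising J h))%E.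
Proof.
move=> n0 par_depth depth_lt b0 b8 om0 om2 nu0 tau2 ell0 hell hG hY sM pM ka0 ka1 uM dM HJ h.
have kap_tau c : 4 * `|kapb b ep c| <= 4 * b.
  by rewrite ler_pM2l // /kapb normrM sg_norm mulr1 ger0_norm // ltW.
pose h0 i := h i 0.
have K00 : 0 <= 2^-1 * expR (64 * forest_cov_const b nu ell).
  by rewrite mulr_ge0 ?invr_ge0 // ltW // expR_gt0.
pose w0 := fweight par (kapb b ep) [set: 'I_n] h0.
have w00 x : 0 < w0 x by exact: expR_gt0.
have addh h' x : w0 x * expR (\sum_i h' i * spn R i x) =
    fweight par (kapb b ep) [set: 'I_n] (fun i => h0 i + h' i) x.
  rewrite /w0 /fweight -expRD; congr expR; rewrite -addrA; congr (_ + _).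
  rewrite (eq_bigl predT) => [|i]; last by rewrite inE.
  rewrite [RHS](eq_bigl predT) => [|i]; last by rewrite inE.
  by rewrite -big_split; apply: eq_bigr => i _; rewrite mulrDl.
have hvar h' y : var (fun x => w0 x * expR (\sum_i h' i * spn R i x))
    (fun x => \sum_(j in G :|: Y) y j * spn R j x) <= 32 * \sum_(j in G :|: Y) y j ^+ 2.
  rewrite (var_ext _ (addh h')).
  apply: (boundary_var par_depth depth_lt kap_tau _ _ om0 (ltW nu0) tau2 hG hY).
    by rewrite mulr_ge0 // ltW.
  by lra.
have hM h' : MLSI (flp (n:=n)) (fun x => w0 x * expR (\sum_i h' i * spn R i x))
    (2^-1 * expR (64 * forest_cov_const b nu ell)).
  apply: (MLSI_ext (fun x => esym (addh h' x))).
  have := @forest_MLSI R n par depth N par_depth depth_lt b om nu ell ep b0 om0 om2 nu0 tau2 ell0 hell. by apply.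
have kaK : ka * 32 <= 64^-1 by lra.
have m32 : (0 : R) <= 32 by [].
have main := bulk_MLSI w00 sM pM uM dM ka0 m32 K00 kaK hvar hM.
have wE x : ising_weight J h x = expR C0 * (w0 x * expR (qf M (fun i => spn R i x) / 2)).
  rewrite ising_weightE HJ /w0 /fweight -!expRD; congr expR.
  rewrite [\sum_(c in [set: 'I_n]) pedge _ _ _ _](eq_bigl predT) => [|i]; last by rewrite inE.
  rewrite [\sum_(i in [set: 'I_n]) _](eq_bigl predT) => [|i]; last by rewrite inE.
  by rewrite /h0; ring.
have iw0 x : 0 < ising_weight J h x by exact: expR_gt0.
apply: rho_MLSI_ge => //.
  by rewrite mulr_gt0 ?expR_gt0 // mulr_gt0 ?invr_gt0 // expR_gt0.
apply: (MLSI_ext (fun x => esym (wE x))).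
by apply: MLSI_scale; [exact: expR_gt0 | exact: main].
Qed.

End deterministic.

(** * Decomposition of the graph *)

Section graphs.
Variables (n : nat) (E : {set upair n}).
Implicit Types (S A U : {set 'I_n}) (i j x y : 'I_n) (p : upair n).

Definition joins p i j : bool := (val p == (i, j)) || (val p == (j, i)).

Definition adj i j : bool := [exists p in E, joins p i j].

Definition touches S p : bool := ((val p).1 \in S) || ((val p).2 \in S).

Definition within S p : bool := ((val p).1 \in S) && ((val p).2 \in S).

Definition eto S : nat := #|[set p in E | touches S p]|.

Definition ein S : nat := #|[set p in E | within S p]|.

(** Connectedness in cut form, which passes to unions and needs no paths. *)
Definition conn S : bool :=
  (0 < #|S|)%N && [forall A : {set 'I_n}, (A \subset S) ==> (0 < #|A|)%N ==>
     (A != S) ==> [exists x in A, exists y in S :\: A, adj x y]].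

Lemma joinsC p i j : joins p i j = joins p j i.
Proof. by rewrite /joins orbC. Qed.

Lemma adjC i j : adj i j = adj j i.
Proof. by apply: eq_existsb => p; rewrite joinsC. Qed.

Lemma joins_ends p : joins p (val p).1 (val p).2.
Proof. by rewrite /joins -surjective_pairing eqxx. Qed.

Lemma ends_lt p : ((val p).1 < (val p).2)%N.
Proof. exact: (valP p). Qed.

Lemma joins_inj p q i j : joins p i j -> joins q i j -> p = q.
Proof.
move=> hp hq; apply: val_inj; have := ends_lt p; have := ends_lt q.
case/orP: hp => /eqP ->; case/orP: hq => /eqP -> //=; lia.
Qed.

Lemma joins_ends_eq p i j i' j' : joins p i j -> joins p i' j' ->
  (i = i' /\ j = j') \/ (i = j' /\ j = i').
Proof.
case/orP=> /eqP e1; case/orP => /eqP; rewrite e1 => -[-> ->]; by [left | right].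
Qed.

Lemma adj_edge i j : adj i j -> exists2 p, p \in E & joins p i j.
Proof. by case/existsP => p /andP[]; exists p. Qed.

Lemma connP S : reflect ((0 < #|S|)%N /\ forall A, A \subset S -> (0 < #|A|)%N ->
   A != S -> exists x y, [/\ x \in A, y \in S, y \notin A & adj x y]) (conn S).
Proof.
apply: (iffP andP) => -[S0 h]; split=> //.
  move=> A AS A0 nA; have := forallP h A; rewrite AS A0 nA /= => /existsP[x /andP[xA /existsP[y]]].
  by rewrite inE => /andP[/andP[yA yS] xy]; exists x, y; split.
apply/forallP => A; apply/implyP => AS; apply/implyP => A0; apply/implyP => nA.
have [x [y [xA yS yA xy]]] := h A AS A0 nA.
by apply/existsP; exists x; rewrite xA /=; apply/existsP; exists y; rewrite inE yA yS.
Qed.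

Lemma conn_gt0 S : conn S -> (0 < #|S|)%N. Proof. by case/andP. Qed.

Lemma proper_part S A : A \subset S -> A != S -> exists2 y, y \in S & y \notin A.
Proof.
move=> AS nA; have /properP[_ //] : A \proper S by rewrite properEneq nA.
Qed.

(** A cut [A] is crossed at a vertex of least rank: one outside [A] if [A] contains the root, one
    inside [A] otherwise. Its neighbour of smaller rank lies on the other side. *)
Lemma conn_ranked (r : 'I_n) (dep : 'I_n -> nat) S : r \in S ->
  (forall v, v \in S -> v != r -> exists u, [/\ u \in S, adj u v & (dep u < dep v)%N]) ->
  conn S.
Proof.
move=> rS hS; apply/connP; split; first by apply/card_gt0P; exists r.
move=> A AS A0 nA; have [y0 y0S y0A] := proper_part AS nA.
have [rA|rA] := boolP (r \in A).
  pose P v := (v \in S) && (v \notin A).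
  have P0 : P y0 by rewrite /P y0S.
  have [v /andP[vS vA] vmin] := arg_minnP dep P0.
  have vr : v != r by apply: contraNneq vA => ->.
  have [u [uS uv uvd]] := hS v vS vr.
  exists u, v; split=> //; apply/negPn/negP => uA.
  by have := vmin u; rewrite /P uS uA => /(_ isT); rewrite leqNgt uvd.
have /card_gt0P[x0 x0A] := A0.
have [v vA vmin] := arg_minnP dep x0A.
have vr : v != r by apply: contraNneq rA => <-.
have [u [uS uv uvd]] := hS v (fintype.subsetP AS v vA) vr.
exists v, u; split=> //; last by rewrite adjC.
by apply/negP => uA; have := vmin u uA; rewrite leqNgt uvd.
Qed.

Lemma conn_bigcup (I : finType) (J : {set I}) (P : {set 'I_n}) (F : I -> {set 'I_n}) :
  conn P -> (forall i : I, i \in J -> conn (F i)) ->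
  (forall i : I, i \in J -> exists2 x, x \in P & x \in F i) ->
  conn (P :|: \bigcup_(i in J) F i).
Proof.
move=> cP cF hF; set U := P :|: _.
have PU x : x \in P -> x \in U by rewrite inE => ->.
have FU (i : I) x : i \in J -> x \in F i -> x \in U.
  by move=> iJ xF; rewrite inE; apply/orP; right; apply/bigcupP; exists i.
apply/connP; split.
  have /card_gt0P[x xP] := conn_gt0 cP; by apply/card_gt0P; exists x; exact: PU.
move=> A AU A0 nA; have [y0 y0U y0A] := proper_part AU nA.
have cut T : conn T -> (forall x, x \in T -> x \in U) ->
    (exists2 x, x \in T & x \in A) -> (exists2 y, y \in T & y \notin A) ->
    exists x y, [/\ x \in A, y \in U, y \notin A & adj x y].
  move=> /connP[_ hT] TU [x xT xA] [y yT yA].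
  have [|||u [v [uAT vT vAT uv]]] := hT (A :&: T).
  - exact: subsetIr.
  - by apply/card_gt0P; exists x; rewrite inE xA.
  - apply: contraNneq yA => e; have : y \in A :&: T by rewrite e.
    by rewrite inE => /andP[].
  move: uAT vAT; rewrite !inE vT andbT => /andP[uA _] vA.
  by exists u, v; split=> //; exact: TU.
case: (boolP [exists x in P, x \in A]) => [/existsP[x /andP[xP xA]]|noP].
  case: (boolP [exists y in P, y \notin A]) => [/existsP[y /andP[yP yA]]|allP].
    by apply: (cut P cP PU); [exists x | exists y].
  have PA z : z \in P -> z \in A.
    by move=> zP; move/existsPn: allP => /(_ z); rewrite zP /= negbK.
  move: y0U; rewrite inE => /orP[/PA|/bigcupP[i iJ yF]]; first by rewrite (negbTE y0A).
  have [z zP zF] := hF i iJ.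
  apply: (cut (F i) (cF i iJ)); first by move=> w; exact: FU.
    by exists z => //; exact: PA.
  by exists y0.
have PA z : z \in P -> z \notin A.
  by move=> zP; move/existsPn: noP => /(_ z); rewrite zP.
have /card_gt0P[x xA] := A0.
have := fintype.subsetP AU x xA; rewrite inE => /orP[/PA|/bigcupP[i iJ xF]].
  by rewrite xA.
have [z zP zF] := hF i iJ.
apply: (cut (F i) (cF i iJ)); first by move=> w; exact: FU.
  by exists x.
by exists z => //; exact: PA.
Qed.

End graphs.

Lemma card_bigcup_le (I T : finType) (J : {set I}) (F : I -> {set T}) :
  (#|\bigcup_(i in J) F i| <= \sum_(i in J) #|F i|)%N.
Proof.
elim/big_rec2: _ => [|i m A _ h]; first by rewrite cards0.
by apply: (leq_trans (leq_card_setU _ _)); rewrite leq_add2l.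
Qed.

(** * A Vitali covering on the line *)

Section vitali.
Variables (T : finType) (dep s : T -> nat).

(* Greedy selection of the largest radius. *)
Lemma vitali_selection (I : {set T}) : exists J : {set T},
  [/\ J \subset I,
     (forall i k, i \in J -> k \in J -> i != k ->
        (s i + s k <= (dep i - dep k) + (dep k - dep i))%N) &
     (forall k, k \in I -> exists2 i, i \in J & ((dep i - dep k) + (dep k - dep i) <= 2 * s i)%N)].
Proof.
have [m hm] := ubnP #|I|; elim: m I hm => // m IH I; rewrite ltnS => hm.
case: (posnP #|I|) => [/eqP|/card_gt0P[i0 i0I]].
  rewrite cards_eq0 => /eqP ->; exists finset.set0; split=> [||k]; rewrite ?inE //.
  by move=> i k; rewrite inE.
have [i iI imax] := arg_maxnP s i0I.
pose I' := [set k in I | (s i + s k <= (dep i - dep k) + (dep k - dep i))%N && (k != i)].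
have I'I : I' \subset I by apply/fintype.subsetP => k; rewrite inE => /andP[].
have I'lt : (#|I'| < m)%N.
  apply: leq_trans hm; apply: proper_card; apply/properP; split=> //.
  by exists i; rewrite ?inE ?eqxx ?andbF.
have [J [JI' Jsep Jcov]] := IH I' I'lt.
exists (i |: J); split.
- apply/fintype.subsetP => k; rewrite !inE => /orP[/eqP -> //|kJ].
  by apply: (fintype.subsetP I'I); apply: (fintype.subsetP JI').
- move=> a k; rewrite !inE => /orP[/eqP->|aJ] /orP[/eqP->|kJ].
  + by rewrite eqxx.
  + by move=> _; have := fintype.subsetP JI' k kJ; rewrite inE => /and3P[_ h _].
  + move=> _; have := fintype.subsetP JI' a aJ; rewrite inE => /and3P[_ h _].
    by rewrite addnC [X in (_ <= X)%N]addnC.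
  + exact: Jsep.
- move=> k kI; have [kI'|kI'] := boolP (k \in I').
    have [a aJ h] := Jcov k kI'; by exists a => //; rewrite inE aJ orbT.
  exists i; first by rewrite !inE eqxx.
  have hs := imax k kI.
  move: kI'; rewrite inE kI /= negb_and negbK => /orP[h|/eqP->]; last by rewrite subnn.
  by rewrite -ltnNge in h; lia.
Qed.

(** The two truncated differences add up to the distance of the positions. Positions in [I] are
    distinct, so a window of radius 2 * s i contains at most 4 * s i + 1 of them. *)
Lemma vitali_card (I J : {set T}) : {in I &, injective dep} ->
  (forall k, k \in I -> exists2 i, i \in J & ((dep i - dep k) + (dep k - dep i) <= 2 * s i)%N) ->
  (#|I| <= \sum_(i in J) (4 * s i).+1)%N.
Proof.
move=> inj cov.
pose near i := [set k in I | ((dep i - dep k) + (dep k - dep i) <= 2 * s i)%N].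
have I_sub : I \subset \bigcup_(i in J) near i.
  apply/fintype.subsetP => k kI; have [i iJ h] := cov k kI.
  by apply/bigcupP; exists i => //; rewrite inE kI.
apply: (leq_trans (subset_leq_card I_sub)).
apply: (leq_trans (card_bigcup_le _ _)).
apply: leq_sum => i _.
pose f k := (dep k + 2 * s i - dep i)%N.
have finj : {in near i &, injective f}.
  move=> a b; rewrite !inE => /andP[aI ha] /andP[bI hb] fab.
  by apply: inj => //; move: fab; rewrite /f; lia.
have fb k : k \in near i -> (f k < (4 * s i).+1)%N.
  by rewrite inE /f => /andP[_]; lia.
have -> : #|near i| = size (map f (enum (near i))) by rewrite size_map -cardE.
rewrite -(size_iota 0 (4 * s i).+1); apply: uniq_leq_size.
  rewrite map_inj_in_uniq ?enum_uniq // => a b; rewrite !mem_enum; exact: finj.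
by move=> z /mapP[k]; rewrite mem_enum => /fb h ->; rewrite mem_iota.
Qed.

End vitali.

Lemma sum_card_disjoint (I T : finType) (J : {set I}) (F : I -> {set T}) (U : {set T}) :
  (forall i, i \in J -> F i \subset U) ->
  (forall i k p, i \in J -> k \in J -> p \in F i -> p \in F k -> i = k) ->
  (\sum_(i in J) #|F i| <= #|U|)%N.
Proof.
move=> FU dis.
have -> : (\sum_(i in J) #|F i| = \sum_(i in J) \sum_(p in U) (p \in F i))%N.
  apply: eq_bigr => i iJ; rewrite -sum1_card big_mkcond [RHS]big_mkcond /=.
  apply: eq_bigr => p _; case: ifPn => [pF|_]; last by case: ifP.
  by rewrite (fintype.subsetP (FU i iJ) p pF).
rewrite exchange_big -sum1_card; apply: leq_sum => p pU /=.
case: (boolP [exists i in J, p \in F i]) => [/existsP[i /andP[iJ pF]]|/existsPn h].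
  rewrite (bigD1 i) //= pF big1 // => k /andP[kJ ki].
  by apply/eqP; rewrite eqb0; apply: contra ki => pk; rewrite (dis i k p).
rewrite big1 // => i iJ; have := h i; rewrite iJ /=.
by move/negbTE => ->.
Qed.

Lemma depth_gap (a c x y s t : nat) : (s + t <= (a - c) + (c - a))%N ->
  (a < x + s)%N -> (x < a + s)%N -> (c < y + t)%N -> (y < c + t)%N ->
  (x <= y.+1)%N -> (y <= x.+1)%N -> False.
Proof. by case: (leqP a c) => h; lia. Qed.

(** * The forest of edges at bad vertices *)

Section bad_forest.
Variables (R : realType) (n : nat) (E : {set upair n}) (Q : R).
Notation adj := (adj E).
Notation eto := (eto E).
Notation conn := (conn E).
Implicit Types (S A U : {set 'I_n}) (i j x y u v : 'I_n) (p : upair n).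

(** All edges touching [S] are counted, not only those inside, so a single vertex of large degree is
    already a bad set. *)
Definition badset S : bool := conn S && (Q * #|S|%:R <= (eto S)%:R).

Definition badv x : bool := [exists S : {set 'I_n}, (x \in S) && badset S].

Definition fadj x y : bool := adj x y && (badv x || badv y).

Lemma fadjC : symmetric fadj.
Proof. by move=> x y; rewrite /fadj adjC orbC. Qed.

Lemma fadj_sym : connect_sym fadj.
Proof. exact: sym_connect_sym fadjC. Qed.

Fixpoint reach (k : nat) x y : bool :=
  if k is k'.+1 then [exists z, reach k' x z && fadj z y] else x == y.

Lemma reach_cons k x z y : fadj x z -> reach k z y -> reach k.+1 x y.
Proof.
elim: k z y => [|k IH] z y xz /=.
  by move=> /eqP <-; apply/existsP; exists x; rewrite eqxx.
move=> /existsP[t /andP[zt ty]]; apply/existsP; exists t; rewrite ty andbT.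
exact: IH zt.
Qed.

Lemma connect_reach x y : connect fadj x y -> exists k, reach k x y.
Proof.
case/connectP => s; elim: s x => [|z s IH] x /=.
  by move=> _ ->; exists 0%N => /=.
move=> /andP[xz zs] ys; have [k hk] := IH z zs ys.
by exists k.+1; apply: reach_cons hk.
Qed.

(* A breadth-first spanning forest of the edges that touch a bad vertex. *)
Definition rt v : 'I_n := fingraph.root fadj v.

Lemma rt_reach v : exists k, reach k (rt v) v.
Proof. by apply: connect_reach; rewrite fadj_sym; exact: connect_root. Qed.

Definition depth v : nat := ex_minn (rt_reach v).

Lemma depth_reach v : reach (depth v) (rt v) v.
Proof. by rewrite /depth; case: ex_minnP. Qed.

Lemma depth_min v k : reach k (rt v) v -> (depth v <= k)%N.
Proof. by rewrite /depth; case: ex_minnP => m _; apply. Qed.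

Lemma fadj_rt x y : fadj x y -> rt x = rt y.
Proof. by move=> xy; apply/eqP; rewrite (root_connect fadj_sym); exact: connect1. Qed.

Lemma fadj_depth x y : fadj x y -> (depth y <= (depth x).+1)%N.
Proof.
move=> xy; apply: depth_min; rewrite -(fadj_rt xy) /=.
by apply/existsP; exists x; rewrite depth_reach.
Qed.

Lemma depth0 v : depth v = 0%N -> rt v = v.
Proof. by move=> h; have := depth_reach v; rewrite h /= => /eqP. Qed.

Lemma depthS v k : depth v = k.+1 -> exists2 u, fadj u v & depth u = k.
Proof.
move=> h; have := depth_reach v; rewrite h /= => /existsP[u /andP[ru uv]].
exists u => //; have e := fadj_rt uv.
have h1 : (depth u <= k)%N by apply: depth_min; rewrite e.
have h2 := fadj_depth uv; lia.
Qed.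

Definition fpar v : option 'I_n :=
  if depth v == 0%N then None else [pick u | fadj u v && ((depth u).+1 == depth v)].

Lemma fpar_some v u : fpar v = Some u -> fadj u v /\ depth v = (depth u).+1.
Proof.
rewrite /fpar; case: ifP => // _; case: pickP => // w /andP[h /eqP e] [<-].
by split.
Qed.

Lemma fpar_none v : fpar v = None -> depth v = 0%N.
Proof.
rewrite /fpar; case: eqP => // /eqP; rewrite -lt0n; case D: (depth v) => [|k] // _.
have [u uv du] := depthS D; case: pickP => // /(_ u).
by rewrite uv du eqxx.
Qed.

Lemma fpar_depth c q : fpar c = Some q -> (depth q < depth c)%N.
Proof. by move=> /fpar_some[_ ->]. Qed.

Lemma fpar_rt v u : fpar v = Some u -> rt u = rt v.
Proof. by move=> /fpar_some[/fadj_rt]. Qed.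

Lemma anc_fdepth k v u : anc fpar k v = Some u -> depth v = (depth u + k)%N /\ rt u = rt v.
Proof.
elim: k v => [|k IH] v; first by move=> [<-]; rewrite addn0.
case D: (fpar v) => [q|]; last by rewrite anc_None.
rewrite (anc_par _ D) => /IH[e1 e2]; have [_ e3] := fpar_some D.
by rewrite e2 (fpar_rt D) e3 e1 addnS.
Qed.

Lemma anc_exists k v : (k <= depth v)%N -> exists u, anc fpar k v = Some u.
Proof.
elim: k v => [|k IH] v; first by exists v.
case D: (fpar v) => [q|]; last by rewrite (fpar_none D).
have [_ e] := fpar_some D; rewrite e ltnS (anc_par _ D); exact: IH.
Qed.

Definition ancs v : {set 'I_n} := [set u | [exists k : 'I_(depth v).+1, anc fpar k v == Some u]].

Lemma ancsP v u : reflect (exists k, anc fpar k v = Some u) (u \in ancs v).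
Proof.
rewrite inE; apply: (iffP existsP) => [[k /eqP e]|[k e]]; first by exists k.
have [h _] := anc_fdepth e.
have kl : (k < (depth v).+1)%N by rewrite h; lia.
by exists (Ordinal kl); apply/eqP.
Qed.

Lemma ancs_refl v : v \in ancs v. Proof. by apply/ancsP; exists 0%N. Qed.

Lemma ancs_par v u w : u \in ancs v -> fpar u = Some w -> w \in ancs v.
Proof.
move=> /ancsP[k e] uw; apply/ancsP; exists k.+1.
by rewrite ancS e /= uw.
Qed.

Lemma ancs_rt v : rt v \in ancs v.
Proof.
have [u hu] := anc_exists (leqnn (depth v)).
have [e1 e2] := anc_fdepth hu.
have du : depth u = 0%N by lia.
by apply/ancsP; exists (depth v); rewrite hu -e2 (depth0 du).
Qed.

Lemma ancs_depth_inj v : {in ancs v &, injective depth}.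
Proof.
move=> a b /ancsP[k ea] /ancsP[k' eb] dab.
have [h1 _] := anc_fdepth ea; have [h2 _] := anc_fdepth eb.
have kk : k = k' by lia.
by move: ea; rewrite kk eb => -[].
Qed.

Lemma card_ancs v : #|ancs v| = (depth v).+1.
Proof.
pose f (k : 'I_(depth v).+1) := odflt v (anc fpar k v).
have fE (k : 'I_(depth v).+1) : anc fpar k v = Some (f k).
  have kl : (k <= depth v)%N by have := ltn_ord k.
  by rewrite /f; have [u ->] := anc_exists kl.
have -> : ancs v = [set f k | k in 'I_(depth v).+1].
  apply/setP => u; rewrite inE; apply/existsP/imsetP.
    by move=> [k /eqP e]; exists k => //; move: e; rewrite fE => -[].
  by move=> [k _ ->]; exists k; rewrite fE.
rewrite card_imset ?card_ord // => a b fab; apply: val_inj => /=.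
have [h1 _] := anc_fdepth (fE a); have [h2 _] := anc_fdepth (fE b).
by move: h1 h2; rewrite fab; lia.
Qed.

Lemma conn_ancs v : conn (ancs v).
Proof.
apply: (conn_ranked (r := rt v) (dep := depth)); first exact: ancs_rt.
move=> u uA ur; case D: (fpar u) => [w|].
  exists w; split; [exact: ancs_par D | by have [/andP[]] := fpar_some D | exact: fpar_depth].
have /ancsP[k e] := uA; have [_ e2] := anc_fdepth e.
by rewrite -e2 (depth0 (fpar_none D)) eqxx in ur.
Qed.

Lemma bad_in S x : badset S -> x \in S -> badv x.
Proof. by move=> bS xS; apply/existsP; exists S; rewrite xS. Qed.

(** All vertices of a bad set are bad, so its inner edges belong to [fadj] and change the depth by
    at most one. By connectedness the set occupies every depth between two of its values. *)
Lemma badset_depth S x y : badset S -> x \in S -> y \in S -> (depth y < depth x + #|S|)%N.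
Proof.
move=> bS xS yS; have /andP[cS _] := bS.
have [//|lxy] := ltnP (depth y) (depth x + #|S|).
have /connP[_ hS] := cS.
have lev t : (depth x <= t <= depth y)%N -> exists2 z, z \in S & depth z = t.
  move=> /andP[xt ty].
  have [e|nt] := eqVneq t (depth y); first by exists y.
  have tlt : (t < depth y)%N by rewrite ltn_neqAle nt.
  elim: t {nt ty} xt tlt => [|t IH] xt tlt.
    by exists x => //; lia.
  have [e|nt] := eqVneq (depth x) t.+1; first by exists x.
  pose A := [set z in S | (depth z <= t)%N].
  have xA : x \in A by rewrite inE xS; lia.
  have [|||a [c [aA cS' cA ac]]] := hS A.
  - by apply/fintype.subsetP => z; rewrite inE => /andP[].
  - by apply/card_gt0P; exists x.
  - apply/eqP => AS; have : y \in A by rewrite AS.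
    by rewrite inE yS; lia.
  have fac : fadj a c by rewrite /fadj ac (bad_in bS cS') orbT.
  have := fadj_depth fac; move: aA cA; rewrite !inE cS' /= => /andP[aS da]; rewrite -ltnNge => dc h.
  by exists c => //; lia.
have : (size (iota (depth x) (depth y - depth x).+1) <= size (map depth (enum S)))%N.
  apply: uniq_leq_size; first exact: iota_uniq.
  move=> t; rewrite mem_iota => ht.
  have [z zS zt] : exists2 z, z \in S & depth z = t by apply: lev; lia.
  by apply/mapP; exists z; rewrite ?mem_enum.
have eS : size (enum S) = #|S| by rewrite cardE.
by rewrite size_iota size_map eS; lia.
Qed.

Definition bset v : {set 'I_n} := odflt finset.set0 [pick S : {set 'I_n} | (v \in S) && badset S].

Lemma bsetP v : badv v -> v \in bset v /\ badset (bset v).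
Proof.
move=> /existsP[S hS]; rewrite /bset; case: pickP => [T /andP[]//|/(_ S)].
by rewrite hS.
Qed.

(* A long path of the forest is half covered by bad sets; a Vitali subfamily of these is
   edge-disjoint, and its union with the path contradicts the density bound. *)
Lemma depth_le (C1 lam : R) v : 0 <= Q -> (0 < depth v)%N ->
  (forall S, conn S -> (eto S)%:R <= C1 * #|S|%:R + lam) ->
  0 <= Q / 12 - C1 -> (Q / 12 - C1) * (depth v)%:R <= lam.
Proof.
move=> Q0 dv star hQ.
pose P := ancs v; pose I := [set u in P | badv u].
pose s u := #|bset u|.
have bI u : u \in I -> badv u by rewrite inE => /andP[].
have IP u : u \in I -> u \in P by rewrite inE => /andP[].
(* A good vertex of the path other than the root has a bad parent, because every forest edge touches
   a bad vertex; so good vertices outnumber bad ones by at most one. *)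
have hI : (depth v <= 2 * #|I|)%N.
  have h1 : (#|P :\: I| <= #|I|.+1)%N.
    pose g u := odflt u (fpar u).
    have : (#|(P :\: I) :\ rt v| <= #|I|)%N.
      have gE u : u \in (P :\: I) :\ rt v -> fpar u = Some (g u).
        rewrite in_setD1 in_setD => /and3P[ur _ uP]; rewrite /g; case D: (fpar u) => [w|] //.
        have /ancsP[k e] := uP; have [_ e2] := anc_fdepth e.
        by rewrite -e2 (depth0 (fpar_none D)) eqxx in ur.
      rewrite -(card_in_imset (f := g)).
        apply: subset_leq_card; apply/fintype.subsetP => w /imsetP[u uD ->].
        have D := gE u uD; move: (uD); rewrite !inE => /and3P[_ nb uP].
        have gP : g u \in ancs v by apply: ancs_par D; rewrite inE.
        rewrite inE in gP; rewrite gP /=.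
        have [/andP[_ /orP[//|bu]] _] := fpar_some D.
        by rewrite uP bu in nb.
      move=> a c aD cD gac; have e1 := gE a aD; have e2 := gE c cD.
      apply: (@ancs_depth_inj v).
      - by move: aD; rewrite !in_setD => /and3P[].
      - by move: cD; rewrite !in_setD => /and3P[].
      have [_ ->] := fpar_some e1; have [_ ->] := fpar_some e2.
      by rewrite gac.
    by move=> h; rewrite (cardsD1 (rt v)); exact: (leq_add (leq_b1 _) h).
  have := cardsID I P; rewrite card_ancs.
  have : (#|P :&: I| <= #|I|)%N by apply: subset_leq_card; exact: subsetIr.
  lia.
have [J [JI Jsep Jcov]] := vitali_selection depth s I.
have depI : {in I &, injective depth}.
  by move=> a c aI cI; apply: (@ancs_depth_inj v); [exact: IP aI | exact: IP cI].
have cI := vitali_card depI Jcov.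
have JIm u : u \in J -> u \in I by exact: fintype.subsetP JI u.
have bJ u : u \in J -> u \in bset u /\ badset (bset u).
  by move=> /JIm /bI /bsetP.
pose U := P :|: \bigcup_(i in J) bset i.
have cU : conn U.
  apply: conn_bigcup; first exact: conn_ancs.
    by move=> i /bJ[_ /andP[]].
  by move=> i iJ; exists i; [exact: IP (JIm _ iJ) | have [] := bJ i iJ].
pose Ss := (\sum_(i in J) s i)%N.
have s1 i : i \in J -> (0 < s i)%N.
  by move=> /bJ[h _]; apply/card_gt0P; exists i.
have h5 : (\sum_(i in J) (4 * s i).+1 <= 5 * Ss)%N.
  rewrite /Ss big_distrr /=; apply: leq_sum => i /s1; lia.
(* The path has depth v + 1 vertices with depth v <= 10 Ss, and the bad sets add at most Ss; as
   depth v > 0 forces Ss > 0, the spare one fits into 12 Ss. *)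
have cardU : (#|U| <= 12 * Ss)%N.
  apply: (leq_trans (leq_card_setU _ _)); rewrite card_ancs.
  have := card_bigcup_le J bset; rewrite -/Ss.
  have h10 : (depth v <= 10 * Ss)%N.
    apply: (leq_trans hI); rewrite (_ : 10 * Ss = 2 * (5 * Ss))%N; last by rewrite mulnA.
    by rewrite leq_mul2l /=; exact: leq_trans cI h5.
  set B := #|_|; move: B => B; lia.
(* An edge touching two selected bad sets would bring their centres closer than the sum of the two
   sizes: each set stays within its size of its centre, and the edge changes the depth by at most
   one. *)
have etoU : (\sum_(i in J) eto (bset i) <= eto U)%N.
  apply: sum_card_disjoint.
    move=> i iJ; apply/fintype.subsetP => p; rewrite !inE => /andP[-> /=].
    have sub x : x \in bset i -> x \in U.
      by move=> h; rewrite inE; apply/orP; right; apply/bigcupP; exists i.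
    rewrite /touches => /orP[/sub|/sub] ->; by rewrite ?orbT.
  move=> i k p iJ kJ; rewrite !inE => /andP[pE ti] /andP[_ tk].
  apply/eqP/negPn/negP => ik.
  have [bi bsi] := bJ i iJ; have [bk bsk] := bJ k kJ.
  have sep := Jsep i k iJ kJ ik.
  have [x [y [xi yk dxy]]] : exists x y, [/\ x \in bset i, y \in bset k &
      (depth x <= (depth y).+1)%N /\ (depth y <= (depth x).+1)%N].
    have a12 : adj (val p).1 (val p).2.
      by apply/existsP; exists p; rewrite pE joins_ends.
    have f12 : fadj (val p).1 (val p).2.
      rewrite /fadj a12 /=; case/orP: ti => /(bad_in bsi) ->; by rewrite ?orbT.
    have f21 : fadj (val p).2 (val p).1 by rewrite fadjC.
    have d1 := fadj_depth f12; have d2 := fadj_depth f21.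
    case/orP: ti => h1; case/orP: tk => h2.
    - by exists (val p).1, (val p).1.
    - by exists (val p).1, (val p).2.
    - by exists (val p).2, (val p).1.
    - by exists (val p).2, (val p).2.
  have g1 := badset_depth bsi bi xi; have g2 := badset_depth bsi xi bi.
  have g3 := badset_depth bsk bk yk; have g4 := badset_depth bsk yk bk.
  by have [dx dy] := dxy; exact: (@depth_gap (depth i) (depth k) (depth x) (depth y) (s i) (s k)).
have hQS : Q * Ss%:R <= (eto U)%:R.
  apply: (@le_trans _ _ (\sum_(i in J) (eto (bset i))%:R)).
    rewrite /Ss natr_sum mulr_sumr; apply: ler_sum => i /bJ[_ /andP[_]].
    by [].
  by rewrite -natr_sum ler_nat.
have h6 := star U cU.
have h7 : Q / 12 * #|U|%:R <= Q * Ss%:R.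
  rewrite -mulrA ler_wpM2l // ler_pdivrMl // -natrM ler_nat //.
have h8 : (depth v)%:R <= #|U|%:R :> R.
  rewrite ler_nat; apply: (@leq_trans #|P|); first by rewrite card_ancs.
  by apply: subset_leq_card; exact: subsetUl.
apply: (@le_trans _ _ ((Q / 12 - C1) * #|U|%:R)); first by rewrite ler_wpM2l.
by rewrite mulrBl; lra.
Qed.

End bad_forest.

(** * Tree edges, extra edges and bulk edges *)

Section forest_edges.
Variables (R : realType) (n : nat) (E : {set upair n}) (Q : R).
Notation adj := (adj E).
Notation eto := (eto E).
Notation ein := (ein E).
Notation conn := (conn E).
Notation badv := (badv E Q).
Notation fpar := (fpar E Q).
Notation depth := (depth E Q).
Notation rt := (rt E Q).
Notation ancs := (ancs E Q).
Notation fadj := (fadj E Q).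
Implicit Types (S A U : {set 'I_n}) (i j x y u v : 'I_n) (p q : upair n).

Definition badtouch p : bool := badv (val p).1 || badv (val p).2.

Definition tedge x : option (upair n) :=
  [pick p in E | if fpar x is Some u then joins p x u else false].

Definition treeE : {set upair n} := [set p in E | [exists x, tedge x == Some p]].

Definition extraE : {set upair n} := [set p in E | badtouch p && (p \notin treeE)].

Definition bulkE : {set upair n} := [set p in E | ~~ badtouch p].

Lemma tedge_some x u : fpar x = Some u ->
  exists p, [/\ tedge x = Some p, p \in E & joins p x u].
Proof.
move=> D; rewrite /tedge D; case: pickP => [p /andP[pE pj]|h]; first by exists p.
have [/andP[/adj_edge[p pE pj] _] _] := fpar_some D.
by have := h p; rewrite pE joinsC pj.
Qed.

Lemma tedge_none x : fpar x = None -> tedge x = None.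
Proof. by rewrite /tedge => ->; case: pickP => // p; rewrite andbF. Qed.

Lemma tedge_par x p : tedge x = Some p -> exists u, fpar x = Some u /\ joins p x u.
Proof.
case D: (fpar x) => [u|]; last by rewrite tedge_none.
by have [p' [-> _ pj]] := tedge_some D => -[<-]; exists u.
Qed.

Lemma tedge_inj x y p : tedge x = Some p -> tedge y = Some p -> x = y.
Proof.
move=> /tedge_par[u [xu ju]] /tedge_par[v [yv jv]].
have [[//]|[e1 e2]] := joins_ends_eq ju jv.
have := fpar_depth xu; have := fpar_depth yv; rewrite e1 e2; lia.
Qed.

Lemma tedge_tree x p : tedge x = Some p -> p \in treeE.
Proof.
move=> h; rewrite inE; apply/andP; split; last by apply/existsP; exists x; rewrite h.
have [u [xu _]] := tedge_par h; have [p' [e pE _]] := tedge_some xu.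
by move: e; rewrite h => -[->].
Qed.

Lemma joins_badtouch p x u : joins p x u -> badv x || badv u -> badtouch p.
Proof. by rewrite /badtouch; case/orP => /eqP -> //=; rewrite orbC. Qed.

Lemma tree_badtouch p : p \in treeE -> badtouch p.
Proof.
rewrite inE => /andP[_ /existsP[x /eqP /tedge_par[u [/fpar_some[/andP[_ b] _] ju]]]].
by apply: (joins_badtouch ju); rewrite orbC.
Qed.

Lemma sum_edges_split (F : upair n -> R) :
  \sum_(p in E) F p = \sum_(p in treeE) F p + \sum_(p in extraE) F p + \sum_(p in bulkE) F p.
Proof.
rewrite !(big_mkcond (fun p => p \in _)) -!big_split; apply: eq_bigr => p _ /=.
have := @tree_badtouch p; rewrite /extraE /bulkE !inE.
case: (p \in E) => /=; last by rewrite !addr0.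
case: [exists x, _] => /=; first by move=> /(_ isT) ->; rewrite /= !addr0.
by move=> _; case: (badtouch p) => /=; rewrite ?addr0 ?add0r.
Qed.

Lemma sum_treeE (F : upair n -> R) :
  \sum_(p in treeE) F p = \sum_x (if tedge x is Some p then F p else 0).
Proof.
transitivity (\sum_x \sum_p (tedge x == Some p)%:R * F p).
  rewrite exchange_big big_mkcond; apply: eq_bigr => p _ /=.
  case: ifPn => pT.
    have := pT; rewrite inE => /andP[_ /existsP[x xp]].
    rewrite (bigD1 x) //= xp mul1r big1 ?addr0 // => y yx.
    case: eqP => [yp|_]; last by rewrite mul0r.
    by rewrite (tedge_inj yp (eqP xp)) eqxx in yx.
  rewrite big1 // => x _; case: eqP => [/tedge_tree|_]; last by rewrite mul0r.
  by rewrite (negbTE pT).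
apply: eq_bigr => x _; case: (tedge x) => [p|]; last by rewrite big1 // => p _; rewrite mul0r.
rewrite (bigD1 p) //= eqxx mul1r big1 ?addr0 // => q qp.
by case: eqP => [[e]|_]; [rewrite e eqxx in qp | rewrite mul0r].
Qed.

Lemma extra_fadj p : p \in extraE -> fadj (val p).1 (val p).2.
Proof.
rewrite inE => /and3P[pE b _]; rewrite /fadj -/(badtouch p) b andbT.
by apply/existsP; exists p; rewrite pE joins_ends.
Qed.

Lemma extra_rt p : p \in extraE -> rt (val p).1 = rt (val p).2.
Proof. by move=> /extra_fadj /fadj_rt. Qed.

(* Two extra edges in one tree would close two independent cycles inside a union of four
   root paths. *)
Lemma extra_unique r p q :
  (forall S, conn S -> (#|S| <= r)%N -> (ein S <= #|S|)%N) ->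
  (forall v, (4 * (depth v).+1 <= r)%N) ->
  p \in extraE -> q \in extraE -> rt (val p).1 = rt (val q).1 -> p = q.
Proof.
move=> diamond dr pX qX e; apply/eqP/negPn/negP => pq.
pose a1 := (val p).1; pose a2 := (val p).2; pose a3 := (val q).1; pose a4 := (val q).2.
pose rho := rt a1.
have r2 : rt a2 = rho by rewrite /rho /a1 (extra_rt pX).
have r3 : rt a3 = rho by rewrite /rho /a1 e.
have r4 : rt a4 = rho by rewrite -r3 /a3 (extra_rt qX).
pose T := (ancs a1 :|: ancs a2) :|: (ancs a3 :|: ancs a4).
have TE v : (v \in T) = [|| v \in ancs a1, v \in ancs a2, v \in ancs a3 | v \in ancs a4].
  by rewrite in_setU !(in_setU v) -!orbA.
have ancr a v : rt a = rho -> v \in ancs a -> rt v = rho.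
  by move=> <- /ancsP[k /anc_fdepth[_]].
have Tr v : v \in T -> rt v = rho.
  by rewrite TE => /or4P[]; apply: ancr.
have Tp v u : v \in T -> fpar v = Some u -> u \in T.
  rewrite !TE => /or4P[] h D; have -> := ancs_par h D; by rewrite ?orbT.
have Tnp v : v \in T -> v != rho -> exists u, fpar v = Some u.
  move=> vT vr; case D: (fpar v) => [u|]; first by exists u.
  by rewrite -(Tr v vT) (depth0 (fpar_none D)) eqxx in vr.
have rhoT : rho \in T by rewrite TE ancs_rt.
have cT : conn T.
  apply: (conn_ranked (r := rho) (dep := depth)) => // v vT vr.
  have [u D] := Tnp v vT vr.
  exists u; split; [exact: Tp D | by have [/andP[]] := fpar_some D | exact: fpar_depth].
have cardT : (#|T| <= r)%N.
  have c1 := leq_card_setU (ancs a1 :|: ancs a2) (ancs a3 :|: ancs a4).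
  have c2 := leq_card_setU (ancs a1) (ancs a2); have c3 := leq_card_setU (ancs a3) (ancs a4).
  apply: leq_trans c1 _; apply: leq_trans (leq_add c2 c3) _; rewrite !card_ancs.
  have := dr a1; have := dr a2; have := dr a3; have := dr a4; lia.
have := diamond T cT cardT; apply/negP; rewrite -ltnNge.
pose W := [set s in E | within T s].
have aT1 : a1 \in T by rewrite TE ancs_refl.
have aT2 : a2 \in T by rewrite TE ancs_refl !orbT.
have aT3 : a3 \in T by rewrite TE ancs_refl !orbT.
have aT4 : a4 \in T by rewrite TE ancs_refl !orbT.
have pW : p \in W.
  by move: pX; rewrite !inE => /and3P[-> _ _]; rewrite /within aT1 aT2.
have qW : q \in W.
  by move: qX; rewrite !inE => /and3P[-> _ _]; rewrite /within aT3 aT4.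
(* The |T| - 1 parent edges inside [T]. With p and q they make |T| + 1 inner edges, one more than
   [diamond] allows. *)
pose Z := [set tedge v | v in T :\ rho].
have cZ : #|T| = #|Z|.+1.
  rewrite (cardsD1 rho) rhoT add1n; congr _.+1; rewrite card_in_imset // => v w.
  rewrite !in_setD1 => /andP[vr vT] /andP[wr wT].
  have [u D] := Tnp v vT vr; have [s [vs _ _]] := tedge_some D.
  by rewrite vs => /esym ws; exact: tedge_inj vs ws.
have notZ s : s \in extraE -> Some s \notin Z.
  rewrite inE => /and3P[_ _ sT]; apply/imsetP => -[v _ /esym /tedge_tree h].
  by rewrite h in sT.
have sub : Some p |: (Some q |: Z) \subset [set Some s | s in W].
  apply/fintype.subsetP => o; rewrite in_setU1 => /orP[/eqP->|].
    by apply/imsetP; exists p.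
  rewrite in_setU1 => /orP[/eqP->|/imsetP[v]]; first by apply/imsetP; exists q.
  rewrite in_setD1 => /andP[vr vT] ->.
  have [u D] := Tnp v vT vr; have [s [vs sE js]] := tedge_some D.
  apply/imsetP; exists s => //; rewrite inE sE /within /=.
  by case/orP: js => /eqP -> /=; rewrite vT (Tp v u).
have := subset_leq_card sub; rewrite card_imset; last by move=> s t [].
rewrite !cardsU1 (notZ q qX) in_setU1 (negbTE (notZ p pX)) orbF.
have -> : (Some p == Some q) = false by apply/negbTE; apply: contra pq => /eqP[->].
by rewrite cZ.
Qed.

Definition extraV : {set 'I_n} := [set x | [exists p in extraE, (x == (val p).1) || (x == (val p).2)]].

(** The descendants of [v] lie in one tree, and that tree has at most one extra edge. *)
Lemma extraV_card N r v :
  (forall S, conn S -> (#|S| <= r)%N -> (ein S <= #|S|)%N) ->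
  (forall v, (4 * (depth v).+1 <= r)%N) ->
  (#|[set j in extraV | [exists k : 'I_N, anc fpar k j == Some v]]| <= 2)%N.
Proof.
move=> diamond dr; set Z := [set j in extraV | _].
have ZE j : j \in Z -> rt j = rt v /\ exists2 p, p \in extraE & (j == (val p).1) || (j == (val p).2).
  rewrite inE => /andP[jV /existsP[k /eqP /anc_fdepth[_ <-]]]; split=> //.
  by move: jV; rewrite inE => /existsP[p /andP[]]; exists p.
case: (posnP #|Z|) => [->//|/card_gt0P[j0 /ZE[r0 [p pX jp]]]].
have rp : rt (val p).1 = rt v.
  by rewrite -r0; case/orP: jp => /eqP -> //; rewrite (extra_rt pX).
have sub : Z \subset [set (val p).1; (val p).2].
  apply/fintype.subsetP => j /ZE[rj [q qX jq]].
  have rq : rt (val q).1 = rt v.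
    by rewrite -rj; case/orP: jq => /eqP -> //; rewrite (extra_rt qX).
  have <- : q = p by apply: (extra_unique diamond dr) => //; rewrite rp.
  by rewrite !inE.
apply: (leq_trans (subset_leq_card sub)).
by rewrite cards2; case: (_ != _).
Qed.

(** Extra edges sharing a vertex would lie in the same tree, so they form a matching, and the bound
    2 |u w| <= u ^ 2 + w ^ 2 on each edge uses every vertex at most once. *)
Lemma extra_form_le r (s : upair n -> bool) (y : 'I_n -> R) :
  (forall S, conn S -> (#|S| <= r)%N -> (ein S <= #|S|)%N) ->
  (forall v, (4 * (depth v).+1 <= r)%N) ->
  `|\sum_(p in extraE) sg R (s p) * y (val p).1 * y (val p).2| <= \sum_(i in extraV) y i ^+ 2 / 2.
Proof.
move=> diamond dr; apply: (le_trans (ler_norm_sum _ _ _)).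
apply: (@le_trans _ _ (\sum_(p in extraE) (y (val p).1 ^+ 2 / 2 + y (val p).2 ^+ 2 / 2))).
  apply: ler_sum => p _; rewrite !normrM sg_norm mul1r -(real_normK (num_real (y (val p).1))).
  rewrite -(real_normK (num_real (y (val p).2))).
  set u := `|_|; set w := `|_|; have := sqr_ge0 (u - w); rewrite sqrrB.
  by move: (u ^+ 2) (w ^+ 2) => U W; rewrite -mulr_natl; lra.
pose inc (p : upair n) (i : 'I_n) : R := (i == (val p).1)%:R + (i == (val p).2)%:R.
have -> : \sum_(p in extraE) (y (val p).1 ^+ 2 / 2 + y (val p).2 ^+ 2 / 2) =
    \sum_i y i ^+ 2 / 2 * (\sum_(p in extraE) inc p i).
  transitivity (\sum_(p in extraE) \sum_i inc p i * (y i ^+ 2 / 2)).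
    apply: eq_bigr => p _.
    rewrite -(sum_delta (fun i => y i ^+ 2 / 2) (val p).1) -(sum_delta (fun i => y i ^+ 2 / 2) (val p).2).
    by rewrite -big_split; apply: eq_bigr => i _; rewrite /inc mulrDl.
  rewrite exchange_big; apply: eq_bigr => i _; rewrite mulr_sumr.
  by apply: eq_bigr => p _; rewrite mulrC.
rewrite [leRHS]big_mkcond; apply: ler_sum => i _.
have y0 : 0 <= y i ^+ 2 / 2 by rewrite divr_ge0 ?sqr_ge0.
have inc0 p : ~~ ((i == (val p).1) || (i == (val p).2)) -> inc p i = 0.
  by rewrite negb_or /inc => /andP[/negbTE-> /negbTE->]; rewrite addr0.
case: ifPn => [iV|iV]; last first.
  rewrite big1 ?mulr0 // => p pX; apply: inc0; apply: contra iV => h.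
  by rewrite inE; apply/existsP; exists p; rewrite pX.
rewrite ler_piMr //.
move: iV; rewrite inE => /existsP[p /andP[pX ip]].
rewrite (bigD1 p) //= big1 => [|q /andP[qX qp]].
  rewrite addr0 /inc; have := ends_lt p; case/orP: ip => /eqP ->; rewrite eqxx.
    by case: eqP => [->|_]; rewrite ?ltnn // addr0.
  by case: eqP => [->|_]; rewrite ?ltnn // add0r.
apply: inc0; apply: contra qp => iq; apply/eqP; apply: (extra_unique diamond dr) => //.
have ri s0 : s0 \in extraE -> (i == (val s0).1) || (i == (val s0).2) -> rt (val s0).1 = rt i.
  by move=> sX /orP[/eqP->//|/eqP->]; exact: extra_rt.
by rewrite (ri q) // (ri p).
Qed.

Definition down v k : {set 'I_n} := [set i | [exists a : 'I_k.+1, anc fpar a i == Some v]].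

Lemma downP v k i : reflect (exists2 a, (a <= k)%N & anc fpar a i = Some v) (i \in down v k).
Proof.
rewrite inE; apply: (iffP existsP) => [[a /eqP h]|[a ak h]].
  by exists a => //; have := ltn_ord a.
by exists (Ordinal (ak : (a < k.+1)%N)); apply/eqP.
Qed.

Lemma down_new v k i : i \in down v k.+1 -> i \notin down v k ->
  exists u, fpar i = Some u /\ u \in down v k.
Proof.
move=> /downP[[|a] ak h] /downP nk; first by case: nk; exists 0%N.
case D: (fpar i) => [u|]; last by rewrite (anc_None _ D) in h.
by exists u; split=> //; apply/downP; exists a => //; rewrite -(anc_par _ D).
Qed.

(** Every new vertex is charged to its own parent edge, which touches [U]. *)
Lemma down_grow v k U : down v k \subset U ->
  (#|down v k.+1 :\: U| <= eto U)%N.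
Proof.
move=> DU; pose W := [set p in E | touches U p].
have h i : i \in down v k.+1 :\: U -> exists u, fpar i = Some u /\ u \in U.
  rewrite in_setD => /andP[iU iD].
  have [|u [D uD]] := down_new iD; first by apply: contra iU; exact: (fintype.subsetP DU).
  by exists u; split=> //; exact: (fintype.subsetP DU).
have <- : #|[set Some p | p in W]| = eto U by rewrite card_imset // => s t [].
have <- : #|[set tedge i | i in down v k.+1 :\: U]| = #|down v k.+1 :\: U|.
  rewrite card_in_imset // => i j /h[u [D _]] _ e.
  have [p [ep _ _]] := tedge_some D; rewrite ep in e.
  exact: tedge_inj ep (esym e).
apply: subset_leq_card; apply/fintype.subsetP => o /imsetP[i /h[u [D uU]] ->].
have [p [-> pE jp]] := tedge_some D; apply/imsetP; exists p => //.
by rewrite inE pE /touches; case/orP: jp => /eqP -> /=; rewrite uU ?orbT.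
Qed.

Lemma conn_down v k : conn (down v k).
Proof.
apply: (conn_ranked (r := v) (dep := depth)); first by apply/downP; exists 0%N.
move=> i /downP[[|a] ak h] iv; first by case: h iv => ->; rewrite eqxx.
case D: (fpar i) => [u|]; last by rewrite (anc_None _ D) in h.
exists u; split; [|by have [/andP[]] := fpar_some D | exact: fpar_depth].
by apply/downP; exists a; [exact: ltnW | rewrite -(anc_par _ D)].
Qed.

Definition upto j a : {set 'I_n} := [set u | [exists k : 'I_a.+1, anc fpar k j == Some u]].

Lemma uptoP j a u : reflect (exists2 k, (k <= a)%N & anc fpar k j = Some u) (u \in upto j a).
Proof.
rewrite inE; apply: (iffP existsP) => [[k /eqP h]|[k ka h]].
  by exists k => //; have := ltn_ord k.
by exists (Ordinal (ka : (k < a.+1)%N)); apply/eqP.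
Qed.

Lemma card_upto j a : (#|upto j a| <= a.+1)%N.
Proof.
pose f (k : 'I_a.+1) := anc fpar k j.
have -> : #|upto j a| = #|[set Some u | u in upto j a]| by rewrite card_imset // => s t [].
rewrite -[X in (_ <= X)%N]card_ord; apply: (@leq_trans #|[set f k | k : 'I_a.+1]|).
  apply: subset_leq_card; apply/fintype.subsetP => o /imsetP[u]; rewrite inE.
  by move=> /existsP[k /eqP h] ->; apply/imsetP; exists k.
exact: leq_imset_card.
Qed.

Lemma conn_down_upto v j a k : anc fpar a j = Some v -> conn (down v k :|: upto j a).
Proof.
move=> jv; pose dist i := (depth i - depth v)%N.
apply: (conn_ranked (r := v) (dep := depth)).
  by rewrite inE; apply/orP; left; apply/downP; exists 0%N.
move=> i iU iv.
suff [u [D uU]] : exists u, fpar i = Some u /\ u \in down v k :|: upto j a.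
  by exists u; split; [|by have [/andP[]] := fpar_some D | exact: fpar_depth].
move: iU; rewrite inE => /orP[/downP[[|b] bk h]|/uptoP[b ba h]].
- by case: h iv => ->; rewrite eqxx.
- case D: (fpar i) => [u|]; last by rewrite (anc_None _ D) in h.
  exists u; split=> //; rewrite inE; apply/orP; left.
  by apply/downP; exists b; [exact: ltnW | rewrite -(anc_par _ D)].
- have lt : (b < a)%N.
    by rewrite ltn_neqAle ba andbT; apply: contraNneq iv => e; move: jv; rewrite -e h => -[->].
  have : anc fpar b.+1 j != None.
    apply/eqP => hN; have : anc fpar a j = None.
      rewrite -(subnK lt) /anc iterD -/(anc fpar b.+1 j) hN.
      by elim: (a - b.+1)%N => //= m ->.
    by rewrite jv.
  rewrite ancS h /=; case D: (fpar i) => [u|] // _; exists u; split=> //.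
  by rewrite inE; apply/orP; right; apply/uptoP; exists b.+1; rewrite // ancS h.
Qed.

Lemma Dw_sum_le N (nu : R) v (B : nat -> R) : 0 <= nu ->
  (forall k, (#|down v k|)%:R <= B k) ->
  \sum_j Dw fpar N nu v j <= \sum_(k < N) nu ^+ k * B k.
Proof.
move=> nu0 hB; rewrite /Dw exchange_big; apply: ler_sum => k _.
rewrite -mulr_sumr ler_wpM2l ?exprn_ge0 //; apply: le_trans (hB k).
rewrite -natr_sum ler_nat -sum1_card [X in (_ <= X)%N]big_mkcond; apply: leq_sum => i _.
case: eqP => [h|_] //=; rewrite ifT //; by apply/downP; exists (nat_of_ord k).
Qed.

(** The first k levels below [v], joined with the path from [j] up to [v], form a connected set
    containing the good vertex [j]. This set is therefore not bad, so another level enlarges it by a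
    factor at most 1 + Q. The path gives the initial size a + 1. *)
Lemma good_down_card j a v k : 0 <= Q -> ~~ badv j -> anc fpar a j = Some v ->
  (#|down v k|)%:R <= (1 + Q) ^+ k * a.+1%:R.
Proof.
move=> Q0 gj jv.
apply: (@le_trans _ _ (#|down v k :|: upto j a|)%:R).
  by rewrite ler_nat subset_leq_card // subsetUl.
elim: k => [|k IH].
  rewrite expr0 mul1r ler_nat; apply: leq_trans (card_upto j a).
  apply: subset_leq_card; rewrite subUset subxx andbT.
  apply/fintype.subsetP => i /downP[b b0 h]; move: b0 h; rewrite leqn0 => /eqP -> [->].
  by apply/uptoP; exists a.
set U := down v k :|: upto j a in IH *.
have sub : down v k.+1 :|: upto j a \subset U :|: (down v k.+1 :\: U).
  apply/fintype.subsetP => i; rewrite inE => /orP[h|h]; last by rewrite in_setU /U in_setU h orbT.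
  by rewrite in_setU in_setD h andbT orbN.
have c1 := leq_trans (subset_leq_card sub) (leq_card_setU _ _).
have c2 : (#|down v k.+1 :\: U| <= eto U)%N by apply: down_grow; exact: subsetUl.
have c3 : (eto U)%:R <= Q * #|U|%:R.
  rewrite leNgt; apply: contra gj => /ltW h; apply/existsP; exists U.
  rewrite /badset (conn_down_upto k jv) h !andbT inE; apply/orP; right.
  by apply/uptoP; exists 0%N.
apply: (@le_trans _ _ (#|U|%:R + (eto U)%:R)).
  by rewrite -natrD ler_nat; apply: leq_trans c1 _; rewrite leq_add2l.
rewrite exprS -mulrA mulrDl mul1r.
have : Q * #|U|%:R <= Q * ((1 + Q) ^+ k * a.+1%:R) by rewrite ler_wpM2l.
by move: IH c3; lra.
Qed.

End forest_edges.

(** * Signed quadratic forms and assembly *)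

Section signed_forms.
Variables (R : realType) (n : nat) (c : upair n -> bool).

Definition sform (D : {set upair n}) (y : 'I_n -> R) : R :=
  \sum_(p in D) sg R (c p) * y (val p).1 * y (val p).2.

Definition smat (D : {set upair n}) (i j : 'I_n) : R :=
  \sum_(p in D) sg R (c p) * ((i == (val p).1)%:R * (j == (val p).2)%:R +
     (i == (val p).2)%:R * (j == (val p).1)%:R).

Lemma smat_sym D i j : smat D i j = smat D j i.
Proof. by apply: eq_bigr => p _; congr (_ * _); ring. Qed.

Lemma smat_diag D i : smat D i i = 0.
Proof.
rewrite /smat big1 // => p _; have := ends_lt p.
case: eqP => [<-|_]; last by rewrite !(mul0r, mulr0, addr0).
by case: eqP => [<-|_]; rewrite ?ltnn // !(mul0r, mulr0, addr0).
Qed.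

Lemma qf_smat D y : qf (smat D) y = 2 * sform D y.
Proof.
rewrite /qf /sform mulr_sumr.
transitivity (\sum_(p in D) \sum_i \sum_j sg R (c p) * ((i == (val p).1)%:R * (j == (val p).2)%:R +
     (i == (val p).2)%:R * (j == (val p).1)%:R) * y i * y j).
  rewrite [RHS]exchange_big; apply: eq_bigr => i _; rewrite [RHS]exchange_big /=.
  by apply: eq_bigr => j _; rewrite /smat !mulr_suml.
apply: eq_bigr => p _.
transitivity (\sum_i ((i == (val p).1)%:R * (sg R (c p) * y i * y (val p).2) +
    (i == (val p).2)%:R * (sg R (c p) * y i * y (val p).1))).
  apply: eq_bigr => i _.
  rewrite -[in RHS](sum_delta y (val p).2) -[in X in _ = _ + X](sum_delta y (val p).1).
  rewrite !mulr_sumr -big_split; apply: eq_bigr => j _ /=; ring.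
rewrite big_split /= !sum_delta; ring.
Qed.

End signed_forms.

Lemma signed_adjE (R : realType) n (E : {set upair n}) (c : {ffun upair n -> bool}) i j :
  signed_adj R E c i j = smat R c E i j.
Proof.
rewrite /signed_adj summxE; apply: eq_bigr => p _.
by rewrite !mxE -!natrM !mulnb.
Qed.

Lemma arith_geom_le (R : realType) (q : R) N : 0 <= q -> q <= 2^-1 ->
  \sum_(k < N) q ^+ k * (2 * k.+1%:R) <= 8.
Proof.
move=> q0 q1.
apply: (@le_trans _ _ (\sum_(k < N) (2^-1 : R) ^+ k * (2 * k.+1%:R))).
  by apply: ler_sum => k _; rewrite ler_wpM2r // lerXn2r // nnegrE.
have h : \sum_(k < N) (2^-1 : R) ^+ k * (2 * k.+1%:R) <= 8 - 4 * (N%:R + 2) * 2^-1 ^+ N.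
  elim: N => [|N IH]; first by rewrite big_ord0 expr0; lra.
  rewrite big_ord_recr /= exprS; move: IH; rewrite -(natr1 N).
  set x := 2^-1 ^+ N; set s := bigop _ _ _; move: (N%:R) => m; move=> IH; nra.
have : 0 <= 4 * (N%:R + 2) * 2^-1 ^+ N :> R by rewrite !mulr_ge0 ?exprn_ge0 ?addr_ge0.
by lra.
Qed.

Section assembly.
Variables (R : realType) (n : nat) (E : {set upair n}) (Q : R) (c : {ffun upair n -> bool}).
Variables (b om nu ell Kc ka : R) (r N : nat).
Notation fpar := (fpar E Q).
Notation depth := (depth E Q).

Theorem graph_rho_ge :
  (0 < n)%N -> 0 <= Q -> 0 < b -> b <= 8^-1 -> 0 <= om -> om <= 2^-1 ->
  0 < nu -> nu * (1 + Q) <= 2^-1 -> (4 * b) ^+ 2 = om * nu -> 0 < ell ->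
  (forall v, \sum_j Dw fpar N nu v j <= ell) ->
  (forall v, (depth v < N)%N) ->
  (forall S, conn E S -> (#|S| <= r)%N -> (ein E S <= #|S|)%N) ->
  (forall v, (4 * (depth v).+1 <= r)%N) ->
  (forall y : 'I_n -> R, (forall i, badv E Q i -> y i = 0) ->
     `|sform c (bulkE E Q) y| <= Kc * \sum_i y i ^+ 2) ->
  0 <= Kc -> b * (2 * Kc + 1) <= ka / 2 -> ka <= 2048^-1 ->
  forall h : 'cV[R]_n,
  (((n%:R * (2^-1 * expR (64 * forest_cov_const b nu ell) * expR 2))^-1)%:E
     <= rho_MLSI (ising (b *: signed_adj R E c) h))%E.
Proof.
move=> n0 Q0 b0 b8 om0 om2 nu0 nuQ tau2 ell0 hell dN diamond dr spec Kc0 kab ka1 h.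
pose G := [set i | ~~ badv E Q i]; pose Y := extraV E Q.
pose eps x : bool := if tedge E Q x is Some p then c p else false.
pose D := bulkE E Q :|: extraE E Q.
(* The diagonal term makes the form of the remaining edges positive semidefinite. On spins it is
   constant, and it is supported where [boundary_var] applies. *)
pose M i j : R := b * smat R c D i j + (ka / 2) * ((i == j) && (i \in G :|: Y))%:R.
have dis : [disjoint bulkE E Q & extraE E Q].
  rewrite disjoint_subset; apply/fintype.subsetP => p; rewrite !inE => /andP[-> /negbTE ->].
  by rewrite andbF.
have sD y : sform c D y = sform c (bulkE E Q) y + sform c (extraE E Q) y.
  by rewrite /sform (eq_bigl [predU bulkE E Q & extraE E Q]) ?bigU // => p; rewrite !inE.
have ka0 : 0 <= ka.
  have : 0 <= b * (2 * Kc + 1) by rewrite mulr_ge0 ?(ltW b0) // addr_ge0 // mulr_ge0.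
  by lra.
have qM y : qf M y = 2 * b * sform c D y + ka / 2 * \sum_(i in G :|: Y) y i ^+ 2.
  transitivity (b * qf (smat R c D) y + ka / 2 * \sum_(i in G :|: Y) y i ^+ 2); last first.
    by rewrite qf_smat mulrA [b * 2]mulrC.
  rewrite /qf !mulr_sumr [X in _ = _ + X]big_mkcond -big_split; apply: eq_bigr => i _ /=.
  have -> : (if i \in G :|: Y then ka / 2 * y i ^+ 2 else 0) =
      \sum_j (j == i)%:R * (ka / 2 * ((i \in G :|: Y)%:R * y i * y j)).
    by rewrite sum_delta; case: ifP => _; rewrite ?mul1r ?mul0r ?mulr0 // expr2.
  rewrite mulr_sumr -big_split; apply: eq_bigr => j _ /=.
  rewrite /M eq_sym; case: (j == i); case: (i \in G :|: Y) => /=; ring.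
have bound y : `|2 * b * sform c D y| <= ka / 2 * \sum_(i in G :|: Y) y i ^+ 2.
  pose y' i := if i \in G then y i else 0.
  (* Bulk edges join good vertices, so [y] may be replaced by 0 at bad ones before the spectral
     hypothesis is used. *)
  have e1 : sform c (bulkE E Q) y = sform c (bulkE E Q) y'.
    apply: eq_bigr => p; rewrite inE /badtouch negb_or => /andP[_ /andP[g1 g2]].
    by rewrite /y' !inE g1 g2.
  have s1 : `|sform c (bulkE E Q) y| <= Kc * \sum_(i in G :|: Y) y i ^+ 2.
    rewrite e1; apply: (le_trans (spec y' _)).
      by move=> i bi; rewrite /y' inE bi.
    rewrite ler_wpM2l // [leRHS]big_mkcond; apply: ler_sum => i _; rewrite /y' in_setU.
    by case: (i \in G) => //=; case: (i \in Y); rewrite ?expr0n ?sqr_ge0.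
  have s2 : `|sform c (extraE E Q) y| <= (\sum_(i in G :|: Y) y i ^+ 2) / 2.
    apply: (le_trans (extra_form_le c y diamond dr)).
    rewrite -mulr_suml ler_wpM2r ?invr_ge0 // big_mkcond [leRHS]big_mkcond.
    apply: ler_sum => i _; rewrite in_setU /Y; case: (i \in extraV E Q); first by rewrite orbT.
    by case: (_ || _); rewrite ?sqr_ge0.
  set SS := \sum_(i in G :|: Y) _ in s1 s2 *.
  have SS0 : 0 <= SS by apply: sumr_ge0 => i _; rewrite sqr_ge0.
  rewrite normrM ger0_norm; last by rewrite mulr_ge0 // (ltW b0).
  apply: (@le_trans _ _ (2 * b * (Kc * SS + SS / 2))).
    rewrite ler_wpM2l ?mulr_ge0 ?(ltW b0) // sD; apply: (le_trans (ler_normD _ _)).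
    by rewrite lerD.
  have -> : 2 * b * (Kc * SS + SS / 2) = b * (2 * Kc + 1) * SS by field.
  by rewrite ler_wpM2r.
have hj i j : (b *: signed_adj R E c) i j = b * smat R c E i j.
  by rewrite mxE signed_adjE.
apply: (@ising_rho_ge R n fpar depth N b om nu ell ka eps G Y M _
  (- (ka / 4 * #|G :|: Y|%:R))) => //.
- exact: fpar_depth.
(* At the k-th ancestor of a good vertex the weighted number of descendants is at most 2 (k + 1), by
   [good_down_card] and nu (1 + Q) <= 1 / 2. *)
- move=> j jG; apply: le_trans (arith_geom_le N om0 om2); apply: ler_sum => k _.
  rewrite ler_wpM2l ?exprn_ge0 //.
  case D1: (anc fpar k j) => [v|]; last by rewrite mulr_ge0.
  apply: (@le_trans _ _ (\sum_i Dw fpar N nu v i)).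
    rewrite big_mkcond; apply: ler_sum => i _; case: ifP => _ //; apply: Dw_ge0.
    exact: ltW.
  have gj : ~~ badv E Q j by move: jG; rewrite inE.
  apply: le_trans (Dw_sum_le N (ltW nu0) (fun k' => good_down_card k' Q0 gj D1)) _.
  under eq_bigr do rewrite mulrA -exprMn.
  rewrite -mulr_suml ler_wpM2r //; apply: geom_le => //.
  by rewrite mulr_ge0 ?(ltW nu0) // addr_ge0.
- by move=> v; exact: (extraV_card N v diamond dr).
- by move=> i j; rewrite /M smat_sym eq_sym; case: eqP => [->|].
- by move=> y; rewrite qM; have := bound y; rewrite ler_norml => /andP[]; lra.
- move=> y; rewrite qM.
  have : \sum_(i in G :|: Y) y i ^+ 2 <= \sum_i y i ^+ 2.
    by rewrite big_mkcond; apply: ler_sum => i _; case: ifP => _; rewrite ?sqr_ge0.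
  set SS := \sum_(i in _) _ in bound *; move=> h1.
  have h2 : ka * SS <= ka * \sum_i y i ^+ 2 by rewrite ler_wpM2l.
  by have := bound y; rewrite ler_norml => /andP[_]; rewrite -/SS; lra.
- by move=> i iN; rewrite /M smat_diag (negbTE iN) andbF !mulr0 addr0.
- move=> x; set y := fun i => spn R i x.
  have -> : qf (fun i j => (b *: signed_adj R E c) i j) y = 2 * b * sform c E y.
    rewrite -mulrA mulrCA -qf_smat /qf mulr_sumr; apply: eq_bigr => i _.
    by rewrite mulr_sumr; apply: eq_bigr => j _; rewrite hj !mulrA.
  rewrite qM.
  have -> : \sum_(i in G :|: Y) y i ^+ 2 = #|G :|: Y|%:R.
    rewrite -sum1_card natr_sum; apply: eq_bigr => i _; rewrite expr2 /y /spn.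
    exact: sg_sqr.
  have -> : \sum_x0 pedge fpar (kapb b eps) x0 x = b * sform c (treeE E Q) y.
    rewrite /sform sum_treeE mulr_sumr; apply: eq_bigr => v _; rewrite /pedge.
    case D1: (fpar v) => [u|]; last by rewrite tedge_none // mulr0.
    have [p [ep _ jp]] := tedge_some D1.
    rewrite ep /kapb /eps ep; case/orP: jp => /eqP -> /=; rewrite /y; ring.
  rewrite [sform c E y](sum_edges_split E Q) sD /sform.
  set s1 := \sum_(p in treeE E Q) _; set s2 := \sum_(p in extraE E Q) _.
  by set s3 := \sum_(p in bulkE E Q) _; field.
Qed.

End assembly.

(** * Regular graphs *)

Section asymptotics.
Variable R : realType.
Implicit Types (d eta ep : R).

(* The Chernoff bound for [star] has parameter 3 m, and 3 m (star_const m - 1) = 2 exp (3 m) + 4. *)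
Definition star_const (m : nat) : R := (2 * expR (3 * m%:R) + 4) / (3 * m%:R) + 1.

(** The parameter [m] trades the constant in front of |S| for the additive term: m = 1 serves for
    depths and for crude growth, and a large fixed m shows that balls of bounded radius have o(log
    n) vertices. *)
Definition star d n (E : {set upair n}) : Prop := forall m, (0 < m <= n)%N ->
  forall S, conn E S -> (eto E S)%:R <= star_const m * d * #|S|%:R + ln n%:R / m%:R.

(* A connected S with |S| + 1 inner edges carries two independent cycles. The size condition
   admits every union of four root paths of the forest. *)
Definition diamond_free d n (E : {set upair n}) : Prop := forall S, conn E S ->
  d * #|S|%:R <= ln (n%:R : R) / 35 + 4 * d -> (ein E S <= #|S|)%N.

Lemma star_const_ge0 m : 0 <= star_const m.
Proof. by rewrite addr_ge0 // divr_ge0 ?addr_ge0 ?mulr_ge0 ?expR_ge0. Qed.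

Lemma expR1_le3 : expR 1 <= 3 :> R.
Proof.
have h : 7 / 8 <= expR (- (8^-1)) :> R by have := expR_ge1Dx (- (8^-1) : R); lra.
have h8 : expR (8^-1) <= 8 / 7 :> R.
  rewrite -[8^-1]opprK expRN invf_ple ?posrE ?expR_gt0 //; lra.
have -> : (1 : R) = 8%:R * 8^-1 by rewrite mulfV.
rewrite expRM_natl; apply: (@le_trans _ _ ((8 / 7) ^+ 8)); last by lra.
by rewrite lerXn2r // nnegrE ?expR_ge0.
Qed.

Lemma star_const1 : star_const 1 <= 24.
Proof.
rewrite /star_const; have -> : 3 * 1%:R = 3%:R * 1 :> R by [].
rewrite expRM_natl mulr1.
have : expR 1 ^+ 3 <= 3 ^+ 3 :> R by rewrite lerXn2r ?expR1_le3 // nnegrE ?expR_ge0.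
by move: (expR 1 ^+ 3) => x; lra.
Qed.

Lemma ln_large (c : R) : exists n0, forall n, (n0 <= n)%N -> c <= ln (n%:R : R).
Proof.
have [n0 h] := eventually_nat_ge (expR c); exists n0 => n nn.
have e0 := expR_gt0 c.
have h' : expR c <= n%:R by apply: le_trans h _; rewrite ler_nat.
by rewrite -[c]expRK ler_ln // posrE //; exact: lt_le_trans h'.
Qed.

Lemma ln_nat_ge0 n : 0 <= ln (n%:R : R).
Proof.
case: n => [|n]; first by rewrite ln0.
by rewrite ln_ge0 // ler1n.
Qed.

Lemma card_down_next n (E : {set upair n}) (Q : R) v k :
  (#|down E Q v k.+1| <= #|down E Q v k| + eto E (down E Q v k))%N.
Proof.
have sub : down E Q v k.+1 \subset down E Q v k :|: (down E Q v k.+1 :\: down E Q v k).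
  by apply/fintype.subsetP => i h; rewrite in_setU in_setD h andbT orbN.
apply: leq_trans (subset_leq_card sub) _; apply: leq_trans (leq_card_setU _ _) _.
by rewrite leq_add2l; exact: down_grow.
Qed.

Lemma down_mono n (E : {set upair n}) (Q : R) v k l : (k <= l)%N ->
  (#|down E Q v k| <= #|down E Q v l|)%N.
Proof.
move=> kl; apply: subset_leq_card; apply/fintype.subsetP => i /downP[a ak h].
by apply/downP; exists a => //; exact: leq_trans kl.
Qed.

Lemma card_down0 n (E : {set upair n}) (Q : R) v : #|down E Q v 0| = 1%N.
Proof.
rewrite -(cards1 v); congr #|pred_of_set _|; apply/setP => i; rewrite in_set1.
apply/downP/eqP => [[[|a] // _]|->]; first by rewrite anc0 => -[].
by exists 0%N.
Qed.

(** Induction on the radius: one more level adds at most the number of edges touching the ball, a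
    constant times its size plus ln n / m, and [m] is chosen with 1 / m <= eta / 2. *)
Lemma down_little_o d k eta : 0 < d -> 0 < eta -> exists n0, forall n (E : {set upair n}) (Q : R) v,
  (n0 <= n)%N -> star d E -> (#|down E Q v k|)%:R <= eta * ln (n%:R).
Proof.
move=> d0; elim: k eta => [|k IH] eta eta0.
  have [n0 h] := ln_large eta^-1; exists n0 => n E Q v nn _.
  rewrite card_down0; have := h n nn.
  by rewrite -(ler_pM2l eta0) mulfV // gt_eqF.
have [m0 hm0] := eventually_nat_ge (2 / eta).
pose m := m0.+1; have m1 : 0 < m%:R :> R by rewrite ltr0n.
have hm : m%:R^-1 <= eta / 2.
  rewrite invf_ple ?posrE ?divr_gt0 // invf_div; apply: le_trans hm0 _.
  by rewrite ler_nat.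
pose c := 1 + star_const m * d.
have c0 : 0 < c by rewrite ltr_pwDl // mulr_ge0 ?star_const_ge0 ?(ltW d0).
have e2 : 0 < eta / (2 * c) by rewrite divr_gt0 // mulr_gt0.
have [n0 h] := IH _ e2; exists (maxn n0 m) => n E Q v; rewrite geq_max => /andP[n0n mn] st.
have h1 := h n E Q v n0n st.
have m1n : (0 < m <= n)%N by rewrite mn.
have h2 := st m m1n _ (conn_down E Q v k).
have h3 : (#|down E Q v k.+1|)%:R <= (#|down E Q v k|)%:R + (eto E (down E Q v k))%:R :> R.
  by rewrite -natrD ler_nat; exact: card_down_next.
have h4 : c * #|down E Q v k|%:R <= c * (eta / (2 * c) * ln n%:R) by rewrite ler_wpM2l // ltW.
have e5 : c * (eta / (2 * c) * ln n%:R) = eta / 2 * ln n%:R.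
  by field; rewrite gt_eqF.
have h6 : ln n%:R / m%:R <= ln n%:R * (eta / 2) by rewrite ler_wpM2l // ln_nat_ge0.
move: h4; rewrite e5 /c mulrDl mul1r; lra.
Qed.

(** The factor 26 d is 24 d from [star_const1], plus d for the ball itself and d for the additive ln
    n. *)
Lemma down_exp d k n (E : {set upair n}) (Q : R) v : 1 < d -> star d E ->
  (#|down E Q v k|)%:R <= (26 * d) ^+ k * (1 + ln (n%:R)).
Proof.
move=> d1 st; have L0 := ln_nat_ge0 n.
have n1 : (0 < 1 <= n)%N by case: n E v st L0 => [|n] // E [].
elim: k => [|k IH]; first by rewrite card_down0 expr0 mul1r; lra.
have h2 := st 1%N n1 _ (conn_down E Q v k).
have h3 : (#|down E Q v k.+1|)%:R <= (#|down E Q v k|)%:R + (eto E (down E Q v k))%:R :> R.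
  by rewrite -natrD ler_nat; exact: card_down_next.
apply: le_trans h3 _; rewrite divr1 in h2.
set a := #|down E Q v k|%:R in IH h2 *.
have a0 : 0 <= a by [].
have h4 : star_const 1 * d * a <= 24 * d * a.
  by rewrite ler_wpM2r // ler_wpM2r ?star_const1 //; lra.
have h5 : a <= d * a by rewrite ler_peMl // ltW.
have h6 : 1 <= (26 * d) ^+ k by apply: exprn_ege1; lra.
rewrite exprS; set X := _ ^+ k in IH h6 *.
have X0 : 0 <= X * (1 + ln n%:R) by rewrite mulr_ge0; lra.
have h7 : d * a <= d * (X * (1 + ln n%:R)) by rewrite ler_wpM2l //; lra.
have h8 : ln n%:R <= d * (X * (1 + ln n%:R)).
  apply: (@le_trans _ _ (1 * (1 * (1 + ln n%:R)))); first by lra.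
  by rewrite ler_pM ?ler_wpM2r //; lra.
by move: h2 h4 h5 h7 h8; rewrite -!mulrA; lra.
Qed.

Lemma half_pow_le (x : R) : 0 < x -> exists k, 2^-1 ^+ k <= x.
Proof.
move=> x0; have [k h] := eventually_nat_ge x^-1; exists k.
have k2 : k%:R <= 2 ^+ k :> R by rewrite -natrX ler_nat; exact/ltnW/ltn_expl.
have x1 : 0 < x^-1 by rewrite invr_gt0.
rewrite exprVn -[x]invrK lef_pV2 ?posrE ?exprn_gt0 //.
exact: le_trans h k2.
Qed.

(** Up to a fixed level K the ball has o(log n) vertices. Beyond K the growth (26 d) ^ k meets nu ^
    k with ratio 1 / 4; one factor 2 ^ (-k) is kept for summation, and the other is at most 2 ^
    (-K), hence small. *)
Lemma Dw_little_o d nu eta : 1 < d -> 0 <= nu -> nu * (26 * d) <= 4^-1 -> 0 < eta ->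
  exists n0, forall n (E : {set upair n}) (Q : R) N v,
  (n0 <= n)%N -> star d E ->
  \sum_j Dw (fpar E Q) N nu v j <= eta * ln (n%:R).
Proof.
move=> d1 nu0 nud eta0.
have [K hK] := @half_pow_le (eta / 16) (divr_gt0 eta0 (ltr0Sn _ _)).
have d0 : 0 < d by lra.
have [n0 h0] := @down_little_o d K _ d0 (divr_gt0 eta0 (ltr0Sn R 7)).
have [n1 h1] := ln_large 1.
exists (maxn n0 n1) => n E Q N v; rewrite geq_max => /andP[n0n n1n] st.
have L1 := h1 n n1n; have hd := h0 n E Q v n0n st.
set L := ln n%:R in L1 hd *.
have nu2 : nu <= 2^-1.
  apply: le_trans (_ : 4^-1 <= _); last by lra.
  by apply: le_trans nud; rewrite ler_peMr //; lra.
pose B k := if (k <= K)%N then eta / 8 * L else (26 * d) ^+ k * (1 + L).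
apply: le_trans (@Dw_sum_le R n E Q N nu v B nu0 _) _.
  move=> k; rewrite /B; case: ifP => kK; last exact: down_exp.
  by apply: le_trans hd; rewrite ler_nat; exact: down_mono.
apply: (@le_trans _ _ (\sum_(k < N) 2^-1 ^+ k * (eta / 8 * L + 2^-1 ^+ K * (1 + L)))).
  apply: ler_sum => k _.
  have p1 : 0 <= eta / 8 * L by rewrite mulr_ge0 // ?divr_ge0 // ?(ltW eta0) //; lra.
  have p2 : 0 <= 2^-1 ^+ K * (1 + L) by rewrite mulr_ge0 ?exprn_ge0 //; lra.
  rewrite /B; case: leqP => kK.
    by apply: ler_pM; rewrite ?exprn_ge0 ?lerXn2r ?nnegrE //; lra.
  rewrite mulrA -exprMn.
  have q0 : 0 <= nu * (26 * d) by rewrite mulr_ge0 // mulr_ge0 // ltW.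
  apply: (@le_trans _ _ (4^-1 ^+ k * (1 + L))).
    by rewrite ler_wpM2r ?lerXn2r ?nnegrE //; lra.
  have -> : 4^-1 ^+ k = 2^-1 ^+ k * 2^-1 ^+ k :> R by rewrite -exprMn; congr (_ ^+ _); lra.
  rewrite -[leLHS]mulrA; apply: ler_wpM2l; first by rewrite exprn_ge0.
  apply: (@le_trans _ _ (2^-1 ^+ K * (1 + L))); last by lra.
  rewrite ler_wpM2r //; first by lra.
  by apply: ler_wiXn2l; rewrite ?invr_ge0 ?invf_le1 //; [lra | exact: ltnW].
rewrite -mulr_suml.
have g := @geom_le R 2^-1 N ltac:(lra) ltac:(lra).
apply: (@le_trans _ _ (2 * (eta / 8 * L + eta / 16 * (1 + L)))); last first.
  have : eta <= eta * L by rewrite ler_peMr // ltW.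
  by lra.
apply: ler_pM => //.
- by apply: sumr_ge0 => k _; rewrite exprn_ge0.
- by rewrite addr_ge0 // mulr_ge0 ?exprn_ge0 ?divr_ge0 // ?(ltW eta0) //; lra.
- by rewrite lerD2l ler_wpM2r //; lra.
Qed.

(** In [depth_le] the density 164 d loses 24 d from [star_const1]. The remaining 140 d bounds depths
    by ln n / (140 d), so four root paths satisfy the size condition of [diamond_free]. *)
Lemma rho_of_regular d Q nu beta Csp ep : 1 < d -> 164 * d <= Q / 12 -> 0 < nu ->
  nu * (26 * d) <= 4^-1 -> nu * (1 + Q) <= 2^-1 -> 16 * (beta / Num.sqrt d) ^+ 2 <= nu / 2 ->
  0 < beta -> beta <= 8^-1 /\ beta * (2 * Csp + 1) <= 4096^-1 -> 0 <= Csp -> 0 < ep ->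
  exists n0, forall n (E : {set upair n}) (c : {ffun upair n -> bool}), (n0 <= n)%N ->
  star d E -> diamond_free d E ->
  (forall y : 'I_n -> R, (forall i, badv E Q i -> y i = 0) ->
     `|sform c (bulkE E Q) y| <= Csp * Num.sqrt d * \sum_i y i ^+ 2) ->
  forall h : 'cV[R]_n,
  ((n%:R `^ (-1 - ep))%:E <= rho_MLSI (ising ((beta / Num.sqrt d) *: signed_adj R E c) h))%E.
Proof.
move=> d1 dQ nu0 nud nuQ bnu beta0 hb Csp0 ep0.
have d0 : 0 < d by lra.
have sd1 : 1 <= Num.sqrt d by rewrite -[1]sqrtr1 ler_wsqrtr // ltW.
have sd0 : 0 < Num.sqrt d by lra.
pose b := beta / Num.sqrt d.
have b0 : 0 < b by rewrite divr_gt0.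
have bb : b <= beta by rewrite ler_pdivrMr // ler_peMr // ltW.
pose K0 := 256 * b * (1 + nu^-1).
have nu10 : 0 < 1 + nu^-1 by rewrite addr_gt0 // invr_gt0.
have K00 : 0 < K0 by exact: (mulr_gt0 (mulr_gt0 (ltr0Sn R 255) b0) nu10).
have eta0 : 0 < ep / (2 * K0) by rewrite divr_gt0 // mulr_gt0.
have [n0 h0] := Dw_little_o d1 (ltW nu0) nud eta0.
have [n1 h1] := ln_large (1 + 4 / ep).
exists (maxn n0 n1) => n E c; rewrite geq_max => /andP[n0n n1n] st dia spec h.
have L1 := h1 n n1n.
have e4 : 0 < 4 / ep by rewrite divr_gt0.
have Lpos : 1 < ln n%:R :> R by lra.
have nn0 : (0 < n)%N by case: n {E c st dia spec h n0n n1n L1} Lpos => // ; rewrite ln0 // ltr10.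
have np : 0 < n%:R :> R by rewrite ltr0n.
pose L : R := ln n%:R; rewrite -/L in L1 Lpos.
(* This choice makes 64 times the forest constant equal to ep / 2 * L; the other half of the
   exponent absorbs expR 2, as ep * L >= 4. *)
pose ell := ep / (2 * K0) * L.
have ell0 : 0 < ell by rewrite mulr_gt0 //; lra.
have Q0 : 0 <= Q by lra.
have dep v : d * (depth E Q v)%:R <= L / 140.
  have [->|dv] := posnP (depth E Q v); first by rewrite mulr0 divr_ge0 //; lra.
  have n1' : (0 < 1 <= n)%N by rewrite nn0.
  have star1 S : conn E S -> (eto E S)%:R <= 24 * d * #|S|%:R + L.
    move=> cS; apply: le_trans (st 1%N n1' S cS) _; rewrite divr1 lerD2r.
    by rewrite !ler_wpM2r ?star_const1 // ltW.
  have hQ : 0 <= Q / 12 - 24 * d by lra.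
  have := depth_le Q0 dv star1 hQ.
  have : 140 * d * (depth E Q v)%:R <= (Q / 12 - 24 * d) * (depth E Q v)%:R.
    by rewrite ler_wpM2r //; lra.
  lra.
pose r := (\max_v 4 * (depth E Q v).+1)%N; pose N := (\max_v depth E Q v).+1.
pose om := 16 * b ^+ 2 / nu.
have n_gt0 : (0 < #|'I_n|)%N by rewrite card_ord.
have rd : d * r%:R <= L / 35 + 4 * d.
  rewrite /r; have [v ->] := @bigop.eq_bigmax _ (fun v : 'I_n => 4 * (depth E Q v).+1)%N n_gt0.
  by have := dep v; rewrite natrM -[(depth E Q v).+1%:R]natr1; lra.
have dia' S : conn E S -> (#|S| <= r)%N -> (ein E S <= #|S|)%N.
  move=> cS Sr; apply: dia => //; apply: le_trans rd; rewrite ler_wpM2l ?(ltW d0) //.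
  by rewrite ler_nat.
have om_le : om <= 2^-1.
  by rewrite ler_pdivrMr // [2^-1 * nu]mulrC.
have main := @graph_rho_ge R n E Q c b om nu ell (Csp * Num.sqrt d) (2048^-1) r N nn0 Q0 b0.
apply: le_trans (main _ _ _ nu0 _ _ ell0 _ _ dia' _ spec _ _ _ h).
- clear main; rewrite lee_fin /powR (gt_eqF np) -/L.
  suff hh : 2^-1 * expR (64 * forest_cov_const b nu ell) * expR 2 <= expR (ep * L).
    have -> : expR ((-1 - ep) * L) = (n%:R * expR (ep * L))^-1.
      have -> : n%:R = expR L by rewrite lnK // posrE.
      by rewrite -expRD -expRN; congr expR; ring.
    have p2 : 0 < 2^-1 * expR (64 * forest_cov_const b nu ell) * expR 2.
      by rewrite mulr_gt0 ?expR_gt0 // mulr_gt0 ?expR_gt0 // invr_gt0.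
    rewrite lef_pV2; first by rewrite ler_wpM2l // ltW.
      by rewrite posrE mulr_gt0 // expR_gt0.
    by rewrite posrE mulr_gt0.
  apply: (@le_trans _ _ (expR (64 * forest_cov_const b nu ell) * expR 2)).
    by rewrite ler_wpM2r ?expR_ge0 // ler_piMl ?expR_ge0 //; lra.
  rewrite -expRD ler_expR.
  have -> : 64 * forest_cov_const b nu ell = ep / 2 * L.
    by rewrite /forest_cov_const /ell -/K0 /K0; field; rewrite !gt_eqF //; rewrite addr_gt0.
  have : ep * (4 / ep) <= ep * L by rewrite ler_wpM2l ?(ltW ep0) //; lra.
  have -> : ep * (4 / ep) = 4 by field; rewrite gt_eqF.
  lra.
- by apply: le_trans bb _; have [] := hb.
- by rewrite divr_ge0 ?(ltW nu0) // mulr_ge0 // sqr_ge0.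
- exact: om_le.
- exact: nuQ.
- by rewrite /om divfK ?gt_eqF //; ring.
- by move=> v; exact: h0.
- by move=> v; rewrite ltnS; exact: leq_bigmax.
- by move=> v; exact: (@leq_bigmax _ (fun v : 'I_n => 4 * (depth E Q v).+1)%N v).
- by rewrite mulr_ge0 // ltW.
- apply: (@le_trans _ _ (beta * (2 * Csp + 1))); last by have [_ h2] := hb; clear -h2; lra.
  rewrite /b mulrDr mulr1 mulrDr mulr1.
  have -> : beta / Num.sqrt d * (2 * (Csp * Num.sqrt d)) = beta * (2 * Csp).
    by field; rewrite gt_eqF.
  by rewrite lerD2l.
- by [].
Qed.

End asymptotics.

Lemma sum_inj_le (R : realType) (I : finType) (P : pred I) (h : I -> nat) (F : nat -> R) K :
  (forall k, 0 <= F k) -> (forall i, P i -> (h i < K)%N) ->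
  (forall i j, P i -> P j -> h i = h j -> i = j) ->
  \sum_(i | P i) F (h i) <= \sum_(k < K) F k.
Proof.
move=> F0 hK hinj.
have -> : \sum_(i | P i) F (h i) = \sum_(i | P i) \sum_(k < K) (h i == k)%:R * F k.
  apply: eq_bigr => i Pi; rewrite (bigD1 (Ordinal (hK i Pi))) //= eqxx mul1r big1 ?addr0 // => k.
  by rewrite -val_eqE /= eq_sym => /negbTE ->; rewrite mul0r.
rewrite exchange_big; apply: ler_sum => k _ /=; rewrite -mulr_suml ler_piMl //.
case: (boolP [exists i, P i && (h i == k)]) => [/existsP[i /andP[Pi hi]]|/existsPn no].
  rewrite (bigD1 i) //= hi big1 ?addr0 // => j /andP[Pj ji]; case: eqP => // hj.
  by rewrite (hinj j i) ?eqxx // in ji; rewrite hj (eqP hi).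
rewrite big1 // => i Pi; have := no i; rewrite Pi /=.
by move/negbTE => ->.
Qed.

(** * Rounding to integer vectors *)

Section rounding.
Variables (R : realType) (n : nat) (c : upair n -> bool) (D : {set upair n}).
Implicit Types (x y z : 'I_n -> R) (k : 'I_n).

Definition upd x k t : 'I_n -> R := fun i => if i == k then t else x i.

(** The ends of an edge are distinct, so no coordinate is ever squared. *)
Lemma sform_affine x k t : sform c D (upd x k t) =
  sform c D (upd x k 0) + t * (sform c D (upd x k 1) - sform c D (upd x k 0)).
Proof.
rewrite /sform -sumrB mulr_sumr -big_split; apply: eq_bigr => p _ /=; rewrite /upd.
case: eqP => [e1|_]; case: eqP => [e2|_]; try ring.
by have := ends_lt p; rewrite e1 e2 ltnn.
Qed.

Lemma upd_id x k : upd x k (x k) = x.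
Proof. by apply/funext => i; rewrite /upd; case: eqP => [->|]. Qed.

(* The form is affine in each coordinate, hence does not decrease under one of the two roundings. *)
Lemma round_one x k : exists m : int,
  [/\ `|m%:~R| <= `|x k| + 1, (x k = 0 -> m = 0) & sform c D x <= sform c D (upd x k m%:~R)].
Proof.
have [x0|x0] := eqVneq (x k) 0.
  exists 0; split=> //; first by rewrite normr0 addr_ge0.
  by rewrite mulr0z -x0 upd_id.
set f := Num.floor (x k).
have f1 : f%:~R <= x k by exact: Num.Theory.floor_le.
have f2 : x k < (f + 1)%:~R by exact: Num.Theory.floorD1_gt.
have f3 : (f + 1)%:~R = f%:~R + 1 :> R by rewrite intrD.
have nx := ler_norm (x k); have nx' := ler_norm (- x k); rewrite normrN in nx'.
rewrite -[in sform c D x](upd_id x k) sform_affine.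
have [B0|B0] := leP 0 (sform c D (upd x k 1) - sform c D (upd x k 0)).
  exists (f + 1); split => //.
  - by rewrite ler_norml; lra.
  - by move=> e; rewrite e eqxx in x0.
  - by rewrite [leRHS]sform_affine lerD2l ler_wpM2r // ltW.
exists f; split => //.
- by rewrite ler_norml; lra.
- by move=> e; rewrite e eqxx in x0.
- by rewrite [leRHS]sform_affine lerD2l ler_wnM2r // ltW.
Qed.

(** Coordinates are rounded one after another. Zeros are kept, so the integer vector still vanishes
    at bad vertices, where degrees are unbounded. *)
Lemma rounding x : exists z : 'I_n -> int,
  [/\ forall i, `|(z i)%:~R| <= `|x i| + 1, forall i, x i = 0 -> z i = 0 &
      sform c D x <= sform c D (fun i => (z i)%:~R)].
Proof.
suff hm : forall m, exists z : 'I_n -> int,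
  [/\ forall i, `|(z i)%:~R| <= `|x i| + 1, forall i, x i = 0 -> z i = 0 &
      sform c D x <= sform c D (fun i => if (i < m)%N then (z i)%:~R else x i)].
  have [z [z1 z2 z3]] := hm n; exists z; split=> //; apply: le_trans z3 _.
  by rewrite le_eqVlt; apply/orP; left; apply/eqP; congr sform; apply/funext => i; rewrite ltn_ord.
elim=> [|m [z [z1 z2 z3]]].
  exists (fun=> 0); split=> // i; first by rewrite normr0 addr_ge0.
have [mn|nm] := ltnP m n; last first.
  exists z; split=> //; apply: le_trans z3 _.
  rewrite le_eqVlt; apply/orP; left; apply/eqP; congr sform; apply/funext => i.
  by rewrite (leq_trans (ltn_ord i) nm) (leq_trans (ltn_ord i) (leqW nm)).
pose k := Ordinal mn.
have [a [a1 a2 a3]] := round_one (fun i => if (i < m)%N then (z i)%:~R else x i) k.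
rewrite /= ltnn in a1 a2.
exists (fun i => if i == k then a else z i); split.
- by move=> i; case: eqP => [->|_].
- by move=> i; case: eqP => [->|_]; [exact: a2 | exact: z2].
apply: le_trans z3 _; apply: le_trans a3 _.
rewrite le_eqVlt; apply/orP; left; apply/eqP; congr sform; apply/funext => i; rewrite /upd.
have [->|ik] := eqVneq i k; first by rewrite /= ltnSn.
have im : (i != m :> nat) by move: ik; rewrite -val_eqE.
by rewrite ltnS [(i <= m)%N]leq_eqVlt (negbTE im).
Qed.

End rounding.

(** * Discrepancy, light pairs and level sets *)

Section cross_edges.
Variables (R : realType) (n : nat) (E : {set upair n}).
Implicit Types (S T : {set 'I_n}) (p : upair n).

Definition cross S T p : bool :=
  ((val p).1 \in S) && ((val p).2 \in T) || ((val p).2 \in S) && ((val p).1 \in T).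

Definition ecross S T : nat := #|[set p in E | cross S T p]|.

(* The Chernoff bound with parameter (i + 1) / 2. Optimising over i replaces the logarithmic
   alternative in the discrepancy property of Kahn and Szemeredi. *)
Definition discrepancy (d : R) : Prop := forall S T i, S \subset T -> (0 < #|T|)%N -> (i <= n.+2)%N ->
  (ecross S T)%:R <= 8 * 2 ^+ i * d * #|S|%:R * #|T|%:R / n%:R +
    12 * #|T|%:R * (1 + ln (n%:R / #|T|%:R)) / i.+1%:R.

(** The radius 4 n accommodates the rounding of a vector of square norm n, because (|x| + 1) ^ 2 <=
    2 x ^ 2 + 2. *)
Definition light_bound (d : R) (c : upair n -> bool) : Prop := forall z : 'I_n -> int,
  \sum_i ((z i)%:~R : R) ^+ 2 <= 4 * n%:R ->
  `|\sum_(p in E | `|(z (val p).1)%:~R * (z (val p).2)%:~R| <= Num.sqrt d)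
      sg R (c p) * (z (val p).1)%:~R * (z (val p).2)%:~R| <= 40 * Num.sqrt d * n%:R.

Lemma ecross_degree S T (m : R) : (forall i, i \in S -> (eto E [set i])%:R <= m) ->
  (ecross S T)%:R <= m * #|S|%:R.
Proof.
move=> hm; have sub : [set p in E | cross S T p] \subset
    \bigcup_(i in S) [set p in E | touches [set i] p].
  apply/fintype.subsetP => p; rewrite inE => /andP[pE /orP[] /andP[h _]].
    by apply/bigcupP; exists (val p).1; rewrite // inE pE /touches inE eqxx.
  by apply/bigcupP; exists (val p).2; rewrite // inE pE /touches !inE eqxx orbT.
apply: (@le_trans _ _ (\sum_(i in S) eto E [set i])%:R).
  rewrite ler_nat; apply: leq_trans (subset_leq_card sub) _; exact: card_bigcup_le.
rewrite natr_sum mulr_natr -sumr_const; exact: ler_sum.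
Qed.

Lemma conn1 i : conn E [set i].
Proof.
apply/connP; split; first by rewrite cards1.
move=> A A1 A0 nA; case/negP: nA; rewrite eqEsubset A1 /= sub1set.
case/card_gt0P: A0 => j jA; have := fintype.subsetP A1 j jA; rewrite inE => /eqP <-.
exact: jA.
Qed.

End cross_edges.

Section levels.
Variables (R : realType) (n : nat) (w : 'I_n -> nat).

(** Superlevel sets in place of dyadic shells: they are nested, which provides the inclusion assumed
    in [discrepancy]. *)
Definition level a : {set 'I_n} := [set i | (2 ^ a <= w i)%N].

Lemma pow4_sum (A m : nat) : (3 * (\sum_(a < A) (2 ^ a <= m) * 4 ^ a) <= 4 * m ^ 2)%N.
Proof.
elim: A => [|A IH]; first by rewrite big_ord0.
rewrite big_ord_recr /=; case: (leqP (2 ^ A) m) => h; last by rewrite mul0n addn0.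
have -> : (\sum_(a < A) (2 ^ a <= m) * 4 ^ a = \sum_(a < A) 4 ^ a)%N.
  apply: eq_bigr => a _; have -> : (2 ^ a <= m)%N; last by rewrite mul1n.
  by apply: leq_trans h; rewrite leq_exp2l // ltnW.
have g : forall B, (3 * (\sum_(a < B) 4 ^ a) + 1 = 4 ^ B)%N.
  elim=> [|B IHB]; first by rewrite big_ord0.
  rewrite big_ord_recr /= expnS; move: (\sum_(a < B) _)%N IHB => S <-; lia.
have := g A; have h2 : (4 ^ A <= m ^ 2)%N by rewrite -[4%N]/(2 ^ 2)%N -expnM mulnC expnM leq_sqr.
by rewrite mul1n; lia.
Qed.

Lemma level_sum A (K : R) : \sum_i (w i)%:R ^+ 2 <= K ->
  \sum_(a < A) 4 ^+ a * #|level a|%:R <= 4 / 3 * K.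
Proof.
move=> hK; apply: le_trans (_ : 4 / 3 * \sum_i (w i)%:R ^+ 2 <= _); last first.
  by rewrite ler_wpM2l //; lra.
have -> : \sum_(a < A) 4 ^+ a * #|level a|%:R =
    \sum_i (\sum_(a < A) (2 ^ a <= w i) * 4 ^ a)%N%:R :> R.
  transitivity (\sum_(a < A) \sum_i ((2 ^ a <= w i) * 4 ^ a)%N%:R : R).
    apply: eq_bigr => a _; rewrite -sum1_card natr_sum mulr_sumr big_mkcond /=.
    apply: eq_bigr => i _; rewrite inE; case: leqP => _; last by rewrite mul0n.
    by rewrite mul1n mulr1 natrX.
  by rewrite exchange_big; apply: eq_bigr => i _; rewrite natr_sum.
rewrite mulr_sumr; apply: ler_sum => i _.
have := pow4_sum A (w i); rewrite -(ler_nat R) (natrM _ 3) (natrM _ 4) natrX; lra.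
Qed.

End levels.

(** This is ln y <= y - 1 at y = (N / t) 16 ^ (-a), with ln 16 <= 4. The logarithm is traded for a
    multiple of the level a plus an error that can be summed over the levels. *)
Lemma logn_split (R : realType) (N t : R) a : 0 < N -> 0 < t ->
  t * (1 + ln (N / t)) <= 4 * a%:R * t + N * 16^-1 ^+ a.
Proof.
move=> N0 t0; pose y := N / t * 16^-1 ^+ a.
have y0 : 0 < y by rewrite mulr_gt0 ?divr_gt0 // exprn_gt0 // invr_gt0.
have x0 : 0 < N / t by rewrite divr_gt0.
have ly : ln y <= y - 1.
  have := expR_ge1Dx (ln y); rewrite lnK ?posrE //; lra.
have l16 : ln (16 : R) <= 4.
  have l2 : ln (2 : R) <= 1.
    have := expR_ge1Dx (ln (2 : R)); rewrite lnK ?posrE //; lra.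
  have -> : (16 : R) = 2 ^+ 4 by rewrite -natrX.
  by rewrite lnXn // -[ln 2 *+ 4]mulr_natr; lra.
have -> : ln (N / t) = ln y + ln 16 * a%:R.
  have -> : N / t = y * 16 ^+ a by rewrite /y -mulrA -exprMn mulVf // expr1n mulr1.
  by rewrite lnM ?posrE ?exprn_gt0 // lnXn // mulr_natr.
have -> : N * 16^-1 ^+ a = t * y by rewrite /y; field; rewrite gt_eqF.
rewrite -[4 * _ * t]mulrC -mulrDr ler_wpM2l ?(ltW t0) //.
have : ln 16 * a%:R <= 4 * a%:R :> R by rewrite ler_wpM2r.
lra.
Qed.

Lemma dyadic_above (R : realType) (x : R) : 1 < x -> exists D : nat, x <= 2 ^+ D /\ 2 ^+ D <= 2 * x.
Proof.
move=> x1; have ex : exists D, x <= 2 ^+ D.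
  have [k h] := eventually_nat_ge x; exists k; apply: le_trans h _.
  by rewrite -natrX ler_nat; exact/ltnW/ltn_expl.
case: (ex_minnP ex) => D hD min; exists D; split=> //.
case: D hD min => [|D] hD min; first by move: hD; rewrite expr0 leNgt x1.
rewrite exprS ler_wpM2l //; have [//|h] := leP (2 ^+ D) x.
by have := min D (ltW h); rewrite ltnn.
Qed.

(** If a + b >= D, the numbers a + D - b and a + b - D add up to 2 a, and (1 + x) (1 + y) >= 1 + x +
    y. Otherwise the first factor alone is large enough. *)
Lemma balance_nat a b D : (a <= b)%N -> (b < a + D)%N ->
  (1 + 2 * a <= (a + D - b).+1 * (a + b - D).+1)%N.
Proof.
move=> ab bD; have [h|h] := leqP (a + D - b) (2 * a)%N.
  have -> : (a + b - D = 2 * a - (a + D - b))%N by lia.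
  move: (a + D - b)%N h => k h.
  have [m ->] : exists m, (2 * a = k + m)%N by exists (2 * a - k)%N; lia.
  by rewrite addKn; nia.
by apply: leq_trans (leq_pmulr _ _); lia.
Qed.

(** * The Kahn-Szemeredi bound for an integer vector *)

Section spectral.
Variables (R : realType) (n : nat) (E : {set upair n}) (c : upair n -> bool) (d Md : R).
Variables (z : 'I_n -> int) (D : nat).
Hypotheses (n0 : (0 < n)%N) (d1 : 1 < d) (Md0 : 0 <= Md).
Hypothesis disc : discrepancy E d.
Hypothesis D1 : Num.sqrt d <= 2 ^+ D.
Hypothesis D2 : 2 ^+ D <= 2 * Num.sqrt d.
Hypothesis deg : forall i, z i != 0 -> (eto E [set i])%:R <= Md * d.
Hypothesis zn : \sum_i ((z i)%:~R : R) ^+ 2 <= 4 * n%:R.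

Let w i : nat := `|z i|%N.
Let U a := level w a.
Let r := Num.sqrt d.
Let A := n.+3.

Lemma sqrt_degree_gt0 : 0 < r.
Proof. by rewrite /r sqrtr_gt0 (lt_trans ltr01). Qed.

Lemma sqr_sqrt_degree : r * r = d.
Proof. by rewrite -expr2 sqr_sqrtr // ltW // (lt_trans ltr01). Qed.

Lemma size_gt0 : 0 < n%:R :> R. Proof. by rewrite ltr0n. Qed.

Lemma abs_int i : (w i)%:R = `|(z i)%:~R| :> R.
Proof. by rewrite /w natr_absz intr_norm. Qed.

Lemma wsum : \sum_i (w i)%:R ^+ 2 <= 4 * n%:R :> R.
Proof. by apply: le_trans zn; apply: ler_sum => i _; rewrite abs_int real_normK ?num_real. Qed.

Definition al a : R := 4 ^+ a * #|U a|%:R.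

Lemma al_ge0 a : 0 <= al a. Proof. by rewrite mulr_ge0 ?exprn_ge0. Qed.

Lemma al_sum : \sum_(a < A) al a <= 6 * n%:R.
Proof. by have := level_sum A wsum; rewrite -/al => h; apply: le_trans h _; have := size_gt0; lra. Qed.

(** Entries are at most 2 sqrt n, so 2 ^ (a + b) <= 4 n <= 2 ^ (n + 2). This keeps the parameter i
    within the range of [discrepancy]. *)
Lemma level_pow a b : (0 < #|U a|)%N -> (0 < #|U b|)%N -> (a + b <= n.+2)%N.
Proof.
move=> /card_gt0P[i]; rewrite inE => hi /card_gt0P[j]; rewrite inE => hj.
have w2 k : ((w k) ^ 2 <= 4 * n)%N.
  rewrite -(ler_nat R) natrX natrM; apply: le_trans wsum.
  by rewrite (bigD1 k) //= lerDl; apply: sumr_ge0 => l _; rewrite sqr_ge0.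
have h : ((2 ^ (a + b)) ^ 2 <= (2 ^ n.+2) ^ 2)%N.
  rewrite expnD expnMn; apply: (@leq_trans ((w i) ^ 2 * (w j) ^ 2)).
    by apply: leq_mul; rewrite leq_sqr.
  apply: (leq_trans (leq_mul (w2 i) (w2 j))).
  rewrite -mulnn; have : (4 * n <= 2 ^ n.+2)%N.
    by rewrite expnS expnS mulnA leq_mul2l /=; exact/ltnW/ltn_expl.
  by move=> hh; exact: leq_mul.
by move: h; rewrite leq_sqr leq_exp2l.
Qed.

(* For b >= a + D the degree bound is used, and otherwise the two terms of [discrepancy] with
   i = a + b - D, where 2 ^ D is comparable to sqrt d. *)
Definition pair_bound a b : R :=
  (if (a + D <= b)%N then Md * d * al b * 2^-1 ^+ (b - a) else 0)
  + 32 * r * al a * al b / n%:R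
  + (if (b < a + D)%N
     then 48 * r * (2^-1 ^+ (a + D - b) * (a + D - b).+1%:R) * (al a + n%:R * 4^-1 ^+ a) else 0).

Lemma pair_bound_ge0 a b : 0 <= pair_bound a b.
Proof.
have h2 k : 0 <= 2^-1 ^+ k :> R by rewrite exprn_ge0.
have rn := ltW sqrt_degree_gt0; have dn : 0 <= d := ltW (lt_trans ltr01 d1).
rewrite /pair_bound; apply: addr_ge0; first apply: addr_ge0.
- case: ifP => _ //; apply: mulr_ge0 => //; apply: mulr_ge0; last exact: al_ge0.
  by rewrite mulr_ge0.
- apply: divr_ge0 => //; apply: mulr_ge0; last exact: al_ge0.
  by apply: mulr_ge0; [rewrite mulr_ge0 | exact: al_ge0].
- case: ifP => _ //; apply: mulr_ge0; last first.
    by apply: addr_ge0; [exact: al_ge0 | rewrite mulr_ge0 // exprn_ge0].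
  by apply: mulr_ge0; rewrite mulr_ge0.
Qed.

Lemma pair_le a b : (a <= b)%N -> r < 2 ^+ (a + b + 2) ->
  2 ^+ (a + b) * (ecross E (U b) (U a))%:R <= pair_bound a b.
Proof.
move=> ab heavy.
have UU : U b \subset U a.
  by apply/fintype.subsetP => i; rewrite !inE; apply: leq_trans; rewrite leq_exp2l.
have [/eqP|Ub] := posnP #|U b|.
  rewrite cards_eq0 => /eqP Ub0; suff -> : ecross E (U b) (U a) = 0%N.
    by rewrite mulr0 pair_bound_ge0.
  apply/eqP; rewrite cards_eq0; apply/eqP/setP => p.
  by rewrite /cross Ub0 !inE andbF.
have Ua : (0 < #|U a|)%N by apply: leq_trans Ub _; exact: subset_leq_card.
have abn := level_pow Ua Ub.
have p2 k : 0 < 2 ^+ k :> R by rewrite exprn_gt0.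
have e4 k : 4 ^+ k = 2 ^+ k * 2 ^+ k :> R by rewrite -exprMn; congr (_ ^+ _); lra.
have e2 k l : 2 ^+ (k + l) * 2^-1 ^+ l = 2 ^+ k :> R.
  by rewrite exprD -mulrA -exprMn mulfV // expr1n mulr1.
have rn := ltW sqrt_degree_gt0.
set s : R := #|U b|%:R; set t : R := #|U a|%:R.
have t0 : 0 < t by rewrite ltr0n.
have s0 : 0 < s by rewrite ltr0n.
set e := (ecross E (U b) (U a))%:R.
have mid : 0 <= 32 * r * al a * al b / n%:R.
  apply: divr_ge0 => //; apply: mulr_ge0; last exact: al_ge0.
  by apply: mulr_ge0; [rewrite mulr_ge0 | exact: al_ge0].
have [cas|cas] := leqP (a + D) b.
  have hdeg : e <= Md * d * s.
    apply: ecross_degree => i; rewrite inE => hi; apply: deg; apply/eqP => zi.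
    by move: hi; rewrite /w zi leqn0 expn_eq0.
  rewrite /pair_bound cas ltnNge cas /= addr0.
  suff -> : Md * d * al b * 2^-1 ^+ (b - a) = 2 ^+ (a + b) * (Md * d * s).
    have := ler_wpM2l (ltW (p2 (a + b)%N)) hdeg; lra.
  have ab2 : 2 ^+ b * 2^-1 ^+ (b - a) = 2 ^+ a :> R by rewrite -{1}(subnKC ab) e2.
  rewrite /al -/s e4 exprD -ab2; ring.
rewrite /pair_bound leqNgt cas /= add0r.
set k := (a + D - b)%N; set i := (a + b - D)%N.
have k1 : (0 < k)%N by rewrite /k subn_gt0.
have iN : (i <= n.+2)%N by apply: leq_trans abn; rewrite /i leq_subr.
have he := disc UU Ua iN; rewrite -/e -/s -/t in he.
(* Here heaviness is used: if D > a + b, then i = 0 and the inequality is [heavy]. *)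
have pi_le : r * 2 ^+ i <= 4 * 2 ^+ (a + b).
  have [Dab|Dab] := leqP D (a + b).
    apply: (@le_trans _ _ (2 ^+ D * 2 ^+ i)); first by rewrite ler_wpM2r // ltW.
    by rewrite -exprD /i subnKC //; have := p2 (a + b)%N; lra.
  have -> : i = 0%N by apply/eqP; rewrite /i subn_eq0 ltnW.
  by move: heavy; rewrite exprD; lra.
(* The denominator i + 1 pays for the factor of order a left by the logarithm, up to k + 1, which is
   summable against 2 ^ (-k). *)
have ki : 1 + 2 * a%:R <= k.+1%:R * i.+1%:R :> R.
  have := balance_nat ab cas; rewrite -/k -/i.
  by rewrite -(ler_nat R) natrD !natrM.
have pk : 2 ^+ (a + b) * 2 ^+ k = 4 ^+ a * 2 ^+ D :> R.
  by rewrite e4 -!exprD; congr (_ ^+ _); rewrite /k; clear -cas; lia.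
have hsplit := logn_split a size_gt0 t0.
have np := size_gt0; set N := n%:R in np he hsplit mid *.
have i1 : 0 < i.+1%:R :> R by rewrite ltr0n.
have k2 : 2^-1 ^+ k * 2 ^+ k = 1 :> R by rewrite -exprMn mulVf // expr1n.
set X := 2 ^+ (a + b) in pi_le pk *.
have X0 : 0 < X by exact: p2.
apply: (@le_trans _ _ (X * (8 * 2 ^+ i * d * s * t / N + 12 * t * (1 + ln (N / t)) / i.+1%:R))).
  by rewrite ler_wpM2l // ltW.
rewrite mulrDr; apply: lerD.
  have -> : X * (8 * 2 ^+ i * d * s * t / N) = (r * 2 ^+ i) * (8 * X * r * s * t / N).
    by rewrite -sqr_sqrt_degree; ring.
  have -> : 32 * r * al a * al b / N = 4 * X * (8 * X * r * s * t / N).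
    by rewrite /al -/s -/t !e4 /X exprD; ring.
  apply: ler_wpM2r => //; apply: divr_ge0; last exact: ltW.
  by apply: mulr_ge0; [apply: mulr_ge0; [rewrite mulr_ge0 // mulr_ge0 // ltW | exact: ltW] | exact: ltW].
have main : t * (1 + ln (N / t)) / i.+1%:R <= 2 * k.+1%:R * t + N * 16^-1 ^+ a.
  rewrite ler_pdivrMr //; apply: le_trans hsplit _.
  have n16 : 0 <= N * 16^-1 ^+ a by rewrite mulr_ge0 ?exprn_ge0 // ltW.
  rewrite [leRHS]mulrDl; apply: lerD.
    have := ler_wpM2r (ltW t0) ki; rewrite mulrDl mul1r.
    have -> : 2 * k.+1%:R * t * i.+1%:R = 2 * (k.+1%:R * i.+1%:R * t) by ring.
    by move: (ltW t0); lra.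
  by rewrite ler_peMr // ler1n.
have k10 : 1 <= k.+1%:R :> R by rewrite ler1n.
have XE : X = 4 ^+ a * 2 ^+ D * 2^-1 ^+ k.
  by rewrite -pk -mulrA [2 ^+ k * _]mulrC k2 mulr1.
have n4 : 4 ^+ a * 16^-1 ^+ a = 4^-1 ^+ a :> R by rewrite -exprMn; congr (_ ^+ _); lra.
have P4 : 0 <= 4 ^+ a :> R by rewrite exprn_ge0.
have Pk : 0 <= 2^-1 ^+ k :> R by rewrite exprn_ge0.
have P41 : 0 <= 4^-1 ^+ a :> R by rewrite exprn_ge0.
apply: (@le_trans _ _ (X * (12 * (2 * k.+1%:R * t + N * 16^-1 ^+ a)))).
  have -> : 12 * t * (1 + ln (N / t)) / i.+1%:R = 12 * (t * (1 + ln (N / t)) / i.+1%:R) by ring.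
  by rewrite ler_wpM2l ?(ltW X0) // ler_wpM2l.
have -> : X * (12 * (2 * k.+1%:R * t + N * 16^-1 ^+ a)) =
    2 ^+ D * (12 * 2^-1 ^+ k * (2 * k.+1%:R * al a + N * 4^-1 ^+ a)).
  by rewrite XE /al -/t -n4; ring.
have -> : 48 * r * (2^-1 ^+ k * k.+1%:R) * (al a + N * 4^-1 ^+ a) =
    (2 * r) * (12 * 2^-1 ^+ k * (2 * k.+1%:R * al a + 2 * k.+1%:R * (N * 4^-1 ^+ a))) by ring.
have M0 : 0 <= N * 4^-1 ^+ a by rewrite mulr_ge0 // ltW.
have a0 := al_ge0 a.
apply: ler_pM => //.
- apply: mulr_ge0; first by rewrite mulr_ge0.
  by apply: addr_ge0 => //; rewrite mulr_ge0 // mulr_ge0 //; lra.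
- apply: ler_wpM2l; first by rewrite mulr_ge0.
  by rewrite lerD2l ler_peMl //; lra.
Qed.

(** The first and third terms decay geometrically away from b = a + D, and the total of [al] is at
    most 6 n. The three contributions are 12 Md, 32 * 36 = 1152 and 48 * 4 * 8 = 1536. *)
Lemma pair_bound_sum : \sum_(a < A) \sum_(b < A) pair_bound a b <= (12 * Md + 2688) * r * n%:R.
Proof.
have rn := ltW sqrt_degree_gt0; have dn : 0 <= d := ltW (lt_trans ltr01 d1).
have S0 : 0 <= \sum_(a < A) al a by apply: sumr_ge0 => a _; exact: al_ge0.
have hS := al_sum; set S := \sum_(a < A) al a in S0 hS.
have T1 : \sum_(a < A) \sum_(b < A) (if (a + D <= b)%N then Md * d * al b * 2^-1 ^+ (b - a) else 0)
    <= 12 * Md * r * n%:R.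
  rewrite exchange_big /=.
  apply: (@le_trans _ _ (\sum_(b < A) al b * (Md * d * (2^-1 ^+ D * 2)))).
    apply: ler_sum => b _; rewrite -big_mkcond /=.
    have -> : \sum_(a < A | (a + D <= b)%N) Md * d * al b * 2^-1 ^+ (b - a) =
        al b * (Md * d * (2^-1 ^+ D * \sum_(a < A | (a + D <= b)%N) 2^-1 ^+ (b - D - a))).
      rewrite !mulr_sumr; apply: eq_bigr => a h; have -> : (b - a = D + (b - D - a))%N by clear -h; lia.
      rewrite exprD; ring.
    apply: ler_wpM2l; first exact: al_ge0.
    apply: ler_wpM2l; first by rewrite mulr_ge0.
    apply: ler_wpM2l; first by rewrite exprn_ge0.
    apply: le_trans (@geom_le R 2^-1 b.+1 _ _); last first.
    - by lra.
    - by lra.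
    apply: (sum_inj_le (F := fun k => 2^-1 ^+ k) (h := fun a : 'I_A => (b - D - a)%N)).
    - by move=> k; rewrite exprn_ge0.
    - by move=> a _; rewrite ltnS -subnDA leq_subr.
    - by move=> a a' h h' e; apply: val_inj => /=; clear -h h' e; lia.
  rewrite -mulr_suml -/S.
  have dD : d * 2^-1 ^+ D <= r.
    rewrite -sqr_sqrt_degree exprVn ler_pdivrMr ?exprn_gt0 //.
    by rewrite ler_wpM2l.
  apply: (@le_trans _ _ (6 * n%:R * (Md * d * (2^-1 ^+ D * 2)))).
    by rewrite ler_wpM2r // mulr_ge0 ?mulr_ge0 ?exprn_ge0.
  have -> : 6 * n%:R * (Md * d * (2^-1 ^+ D * 2)) = (12 * Md * n%:R) * (d * 2^-1 ^+ D) by ring.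
  have -> : 12 * Md * r * n%:R = (12 * Md * n%:R) * r by ring.
  by rewrite ler_wpM2l // mulr_ge0 // mulr_ge0.
have T2 : \sum_(a < A) \sum_(b < A) 32 * r * al a * al b / n%:R <= 1152 * r * n%:R.
  have -> : \sum_(a < A) \sum_(b < A) 32 * r * al a * al b / n%:R = 32 * r * (S * S) / n%:R.
    rewrite {1}/S mulr_suml mulr_sumr mulr_suml; apply: eq_bigr => a _.
    by rewrite /S !mulr_sumr mulr_suml; apply: eq_bigr => b _; ring.
  rewrite ler_pdivrMr ?size_gt0 //.
  have : S * S <= 6 * n%:R * (6 * n%:R) by apply: ler_pM.
  move=> h; have -> : 1152 * r * n%:R * n%:R = 32 * r * (6 * n%:R * (6 * n%:R)) by ring.
  by rewrite ler_wpM2l // mulr_ge0.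
have T3 : \sum_(a < A) \sum_(b < A) (if (b < a + D)%N
     then 48 * r * (2^-1 ^+ (a + D - b) * (a + D - b).+1%:R) * (al a + n%:R * 4^-1 ^+ a) else 0)
    <= 1536 * r * n%:R.
  apply: (@le_trans _ _ (\sum_(a < A) 48 * r * 4 * (al a + n%:R * 4^-1 ^+ a))).
    apply: ler_sum => a _; rewrite -big_mkcond /= -mulr_suml.
    apply: ler_wpM2r; first by rewrite addr_ge0 ?al_ge0 // mulr_ge0 // exprn_ge0.
    rewrite -mulr_sumr; apply: ler_wpM2l; first by rewrite mulr_ge0.
    have h8 : \sum_(k < (a + D).+1) 2^-1 ^+ k * (2 * k.+1%:R) <= 8 :> R.
      by apply: arith_geom_le; lra.
    have : \sum_(b < A | (b < a + D)%N) (2^-1 ^+ (a + D - b) * (a + D - b).+1%:R) <=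
        \sum_(k < (a + D).+1) 2^-1 ^+ k * k.+1%:R :> R.
      apply: (sum_inj_le (F := fun k => 2^-1 ^+ k * k.+1%:R) (h := fun b : 'I_A => (a + D - b)%N)).
      - by move=> k; rewrite mulr_ge0 ?exprn_ge0.
      - by move=> b _; rewrite ltnS leq_subr.
      - by move=> b b' h h' e; apply: val_inj => /=; clear -h h' e; lia.
    have : \sum_(k < (a + D).+1) 2^-1 ^+ k * (2 * k.+1%:R) =
        2 * \sum_(k < (a + D).+1) 2^-1 ^+ k * k.+1%:R :> R.
      by rewrite mulr_sumr; apply: eq_bigr => k _; ring.
    lra.
  rewrite -mulr_sumr big_split /= -mulr_sumr -/S.
  have g : \sum_(a < A) 4^-1 ^+ a <= 2 :> R by apply: geom_le; lra.
  have h : S + n%:R * \sum_(a < A) 4^-1 ^+ a <= 8 * n%:R.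
    have : n%:R * \sum_(a < A) 4^-1 ^+ a <= n%:R * 2 :> R by rewrite ler_wpM2l.
    lra.
  have -> : 1536 * r * n%:R = 48 * r * 4 * (8 * n%:R) by ring.
  by apply: ler_wpM2l => //; rewrite mulr_ge0 // mulr_ge0.
have -> : \sum_(a < A) \sum_(b < A) pair_bound a b =
    \sum_(a < A) \sum_(b < A) (if (a + D <= b)%N then Md * d * al b * 2^-1 ^+ (b - a) else 0) +
    \sum_(a < A) \sum_(b < A) 32 * r * al a * al b / n%:R +
    \sum_(a < A) \sum_(b < A) (if (b < a + D)%N
     then 48 * r * (2^-1 ^+ (a + D - b) * (a + D - b).+1%:R) * (al a + n%:R * 4^-1 ^+ a) else 0).
  by rewrite -!big_split; apply: eq_bigr => a _; rewrite -!big_split.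
have -> : (12 * Md + 2688) * r * n%:R = 12 * Md * r * n%:R + 1152 * r * n%:R + 1536 * r * n%:R by ring.
by apply: lerD => //; apply: lerD.
Qed.

(** A heavy edge is charged to one pair of levels, the binary logarithms of its two entries; the
    factor 4 is the rounding of both to powers of 2. *)
Lemma heavy_le : \sum_(p in E | ~~ (`|(z (val p).1)%:~R * (z (val p).2)%:~R| <= r))
    `|(z (val p).1)%:~R * (z (val p).2)%:~R| <= 4 * ((12 * Md + 2688) * r * n%:R).
Proof.
apply: (@le_trans _ _ (\sum_(p in E) \sum_(a < A) \sum_(b < A)
   ((a <= b)%N && (r < 2 ^+ (a + b + 2)))%:R * (4 * 2 ^+ (a + b)) * (cross (U b) (U a) p)%:R)).
  rewrite big_mkcondr /=; apply: ler_sum => p pE.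
  have nonneg a b : 0 <= ((a <= b)%N && (r < 2 ^+ (a + b + 2)))%:R * (4 * 2 ^+ (a + b))
      * (cross (U b) (U a) p)%:R :> R.
    by rewrite mulr_ge0 // mulr_ge0 // mulr_ge0 ?exprn_ge0.
  case: ifPn => [|_]; last by apply: sumr_ge0 => a _; apply: sumr_ge0 => b _.
  rewrite -ltNge normrM -!abs_int => heavy.
  have [w1 w2] : (0 < w (val p).1)%N /\ (0 < w (val p).2)%N.
    by split; rewrite lt0n; apply/eqP => e; move: heavy; rewrite e ?mul0r ?mulr0 ltNge (ltW sqrt_degree_gt0).
  set L1 := trunc_log 2 (w (val p).1); set L2 := trunc_log 2 (w (val p).2).
  have /andP[l1 u1] := @trunc_log_bounds 2 _ isT w1.
  have /andP[l2 u2] := @trunc_log_bounds 2 _ isT w2.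
  rewrite -/L1 in l1 u1; rewrite -/L2 in l2 u2.
  have i1 : (val p).1 \in U L1 by rewrite inE.
  have i2 : (val p).2 \in U L2 by rewrite inE.
  have L12 : (L1 + L2 <= n.+2)%N.
    by apply: level_pow; apply/card_gt0P; [exists (val p).1 | exists (val p).2].
  have ub : (w (val p).1)%:R * (w (val p).2)%:R <= 4 * 2 ^+ (L1 + L2) :> R.
    have -> : 4 * 2 ^+ (L1 + L2) = (2 ^ L1.+1)%:R * (2 ^ L2.+1)%:R :> R.
      by rewrite !natrX !exprS exprD; ring.
    by apply: ler_pM => //; rewrite ler_nat ltnW.
  have hv : r < 2 ^+ (L1 + L2 + 2).
    by apply: lt_le_trans heavy _; rewrite exprD [leRHS]mulrC; apply: (le_trans ub); rewrite expr2; lra.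
  have mx : (maxn L1 L2 < A)%N by rewrite gtn_max; apply/andP; split; rewrite /A; clear -L12; lia.
  have mn : (minn L1 L2 < A)%N by rewrite gtn_min; apply/orP; left; rewrite /A; clear -L12; lia.
  rewrite (bigD1 (Ordinal mn)) //= (bigD1 (Ordinal mx)) //=.
  have -> : cross (U (maxn L1 L2)) (U (minn L1 L2)) p.
    rewrite /cross; have [h|h] := leqP L1 L2.
      by rewrite i1 i2 orbT.
    by rewrite i1 i2.
  have mm : (minn L1 L2 <= maxn L1 L2)%N by rewrite geq_min leq_maxl.
  have sm : (minn L1 L2 + maxn L1 L2 = L1 + L2)%N by clear; lia.
  rewrite mm sm hv mul1r mulr1.
  apply: (le_trans ub); rewrite -addrA lerDl addr_ge0 //; apply: sumr_ge0 => a _ //.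
  by apply: sumr_ge0.
apply: le_trans (ler_wpM2l _ pair_bound_sum); last by [].
rewrite exchange_big mulr_sumr; apply: ler_sum => a _ /=.
rewrite exchange_big mulr_sumr; apply: ler_sum => b _ /=.
rewrite -mulr_sumr -natr_sum.
have -> : (\sum_(p in E) cross (U b) (U a) p = ecross E (U b) (U a))%N.
  rewrite /ecross -sum1_card big_mkcond [RHS]big_mkcond /=; apply: eq_bigr => p _.
  by rewrite inE; case: (p \in E) => //=; case: cross.
case: (boolP (_ && _)) => [/andP[ab hv]|_]; last first.
  by rewrite !mul0r mulr_ge0 // pair_bound_ge0.
by rewrite mul1r -mulrA ler_wpM2l // pair_le.
Qed.

Hypothesis light : light_bound E d c.

Lemma integer_form_bound : `|sform c E (fun i => (z i)%:~R)| <= (48 * Md + 10792) * r * n%:R.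
Proof.
rewrite /sform (bigID (fun p => `|(z (val p).1)%:~R * (z (val p).2)%:~R| <= r :> R)) /=.
apply: (le_trans (ler_normD _ _)).
have -> : (48 * Md + 10792) * r * n%:R = 40 * r * n%:R + 4 * ((12 * Md + 2688) * r * n%:R) by ring.
apply: lerD; first exact: light.
apply: le_trans heavy_le; apply: (le_trans (ler_norm_sum _ _ _)).
by apply: ler_sum => p _; rewrite -mulrA normrM sg_norm mul1r.
Qed.

End spectral.

Lemma sform_scale (R : realType) n (c : upair n -> bool) (D : {set upair n}) (y : 'I_n -> R) a :
  sform c D (fun i => a * y i) = a ^+ 2 * sform c D y.
Proof. by rewrite /sform mulr_sumr; apply: eq_bigr => p _; ring. Qed.

Lemma sform_negb (R : realType) n (c : upair n -> bool) (D : {set upair n}) (y : 'I_n -> R) :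
  sform (fun p => ~~ c p) D y = - sform c D y.
Proof.
rewrite /sform -sumrN; apply: eq_bigr => p _.
by rewrite /sg; case: (c p); rewrite /= ?expr0 ?expr1; ring.
Qed.

(** By homogeneity [y] is scaled to square norm n, then rounded. An upper bound is enough, since
    changing all signs negates the form. *)
Lemma spectral_bound (R : realType) n (E : {set upair n}) (c : upair n -> bool) (d Md : R) y :
  (0 < n)%N -> 1 < d -> 0 <= Md -> discrepancy E d -> light_bound E d c ->
  (forall i, badv E (Md * d) i -> y i = 0) ->
  `|sform c (bulkE E (Md * d)) y| <= (48 * Md + 10792) * Num.sqrt d * \sum_i y i ^+ 2.
Proof.
move=> n0 d1 Md0 disc light hy; set K := (48 * Md + 10792) * Num.sqrt d.
have np : 0 < n%:R :> R by rewrite ltr0n.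
have s1 : 1 < Num.sqrt d by rewrite -[1]sqrtr1 ltr_sqrt; lra.
have [D [D1 D2]] := dyadic_above s1.
have -> : sform c (bulkE E (Md * d)) y = sform c E y.
  rewrite /sform [RHS]big_mkcond [LHS]big_mkcond /=; apply: eq_bigr => p _; rewrite inE.
  case: (p \in E) => //=; case: ifPn => //; rewrite negbK => /orP[] /hy ->; by rewrite ?mulr0 ?mul0r.
set N2 := \sum_i _.
have N20 : 0 <= N2 by apply: sumr_ge0 => i _; rewrite sqr_ge0.
have [N2z|N2p] := eqVneq N2 0.
  have y0 i : y i = 0.
    have /psumr_eq0P h : forall i, true -> 0 <= y i ^+ 2 by move=> j _; rewrite sqr_ge0.
    by apply/eqP; rewrite -sqrf_eq0 (h N2z).
  by rewrite N2z mulr0 /sform big1 ?normr0 // => p _; rewrite y0 mulr0 mul0r.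
have N2g : 0 < N2 by rewrite lt_neqAle eq_sym N2p.
pose a := Num.sqrt (n%:R / N2); pose x i := a * y i.
have a2 : a ^+ 2 = n%:R / N2 by rewrite sqr_sqrtr // divr_ge0.
have x2 : \sum_i x i ^+ 2 = n%:R.
  under eq_bigr do rewrite exprMn a2; rewrite -mulr_sumr -/N2; field.
  by rewrite gt_eqF.
have key z : (forall i, `|(z i)%:~R| <= `|x i| + 1) -> (forall i, x i = 0 -> z i = 0) ->
    `|sform c E (fun i => (z i)%:~R)| <= K * n%:R.
  move=> z1 z2; apply: (integer_form_bound n0 d1 Md0 disc D1 D2 _ _ light).
    (* A vertex of degree at least Md * d is a bad set by itself, so [y], and with it the rounded
       vector, vanishes there. *)
    move=> i zi; rewrite leNgt; apply/negP => /ltW h; case/negP: zi; apply/eqP; apply: z2.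
    rewrite /x hy ?mulr0 //; apply/existsP; exists [set i]; rewrite inE eqxx /= /badset conn1 /=.
    by rewrite cards1 mulr1.
  apply: (@le_trans _ _ (\sum_i (2 * x i ^+ 2 + 2))).
    apply: ler_sum => i _; rewrite -(real_normK (num_real (_%:~R))) -(real_normK (num_real (x i))).
    have := z1 i; set u := `|(z i)%:~R|; set v := `|x i| => uv.
    have u0 : 0 <= u by exact: normr_ge0.
    have v0 : 0 <= v by exact: normr_ge0.
    have : u ^+ 2 <= (v + 1) ^+ 2 by rewrite lerXn2r // nnegrE addr_ge0.
    have -> : (v + 1) ^+ 2 = 2 * v ^+ 2 + 2 - (v - 1) ^+ 2 by ring.
    by have := sqr_ge0 (v - 1); lra.
  rewrite big_split /= -mulr_sumr x2 sumr_const card_ord -mulr_natr; lra.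
have up : forall c', (forall z, (forall i, `|(z i)%:~R| <= `|x i| + 1) -> (forall i, x i = 0 -> z i = 0) ->
    `|sform c' E (fun i => (z i)%:~R)| <= K * n%:R) -> sform c' E y <= K * N2.
  move=> c' hc; have [z [z1 z2 z3]] := rounding c' E x.
  have h := le_trans z3 (le_trans (ler_norm _) (hc z z1 z2)).
  rewrite sform_scale a2 in h.
  have -> : sform c' E y = N2 / n%:R * (n%:R / N2 * sform c' E y) by field; rewrite !gt_eqF.
  have -> : K * N2 = N2 / n%:R * (K * n%:R) by field; rewrite gt_eqF.
  by rewrite ler_wpM2l // divr_ge0.
rewrite ler_norml up // andbT lerNl -sform_negb; apply: up => z z1 z2.
by rewrite sform_negb normrN; exact: key.
Qed.

(** * Regularity of the random graph *)

Section spanning_tree.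
Variables (n : nat) (E : {set upair n}).

(** A tree grows from its root by one vertex across a cut at a time. [dep] decreases towards the
    root, which makes the parent edges of different vertices distinct. *)
Lemma conn_tree S : conn E S -> exists r (f : 'I_n -> 'I_n) (dep : 'I_n -> nat),
  r \in S /\ forall v, v \in S -> v != r -> [/\ f v \in S, adj E v (f v) & (dep (f v) < dep v)%N].
Proof.
move=> cS; have /card_gt0P[r rS] := conn_gt0 cS; have /connP[_ hS] := cS.
suff [A [f [dep [AS cA hA]]]] : exists (A : {set 'I_n}) (f : 'I_n -> 'I_n) (dep : 'I_n -> nat),
    [/\ A \subset S, #|A| = #|S| & r \in A /\
     forall v, v \in A -> v != r -> [/\ f v \in A, adj E v (f v) & (dep (f v) < dep v)%N]].
  have <- : A = S by apply/eqP; rewrite eqEcard AS cA leqnn.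
  by exists r, f, dep.
have : (0 < #|S| <= #|S|)%N by rewrite leqnn (conn_gt0 cS).
move: {1 2 4}#|S| => k; elim: k => // k IH /andP[_ kS].
have [k0|k0] := posnP k.
  exists [set r], id, (fun=> 0%N); rewrite k0 cards1 sub1set rS; split=> //.
  by split=> [|v]; rewrite inE ?eqxx // => ->.
have [|A [f [dep [AS cA [rA hA]]]]] := IH; first by rewrite k0 ltnW.
have [||x [y [xA yS yA xy]]] := hS A AS; first by rewrite cA.
  by apply/eqP => e; move: kS; rewrite -cA e ltnn.
exists (y |: A), (fun v => if v == y then x else f v), (fun v => if v == y then (dep x).+1 else dep v).
have neq v : v \in A -> (v == y) = false by move=> vA; apply: contraNF yA => /eqP <-.
split.
- by apply/fintype.subsetP => v; rewrite in_setU1 => /orP[/eqP->//|/(fintype.subsetP AS)].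
- by rewrite cardsU1 yA cA.
split; first by rewrite in_setU1 rA orbT.
move=> v; rewrite in_setU1 => /orP[/eqP->|vA] vr.
  by rewrite eqxx (neq x xA) in_setU1 xA orbT adjC xy ltnSn.
have [h1 h2 h3] := hA v vA vr.
by rewrite (neq v vA) (neq _ h1) in_setU1 h1 orbT.
Qed.

End spanning_tree.

Section random_edges.
Variables (R : realType) (n : nat) (pr : upair n -> R) (q : R).
Hypotheses (pr0 : forall p, 0 <= pr p) (prq : forall p, pr p <= q) (q1 : q <= 1).
Implicit Types (E X T : {set upair n}) (S : {set 'I_n}) (p : upair n).

Definition wE E : R := \prod_p (if p \in E then pr p else 1 - pr p).

Lemma pr_le1 p : 0 <= 1 - pr p. Proof. by rewrite subr_ge0 (le_trans (prq p)). Qed.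

Lemma wE_ge0 E : 0 <= wE E.
Proof. by apply: prodr_ge0 => p _; case: ifP => _; [exact: pr0 | exact: pr_le1]. Qed.

(** Independence of the edges, in the form of a generating function. *)
Lemma sum_wE_prod (x y : upair n -> R) :
  \sum_E wE E * \prod_p (if p \in E then x p else y p) = \prod_p (pr p * x p + (1 - pr p) * y p).
Proof.
rewrite bigA_distr [RHS](eq_bigl predT) => [|E]; last by rewrite inE.
apply: eq_bigr => E _; rewrite /wE -big_split; apply: eq_bigr => p _ /=.
by case: ifP.
Qed.

Lemma sum_wE : \sum_E wE E = 1.
Proof.
have := sum_wE_prod (fun=> 1) (fun=> 1).
rewrite (eq_bigr wE) => [->|E _]; last first.
  by rewrite big1 ?mulr1 // => p _; case: ifP.
by rewrite big1 // => p _; rewrite !mulr1 addrC subrK.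
Qed.

(* Exponential Markov inequality; the factor [y p = 0] on absent edges of [X] enforces [X \subset E]. *)
Lemma edges_tail X T (lam kap : R) : [disjoint X & T] -> 0 <= lam -> 0 <= q ->
  \sum_E wE E * ((X \subset E) && (kap <= #|E :&: T|%:R))%:R <=
  q ^+ #|X| * expR (q * #|T|%:R * expR lam - lam * kap).
Proof.
move=> XT lam0 q0.
pose x p : R := if p \in T then expR lam else 1; pose y p : R := if p \in X then 0 else 1.
apply: (@le_trans _ _ (expR (- (lam * kap)) * \sum_E wE E * \prod_p (if p \in E then x p else y p))).
  rewrite mulr_sumr; apply: ler_sum => E _; rewrite mulrCA ler_wpM2l ?wE_ge0 //.
  have pge : 0 <= \prod_p (if p \in E then x p else y p).
    apply: prodr_ge0 => p _; rewrite /x /y; case: ifP => _; case: ifP => _ //; exact: expR_ge0.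
  case: andP => [[XE hk]|_]; last by rewrite mulr_ge0 // expR_ge0.
  have -> : \prod_p (if p \in E then x p else y p) = expR (lam * #|E :&: T|%:R).
    transitivity (\prod_(p in E :&: T) expR lam).
      rewrite [RHS]big_mkcond; apply: eq_bigr => p _; rewrite inE /x /y.
      case: (boolP (p \in E)) => //= pE; case: ifP => // pX.
      by rewrite (fintype.subsetP XE p pX) in pE.
    by rewrite prodr_const -expRM_natl mulrC.
  apply: (@le_trans _ _ (expR 0)); first by rewrite expR0.
  by rewrite -expRD ler_expR addrC subr_ge0 ler_wpM2l.
rewrite sum_wE_prod mulrC expRD mulrA ler_wpM2r ?expR_ge0 //.
apply: (@le_trans _ _ (\prod_p ((if p \in X then q else 1) * (if p \in T then expR (q * expR lam) else 1)))).
  apply: ler_prod => p _; rewrite /x /y.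
  have e0 := expR_ge0 lam; have e1 : 1 <= expR lam by rewrite -(expR0 R) ler_expR.
  have [pX|pX] := boolP (p \in X).
    have -> : (p \in T) = false by exact: (disjointFr XT pX).
    by rewrite !mulr1 mulr0 addr0 pr0 prq.
  case: ifP => pT.
    rewrite mul1r mulr1; apply/andP; split; first by rewrite addr_ge0 ?pr_le1 // mulr_ge0 ?pr0.
    apply: (@le_trans _ _ (1 + q * expR lam)); last exact: expR_ge1Dx.
    have : pr p * expR lam <= q * expR lam by rewrite ler_wpM2r.
    by have := pr0 p; lra.
  by rewrite !mulr1 addrC subrK lexx ler01.
rewrite big_split /= -big_mkcond prodr_const -big_mkcond prodr_const.
by rewrite -expRM_natl mulrA [_ * q]mulrC.
Qed.

(* A spanning tree of S is coded by its root and its parent function: at most |S| ^ |S| choices. *)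
Lemma conn_tail S X (lam kap : R) : 0 <= lam -> 0 <= q ->
  \sum_E wE E * (conn E S && (kap + #|S|%:R <= #|E :&: X|%:R + 1))%:R <=
  #|S|%:R ^+ #|S| * q ^+ #|S|.-1 * expR (q * #|X|%:R * expR lam - lam * kap).
Proof.
move=> lam0 q0; set s := #|S|.
have [s0|s0] := posnP s.
  rewrite big1 => [|E _]; last by rewrite /conn -/s s0 mulr0.
  by rewrite mulr_ge0 ?expR_ge0 // mulr_ge0 ?exprn_ge0.
pose tr r (f : {ffun 'I_n -> 'I_n}) : {set upair n} :=
  [set p | [exists v in S :\ r, joins p v (f v)]].
pose ok r (f : {ffun 'I_n -> 'I_n}) E :=
  [&& #|tr r f| == s.-1, tr r f \subset E & kap <= #|E :&: (X :\: tr r f)|%:R :> R].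
apply: (@le_trans _ _ (\sum_E wE E * \sum_(r in S) \sum_(f in pffun_on r (mem (S :\ r)) (mem S)) (ok r f E)%:R)).
  apply: ler_sum => E _; rewrite ler_wpM2l ?wE_ge0 //.
  case: andP => [[cE hk]|_]; last by apply: sumr_ge0 => r _; apply: sumr_ge0.
  have [r [g [dep [rS hg]]]] := conn_tree cE.
  pose f := [ffun v => if v \in S :\ r then g v else r].
  have fE v : v \in S :\ r -> f v = g v by move=> h; rewrite ffunE h.
  have fP : f \in pffun_on r (mem (S :\ r)) (mem S).
    apply/pffun_onP; split.
      by apply/supportP => v vN; rewrite ffunE (negbTE vN).
    move=> y /fintype.imageP[v vD ->]; rewrite fE //.
    by move: vD; rewrite !inE => /andP[vr vS]; have [] := hg v vS vr.
  have edge v : v \in S :\ r -> exists2 p, p \in E & joins p v (f v).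
    move=> vD; rewrite fE //; move: vD; rewrite !inE => /andP[vr vS].
    by have [_ /adj_edge] := hg v vS vr.
  pose te v : option (upair n) := [pick p in E | joins p v (f v)].
  have teP v : v \in S :\ r -> exists p, [/\ te v = Some p, p \in E & joins p v (f v)].
    move=> /edge[p0 p0E j0]; rewrite /te; case: pickP => [p /andP[pE jp]|/(_ p0)]; first by exists p.
    by rewrite p0E j0.
  have trE : [set Some p | p in tr r f] = [set te v | v in S :\ r].
    apply/setP => o; apply/imsetP/imsetP.
      move=> [p]; rewrite inE => /existsP[v /andP[vD jp]] ->; exists v => //.
      by have [p' [-> _ jp']] := teP v vD; rewrite (joins_inj jp jp').
    move=> [v vD ->]; have [p' [-> _ jp']] := teP v vD; exists p' => //.
    by rewrite inE; apply/existsP; exists v; rewrite vD.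
  have ctr : #|tr r f| = s.-1.
    rewrite -(card_imset _ (@Some_inj _)) trE card_in_imset.
      by rewrite /s (cardsD1 r S) rS.
    move=> v w vD wD; have [p [-> _ jp]] := teP v vD; have [p' [-> _ jp']] := teP w wD => -[e].
    rewrite -e in jp'; have [[//]|[e1 e2]] := joins_ends_eq jp jp'.
    rewrite (fE w wD) in e1; rewrite (fE v vD) in e2.
    move: vD wD; rewrite !inE => /andP[vr vS] /andP[wr wS].
    have [_ _ d1] := hg v vS vr; have [_ _ d2] := hg w wS wr.
    by rewrite e2 in d1; rewrite -e1 in d2; have := ltn_trans d1 d2; rewrite ltnn.
  have trsub : tr r f \subset E.
    apply/fintype.subsetP => p; rewrite inE => /existsP[v /andP[vD jp]].
    by have [p' p'E jp'] := edge v vD; rewrite (joins_inj jp jp').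
  have okf : ok r f E.
    rewrite /ok ctr eqxx trsub /=.
    (* At most s - 1 edges of [X] are used by the tree, so at least [kap] of them remain outside
       it. *)
    have h1 : (#|E :&: X| <= #|E :&: (X :\: tr r f)| + s.-1)%N.
      rewrite -ctr; apply: leq_trans (leq_card_setU _ _); apply: subset_leq_card.
      apply/fintype.subsetP => p; rewrite in_setI in_setU in_setI in_setD => /andP[-> ->].
      by rewrite andbT orNb.
    move: h1; rewrite -(ler_nat R) natrD.
    have : s%:R = s.-1%:R + 1 :> R by rewrite natr1 prednK.
    by move: hk; rewrite -/s; lra.
  rewrite (bigD1 r) //= (bigD1 f) //= okf -addrA lerDl addr_ge0 //; apply: sumr_ge0 => i _ //.
  by apply: sumr_ge0.
under eq_bigr do rewrite mulr_sumr.
rewrite exchange_big /=.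
apply: (@le_trans _ _ (\sum_(r in S) \sum_(f in pffun_on r (mem (S :\ r)) (mem S))
   q ^+ s.-1 * expR (q * #|X|%:R * expR lam - lam * kap))).
  apply: ler_sum => r rS; under eq_bigr do rewrite mulr_sumr.
  rewrite exchange_big /=; apply: ler_sum => f _.
  have [ctr|ctr] := eqVneq #|tr r f| s.-1; last first.
    rewrite big1 => [|E _]; last by rewrite /ok (negbTE ctr) mulr0.
    by rewrite mulr_ge0 ?expR_ge0 // exprn_ge0.
  under eq_bigr do rewrite /ok ctr eqxx /=.
  apply: le_trans (edges_tail kap _ lam0 q0) _.
    by rewrite disjoint_sym disjoints_subset subDset setUCr finset.subsetT.
  rewrite ctr ler_wpM2l ?exprn_ge0 // ler_expR lerD2r ler_wpM2r ?expR_ge0 // ler_wpM2l //.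
  by rewrite ler_nat subset_leq_card // subsetDl.
rewrite (eq_bigr (fun=> s%:R ^+ s.-1 * (q ^+ s.-1 * expR (q * #|X|%:R * expR lam - lam * kap)))).
  by rewrite sumr_const -/s -[leLHS]mulr_natl mulrA -exprS prednK // mulrA.
move=> r rS; rewrite sumr_const card_pffun_on -[LHS]mulr_natl natrX.
have -> : #|[eta mem S]| = s by apply: eq_card.
by have -> : #|[eta mem (S :\ r)]| = s.-1; [rewrite /s (cardsD1 r S) rS; apply: eq_card | ].
Qed.

End random_edges.

Section counting.
Variable R : realType.

Lemma sum_sets (T : finType) (g : nat -> R) :
  \sum_(S : {set T}) g #|S| = \sum_(k < #|T|.+1) 'C(#|T|, k)%:R * g k.
Proof.
have hS (S : {set T}) : (#|S| < #|T|.+1)%N by rewrite ltnS max_card.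
rewrite (partition_big (fun S : {set T} => Ordinal (hS S)) predT) //=; apply: eq_bigr => k _.
rewrite (eq_bigr (fun=> g k)) => [|S /eqP <-] //.
transitivity (\sum_(S in [set A : {set T} | #|A| == k]) g k).
  by apply: eq_bigl => S; rewrite inE -val_eqE.
by rewrite sumr_const card_draws [RHS]mulr_natl.
Qed.

(** From s ^ s <= e ^ s * s!, a single term of the exponential series. It absorbs the s ^ s codes of
    spanning trees in the union bound. *)
Lemma bin_pow_le n s : ('C(n, s))%:R * s%:R ^+ s <= (expR 1 * n%:R) ^+ s :> R.
Proof.
case: s => [|s]; first by rewrite bin0 !expr0 mulr1.
have f0 : 0 < (s.+1)`!%:R :> R by rewrite ltr0n fact_gt0.
have h1 : s.+1%:R ^+ s.+1 <= expR 1 ^+ s.+1 * (s.+1)`!%:R :> R.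
  have := @expR_ge1Dxn R s.+1%:R s (ler0n _ _).
  rewrite -expRM_natl mulr1 => h; rewrite -ler_pdivrMr //.
  by apply: le_trans h; rewrite lerDr.
have ff m : (n ^_ m <= n ^ m)%N.
  elim: m => [|m IH]; first by rewrite ffactn0.
  by rewrite ffactnSr expnSr leq_mul // leq_subr.
have h2 : ('C(n, s.+1))%:R * (s.+1)`!%:R <= n%:R ^+ s.+1 :> R.
  by rewrite -natrM bin_ffact -natrX ler_nat.
apply: (@le_trans _ _ ('C(n, s.+1)%:R * (expR 1 ^+ s.+1 * (s.+1)`!%:R))).
  by rewrite ler_wpM2l.
by rewrite mulrCA exprMn; apply: ler_wpM2l => //.
Qed.

End counting.

Lemma failure_le (R : realType) (I : finType) (P : Prop) (b : I -> bool) :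
  (~ P -> exists i, b i) -> (`[< ~ P >])%:R <= \sum_i (b i)%:R :> R.
Proof.
move=> h; case: asboolP => [/h [i bi]|_]; last by apply: sumr_ge0.
by rewrite (bigD1 i) //= bi lerDl; apply: sumr_ge0.
Qed.

Lemma card_pairs_le n (A B : {set 'I_n}) (X : {set upair n}) :
  (forall p, p \in X -> exists a b, [/\ a \in A, b \in B & joins p a b]) ->
  (#|X| <= #|A| * #|B|)%N.
Proof.
move=> h; pose g (ab : 'I_n * 'I_n) : option (upair n) := [pick p | joins p ab.1 ab.2].
rewrite -cardsX -(card_imset _ (@Some_inj _)).
apply: (@leq_trans #|[set g x | x in setX A B]|); last exact: leq_imset_card.
apply: subset_leq_card; apply/fintype.subsetP => o /imsetP[p pX ->].
have [a [b [aA bB j]]] := h p pX; apply/imsetP; exists (a, b); first by rewrite in_setX aA.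
by rewrite /g; case: pickP => [p' /= j'|/(_ p)]; [rewrite (joins_inj j j') | rewrite /= j].
Qed.

Lemma etoE n (E : {set upair n}) S : eto E S = #|E :&: [set p | touches S p]|.
Proof. by apply: eq_card => p; rewrite !inE. Qed.

Lemma einE n (E : {set upair n}) S : ein E S = #|E :&: [set p | within S p]|.
Proof. by apply: eq_card => p; rewrite !inE. Qed.

Lemma ecrossE n (E : {set upair n}) S T : ecross E S T = #|E :&: [set p | cross S T p]|.
Proof. by apply: eq_card => p; rewrite !inE. Qed.

Section degree_constants.
Variables (R : realType) (d : R).
Hypothesis d1 : 1 < d.

(** From 1 + u <= exp u at u = (3 d - 1) / 2, squared. It compares the growth rate 2 d e of the
    expected number of connected sets with exponentials in d. *)
Lemma degree_exp : 4 * d * expR 1 <= expR (3 * d).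
Proof.
have d1' := d1.
have -> : expR (3 * d) = expR ((3 * d - 1) / 2) * expR ((3 * d - 1) / 2) * expR 1.
  by rewrite -!expRD; congr expR; field.
rewrite ler_wpM2r ?expR_ge0 //.
have h := expR_ge1Dx ((3 * d - 1) / 2).
apply: (@le_trans _ _ ((1 + (3 * d - 1) / 2) * (1 + (3 * d - 1) / 2))); last first.
  by apply: ler_pM => //; lra.
have : 0 <= (9 * d - 1) * (d - 1) by rewrite mulr_ge0 //; lra.
lra.
Qed.

Lemma degree_half : 2 * d * expR 1 * expR (- (4 * d)) <= 2^-1.
Proof.
have d1' := d1; have h := degree_exp; have e0 := expR_gt0 (3 * d).
rewrite expRN ler_pdivrMr ?expR_gt0 //.
have : expR (3 * d) <= expR (4 * d) by rewrite ler_expR; lra.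
by lra.
Qed.

End degree_constants.

(** * Failure probabilities of the edge properties *)

Section failure.
Variables (R : realType) (n : nat) (d : R) (pr : upair n -> R).
Let q : R := 2 * d / n%:R.
Hypotheses (n0 : (0 < n)%N) (d1 : 1 < d) (q1 : q <= 1).
Hypotheses (pr0 : forall p, 0 <= pr p) (prq : forall p, pr p <= q).
Implicit Types (E X : {set upair n}) (S T : {set 'I_n}) (p : upair n).
Notation wE := (wE pr).
Notation L := (ln (n%:R : R)).

Lemma nR_gt0 : 0 < n%:R :> R. Proof. by rewrite ltr0n. Qed.

Lemma nR_exp : n%:R = expR L. Proof. by rewrite lnK // posrE nR_gt0. Qed.

Lemma edge_q_ge0 : 0 <= q.
Proof. by rewrite /q divr_ge0 // mulr_ge0 // ltW // (lt_trans ltr01). Qed.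

Lemma sum_indicator (I : finType) (b : I -> {set upair n} -> bool) (B : I -> R) (P : {set upair n} -> Prop) :
  (forall E, ~ P E -> exists i, b i E) ->
  (forall i, \sum_E wE E * (b i E)%:R <= B i) ->
  \sum_E wE E * (`[< ~ P E >])%:R <= \sum_i B i.
Proof.
move=> h hB; apply: (@le_trans _ _ (\sum_E \sum_i wE E * (b i E)%:R)).
  apply: ler_sum => E _; rewrite -mulr_sumr ler_wpM2l ?(wE_ge0 pr0 prq q1) //.
  by apply: failure_le; exact: h.
by rewrite exchange_big; apply: ler_sum.
Qed.

(** The choices of [S] and of its spanning tree give (e n) ^ s, and the tree edges have probability
    at most (2 d / n) ^ (s - 1), so about n (2 d e) ^ (s - 1) connected sets of size s are
    expected. *)
Lemma conn_union (w : nat -> R) : (forall k, 0 <= w k) ->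
  \sum_(S : {set 'I_n}) (if #|S| == 0%N then 0 else #|S|%:R ^+ #|S| * q ^+ #|S|.-1 * w #|S|) <=
  \sum_(j < n) expR 1 * n%:R * (2 * d * expR 1) ^+ j * w j.+1.
Proof.
move=> w0; have q0 := edge_q_ge0; have np := nR_gt0.
rewrite (@sum_sets R 'I_n (fun s => if s == 0%N then 0 else s%:R ^+ s * q ^+ s.-1 * w s)).
rewrite card_ord big_ord_recl /= mulr0 add0r; apply: ler_sum => j _.
rewrite /bump /= add1n /= -!mulrA mulrA.
apply: (@le_trans _ _ ((expR 1 * n%:R) ^+ j.+1 * (q ^+ j * w j.+1))).
  apply: ler_wpM2r; last exact: bin_pow_le.
  by rewrite mulr_ge0 // exprn_ge0.
rewrite exprS -!mulrA ler_wpM2l ?expR_ge0 // ler_wpM2l // !mulrA ler_wpM2r //.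
rewrite -exprMn le_eqVlt; apply/orP; left; apply/eqP; congr (_ ^+ _).
by rewrite /q; field; rewrite gt_eqF.
Qed.

(** With parameter 3 m, [star_const] leaves exp (- 4 d s - 3 ln n) for a set of size s. The first
    term beats (2 d e) ^ (s - 1), and n ^ (-3) pays for the factor n of [conn_union] and for the n
    values of m. *)
Lemma star_failure : \sum_E wE E * (`[< ~ star d E >])%:R <= 6 / n%:R.
Proof.
have q0 := edge_q_ge0; have np := nR_gt0; have d1' := d1; have d0 : 0 < d := lt_trans ltr01 d1.
pose kap (m : nat) (s : R) := star_const R m * d * s + L / m%:R - s.
pose w k := expR (- (4 * d * k%:R) - 3 * L).
pose g S := if #|S| == 0%N then 0 else #|S|%:R ^+ #|S| * q ^+ #|S|.-1 * w #|S|.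
apply: le_trans (_ : \sum_(i : 'I_n * {set 'I_n}) g i.2 <= _).
  apply: (sum_indicator (I := ('I_n * {set 'I_n})%type) (P := fun E : {set upair n} => star d E) (B := fun i => g i.2) (b := fun i E => conn E i.2 &&
    (kap i.1.+1 #|i.2|%:R + #|i.2|%:R <= #|E :&: [set p | touches i.2 p]|%:R + 1))).
    move=> E nS; apply: contrapT => h; apply: nS => m /andP[m0 mn] S cS.
    rewrite leNgt; apply/negP => lt; apply: h.
    have mn' : (m.-1 < n)%N by rewrite prednK.
    exists (Ordinal mn', S); rewrite cS /= prednK // -etoE /kap.
    lra.
  move=> [i S] /=; set m := i.+1; rewrite /g.
  have [s0|s0] := posnP #|S|.
    by rewrite big1 // => E _; rewrite /conn s0 mulr0.
  have mp : 0 < m%:R :> R by rewrite ltr0n.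
  have lam0 : 0 <= 3 * m%:R :> R by rewrite mulr_ge0.
  apply: (le_trans (conn_tail pr0 prq q1 S _ (kap m #|S|%:R) lam0 q0)).
  rewrite ler_wpM2l //; first by rewrite mulr_ge0 // exprn_ge0.
  rewrite /w ler_expR.
  have cX : #|[set p | touches S p]|%:R <= #|S|%:R * n%:R :> R.
    rewrite -natrM ler_nat -[X in (_ * X)%N]card_ord -cardsT; apply: card_pairs_le => p.
    rewrite inE => /orP[] h; first by exists (val p).1, (val p).2; rewrite h inE joins_ends.
    by exists (val p).2, (val p).1; rewrite h inE joinsC joins_ends.
  have e0 := expR_ge0 (3 * m%:R : R); set e := expR (3 * m%:R) in e0 *.
  have h1 : q * #|[set p | touches S p]|%:R * e <= 2 * d * #|S|%:R * e.
    rewrite ler_wpM2r //; have -> : 2 * d * #|S|%:R = q * (#|S|%:R * n%:R).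
      by rewrite /q; field; rewrite gt_eqF.
    by rewrite ler_wpM2l.
  have -> : 3 * m%:R * kap m #|S|%:R = (2 * e + 4 + 3 * m%:R) * d * #|S|%:R + 3 * L - 3 * m%:R * #|S|%:R.
    by rewrite /kap /star_const -/e; field; rewrite gt_eqF.
  have h2 : 3 * m%:R * #|S|%:R <= 3 * m%:R * #|S|%:R * d by rewrite ler_peMr ?mulr_ge0 // ltW.
  move: h1 h2; lra.
rewrite -(pair_bigA _ (fun (_ : 'I_n) (S : {set 'I_n}) => g S)) /=.
rewrite sumr_const card_ord.
have hw : \sum_S g S <= 6 / n%:R ^+ 2.
  apply: le_trans (conn_union _) _; first by move=> k; exact: expR_ge0.
  have g2 := @geom_le R 2^-1 n ltac:(lra) ltac:(lra).
  apply: (@le_trans _ _ (3 * n%:R * n%:R ^- 3 * \sum_(j < n) 2^-1 ^+ j)).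
    rewrite mulr_sumr; apply: ler_sum => j _.
    have -> : w j.+1 = expR (- (4 * d)) ^+ j * expR (- (4 * d)) * n%:R ^- 3.
      rewrite /w -expRM_natl [in n%:R ^- 3]nR_exp -expRM_natl -expRN -!expRD; congr expR.
      by rewrite -natr1; ring.
    rewrite -!mulrA; apply: ler_pM; [exact: expR_ge0 | | exact: expR1_le3 | ].
      by rewrite !mulr_ge0 ?exprn_ge0 ?invr_ge0 ?exprn_ge0 ?mulr_ge0 ?expR_ge0 // ?ltW.
    rewrite ler_wpM2l //.
    have h3 : ((2 * d * expR 1) * expR (- (4 * d))) ^+ j <= 2^-1 ^+ j.
      rewrite lerXn2r ?nnegrE ?degree_half //.
      by rewrite mulr_ge0 ?expR_ge0 // mulr_ge0 ?expR_ge0 // mulr_ge0 // ltW.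
    have h4 : expR (- (4 * d)) <= 1 by rewrite -[leRHS](expR0 R) ler_expR; lra.
    have h5 : 0 <= n%:R ^- 3 :> R by rewrite invr_ge0 exprn_ge0.
    rewrite exprMn in h3.
    have -> : (2 * (d * expR 1)) ^+ j * (expR (- (4 * d)) ^+ j * (expR (- (4 * d)) * n%:R ^- 3)) =
       n%:R ^- 3 * ((2 * d * expR 1) ^+ j * expR (- (4 * d)) ^+ j * expR (- (4 * d))).
      by rewrite [2 * (d * expR 1)]mulrA; ring.
    rewrite ler_wpM2l //; apply: (@le_trans _ _ (2^-1 ^+ j * 1)); last by rewrite mulr1.
    apply: ler_pM => //.
    by rewrite mulr_ge0 ?exprn_ge0 ?expR_ge0 // mulr_ge0 ?expR_ge0 // mulr_ge0 // ltW.
  have -> : 6 / n%:R ^+ 2 = 3 * n%:R * n%:R ^- 3 * 2 :> R by field; rewrite gt_eqF.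
  by rewrite ler_wpM2l // mulr_ge0 ?mulr_ge0 // invr_ge0 exprn_ge0.
rewrite -[leLHS]mulr_natl; apply: (@le_trans _ _ (n%:R * (6 / n%:R ^+ 2))); first by rewrite ler_wpM2l.
by rewrite le_eqVlt; apply/orP; left; apply/eqP; field; rewrite gt_eqF.
Qed.

(** Two surplus edges, with parameter 3 / 4 ln n, cost n ^ (- 3 / 2) up to a constant. The
    admissible sets contribute n times exp (3 ln n / 35 + 12 d), and 1 + 3 / 35 - 3 / 2 < - 1 /
    4. *)
Lemma diamond_failure : 768 + 5 * d <= L ->
  \sum_E wE E * (`[< ~ diamond_free d E >])%:R <= 2 * expR (2 + 12 * d - L / 4).
Proof.
move=> Lbig; have q0 := edge_q_ge0; have np := nR_gt0; have d1' := d1; have d0 : 0 < d := lt_trans ltr01 d1.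
pose w (k : nat) := if d * k%:R <= L / 35 + 4 * d then expR (1 - 3 / 2 * L) else 0.
have w0 k : 0 <= w k by rewrite /w; case: ifP => // _; exact: expR_ge0.
pose g S := if #|S| == 0%N then 0 else #|S|%:R ^+ #|S| * q ^+ #|S|.-1 * w #|S|.
apply: le_trans (_ : \sum_S g S <= _).
  apply: (sum_indicator (P := fun E : {set upair n} => diamond_free d E) (B := g) (b := fun S E => (d * #|S|%:R <= L / 35 + 4 * d) && (conn E S &&
    (2 + #|S|%:R <= #|E :&: [set p | within S p]|%:R + 1 :> R)))).
    move=> E nD; apply: contrapT => h; apply: nD => S cS hS.
    rewrite leqNgt; apply/negP => lt; apply: h; exists S; rewrite hS cS /= -einE.
    have : #|S|%:R + 1 <= (ein E S)%:R :> R by rewrite natr1 ler_nat.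
    lra.
  move=> S /=; rewrite /g /w; case: ifP => s0.
    by rewrite big1 // => E _; rewrite /conn (eqP s0) /= andbF mulr0.
  case: (boolP (d * #|S|%:R <= L / 35 + 4 * d)) => hS; last first.
    by rewrite mulr0 big1 // => E _; rewrite /= mulr0.
  have lam0 : 0 <= 3 / 4 * L by lra.
  apply: (le_trans (conn_tail pr0 prq q1 S _ 2 lam0 q0)).
  rewrite ler_wpM2l //; first by rewrite mulr_ge0 // exprn_ge0.
  rewrite ler_expR.
  have cX : #|[set p | within S p]|%:R <= #|S|%:R * #|S|%:R :> R.
    rewrite -natrM ler_nat; apply: card_pairs_le => p.
    by rewrite inE => /andP[h1 h2]; exists (val p).1, (val p).2; rewrite h1 h2 joins_ends.
  set s : R := #|S|%:R in hS cX *; have s0' : 0 <= s by [].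
  have hds : d * s <= L by lra.
  have h1 : q * #|[set p | within S p]|%:R <= 2 * L ^+ 2 * expR (- L).
    have -> : expR (- L) = n%:R^-1 by rewrite expRN -nR_exp.
    rewrite /q -mulrA [_ * _^-1]mulrC mulrA mulrAC [_ * n%:R^-1]mulrC ler_wpM2l ?invr_ge0 ?(ltW np) //.
    apply: (@le_trans _ _ (2 * (d * s) * (d * s))); last first.
      rewrite expr2 !mulrA -!mulrA ler_wpM2l // mulrA; apply: ler_pM => //; exact: mulr_ge0 (ltW d0) s0'.
    rewrite -!mulrA ler_wpM2l // ler_wpM2l ?(ltW d0) //; apply: (le_trans cX).
    by rewrite ler_wpM2l // ler_peMl // ltW.
  have h2 : 2 * L ^+ 2 <= expR (L / 4).
    have L4 : 0 <= L / 4 by lra.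
    have := @expR_ge1Dxn R (L / 4) 2 L4.
    have -> : (3`!)%:R = 6 :> R by [].
    have : 768 * (L ^+ 2 / 384) <= L * (L ^+ 2 / 384).
      have p384 : 0 <= L ^+ 2 / 384 by rewrite divr_ge0 ?sqr_ge0 ?ler0n.
      by apply: (ler_wpM2r p384); apply: le_trans Lbig; rewrite lerDl (mulr_ge0 (ler0n _ 5) (ltW d0)).
    have -> : (L / 4) ^+ 3 / 6 = L * (L ^+ 2 / 384) by field.
    lra.
  have h3 : q * #|[set p | within S p]|%:R * expR (3 / 4 * L) <= 1.
    apply: (@le_trans _ _ (expR (L / 4) * expR (- L) * expR (3 / 4 * L))).
      rewrite ler_wpM2r ?expR_ge0 //; apply: (le_trans h1); by rewrite ler_wpM2r ?expR_ge0.
    rewrite -!expRD; have -> : L / 4 + - L + 3 / 4 * L = 0 by field.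
    by rewrite expR0.
  move: h3; lra.
apply: le_trans (conn_union w0) _.
have g2 := @geom_le R 2^-1 n ltac:(lra) ltac:(lra).
apply: (@le_trans _ _ (\sum_(j < n) 2^-1 ^+ j * expR (2 + 12 * d - L / 4))).
  apply: ler_sum => j _; rewrite /w; case: ifP => hj; last first.
    by rewrite mulr0 mulr_ge0 ?expR_ge0 // exprn_ge0.
  have -> : 2 * d * expR 1 = 2^-1 * (4 * d * expR 1) by field.
  rewrite exprMn.
  have h4 : (4 * d * expR 1) ^+ j <= expR (3 * L / 35 + 12 * d).
    apply: (@le_trans _ _ (expR (3 * d) ^+ j)).
      rewrite lerXn2r ?nnegrE ?degree_exp ?expR_ge0 //.
      by rewrite mulr_ge0 ?expR_ge0 // mulr_ge0 // ltW.
    rewrite -expRM_natl ler_expR; move: hj; rewrite -natr1; lra.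
  have -> : expR 1 * n%:R * (2^-1 ^+ j * (4 * d * expR 1) ^+ j) * expR (1 - 3 / 2 * L) =
      2^-1 ^+ j * ((4 * d * expR 1) ^+ j * (expR 1 * n%:R * expR (1 - 3 / 2 * L))) by ring.
  rewrite ler_wpM2l ?exprn_ge0 //; have nE := nR_exp; move: h4 nE.
  set l := L; move=> h4 nE; rewrite nE.
  apply: (@le_trans _ _ (expR (3 * l / 35 + 12 * d) * (expR 1 * expR l * expR (1 - 3 / 2 * l)))).
    by rewrite ler_wpM2r // !mulr_ge0 ?expR_ge0.
  rewrite -!expRD ler_expR; move: Lbig; rewrite -/l; lra.
by rewrite -mulr_suml ler_wpM2r ?expR_ge0.
Qed.

(** Without connectedness there is no tree, and [edges_tail] is used with an empty [X]. With y = |T|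
    (1 + ln (n / |T|)) the tail is exp (- 6 y), the choices of T of a given size and of S inside it
    number at most exp (2 y), and y >= 1 + ln n leaves n ^ (-4). *)
Lemma disc_failure : \sum_E wE E * (`[< ~ discrepancy E d >])%:R <= 8 / n%:R.
Proof.
have q0 := edge_q_ge0; have np := nR_gt0; have d1' := d1; have d0 : 0 < d := lt_trans ltr01 d1.
have L0 := ln_nat_ge0 R n.
pose y (k : nat) : R := k%:R * (1 + ln (n%:R / k%:R)).
pose bd i S T : R := 8 * 2 ^+ i * d * #|S|%:R * #|T|%:R / n%:R + 12 * y #|T| / i.+1%:R.
pose g (k : nat) : R := if k == 0%N then 0 else expR (- (6 * y k)).
have y1 k : (0 < k)%N -> (k <= n)%N -> 1 + L <= y k /\ k%:R <= y k.
  move=> k0 kn; have kp : 0 < k%:R :> R by rewrite ltr0n.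
  have lk : ln (k%:R : R) <= L by rewrite ler_ln ?posrE // ler_nat.
  have lk0 := ln_nat_ge0 R k.
  have lk1 : ln (k%:R : R) <= k%:R - 1.
    by have := expR_ge1Dx (ln (k%:R : R)); rewrite lnK ?posrE //; lra.
  have yE : y k = k%:R * (1 + L - ln k%:R).
    by rewrite /y ln_div ?posrE //; congr (_ * _); ring.
  have k1 : 1 <= k%:R :> R by rewrite ler1n.
  split; rewrite yE.
    have : 0 <= (k%:R - 1) * (L - ln (k%:R : R)) by rewrite mulr_ge0 //; lra.
    lra.
  by rewrite ler_peMr //; lra.
apply: le_trans (_ : \sum_(i : 'I_n.+3 * ({set 'I_n} * {set 'I_n}))
   (i.2.2 \subset i.2.1)%:R * g #|i.2.1| <= _).
  apply: (sum_indicator (I := ('I_n.+3 * ({set 'I_n} * {set 'I_n}))%type) (P := fun E : {set upair n} => discrepancy E d) (B := fun i => (i.2.2 \subset i.2.1)%:R * g #|i.2.1|) (b := fun i E => [&& i.2.2 \subset i.2.1, (0 < #|i.2.1|)%N &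
    bd i.1 i.2.2 i.2.1 <= (ecross E i.2.2 i.2.1)%:R])).
    move=> E nD; apply: contrapT => h; apply: nD => S T i ST T0 hi.
    rewrite leNgt; apply/negP => lt; apply: h.
    exists (Ordinal (hi : (i < n.+3)%N), (T, S)); rewrite /= ST T0 /= /bd /y.
    by apply: ltW; rewrite mulrA.
  move=> [i [T S]] /=; case: (boolP (S \subset T)) => ST; last first.
    by rewrite mul0r big1 // => E _; rewrite mulr0.
  rewrite mul1r /g; have [T0|T0] := posnP #|T|.
    by rewrite big1 // => E _; rewrite mulr0.
  have lam0 : 0 <= i.+1%:R / 2 :> R by rewrite divr_ge0.
  have dis0 : [disjoint (finset.set0 : {set upair n}) & [set p | cross S T p]].
    by rewrite disjoints_subset finset.sub0set.
  apply: (@le_trans _ _ (\sum_E wE E * ((finset.set0 \subset E) &&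
      (bd i S T <= #|E :&: [set p | cross S T p]|%:R))%:R)).
    by apply: ler_sum => E _; rewrite finset.sub0set -ecrossE.
  apply: (le_trans (edges_tail pr0 prq q1 (bd i S T) dis0 lam0 q0)); rewrite cards0 expr0 mul1r ler_expR.
  have cX : #|[set p | cross S T p]|%:R <= #|S|%:R * #|T|%:R :> R.
    rewrite -natrM ler_nat; apply: card_pairs_le => p.
    rewrite inE => /orP[] /andP[h1 h2].
      by exists (val p).1, (val p).2; rewrite h1 h2 joins_ends.
    by exists (val p).2, (val p).1; rewrite h1 h2 joinsC joins_ends.
  have hlam : expR (i.+1%:R / 2) <= 2 * 2 ^+ i :> R.
    have e2 : expR (2^-1) <= 2 :> R.
      have h0 : 2^-1 <= expR (- 2^-1) :> R by have := expR_ge1Dx (- 2^-1 : R); lra.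
      by rewrite -[2^-1]opprK expRN invf_ple ?posrE ?expR_gt0.
    by rewrite expRM_natl -exprS lerXn2r ?nnegrE ?expR_ge0.
  have st0 : 0 <= #|S|%:R * #|T|%:R :> R by rewrite mulr_ge0.
  have h1 : q * #|[set p | cross S T p]|%:R * expR (i.+1%:R / 2) <=
      q * (#|S|%:R * #|T|%:R) * (2 * 2 ^+ i).
    apply: ler_pM => //; first exact: (mulr_ge0 q0 (ler0n _ _)).
    exact: (ler_wpM2l q0 cX).
  have i1 : 1 <= i.+1%:R :> R by rewrite ler1n.
  have h2 : i.+1%:R / 2 * bd i S T =
      i.+1%:R * (q * (#|S|%:R * #|T|%:R) * (2 * 2 ^+ i)) + 6 * y #|T|.
    rewrite /bd /q; field; rewrite (gt_eqF np) /= gt_eqF //; lra.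
  rewrite h2; have h3 : q * (#|S|%:R * #|T|%:R) * (2 * 2 ^+ i) <=
      i.+1%:R * (q * (#|S|%:R * #|T|%:R) * (2 * 2 ^+ i)).
    by rewrite ler_peMl // (mulr_ge0 (mulr_ge0 q0 st0)) // mulr_ge0 // exprn_ge0.
  lra.
rewrite -(pair_bigA _ (fun (_ : 'I_n.+3) (x : {set 'I_n} * {set 'I_n}) =>
   (x.2 \subset x.1)%:R * g #|x.1|)) /= sumr_const card_ord.
have hT : \sum_(x : {set 'I_n} * {set 'I_n}) (x.2 \subset x.1)%:R * g #|x.1| <= 2 * n%:R * n%:R ^- 4.
  rewrite -(pair_bigA _ (fun T S : {set 'I_n} => (S \subset T)%:R * g #|T|)) /=.
  have -> : \sum_(T : {set 'I_n}) \sum_(S : {set 'I_n}) (S \subset T)%:R * g #|T| =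
      \sum_(T : {set 'I_n}) 2 ^+ #|T| * g #|T|.
    apply: eq_bigr => T _; rewrite -mulr_suml; congr (_ * _).
    rewrite -natrX -card_powerset -sum1_card natr_sum [RHS]big_mkcond /=.
    by apply: eq_bigr => S _; rewrite powersetE; case: (S \subset T).
  rewrite (@sum_sets R 'I_n (fun k => 2 ^+ k * g k)) card_ord big_ord_recl /= {1}/g /= !mulr0 add0r.
  apply: (@le_trans _ _ (\sum_(j < n) n%:R ^- 4 : R)); last first.
    rewrite sumr_const card_ord -[leLHS]mulr_natl ler_wpM2r ?invr_ge0 ?exprn_ge0 //.
    by have := ltW np; lra.
  apply: ler_sum => j _; rewrite /bump /= add1n /g /=.
  have kn := ltn_ord j; set k := j.+1; have k0 : (0 < k)%N by [].
  have [y1k y2k] := y1 k k0 kn.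
  have kp : 0 < k%:R :> R by rewrite ltr0n.
  have c1 : 'C(n, k)%:R <= expR (y k).
    have := bin_pow_le R n k; rewrite -ler_pdivlMr ?exprn_gt0 //.
    suff -> : (expR 1 * n%:R) ^+ k / k%:R ^+ k = expR (y k) by [].
    rewrite -expr_div_n /y expRM_natl.
    congr (_ ^+ _); rewrite expRD lnK ?posrE ?divr_gt0 //; ring.
  have c2 : 2 ^+ k <= expR (y k) :> R.
    apply: (@le_trans _ _ (expR k%:R)); last by rewrite ler_expR.
    rewrite -[k%:R]mulr1 expRM_natl lerXn2r ?nnegrE ?expR_ge0 //.
    by have := expR_ge1Dx (1 : R); lra.
  apply: (@le_trans _ _ (expR (y k) * (expR (y k) * expR (- (6 * y k))))).
    apply: ler_pM => //.
    by rewrite ler_wpM2r ?expR_ge0.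
  have -> : n%:R ^- 4 = expR (- (4 * L)) by rewrite [in LHS]nR_exp -expRM_natl -expRN.
  rewrite -!expRD ler_expR; lra.
rewrite -[leLHS]mulr_natl.
apply: (@le_trans _ _ (4 * n%:R * (2 * n%:R * n%:R ^- 4))).
  apply: ler_pM => //.
    by apply: sumr_ge0 => x _; rewrite mulr_ge0 // /g; case: ifP => // _; exact: expR_ge0.
  by rewrite -natrM ler_nat; case: (n) n0 => // k _; lia.
have -> : 4 * n%:R * (2 * n%:R * n%:R ^- 4) = 8 / n%:R * n%:R^-1 :> R by field; rewrite gt_eqF.
by rewrite ler_piMr ?divr_ge0 ?(ltW np) // invf_le1 // ler1n.
Qed.

End failure.

(** Entries between - 2 n and 2 n are coded by their shift, so the vectors of the union bound range
    over a finite type. *)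
Lemma int_window n (x : int) : `|x| <= (2 * n)%:Z ->
  (`|(x + (2 * n)%:Z)%R|%N < (4 * n).+1)%N /\ (`|(x + (2 * n)%:Z)%R|%N)%:Z - (2 * n)%:Z = x.
Proof. by move=> h; split; lia. Qed.

(** * Light pairs: random signs and integer vectors *)

Section signs.
Variables (R : realType) (n : nat) (d : R) (pr : upair n -> R).
Let q : R := 2 * d / n%:R.
Hypotheses (n0 : (0 < n)%N) (d1 : 1 < d) (q1 : q <= 1).
Hypotheses (pr0 : forall p, 0 <= pr p) (prq : forall p, pr p <= q).
Implicit Types (E : {set upair n}) (c : {ffun upair n -> bool}) (p : upair n).
Notation wE := (wE pr).
Notation signs := {ffun upair n -> bool}.
Notation half := (2 ^- #|{: upair n}| : R).

Lemma half_ge0 : 0 <= half. Proof. by rewrite invr_ge0 exprn_ge0. Qed.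

Lemma sum_half : \sum_(c : {ffun upair n -> bool}) half = 1.
Proof.
rewrite sumr_const card_ffun card_bool -[LHS]mulr_natl natrX mulfV //.
Qed.

Lemma sign_mgf E (v : upair n -> R) :
  \sum_(c : {ffun upair n -> bool}) half * expR (\sum_(p in E) sg R (c p) * v p) =
  \prod_p (if p \in E then ch (v p) else 1).
Proof.
rewrite -mulr_sumr.
transitivity (half * \sum_(c : {ffun upair n -> bool}) \prod_p
    (fun p (b : bool) => if p \in E then expR (sg R b * v p) else 1) p (c p)).
  congr (_ * _); apply: eq_bigr => c _; rewrite expR_sum big_mkcond.
  by apply: eq_bigr => p _; case: ifP.
transitivity (half * \prod_p \sum_(b : bool) (if p \in E then expR (sg R b * v p) else 1)).
  by rewrite bigA_distr_bigA.
have -> : \prod_p \sum_(b : bool) (if p \in E then expR (sg R b * v p) else 1) =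
    \prod_p (2 * (if p \in E then ch (v p) else 1)).
  apply: eq_bigr => p _; rewrite big_bool /=; case: ifP => _; last by rewrite mulr1.
  by rewrite /sg expr1 expr0 mulN1r mul1r /ch; field.
by rewrite big_split /= prodr_const mulrA mulVf ?mul1r // expf_neq0.
Qed.

(** The random signs remove the odd terms, so each pair contributes 1 + pr p (ch v - 1) <= exp (q v
    ^ 2). The condition |v| <= 1 is what lightness means after division by sqrt d. *)
Lemma form_mgf (v : upair n -> R) : (forall p, `|v p| <= 1) ->
  \sum_E \sum_(c : signs) wE E * half * expR (\sum_(p in E) sg R (c p) * v p) <= expR (q * \sum_p v p ^+ 2).
Proof.
move=> v1.
under eq_bigr => E _ do (under eq_bigr do rewrite -mulrA; rewrite -mulr_sumr sign_mgf).
rewrite (sum_wE_prod pr (fun p => ch (v p)) (fun=> 1)) mulr_sumr expR_sum.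
apply: ler_prod => p _; have c1 := ch_ge1 (v p).
have p0 := pr0 p.
apply/andP; split; first by have : 0 <= pr p * (ch (v p) - 1); [rewrite mulr_ge0 // subr_ge0 | lra].
have v2 : v p ^+ 2 <= 1.
  by rewrite -(real_normK (num_real (v p))) expr_le1.
have c2 : ch (v p) <= 1 + v p ^+ 2.
  apply: (le_trans (ch_le (v p))); set x := v p ^+ 2 in v2 *.
  have x0 : 0 <= x by exact: sqr_ge0.
  have h := expR_ge1Dx (- (x / 2)).
  have hp : 0 < 1 - x / 2 by lra.
  rewrite -[x / 2]opprK expRN; apply: (@le_trans _ _ (1 - x / 2)^-1).
    by rewrite lef_pV2 ?posrE ?expR_gt0.
  rewrite -div1r ler_pdivrMr //.
  have : 0 <= x * (1 - x) by rewrite mulr_ge0 //; lra.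
  by lra.
apply: le_trans (expR_ge1Dx _).
have : pr p * (ch (v p) - 1) <= q * v p ^+ 2 by apply: ler_pM => //; lra.
lra.
Qed.

Lemma sum_pairs_le (F : 'I_n -> R) : (forall i, 0 <= F i) ->
  \sum_(p : upair n) F (val p).1 * F (val p).2 <= (\sum_i F i) ^+ 2.
Proof.
move=> F0.
have -> : (\sum_i F i) ^+ 2 = \sum_(x : 'I_n * 'I_n) F x.1 * F x.2.
  rewrite -(pair_bigA _ (fun i j => F i * F j)) /= expr2 mulr_suml.
  by apply: eq_bigr => i _; rewrite mulr_sumr.
have -> : \sum_(p : upair n) F (val p).1 * F (val p).2 =
    \sum_(x in [set val p | p : upair n]) F x.1 * F x.2.
  by rewrite big_imset //= => p p' _ _ /val_inj.
by rewrite big_mkcond; apply: ler_sum => x _; case: ifP => // _; rewrite mulr_ge0.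
Qed.

(** Chernoff with parameter 1 / sqrt d: the exponent (2 d / n) (4 n) ^ 2 / d = 32 n stands against
    the threshold 40 n, and 2 accounts for both signs. *)
Lemma light_tail (z : 'I_n -> R) : \sum_i z i ^+ 2 <= 4 * n%:R ->
  \sum_E \sum_(c : signs) wE E * half * (40 * Num.sqrt d * n%:R <
    `|\sum_(p in E | `|z (val p).1 * z (val p).2| <= Num.sqrt d)
        sg R (c p) * z (val p).1 * z (val p).2|)%R%:R <= 2 * expR (- (8 * n%:R)).
Proof.
move=> zn; set r := Num.sqrt d; have np : 0 < n%:R :> R by rewrite ltr0n.
have d0 : 0 < d := lt_trans ltr01 d1.
have r0 : 0 < r by rewrite sqrtr_gt0.
have rr : r ^+ 2 = d by rewrite sqr_sqrtr // ltW.
pose lt p := `|z (val p).1 * z (val p).2| <= r.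
pose F E c := \sum_(p in E | lt p) sg R (c p) * z (val p).1 * z (val p).2.
pose v p : R := if lt p then z (val p).1 * z (val p).2 / r else 0.
have v1 p : `|v p| <= 1.
  rewrite /v; case: ifP => [h|_]; last by rewrite normr0.
  by rewrite normrM normfV (gtr0_norm r0) ler_pdivrMr // mul1r.
have Nv1 p : `|- v p| <= 1 by rewrite normrN.
have vE E c : \sum_(p in E) sg R (c p) * v p = F E c / r.
  rewrite /F big_mkcondr mulr_suml; apply: eq_bigr => p _; rewrite /v.
  by case: ifP => _; [rewrite !mulrA | rewrite mulr0 mul0r].
have NvE E c : \sum_(p in E) sg R (c p) * - v p = - (F E c / r).
  by rewrite -vE -sumrN; apply: eq_bigr => p _; rewrite mulrN.
have v2 : q * \sum_p v p ^+ 2 <= 32 * n%:R.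
  have h : \sum_p v p ^+ 2 <= (4 * n%:R) ^+ 2 / d.
    apply: (@le_trans _ _ (\sum_p (z (val p).1 ^+ 2 * z (val p).2 ^+ 2) / d)).
      apply: ler_sum => p _; rewrite /v; case: ifP => _.
        by rewrite expr_div_n rr exprMn.
      by rewrite expr0n; exact: (divr_ge0 (mulr_ge0 (sqr_ge0 _) (sqr_ge0 _)) (ltW d0)).
    rewrite -mulr_suml ler_wpM2r ?invr_ge0 ?(ltW d0) //.
    apply: (le_trans (sum_pairs_le (F := fun i => z i ^+ 2) _)) => [i|]; first exact: sqr_ge0.
    by rewrite lerXn2r ?nnegrE ?mulr_ge0 //; apply: sumr_ge0 => i _; rewrite sqr_ge0.
  have q0 : 0 <= q by rewrite divr_ge0 ?(ltW np) // mulr_ge0 // ltW.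
  have := ler_wpM2l q0 h.
  have -> : q * ((4 * n%:R) ^+ 2 / d) = 32 * n%:R by rewrite /q; field; rewrite !gt_eqF.
  by [].
apply: (@le_trans _ _ (expR (- (40 * n%:R)) * (\sum_E \sum_(c : signs) wE E * half * expR (\sum_(p in E) sg R (c p) * v p) +
    \sum_E \sum_(c : signs) wE E * half * expR (\sum_(p in E) sg R (c p) * - v p)))).
  rewrite -big_split mulr_sumr; apply: ler_sum => E _; rewrite -big_split mulr_sumr.
  apply: ler_sum => c _ /=; rewrite -mulrDr mulrCA ler_wpM2l //.
    by rewrite mulr_ge0 ?half_ge0 // (wE_ge0 pr0 prq q1).
  rewrite vE NvE -/(F E c); set f := F E c.
  have e1 := expR_ge0 (f / r); have e2 := expR_ge0 (- (f / r)); have e3 := expR_ge0 (- (40 * n%:R) : R).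
  case: ltP => [h|_]; last by rewrite mulr_ge0 // addr_ge0.
  have h' : 40 * n%:R <= `|f / r|.
    rewrite normrM normfV (gtr0_norm r0) ler_pdivlMr // mulrAC; exact: ltW.
  rewrite mulrDr -!expRD -[leLHS](expR0 R).
  have [f0|f0] := leP 0 (f / r).
    rewrite ger0_norm // in h'.
    apply: (@le_trans _ _ (expR (- (40 * n%:R) + f / r))); first by rewrite ler_expR; lra.
    by rewrite lerDl expR_ge0.
  rewrite ltr0_norm // in h'.
  apply: (@le_trans _ _ (expR (- (40 * n%:R) + - (f / r)))); first by rewrite ler_expR; lra.
  by rewrite lerDr expR_ge0.
have m1 := form_mgf v1; have m2 := form_mgf Nv1.
have e32 : expR (q * \sum_p v p ^+ 2) <= expR (32 * n%:R) by rewrite ler_expR.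
have e32' : expR (q * \sum_p (- v p) ^+ 2) <= expR (32 * n%:R).
  by under eq_bigr do rewrite sqrrN.
apply: (@le_trans _ _ (expR (- (40 * n%:R)) * (expR (32 * n%:R) + expR (32 * n%:R)))).
  by rewrite ler_wpM2l ?expR_ge0 // lerD //; [exact: le_trans e32 | exact: le_trans e32'].
rewrite -mulr2n -[_ *+ 2]mulr_natl mulrCA -expRD ler_wpM2l // ler_expR; lra.
Qed.

(** Two geometric series of ratio 1 / 2, since exp (- m ^ 2) <= 2 ^ (-m); their total 4 is at most
    exp 2. *)
Lemma integer_count : \sum_(k < (4 * n).+1) expR (- ((k%:R - (2 * n)%:R) ^+ 2)) <= expR 2 :> R.
Proof.
have e2 : 4 <= expR 2 :> R.
  have -> : (2 : R) = 1 + 1 by lra.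
  rewrite expRD; have h : 2 <= expR 1 :> R by have := expR_ge1Dx (1 : R); lra.
  apply: (@le_trans _ _ (2 * 2)); [lra | exact: ler_pM].
apply: le_trans e2.
pose F k : R := 2^-1 ^+ k.
have F0 k : 0 <= F k by rewrite exprn_ge0.
have half1 : expR (- 1) <= 2^-1 :> R.
  by rewrite expRN lef_pV2 ?posrE ?expR_gt0 //; have := expR_ge1Dx (1 : R); lra.
have dec (m : nat) (x : R) : x ^+ 2 = m%:R ^+ 2 -> expR (- x ^+ 2) <= F m.
  move=> ->; apply: (@le_trans _ _ (expR (- m%:R))).
    rewrite ler_expR lerN2 -natrX ler_nat; case: m => // m; exact: leq_pmulr.
  have -> : - m%:R = m%:R * -1 :> R by rewrite mulrN1.
  by rewrite expRM_natl lerXn2r ?nnegrE ?expR_ge0.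
rewrite (bigID (fun k : 'I_(4 * n).+1 => (k <= 2 * n)%N)) /=.
have g := @geom_le R 2^-1 (4 * n).+1 ltac:(lra) ltac:(lra).
have -> : (4 : R) = 2 + 2 by lra.
apply: lerD; apply: le_trans g.
  apply: (@le_trans _ _ (\sum_(k < (4 * n).+1 | (k <= 2 * n)%N) F (2 * n - k)%N)).
    by apply: ler_sum => k h; apply: dec; rewrite natrB // -sqrrN opprB.
  apply: sum_inj_le => // [k _|k l h h' e]; first by rewrite ltnS leq_subLR; lia.
  by apply: val_inj => /=; clear -h h' e; lia.
apply: (@le_trans _ _ (\sum_(k < (4 * n).+1 | ~~ (k <= 2 * n)%N) F (k - 2 * n)%N)).
  by apply: ler_sum => k; rewrite -ltnNge => /ltnW h; apply: dec; rewrite natrB.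
apply: sum_inj_le => // [k _|k l h h' e].
  by have := ltn_ord k; rewrite !ltnS; apply: leq_trans; exact: leq_subr.
by apply: val_inj => /=; clear -h h' e; lia.
Qed.

(** An exponential weight counts the integer vectors of square norm at most 4 n: there are at most
    exp (4 n) exp (2) ^ n of them, and each fails with probability at most 2 exp (- 8 n). *)
Lemma light_failure : \sum_E \sum_(c : signs) wE E * half * (`[< ~ light_bound E d c >])%:R <=
  2 * expR (- (2 * n%:R)).
Proof.
pose zf (f : {ffun 'I_n -> 'I_(4 * n).+1}) i : int := (f i : nat)%:Z - (2 * n)%:Z.
pose sm f : R := \sum_i ((zf f i)%:~R : R) ^+ 2.
pose bad f E c : bool := (sm f <= 4 * n%:R) && (40 * Num.sqrt d * n%:R <
    `|\sum_(p in E | `|((zf f (val p).1)%:~R : R) * (zf f (val p).2)%:~R| <= Num.sqrt d)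
        sg R (c p) * (zf f (val p).1)%:~R * (zf f (val p).2)%:~R|).
apply: (@le_trans _ _ (\sum_E \sum_(c : signs) \sum_f wE E * half * (bad f E c)%:R)).
  apply: ler_sum => E _; apply: ler_sum => c _; rewrite -mulr_sumr ler_wpM2l //.
    by rewrite mulr_ge0 ?half_ge0 // (wE_ge0 pr0 prq q1).
  apply: failure_le => nL; apply: contrapT => h; apply: nL => z hz.
  rewrite leNgt; apply/negP => lt; apply: h.
  have zb i : `|z i| <= (2 * n)%:Z.
    have : ((z i)%:~R : R) ^+ 2 <= 4 * n%:R.
      by apply: le_trans hz; rewrite (bigD1 i) //= lerDl; apply: sumr_ge0 => j _; rewrite sqr_ge0.
    rewrite -rmorphXn /= -[4 * _]/(4%:R * n%:R) -natrM pmulrn ler_int => h4.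
    have : `|z i| ^+ 2 <= (2 * n)%:Z ^+ 2.
      rewrite real_normK ?num_real //; apply: (le_trans h4).
      rewrite -rmorphXn /= lez_nat; case: (n) => // k; nia.
    by rewrite ler_pXn2r ?nnegrE.
  have zlt i : (`|(z i + (2 * n)%:Z)%R|%N < (4 * n).+1)%N by exact: (int_window (zb i)).1.
  exists [ffun i => Ordinal (zlt i)].
  have zE i : zf [ffun i => Ordinal (zlt i)] i = z i.
    by rewrite /zf ffunE /=; exact: (int_window (zb i)).2.
  rewrite /bad /sm.
  under eq_bigr do rewrite zE.
  rewrite hz /=; apply: lt_le_trans lt _.
  rewrite le_eqVlt; apply/orP; left; apply/eqP; congr `|_|.
  by apply: eq_big => [p|p _]; rewrite !zE.
apply: (@le_trans _ _ (\sum_f expR (4 * n%:R - sm f) * (2 * expR (- (8 * n%:R))))).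
  under eq_bigr do rewrite exchange_big.
  rewrite exchange_big; apply: ler_sum => f _ /=.
  have [hf|hf] := leP (sm f) (4 * n%:R); last first.
    rewrite big1 ?mulr_ge0 ?expR_ge0 // => E _; rewrite big1 // => c _.
    by rewrite /bad leNgt hf /= mulr0.
  apply: (@le_trans _ _ (2 * expR (- (8 * n%:R)))).
    have := light_tail hf; apply: le_trans; apply: ler_sum => E _; apply: ler_sum => c _.
    by rewrite /bad hf.
  by rewrite ler_peMl ?mulr_ge0 ?expR_ge0 // -[leLHS](expR0 R) ler_expR subr_ge0.
rewrite -mulr_suml.
have -> : \sum_f expR (4 * n%:R - sm f) = expR (4 * n%:R) *
    (\sum_(k < (4 * n).+1) expR (- ((k%:R - (2 * n)%:R) ^+ 2))) ^+ n.
  transitivity (expR (4 * n%:R) * \sum_(f : {ffun 'I_n -> 'I_(4 * n).+1})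
      \prod_i expR (- (((f i)%:R : R) - (2 * n)%:R) ^+ 2)).
    rewrite mulr_sumr; apply: eq_bigr => f _; rewrite expRD; congr (_ * _).
    rewrite -expR_sum /sm -sumrN; congr expR; apply: eq_bigr => i _.
    by rewrite /zf intrB.
  congr (_ * _).
  rewrite -(bigA_distr_bigA (fun (_ : 'I_n) (k : 'I_(4 * n).+1) => expR (- ((k%:R : R) - (2 * n)%:R) ^+ 2))).
  by rewrite prodr_const card_ord.
apply: (@le_trans _ _ (expR (4 * n%:R) * expR 2 ^+ n * (2 * expR (- (8 * n%:R))))).
  rewrite ler_wpM2r ?mulr_ge0 ?expR_ge0 // ler_wpM2l ?expR_ge0 //.
  by rewrite lerXn2r ?nnegrE ?integer_count ?expR_ge0 //; apply: sumr_ge0 => k _; exact: expR_ge0.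
rewrite mulrCA ler_wpM2l // -expRM_natl -!expRD ler_expR; lra.
Qed.

End signs.

(** * The block model and the limit *)

Section model.
Variables (R : realType) (n : nat) (d lambda : R).
Hypotheses (n0 : (0 < n)%N) (d1 : 1 < d) (hl : `|lambda| <= Num.sqrt d).
Hypothesis q1 : 2 * d / n%:R <= 1.
Notation half := (2 ^- #|{: upair n}| : R).

Definition regular (E : {set upair n}) (c : {ffun upair n -> bool}) : Prop :=
  [/\ star d E, diamond_free d E, discrepancy E d & light_bound E d c].

(** Since |lambda| sqrt d <= d. The labels enter the later estimates through this uniform bound
    alone, so these hold conditionally on every labelling. *)
Lemma edge_prob_bounds (s : config n) p :
  0 <= edge_prob d lambda s p /\ edge_prob d lambda s p <= 2 * d / n%:R.
Proof.
have d0 : 0 < d := lt_trans ltr01 d1.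
have r0 : 0 <= Num.sqrt d by exact: sqrtr_ge0.
have rr : Num.sqrt d * Num.sqrt d = d by rewrite -expr2 sqr_sqrtr // ltW.
have h : `|lambda * Num.sqrt d| <= d.
  by rewrite normrM (ger0_norm r0) -[leRHS]rr ler_wpM2r.
move: h; rewrite ler_norml => /andP[h1 h2].
have ni : 0 <= n%:R^-1 :> R by rewrite invr_ge0.
rewrite /edge_prob; case: ifP => _; split.
- by rewrite mulr_ge0 //; lra.
- by rewrite ler_wpM2r //; lra.
- by rewrite mulr_ge0 //; lra.
- by rewrite ler_wpM2r //; lra.
Qed.

Lemma sbmE (s : config n) (E : {set upair n}) : sbm d lambda s E = 2 ^- n * wE (edge_prob d lambda s) E.
Proof. by []. Qed.

Lemma sum_configs : \sum_(s : config n) (2 ^- n : R) = 1.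
Proof.
rewrite sumr_const card_ffun card_bool card_ord -[LHS]mulr_natl natrX mulfV //.
Qed.

Lemma prob_le1 (Q : 'M[R]_n -> Prop) : signed_sbm_prob d lambda Q <= 1.
Proof.
rewrite -[leRHS]sum_configs; apply: ler_sum => s _.
have pr0 p := (edge_prob_bounds s p).1; have prq p := (edge_prob_bounds s p).2.
rewrite -[leRHS]mulr1 -[X in _ <= _ * X](sum_wE (edge_prob d lambda s)) mulr_sumr; apply: ler_sum => E _.
rewrite sbmE -[leRHS]mulr1 -[X in _ <= _ * X](sum_half R n) mulr_sumr.
rewrite big_mkcond; apply: ler_sum => c _; case: ifP => // _.
rewrite !mulr_ge0 ?invr_ge0 ?exprn_ge0 //; exact: wE_ge0 pr0 prq q1 _.
Qed.

(** Union bound over the four properties, for each labelling; 14 = 6 + 8 collects [star] and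
    [discrepancy]. *)
Lemma prob_ge (Q : 'M[R]_n -> Prop) : 768 + 5 * d <= ln (n%:R : R) ->
  (forall E c, regular E c -> Q (signed_adj R E c)) ->
  1 - (14 / n%:R + 2 * expR (2 + 12 * d - ln n%:R / 4) + 2 * expR (- (2 * n%:R)))
    <= signed_sbm_prob d lambda Q.
Proof.
move=> Lbig hQ; set del := 14 / n%:R + _ + _.
have -> : 1 - del = \sum_(s : config n) 2 ^- n * (1 - del) by rewrite -mulr_suml sum_configs mul1r.
apply: ler_sum => s _.
have pr0 p := (edge_prob_bounds s p).1; have prq p := (edge_prob_bounds s p).2.
set pr := edge_prob d lambda s in pr0 prq.
have w0 E : 0 <= wE pr E by exact: wE_ge0 pr0 prq q1 _.
have h0 : 0 <= half by exact: half_ge0.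
pose f1 (E : {set upair n}) : R := (`[< ~ star d E >])%:R.
pose f2 (E : {set upair n}) : R := (`[< ~ diamond_free d E >])%:R.
pose f3 (E : {set upair n}) : R := (`[< ~ discrepancy E d >])%:R.
pose f4 (E : {set upair n}) (c : {ffun upair n -> bool}) : R := (`[< ~ light_bound E d c >])%:R.
have b1 : \sum_E wE pr E * f1 E <= 6 / n%:R by exact: star_failure n0 d1 q1 pr0 prq.
have b2 : \sum_E wE pr E * f2 E <= 2 * expR (2 + 12 * d - ln n%:R / 4).
  exact: diamond_failure n0 d1 q1 pr0 prq Lbig.
have b3 : \sum_E wE pr E * f3 E <= 8 / n%:R by exact: disc_failure n0 d1 q1 pr0 prq.
have b4 : \sum_E \sum_(c : {ffun upair n -> bool}) wE pr E * half * f4 E c <= 2 * expR (- (2 * n%:R)).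
  exact: light_failure n0 d1 q1 pr0 prq.
have split1 : \sum_E wE pr E * (1 - f1 E - f2 E - f3 E) -
    \sum_E \sum_(c : {ffun upair n -> bool}) wE pr E * half * f4 E c >= 1 - del.
  have -> : \sum_E wE pr E * (1 - f1 E - f2 E - f3 E) =
     1 - \sum_E wE pr E * f1 E - \sum_E wE pr E * f2 E - \sum_E wE pr E * f3 E.
    by rewrite -[X in _ = X - _ - _ - _](sum_wE pr) -!sumrB; apply: eq_bigr => E _; ring.
  have -> : del = 6 / n%:R + 8 / n%:R + 2 * expR (2 + 12 * d - ln n%:R / 4) + 2 * expR (- (2 * n%:R)).
    by rewrite /del; ring.
  lra.
apply: le_trans (ler_wpM2l _ split1) _; first by rewrite invr_ge0 exprn_ge0.
rewrite -sumrB mulr_sumr; apply: ler_sum => E _.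
rewrite sbmE -/pr [leRHS]big_mkcond.
have -> : wE pr E * (1 - f1 E - f2 E - f3 E) - \sum_(c : {ffun upair n -> bool}) wE pr E * half * f4 E c =
    \sum_(c : {ffun upair n -> bool}) wE pr E * half * (1 - f1 E - f2 E - f3 E - f4 E c).
  rewrite -[LHS]addr0 -[X in X * _ - _](mulr1 (wE pr E)) -[in X in X * _ - _](sum_half R n).
  rewrite addr0 mulr_sumr mulr_suml -sumrB; apply: eq_bigr => c _; ring.
rewrite mulr_sumr; apply: ler_sum => c _.
have wh : 0 <= 2 ^- n * wE pr E * half.
  by rewrite mulr_ge0 // mulr_ge0 // invr_ge0 exprn_ge0.
clear b1 b2 b3 b4 split1 Lbig.
have n1 : 0 <= f1 E by []. have n2 : 0 <= f2 E by [].
have n3 : 0 <= f3 E by []. have n4 : 0 <= f4 E c by [].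
have -> : 2 ^- n * (wE pr E * half * (1 - f1 E - f2 E - f3 E - f4 E c)) =
   2 ^- n * wE pr E * half * (1 - f1 E - f2 E - f3 E - f4 E c) by ring.
case: asboolP => [_|nQ]; first by rewrite -[leRHS]mulr1 ler_wpM2l //; lra.
rewrite -[leRHS](mulr0 (2 ^- n * wE pr E * half)) ler_wpM2l //.
have one (P : Prop) : ~ P -> (`[< ~ P >])%:R = 1 :> R by move=> nP; case: asboolP.
have [p1|/one e1] := pselect (star d E); last by rewrite /f1 e1; move: n2 n3 n4; lra.
have [p2|/one e2] := pselect (diamond_free d E); last by rewrite /f2 e2; move: n1 n3 n4; lra.
have [p3|/one e3] := pselect (discrepancy E d); last by rewrite /f3 e3; move: n1 n2 n4; lra.
have [p4|/one e4] := pselect (light_bound E d c); last by rewrite /f4 e4; move: n1 n2 n3; lra.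
by case: nQ; apply: hQ; split.
Qed.

End model.

(** The value at n is 1 / (k + 1) for the largest k <= n whose threshold n has passed. Before any
    threshold is passed, the maximum over the empty set gives the value 1, and nothing is claimed
    there. *)
Lemma diagonal_sequence (R : realType) (P : nat -> R -> Prop) :
  (forall e, 0 < e -> exists n0, forall n, (n0 <= n)%N -> P n e) ->
  exists (eps : nat -> R) (n0 : nat),
    (forall e, 0 < e -> exists n1, forall n, (n1 <= n)%N -> 0 <= eps n <= e) /\
    forall n, (n0 <= n)%N -> P n (eps n).
Proof.
move=> h; have pos k : 0 < k.+1%:R^-1 :> R by rewrite invr_gt0.
have [N hN] := choice (fun k : nat => h (k.+1%:R^-1) (pos k)).
pose A n := [set k : 'I_n.+1 | (N k <= n)%N].
pose K n := (\max_(k in A n) k)%N.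
exists (fun n => (K n).+1%:R^-1), (N 0%N); split.
  move=> e e0; have [k hk] := eventually_nat_ge e^-1.
  exists (maxn k (N k)) => n; rewrite geq_max => /andP[kn Nkn].
  rewrite invr_ge0 ler0n /=.
  have kA : Ordinal (kn : (k < n.+1)%N) \in A n by rewrite inE.
  have kK : (k <= K n)%N := bigop.leq_bigmax_cond (F := fun k : 'I_n.+1 => nat_of_ord k) _ kA.
  rewrite invf_ple ?posrE //; apply: le_trans hk _; rewrite ler_nat; exact: leqW.
move=> n Nn; apply: hN.
have cA : (0 < #|A n|)%N by apply/card_gt0P; exists ord0; rewrite inE.
have [k kA e] := bigop.eq_bigmax_cond (fun k : 'I_n.+1 => nat_of_ord k) cA.
by rewrite /K e; move: kA; rewrite inE.
Qed.

(** [M] is the density threshold in units of d and must reach 12 * 164 = 1968. It fixes the spectral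
    constant, and beta is small against the latter. With nu = 1 / (4 (M + 1) d) all conditions scale
    in d, so beta does not depend on d. *)
Lemma admissible_constants (R : realType) : exists M beta : R, 0 < beta /\ 0 <= M /\ 0 <= 48 * M + 10792 /\
  (beta <= 8^-1 /\ beta * (2 * (48 * M + 10792) + 1) <= 4096^-1) /\
  forall d, 1 < d -> exists nu, [/\ 164 * d <= M * d / 12, 0 < nu, nu * (26 * d) <= 4^-1,
    nu * (1 + M * d) <= 2^-1 & 16 * (beta / Num.sqrt d) ^+ 2 <= nu / 2].
Proof.
have [M [M1 M2]] : exists M : R, 1968 <= M /\ 1 <= M by exists 2000; split; lra.
have [Csp CspE] : exists C : R, C = 48 * M + 10792 by exists (48 * M + 10792).
pose K : R := 2 * Csp + 1.
have KM : M + 1 <= K by rewrite /K CspE; lra.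
have K8 : 8 <= K by rewrite /K CspE; lra.
have Csp0 : 0 <= Csp by rewrite CspE; lra.
have [g [g0 [g1 gE]]] : exists g : R, 0 < g /\ g <= 128^-1 /\ g <= 4096^-1.
  by exists 4096^-1; split; [|split]; lra.
have K0 : 0 < K by lra.
pose beta := g / K.
have beta0 : 0 < beta by rewrite divr_gt0.
have betaK : beta * K = g by rewrite /beta divfK // gt_eqF.
have beta8 : beta <= 8^-1.
  have : beta * 8 <= beta * K by rewrite ler_wpM2l // ltW.
  by rewrite betaK; lra.
exists M, beta; rewrite -CspE.
refine (conj beta0 (conj (le_trans ler01 M2) (conj Csp0 (conj _ _)))).
  by rewrite -/K betaK; split; [exact: beta8 | exact: gE].
move=> d d1; clear gE Csp0 CspE K8.
have d0 : 0 < d := lt_trans ltr01 d1.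
have M10 : 0 < M + 1 by lra.
pose nu := (4 * (M + 1) * d)^-1.
have nu0 : 0 < nu by rewrite invr_gt0 !mulr_gt0.
have dQ : 164 * d <= M * d / 12.
  have : 1968 * d <= M * d by rewrite ler_wpM2r // ltW.
  by clear -d0; lra.
have nuE : nu * ((M + 1) * d) = 4^-1 by rewrite /nu; field; rewrite !gt_eqF.
have nud : nu * (26 * d) <= 4^-1.
  by rewrite -nuE ler_wpM2l ?(ltW nu0) // ler_wpM2r ?(ltW d0) //; lra.
have nuQ : nu * (1 + M * d) <= 2^-1.
  apply: (@le_trans _ _ (nu * ((M + 1) * d))); last by rewrite nuE; lra.
  by rewrite ler_wpM2l ?(ltW nu0) //; lra.
have bnu : 16 * (beta / Num.sqrt d) ^+ 2 <= nu / 2.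
  rewrite expr_div_n sqr_sqrtr ?(ltW d0) //.
  have -> : nu / 2 = (8 * (M + 1))^-1 / d by rewrite /nu; field; rewrite !gt_eqF.
  rewrite mulrA ler_wpM2r ?invr_ge0 ?(ltW d0) //.
  rewrite -[leRHS]mul1r ler_pdivlMr ?mulr_gt0 //.
  have h1 : beta * (M + 1) <= g by rewrite -betaK; exact: (ler_wpM2l (ltW beta0) KM).
  have h2 : 128 * (beta * (beta * (M + 1))) <= 128 * (8^-1 * g).
    rewrite ler_wpM2l //; apply: ler_pM => //; first exact: ltW.
    by rewrite mulr_ge0 // ltW.
  rewrite expr2; lra.
by exists nu.
Qed.

Local Open Scope classical_set_scope.

Theorem theorem4p1 (R : realType) :
  exists beta : R, 0 < beta /\
    forall d lambda : R, 1 < d -> `|lambda| <= Num.sqrt d ->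
    exists eps : nat -> R,
      eps n @[n --> \oo] --> (0 : R) /\
      signed_sbm_prob d lambda (fun A : 'M[R]_n =>
          forall h : 'cV[R]_n,
            ((n%:R `^ (-1 - eps n))%:E
              <= rho_MLSI (ising ((beta / Num.sqrt d) *: A) h))%E)
        @[n --> \oo] --> (1 : R).
Proof.
have [M [beta [beta0 [M0 [Csp0 [hb hd]]]]]] := admissible_constants R.
exists beta; split=> // d lambda d1 hl.
have d0 : 0 < d := lt_trans ltr01 d1.
have [nu [dQ nu0 nud nuQ bnu]] := hd d d1.
pose P n e := forall (E : {set upair n}) (c : {ffun upair n -> bool}), regular d E c ->
  forall h : 'cV[R]_n, ((n%:R `^ (-1 - e))%:E
     <= rho_MLSI (ising ((beta / Num.sqrt d) *: signed_adj R E c) h))%E.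
have hP e : 0 < e -> exists n0, forall n, (n0 <= n)%N -> P n e.
  move=> e0; have [n0 hn0] := rho_of_regular d1 dQ nu0 nud nuQ bnu beta0 hb Csp0 e0.
  exists (maxn n0 1) => n; rewrite geq_max => /andP[n0n n1] E c [st dia disc light] h.
  apply: hn0 => // y hy.
  exact: spectral_bound n1 d1 M0 disc light hy.
have [eps [N0 [eps0 hN0]]] := diagonal_sequence hP.
clear dQ nud nuQ bnu Csp0 hb hd.
exists eps; split.
  apply/cvgrPdist_le => e e0; have [n1 hn1] := eps0 e e0.
  exists n1 => // n /= /hn1 /andP[h1 h2].
  by rewrite sub0r normrN ger0_norm.
apply/cvgrPdist_le => e e0.
(* This threshold brings exp (2 + 12 d - ln n / 4) below e / 8. *)
have [n1 hn1] := ln_large (768 + 5 * d + 4 * (2 + 12 * d - ln (e / 8))).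
(* 32 / e brings 16 / n below e / 2, and 2 d keeps the edge probabilities at most 1. *)
have [n2 hn2] := eventually_nat_ge (32 / e + 2 * d + 1).
have [n3 hn3] := ln_large (768 + 5 * d).
exists (maxn (maxn N0 n1) (maxn n2 n3)) => // n /=.
rewrite !geq_max => /andP[/andP[nN0 nn1] /andP[nn2 nn3]].
have hn : 32 / e + 2 * d + 1 <= n%:R by apply: le_trans hn2 _; rewrite ler_nat.
have e32 : 0 < 32 / e by rewrite divr_gt0.
have np : 0 < n%:R :> R by lra.
have n0 : (0 < n)%N by rewrite -(ltr0n R).
have q1 : 2 * d / n%:R <= 1 by rewrite ler_pdivrMr // mul1r; lra.
have up := prob_le1 d1 hl q1.
have : 1 - (14 / n%:R + 2 * expR (2 + 12 * d - ln n%:R / 4) + 2 * expR (- (2 * n%:R))) <=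
    signed_sbm_prob d lambda (fun A : 'M[R]_n => forall h : 'cV[R]_n,
      ((n%:R `^ (-1 - eps n))%:E <= rho_MLSI (ising ((beta / Num.sqrt d) *: A) h))%E).
  by apply: prob_ge => //; [exact: hn3 | exact: hN0].
set Pn := signed_sbm_prob _ _ _; move=> low.
have Pn1 : Pn <= 1 by exact: up.
have L1 := hn1 n nn1.
have t1 : 16 / n%:R <= e / 2.
  rewrite ler_pdivrMr //; have : e / 2 * (32 / e) <= e / 2 * n%:R.
    by rewrite ler_wpM2l ?divr_ge0 ?(ltW e0) //; lra.
  have -> : e / 2 * (32 / e) = 16 by field; rewrite gt_eqF.
  by [].
have t2 : expR (2 + 12 * d - ln n%:R / 4) <= e / 8.
  rewrite -[leRHS]lnK ?posrE ?divr_gt0 // ler_expR; lra.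
have t3 : expR (- (2 * n%:R)) <= n%:R^-1 :> R.
  rewrite expRN lef_pV2 ?posrE ?expR_gt0 //.
  by have := expR_ge1Dx (2 * n%:R : R); lra.
have t4 : 16 / n%:R = 14 / n%:R + 2 * n%:R^-1 :> R by ring.
rewrite ger0_norm; last by rewrite subr_ge0.
rewrite t4 in t1; lra.
Qed.
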